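(* Let $k\in(0,1)$. For each of the following functions $f$ and all $y\in\mathbb{R}$, the Fourier transform $\mathcal{F}[f](y)=\int_{\mathbb{R}+i\epsilon}f(x)e^{2\pi i xy}\,dx$ is given by the indicated expression: (1) $f(x)=\dfrac{\mathrm{dc}(2K'x,k)}{\cosh(\pi x)}$, $\ \mathcal{F}[f](y)=-2k\,\dfrac{k'\,\mathrm{sd}(2Ky,k')-e^{\pi y}}{e^{2\pi y}+1}$; (2) $f(x)=\dfrac{\mathrm{nc}(2K'x,k)}{\cosh(\pi x)}$, $\ \mathcal{F}[f](y)=2k\,\dfrac{\mathrm{sd}(2Ky,k')}{e^{2\pi y}-1}$; (3) $f(x)=\dfrac{\mathrm{sc}(2K'x,k)}{\cosh(\pi x)}$, $\ \mathcal{F}[f](y)=-2i\,\dfrac{\mathrm{cn}(2Ky,k')-e^{\pi y}}{e^{2\pi y}-1}$; (4) $f(x)=\dfrac{\mathrm{cd}(2K'x,k)}{\cosh(\pi x)}$, $\ \mathcal{F}[f](y)=-\dfrac1k\,\dfrac{k'\,\mathrm{cd}(2Ky,k')-1}{\cosh(\pi y)}$; (5) $f(x)=\dfrac{\mathrm{nd}(2K'x,k)}{\cosh(\pi x)}$, $\ \mathcal{F}[f](y)=\dfrac{\mathrm{sn}(2Ky,k')}{\sinh(\pi y)}$; (6) $f(x)=\dfrac{\mathrm{sd}(2K'x,k)}{\cosh(\pi x)}$, $\ \mathcal{F}[f](y)=-\dfrac{i}{k}\,\dfrac{\mathrm{cd}(2Ky,k')-1}{\sinh(\pi y)}$; (7)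 $f(x)=\dfrac{\mathrm{cs}(2K'x,k)}{\cosh(\pi x)}$, $\ \mathcal{F}[f](y)=2i\,\dfrac{\mathrm{dn}(2Ky,k')-e^{\pi y}}{e^{2\pi y}-1}$; (8) $f(x)=\dfrac{\mathrm{ds}(2K'x,k)}{\cosh(\pi x)}$, $\ \mathcal{F}[f](y)=2ik\,\dfrac{\mathrm{nd}(2Ky,k')-e^{\pi y}}{e^{2\pi y}-1}$; (9) $f(x)=\dfrac{\mathrm{ns}(2K'x,k)}{\cosh(\pi x)}$, $\ \mathcal{F}[f](y)=-2ik\,\dfrac{\mathrm{nd}(2Ky,k')}{e^{2\pi y}+1}$; (10) $f(x)=\dfrac{\mathrm{dc}(2K'x,k)}{\sinh(\pi x)}$, $\ \mathcal{F}[f](y)=2i\,\dfrac{k'\,\mathrm{cd}(2Ky,k')-1}{e^{2\pi y}+1}$; (11) $f(x)=\dfrac{\mathrm{nc}(2K'x,k)}{\sinh(\pi x)}$, $\ \mathcal{F}[f](y)=-2i\,\dfrac{\mathrm{cd}(2Ky,k')-1}{e^{2\pi y}-1}$; (12) $f(x)=\dfrac{\mathrm{sc}(2K'x,k)}{\sinh(\pi x)}$, $\ \mathcal{F}[f](y)=2\,\dfrac{\mathrm{sn}(2Ky,k')}{e^{2\pi y}-1}$; (13) $f(x)=\dfrac{\mathrm{cd}(2K'x,k)}{\sinh(\pi x)}$, $\ \mathcal{F}[f](y)=-i\,\dfrac{k'\,\mathrm{sd}(2Ky,k')+e^{-\pi y}}{\cosh(\pi y)}$; (14) $f(x)=\dfrac{\mathrm{nd}(2K'x,k)}{\sinh(\pi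 x)}$, $\ \mathcal{F}[f](y)=-i\,\dfrac{\mathrm{cn}(2Ky,k')-e^{-\pi y}}{\sinh(\pi y)}$; (15) $f(x)=\dfrac{\mathrm{sd}(2K'x,k)}{\sinh(\pi x)}$, $\ \mathcal{F}[f](y)=\dfrac{\mathrm{sd}(2Ky,k')}{\sinh(\pi y)}$; (16) $f(x)=\dfrac{\mathrm{cn}(2K'x,k)}{\sinh(\pi x)}$, $\ \mathcal{F}[f](y)=-i\,\dfrac{\mathrm{nd}(2Ky,k')-e^{-\pi y}}{\sinh(\pi y)}$; (17) $f(x)=\dfrac{\mathrm{dn}(2K'x,k)}{\sinh(\pi x)}$, $\ \mathcal{F}[f](y)=-i\,\dfrac{\mathrm{dn}(2Ky,k')-e^{-\pi y}}{\sinh(\pi y)}$; (18) $f(x)=\dfrac{\mathrm{sn}(2K'x,k)}{\sinh(\pi x)}$, $\ \mathcal{F}[f](y)=\dfrac{\mathrm{nd}(2Ky,k')}{\cosh(\pi y)}$.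
   Context: $k\in(0,1)$ is the modulus, $k'=\sqrt{1-k^2}$, $K=K(k)=\int_0^{\pi/2}(1-k^2\sin^2\theta)^{-1/2}d\theta$ is the complete elliptic integral of the first kind, and $K'=K(k')$. $\mathrm{sn},\mathrm{cn},\mathrm{dn}$ are the Jacobi elliptic functions, as functions of (argument, modulus), and the other nine are defined in Glaisher's notation: $\mathrm{pq}=\mathrm{pr}/\mathrm{qr}$, i.e. $\mathrm{ns}=1/\mathrm{sn}$, $\mathrm{nc}=1/\mathrm{cn}$, $\mathrm{nd}=1/\mathrm{dn}$, $\mathrm{sc}=\mathrm{sn}/\mathrm{cn}$, $\mathrm{sd}=\mathrm{sn}/\mathrm{dn}$, $\mathrm{cs}=\mathrm{cn}/\mathrm{sn}$, $\mathrm{cd}=\mathrm{cn}/\mathrm{dn}$, $\mathrm{ds}=\mathrm{dn}/\mathrm{sn}$, $\mathrm{dc}=\mathrm{dn}/\mathrm{cn}$. The Fourier transform is $\mathcal{F}[f](y)=\int_{\mathbb{R}+i\epsilon}f(x)e^{2\pi i xy}\,dx$, $y\in\mathbb{R}$, where $\epsilon$ is a small positive number (any $\epsilon\in(0,1/2)$); the functions $f$ considered are analytic in the strip $0<\mathrm{Im}(x)<1/2$ and the integral does not depend on $\epsilon$ in this range. At $y=0$, right-hand sides of the form $0/0$ are understood as limits $y\to0$. *)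

(* Defs.v *)
From Stdlib Require Import Reals Lra Psatz.
From Coquelicot Require Import Coquelicot.

Local Open Scope R_scope.

Definition ellipticF (phi k : R) : R :=
  RInt (fun theta => / sqrt (1 - k ^ 2 * sin theta ^ 2)) 0 phi.

Definition ellipticK (k : R) : R := ellipticF (PI / 2) k.

Definition compl_modulus (k : R) : R := sqrt (1 - k ^ 2).

(** For [0 < k < 1], [ellipticF _ k] is a bijection of the real line
    ([ellipticF_am], [am_ellipticF] below); [am _ k] is its inverse. *)
Definition am (u k : R) : R := iota (fun phi : R => ellipticF phi k = u).

Definition Rsn (u k : R) : R := sin (am u k).
Definition Rcn (u k : R) : R := cos (am u k).
Definition Rdn (u k : R) : R := sqrt (1 - k ^ 2 * Rsn u k ^ 2).

(** Continuation to complex arguments [z = x + i y]: Jacobi's imaginary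
    transformation combined with the addition theorems.  The functions obtained
    extend [Rsn], [Rcn], [Rdn] ([sn_R], [cn_R], [dn_R]) and are holomorphic
    wherever [jacobi_den] does not vanish ([is_derive_jacobi]); the zeros of
    [jacobi_den], at [x = 2 m K], [y = (2 n + 1) K'], are the poles. *)
Definition jacobi_den (z : C) (k : R) : R :=
  Rcn (Im z) (compl_modulus k) ^ 2
  + k ^ 2 * Rsn (Re z) k ^ 2 * Rsn (Im z) (compl_modulus k) ^ 2.

Definition sn (z : C) (k : R) : C :=
  let s := Rsn (Re z) k in let c := Rcn (Re z) k in let d := Rdn (Re z) k in
  let k' := compl_modulus k in
  let s1 := Rsn (Im z) k' in let c1 := Rcn (Im z) k' in let d1 := Rdn (Im z) k' in
  ((s * d1) / jacobi_den z k, (c * d * s1 * c1) / jacobi_den z k).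

Definition cn (z : C) (k : R) : C :=
  let s := Rsn (Re z) k in let c := Rcn (Re z) k in let d := Rdn (Re z) k in
  let k' := compl_modulus k in
  let s1 := Rsn (Im z) k' in let c1 := Rcn (Im z) k' in let d1 := Rdn (Im z) k' in
  ((c * c1) / jacobi_den z k, - (s * d * s1 * d1) / jacobi_den z k).

Definition dn (z : C) (k : R) : C :=
  let s := Rsn (Re z) k in let c := Rcn (Re z) k in let d := Rdn (Re z) k in
  let k' := compl_modulus k in
  let s1 := Rsn (Im z) k' in let c1 := Rcn (Im z) k' in let d1 := Rdn (Im z) k' in
  ((d * c1 * d1) / jacobi_den z k, - (k ^ 2 * s * c * s1) / jacobi_den z k).

Definition ns (z : C) (k : R) : C := (1 / sn z k)%C.
Definition nc (z : C) (k : R) : C := (1 / cn z k)%C.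
Definition nd (z : C) (k : R) : C := (1 / dn z k)%C.
Definition sc (z : C) (k : R) : C := (sn z k / cn z k)%C.
Definition sd (z : C) (k : R) : C := (sn z k / dn z k)%C.
Definition cs (z : C) (k : R) : C := (cn z k / sn z k)%C.
Definition cd (z : C) (k : R) : C := (cn z k / dn z k)%C.
Definition ds (z : C) (k : R) : C := (dn z k / sn z k)%C.
Definition dc (z : C) (k : R) : C := (dn z k / cn z k)%C.

Definition Cexp (z : C) : C := (exp (Re z) * cos (Im z), exp (Re z) * sin (Im z)).
Definition Ccosh (z : C) : C := ((Cexp z + Cexp (- z)) / 2)%C.
Definition Csinh (z : C) : C := ((Cexp z - Cexp (- z)) / 2)%C.

(** [l] is the (two-sided improper) integral of [f x * exp (2 pi i x y)] over
    [R + i eps], with the same value [l] for every admissible [eps]. *)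
Definition is_Fourier (f : C -> C) (y : R) (l : C) : Prop :=
  forall eps : R, 0 < eps < 1 / 2 ->
  is_RInt_gen (V := C_R_NormedModule)
    (fun t : R => let x : C := (t, eps) in
       (f x * Cexp (2 * PI * Ci * x * y))%C)
    (Rbar_locally m_infty) (Rbar_locally p_infty) l.

(** [q] is the value of [N / D] at [y], an expression [0 / 0] being understood
    as the limit of the quotient. *)
Definition is_quotient (N : R -> C) (D : R -> R) (y : R) (q : C) : Prop :=
  (D y <> 0 /\ q = (N y / D y)%C)
  \/ (N y = 0 /\ D y = 0
      /\ filterlim (fun t => (N t / D t)%C) (locally' y) (locally q)).

Definition Fourier_eq (f : C -> C) (a : C) (N : R -> C) (D : R -> R) : Prop :=
  forall y : R, exists q : C, is_quotient N D y q /\ is_Fourier f y (a * q)%C.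

Lemma ellipticF_radicand_pos (k theta : R) : 0 < k < 1 -> 0 < 1 - k ^ 2 * sin theta ^ 2.
Proof.
intros hk; pose proof (SIN_bound theta).
assert (sin theta ^ 2 <= 1) by nra. assert (k ^ 2 < 1) by nra. nra.
Qed.

Lemma is_derive_ellipticF (k phi : R) : 0 < k < 1 ->
  is_derive (fun p => ellipticF p k) phi (/ sqrt (1 - k ^ 2 * sin phi ^ 2)).
Proof.
intros hk.
assert (Hc : forall t, continuous (fun theta => / sqrt (1 - k ^ 2 * sin theta ^ 2)) t).
{ intros t. apply (ex_derive_continuous (V := R_NormedModule)).
  pose proof (ellipticF_radicand_pos k t hk). auto_derive.
  replace (1 + - (k * (k * 1) * (sin t * (sin t * 1)))) with (1 - k ^ 2 * sin t ^ 2) by ring.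
  repeat split; [easy|]. now apply Rgt_not_eq, sqrt_lt_R0. }
apply (is_derive_RInt (V := R_NormedModule)
  (fun theta => / sqrt (1 - k ^ 2 * sin theta ^ 2)) (fun p => ellipticF p k) 0 phi).
- apply filter_forall; intros p.
  apply (RInt_correct (V := R_CompleteNormedModule)
    (fun theta => / sqrt (1 - k ^ 2 * sin theta ^ 2)) 0 p).
  apply (ex_RInt_continuous (V := R_CompleteNormedModule)). intros; apply Hc.
- apply Hc.
Qed.

Lemma ellipticF_expand (k a b : R) : 0 < k < 1 -> a <= b ->
  b - a <= ellipticF b k - ellipticF a k.
Proof.
intros hk hab.
destruct (MVT_gen (fun p => ellipticF p k) a b (fun p => / sqrt (1 - k ^ 2 * sin p ^ 2)))
  as [c [_ Hc]].
- intros; now apply is_derive_ellipticF.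
- intros x _. apply continuity_pt_filterlim.
  apply (ex_derive_continuous (V := R_NormedModule) (fun p => ellipticF p k)).
  eexists; now apply is_derive_ellipticF.
- rewrite Hc. pose proof (ellipticF_radicand_pos k c hk) as Hp.
  assert (Hs : sqrt (1 - k ^ 2 * sin c ^ 2) <= 1).
  { apply Rle_trans with (sqrt 1); [|right; apply sqrt_1]. apply sqrt_le_1_alt.
    pose proof (pow2_ge_0 (k * sin c)). rewrite Rpow_mult_distr in H. lra. }
  assert (Hq : 0 < sqrt (1 - k ^ 2 * sin c ^ 2)) by exact (sqrt_lt_R0 _ Hp).
  assert (1 <= / sqrt (1 - k ^ 2 * sin c ^ 2)).
  { rewrite <- Rinv_1 at 1. now apply Rinv_le_contravar. }
  nra.
Qed.

Lemma ellipticF_0 (k : R) : ellipticF 0 k = 0.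
Proof. unfold ellipticF. apply (RInt_point (V := R_CompleteNormedModule)). Qed.

Lemma ellipticF_inj (k a b : R) : 0 < k < 1 -> ellipticF a k = ellipticF b k -> a = b.
Proof.
intros hk e. destruct (Rle_dec a b) as [h|h].
- pose proof (ellipticF_expand k a b hk h); lra.
- pose proof (ellipticF_expand k b a hk ltac:(lra)); lra.
Qed.

Lemma ellipticF_am (k u : R) : 0 < k < 1 -> ellipticF (am u k) k = u.
Proof.
intros hk. unfold am. apply (iota_correct (fun phi => ellipticF phi k = u)).
pose proof (ellipticF_expand k 0 (Rabs u) hk (Rabs_pos u)) as H1.
pose proof (ellipticF_expand k (- Rabs u) 0 hk ltac:(pose proof (Rabs_pos u); lra)) as H2.
rewrite ellipticF_0 in H1, H2.
destruct (IVT_gen (fun p => ellipticF p k) (- Rabs u) (Rabs u) u) as [x [_ Hx]].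
- intros x. apply continuity_pt_filterlim.
  apply (ex_derive_continuous (V := R_NormedModule) (fun p => ellipticF p k)).
  eexists; now apply is_derive_ellipticF.
- pose proof (Rle_abs u). pose proof (Rle_abs (- u)). rewrite Rabs_Ropp in *.
  rewrite Rmin_left, Rmax_right by lra. lra.
- exists x; split; [exact Hx|]. intros y Hy. apply (ellipticF_inj k); congruence.
Qed.

Lemma am_ellipticF (k phi : R) : 0 < k < 1 -> am (ellipticF phi k) k = phi.
Proof. intros hk. apply (ellipticF_inj k); [easy|]. now apply ellipticF_am. Qed.

Lemma am_lipschitz (k u v : R) : 0 < k < 1 -> Rabs (am v k - am u k) <= Rabs (v - u).
Proof.
intros hk. pose proof (ellipticF_am k u hk). pose proof (ellipticF_am k v hk).
destruct (Rle_dec (am u k) (am v k)) as [h|h].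
- pose proof (ellipticF_expand k _ _ hk h). rewrite !Rabs_pos_eq; lra.
- pose proof (ellipticF_expand k (am v k) (am u k) hk ltac:(lra)). rewrite !Rabs_left; lra.
Qed.

Lemma Rdn_pos (u k : R) : 0 < k < 1 -> 0 < Rdn u k.
Proof. intros hk. apply sqrt_lt_R0, ellipticF_radicand_pos; easy. Qed.

Lemma is_derive_am (k u : R) : 0 < k < 1 -> is_derive (fun v => am v k) u (Rdn u k).
Proof.
intros hk. apply is_derive_Reals.
pose proof (Rdn_pos u k hk) as Hd.
assert (HF := is_derive_ellipticF k (am u k) hk). apply is_derive_Reals in HF.
change (sqrt _) with (Rdn u k) in HF.
set (d := Rdn u k) in *.
intros eps Heps.
destruct (HF (eps / d)) as [del Hdel].
{ now apply Rdiv_lt_0_compat. }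
exists del. intros h h0 hdel.
set (D := am (u + h) k - am u k).
assert (HD : Rabs D <= Rabs h).
{ pose proof (am_lipschitz k u (u + h) hk) as H. replace (u + h - u) with h in H by ring. exact H. }
assert (E : am (u + h) k = am u k + D) by (unfold D; ring).
assert (D0 : D <> 0).
{ intros D0. apply h0. pose proof (ellipticF_am k u hk). pose proof (ellipticF_am k (u + h) hk).
  rewrite E, D0, Rplus_0_r in H0. lra. }
specialize (Hdel D D0 ltac:(lra)).
rewrite <- E, !ellipticF_am in Hdel by easy.
replace (u + h - u) with h in Hdel by ring.
replace (D / h - d) with (- (d * (D / h) * (h / D - / d))) by (field; repeat split; lra).
rewrite Rabs_Ropp, !Rabs_mult, (Rabs_pos_eq d) by lra.
assert (Hr : Rabs (D / h) <= 1).
{ unfold Rdiv. rewrite Rabs_mult, Rabs_inv.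
  apply (Rmult_le_reg_r (Rabs h)); [now apply Rabs_pos_lt|].
  rewrite Rmult_assoc, Rinv_l, Rmult_1_r, Rmult_1_l; [easy|]. now apply Rabs_no_R0. }
set (a := Rabs (D / h)) in *. set (b := Rabs (h / D - / d)) in *.
assert (0 <= a) by apply Rabs_pos. assert (0 <= b) by apply Rabs_pos.
apply Rle_lt_trans with (d * b).
{ rewrite <- (Rmult_1_r d) at 2. rewrite !Rmult_assoc. apply Rmult_le_compat_l; [lra|].
  apply Rmult_le_compat_r; lra. }
apply (Rmult_lt_compat_l d) in Hdel; [|easy].
replace (d * (eps / d)) with eps in Hdel by (field; lra). exact Hdel.
Qed.

Lemma Rsn2_Rcn2 (u k : R) : Rsn u k ^ 2 + Rcn u k ^ 2 = 1.
Proof. unfold Rsn, Rcn. pose proof (sin2_cos2 (am u k)). unfold Rsqr in H. lra. Qed.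

Lemma Rdn2 (u k : R) : 0 < k < 1 -> Rdn u k ^ 2 = 1 - k ^ 2 * Rsn u k ^ 2.
Proof.
intros hk. unfold Rdn. rewrite pow2_sqrt; [easy|].
apply Rlt_le, (ellipticF_radicand_pos k (am u k) hk).
Qed.

Lemma is_derive_Rsn (u k : R) : 0 < k < 1 ->
  is_derive (fun v => Rsn v k) u (Rcn u k * Rdn u k).
Proof.
intros hk. rewrite Rmult_comm. unfold Rsn.
apply (is_derive_comp sin (fun v => am v k)).
- apply is_derive_Reals, derivable_pt_lim_sin.
- now apply is_derive_am.
Qed.

Lemma is_derive_Rcn (u k : R) : 0 < k < 1 ->
  is_derive (fun v => Rcn v k) u (- (Rsn u k * Rdn u k)).
Proof.
intros hk. replace (- (Rsn u k * Rdn u k)) with (Rdn u k * - Rsn u k) by ring.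
apply (is_derive_comp cos (fun v => am v k)).
- apply is_derive_Reals, derivable_pt_lim_cos.
- now apply is_derive_am.
Qed.

Lemma is_derive_Rdn (u k : R) : 0 < k < 1 ->
  is_derive (fun v => Rdn v k) u (- (k ^ 2 * Rsn u k * Rcn u k)).
Proof.
intros hk. pose proof (Rdn_pos u k hk) as Hd.
pose proof (is_derive_Rsn u k hk) as Hs.
assert (Hr : is_derive (fun v => 1 - k ^ 2 * Rsn v k ^ 2) u
               (- (k ^ 2 * (2 * Rsn u k * (Rcn u k * Rdn u k))))).
{ apply is_derive_Reals. apply is_derive_Reals in Hs.
  replace (- (k ^ 2 * (2 * Rsn u k * (Rcn u k * Rdn u k)))) with
    (0 - k ^ 2 * (INR 2 * Rsn u k ^ pred 2 * (Rcn u k * Rdn u k))) by (simpl; ring).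
  apply (derivable_pt_lim_minus (fun _ => 1)); [apply derivable_pt_lim_const|].
  apply (derivable_pt_lim_scal (fun v => Rsn v k ^ 2)).
  apply (derivable_pt_lim_comp (fun v => Rsn v k) (fun t => t ^ 2)); [easy|].
  apply derivable_pt_lim_pow. }
replace (- (k ^ 2 * Rsn u k * Rcn u k)) with
  (- (k ^ 2 * (2 * Rsn u k * (Rcn u k * Rdn u k))) * / (2 * Rdn u k)) by (field; lra).
apply (is_derive_comp sqrt (fun v => 1 - k ^ 2 * Rsn v k ^ 2)); [|exact Hr].
apply is_derive_Reals. apply derivable_pt_lim_sqrt.
exact (ellipticF_radicand_pos k (am u k) hk).
Qed.

Lemma am_0 (k : R) : 0 < k < 1 -> am 0 k = 0.
Proof. intros hk. rewrite <- (ellipticF_0 k) at 1. now apply am_ellipticF. Qed.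

Lemma compl_modulus_range (k : R) : 0 < k < 1 -> 0 < compl_modulus k < 1.
Proof.
intros hk. unfold compl_modulus. split.
- apply sqrt_lt_R0. nra.
- apply Rlt_le_trans with (sqrt 1); [|right; apply sqrt_1]. apply sqrt_lt_1_alt. nra.
Qed.

Lemma compl_modulus_sqr (k : R) : 0 < k < 1 -> compl_modulus k ^ 2 = 1 - k ^ 2.
Proof. intros hk. unfold compl_modulus. rewrite pow2_sqrt; nra. Qed.

Lemma jacobi_R_init (k : R) : 0 < k < 1 -> Rsn 0 k = 0 /\ Rcn 0 k = 1 /\ Rdn 0 k = 1.
Proof.
intros hk. unfold Rdn, Rsn, Rcn. rewrite am_0, sin_0, cos_0 by easy.
repeat split. replace (1 - k ^ 2 * 0 ^ 2) with 1 by ring. apply sqrt_1.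
Qed.

Lemma sn_R (x k : R) : 0 < k < 1 -> sn x k = RtoC (Rsn x k).
Proof.
intros hk. destruct (jacobi_R_init _ (compl_modulus_range k hk)) as [E1 [E2 E3]].
unfold sn, jacobi_den, RtoC; simpl; rewrite E1, E2, E3. f_equal; field.
Qed.

Lemma cn_R (x k : R) : 0 < k < 1 -> cn x k = RtoC (Rcn x k).
Proof.
intros hk. destruct (jacobi_R_init _ (compl_modulus_range k hk)) as [E1 [E2 E3]].
unfold cn, jacobi_den, RtoC; simpl; rewrite E1, E2, E3. f_equal; field.
Qed.

Lemma dn_R (x k : R) : 0 < k < 1 -> dn x k = RtoC (Rdn x k).
Proof.
intros hk. destruct (jacobi_R_init _ (compl_modulus_range k hk)) as [E1 [E2 E3]].
unfold dn, jacobi_den, RtoC; simpl; rewrite E1, E2, E3. f_equal; field.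
Qed.

Lemma is_derive_C (f : C -> C) (z : C) (a b : R) :
  differentiable_pt_lim (fun x y => Re (f (x, y))) (Re z) (Im z) a (- b) ->
  differentiable_pt_lim (fun x y => Im (f (x, y))) (Re z) (Im z) b a ->
  is_derive (K := C_AbsRing) (V := C_NormedModule) f z (a, b).
Proof.
intros H1 H2. split; [apply is_linear_scal_l|].
intros w Hw eps. apply (is_filter_lim_locally_unique (V := AbsRing_NormedModule C_AbsRing)) in Hw; subst w.
assert (He : 0 < eps / 2) by (destruct eps; simpl; lra).
destruct (H1 (mkposreal _ He)) as [d1 D1]. destruct (H2 (mkposreal _ He)) as [d2 D2].
simpl in D1, D2.
assert (Hd : 0 < Rmin d1 d2) by (apply Rmin_pos; apply cond_pos).
exists (mkposreal _ Hd). intros w Hw. change C in w.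
assert (Hw' : Cmod (w - z)%C < Rmin d1 d2) by exact Hw.
pose proof (Rmax_Cmod (w - z)%C) as Hm.
destruct w as [u v], z as [x y]. simpl in *. 
change (Cmod ((f (u, v) - f (x, y)) - ((u, v) - (x, y)) * (a, b))%C
        <= eps * Cmod ((u, v) - (x, y))%C).
unfold Cminus, Cplus, Copp in Hm; simpl in Hm.
change ((u + - x, v + - y)) with (((u, v) - (x, y))%C) in Hm.
set (M := Cmod ((u, v) - (x, y))%C) in *.
assert (Hu : Rabs (u - x) <= M) by (eapply Rle_trans; [apply Rmax_l | exact Hm]).
assert (Hv : Rabs (v - y) <= M) by (eapply Rle_trans; [apply Rmax_r | exact Hm]).
pose proof (Rmin_l d1 d2). pose proof (Rmin_r d1 d2).
specialize (D1 u v ltac:(lra) ltac:(lra)). specialize (D2 u v ltac:(lra) ltac:(lra)).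
assert (HM : Rmax (Rabs (u - x)) (Rabs (v - y)) <= M) by now apply Rmax_lub.
eapply Rle_trans; [apply Cmod_2Rmax|].
assert (HE : 0 <= eps / 2 * M) by (apply Rmult_le_pos; [lra | apply Cmod_ge_0]).
assert (HEM : eps / 2 * Rmax (Rabs (u - x)) (Rabs (v - y)) <= eps / 2 * M)
  by (apply Rmult_le_compat_l; lra).
assert (Hs : sqrt 2 <= 2).
{ rewrite <- (sqrt_pow2 2) at 2 by lra. apply sqrt_le_1_alt; lra. }
apply Rle_trans with (2 * (eps / 2 * M)); [|right; simpl; field].
apply Rmult_le_compat; [apply sqrt_pos | | exact Hs |].
- eapply Rle_trans; [apply Rabs_pos | apply Rmax_l].
- apply Rmax_lub; (eapply Rle_trans; [|exact HEM]).
  + replace (fst _) with (fst (f (u, v)) - fst (f (x, y)) - (a * (u - x) + - b * (v - y)))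
      by (simpl; ring). exact D1.
  + replace (snd _) with (snd (f (u, v)) - snd (f (x, y)) - (b * (u - x) + a * (v - y)))
      by (simpl; ring). exact D2.
Qed.

Lemma differentiable_pt_lim_mult (p q : R -> R -> R) (x y a b c d : R) :
  differentiable_pt_lim p x y a b -> differentiable_pt_lim q x y c d ->
  differentiable_pt_lim (fun u v => p u v * q u v) x y
    (q x y * a + p x y * c) (q x y * b + p x y * d).
Proof.
intros Hp Hq.
apply (differentiable_pt_lim_comp Rmult p q x y (q x y) (p x y)); try easy.
apply filterdiff_differentiable_pt_lim.
apply (filterdiff_ext_lin (K := R_AbsRing) _ (fun u : R * R => plus (mult (fst u) (q x y)) (mult (p x y) (snd u)))).
- apply (filterdiff_mult (K := R_AbsRing) (p x y, q x y)); [easy|]. intros; apply Rmult_comm.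
- intros [u v]; simpl. unfold plus, mult; simpl. ring.
Qed.

Lemma differentiable_pt_lim_inv (p : R -> R -> R) (x y a b : R) :
  p x y <> 0 -> differentiable_pt_lim p x y a b ->
  differentiable_pt_lim (fun u v => / p u v) x y
    (- / p x y ^ 2 * a) (- / p x y ^ 2 * b).
Proof.
intros H0 Hp.
replace (- / p x y ^ 2 * a) with (- / p x y ^ 2 * a + 0 * a) by ring.
replace (- / p x y ^ 2 * b) with (- / p x y ^ 2 * b + 0 * b) by ring.
apply (differentiable_pt_lim_comp (fun u _ => / u) p p); try easy.
apply differentiable_pt_lim_proj1_0.
replace (- / p x y ^ 2) with (- 1 / p x y ^ 2) by (field; easy).
apply is_derive_Reals. auto_derive; [easy|]. field; easy.
Qed.

Lemma differentiable_pt_lim_plus (p q : R -> R -> R) (x y a b c d : R) :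
  differentiable_pt_lim p x y a b -> differentiable_pt_lim q x y c d ->
  differentiable_pt_lim (fun u v => p u v + q u v) x y (a + c) (b + d).
Proof.
intros Hp Hq.
replace (a + c) with (1 * a + 1 * c) by ring. replace (b + d) with (1 * b + 1 * d) by ring.
apply (differentiable_pt_lim_comp Rplus p q x y 1 1); try easy.
intros eps. exists eps. intros u v _ _.
replace (_ - _) with 0 by ring. rewrite Rabs_R0.
apply Rmult_le_pos; [apply Rlt_le, cond_pos|].
eapply Rle_trans; [apply Rabs_pos | apply Rmax_l].
Qed.

Lemma differentiable_pt_lim_fst (g : R -> R) (x y l : R) :
  is_derive g x l -> differentiable_pt_lim (fun u _ => g u) x y l 0.
Proof. intros H. apply differentiable_pt_lim_proj1_0. now apply is_derive_Reals. Qed.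

Lemma differentiable_pt_lim_snd (g : R -> R) (x y l : R) :
  is_derive g y l -> differentiable_pt_lim (fun _ v => g v) x y 0 l.
Proof.
intros H eps. destruct (differentiable_pt_lim_fst g y x l H eps) as [d Hd].
exists d. intros u v hu hv. rewrite Rmax_comm.
replace (0 * (u - x) + l * (v - y)) with (l * (v - y) + 0 * (u - x)) by ring. now apply Hd.
Qed.

Lemma differentiable_pt_lim_const (c x y : R) :
  differentiable_pt_lim (fun _ _ => c) x y 0 0.
Proof. apply (differentiable_pt_lim_fst (fun _ => c)). apply (is_derive_const (V := R_NormedModule)). Qed.

Lemma differentiable_pt_lim_eq (p : R -> R -> R) (x y a b a' b' : R) :
  a = a' -> b = b' -> differentiable_pt_lim p x y a b -> differentiable_pt_lim p x y a' b'.
Proof. now intros -> ->. Qed.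

Lemma differentiable_pt_lim_opp (p : R -> R -> R) (x y a b : R) :
  differentiable_pt_lim p x y a b ->
  differentiable_pt_lim (fun u v => - p u v) x y (- a) (- b).
Proof.
intros Hp eps. destruct (Hp eps) as [d Hd]. exists d. intros u v hu hv.
replace (_ - _) with (- (p u v - p x y - (a * (u - x) + b * (v - y)))) by ring.
rewrite Rabs_Ropp. now apply Hd.
Qed.

Ltac diff2 Hden HD :=
  lazymatch goal with
  | |- differentiable_pt_lim (fun u v => jacobi_den (u, v) _) _ _ _ _ => exact HD
  | |- differentiable_pt_lim (fun u v => Rplus _ _) _ _ _ _ =>
      eapply differentiable_pt_lim_plus; diff2 Hden HD
  | |- differentiable_pt_lim (fun u v => Ropp _) _ _ _ _ =>
      eapply differentiable_pt_lim_opp; diff2 Hden HD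
  | |- differentiable_pt_lim (fun u v => Rmult _ _) _ _ _ _ =>
      eapply differentiable_pt_lim_mult; diff2 Hden HD
  | |- differentiable_pt_lim (fun u v => Rinv _) _ _ _ _ =>
      eapply differentiable_pt_lim_inv; [exact Hden | diff2 Hden HD]
  | |- differentiable_pt_lim (fun u v => Rsn u _) _ _ _ _ =>
      apply differentiable_pt_lim_fst; now apply is_derive_Rsn
  | |- differentiable_pt_lim (fun u v => Rcn u _) _ _ _ _ =>
      apply differentiable_pt_lim_fst; now apply is_derive_Rcn
  | |- differentiable_pt_lim (fun u v => Rdn u _) _ _ _ _ =>
      apply differentiable_pt_lim_fst; now apply is_derive_Rdn
  | |- differentiable_pt_lim (fun u v => Rsn v _) _ _ _ _ =>
      apply differentiable_pt_lim_snd; now apply is_derive_Rsn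
  | |- differentiable_pt_lim (fun u v => Rcn v _) _ _ _ _ =>
      apply differentiable_pt_lim_snd; now apply is_derive_Rcn
  | |- differentiable_pt_lim (fun u v => Rdn v _) _ _ _ _ =>
      apply differentiable_pt_lim_snd; now apply is_derive_Rdn
  | |- _ => apply differentiable_pt_lim_const
  end.

Lemma is_derive_jacobi (z : C) (k : R) : 0 < k < 1 -> jacobi_den z k <> 0 ->
  is_derive (K := C_AbsRing) (V := C_NormedModule) (fun w => sn w k) z (cn z k * dn z k)%C
  /\ is_derive (K := C_AbsRing) (V := C_NormedModule) (fun w => cn w k) z (- (sn z k * dn z k))%C
  /\ is_derive (K := C_AbsRing) (V := C_NormedModule) (fun w => dn w k) z
       (- (k ^ 2 * sn z k * cn z k))%C.
Proof.
intros hk Hden. pose proof (compl_modulus_range k hk) as hk'.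
destruct z as [x y].
assert (HD : differentiable_pt_lim (fun u v => jacobi_den (u, v) k) x y
  (2 * k ^ 2 * Rsn x k * Rcn x k * Rdn x k * Rsn y (compl_modulus k) ^ 2)
  (2 * Rsn y (compl_modulus k) * Rcn y (compl_modulus k) * Rdn y (compl_modulus k)
   * (k ^ 2 * Rsn x k ^ 2 - 1))).
{ unfold jacobi_den, Re, Im, pow; simpl fst; simpl snd.
  eapply differentiable_pt_lim_eq; cycle 2; [diff2 Hden Hden | |].
  - cbv beta; ring.
  - cbv beta; ring. }
pose proof (Rdn2 x k hk) as E2.
pose proof (Rdn2 y (compl_modulus k) hk') as E4.
rewrite (compl_modulus_sqr k hk) in E4.
assert (E1 : Rcn x k ^ 2 = 1 - Rsn x k ^ 2) by (pose proof (Rsn2_Rcn2 x k); lra).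
assert (E3 : Rcn y (compl_modulus k) ^ 2 = 1 - Rsn y (compl_modulus k) ^ 2)
  by (pose proof (Rsn2_Rcn2 y (compl_modulus k)); lra).
assert (E5 : jacobi_den (x, y) k = 1 - Rsn y (compl_modulus k) ^ 2
  + k ^ 2 * Rsn x k ^ 2 * Rsn y (compl_modulus k) ^ 2)
  by (rewrite <- E3; easy).
pose proof (compl_modulus_sqr k hk) as E6.
split; [|split].
all: match goal with |- is_derive _ _ ?l => rewrite (surjective_pairing l) end.
all: apply is_derive_C; simpl Re; simpl Im.
all: eapply differentiable_pt_lim_eq; cycle 2.
all: try (unfold sn, cn, dn, Re, Im, Rdiv, pow; cbv zeta; simpl fst; simpl snd; diff2 Hden HD).
all: cbv beta; unfold sn, cn, dn, Cmult, Copp, RtoC, Re, Im; cbv zeta; simpl fst; simpl snd.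
all: clear HD; set (r := jacobi_den (x, y) k) in *; clearbody r.
all: set (s1 := Rsn y (compl_modulus k)) in *; set (c1 := Rcn y (compl_modulus k)) in *.
all: set (d1 := Rdn y (compl_modulus k)) in *; clearbody s1 c1 d1.
all: set (s := Rsn x k) in *; set (c := Rcn x k) in *; set (d := Rdn x k) in *; clearbody s c d.
all: field_simplify_eq; [|exact Hden].
all: rewrite E5.
all: ring [E1 E2 E3 E4 E6].
Qed.

(* Main.v *)
Require Import Defs.
From Stdlib Require Import Reals Ranalysis5 Lra Psatz ZArith Lia.
From Coquelicot Require Import Coquelicot.

(** Let [P = pi K' / K].  The functions ns, ds, cs are, up to a linear change of
    variable, sums over the translates by [P] of [csch] and [coth].  Partial
    fractions of products of hyperbolic functions give these sums an addition
    law, hence the differential equations of the Jacobi functions, with which they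
    are identified on two lines and then, by the addition theorem, in the strip.
    Grouping the same sums the other way (Lambert series) gives their Fourier
    expansions, which turn each transform into a series in the transforms of
    [csch (pi x)] and [sech (pi x)], namely hyperbolic functions of shifted
    arguments.  Multiplying by [sinh (pi y)] or [cosh (pi y)] splits its terms
    into partial fractions, and the series becomes again one of the lattice sums,
    now on the line [Im = pi / 2], where it is a Jacobi function of modulus [k']. *)

Local Open Scope C_scope.

(** The Jacobi functions enter through the inversion of a real integral and the addition theorems,
    which give no access to series; the lattice sums have series, addition law and differential
    equations at once. They carry a modulus [kap P] known only through their values at one point,
    and its identification rests on the monotonicity of the ratio of complete integrals. [sn], [cn],
    [dn], [sd], [cd], [nd] have no pole with |Im x| < 1/2 and are expanded about the real axis. The
    six others have poles on that axis and are expanded about Im x = 1/2, in the variable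
    [x - Ci / 2]. This shift exchanges the kernels 1 / sinh and 1 / cosh and puts the line of
    integration below the pole of csch; whence the two signs [s] in [tanh_kernel]. The transform of
    [csch (pi x)] is pinned down by two symmetries and by one limit, as the line of integration
    descends to the real axis. The values 0 / 0 need no expansion at 0: up to an exponential factor
    each transform is Lipschitz in [y], so the identity multiplied by its denominator already
    determines the limit. *)

(** * Complex exponential and hyperbolic functions *)

Lemma Cexp_plus (a b : C) : Cexp (a + b) = Cexp a * Cexp b.
Proof.
destruct a as [a1 a2], b as [b1 b2]; unfold Cexp, Cmult, Cplus; simpl.
rewrite exp_plus, cos_plus, sin_plus. f_equal; ring.
Qed.

Lemma Cexp_0 : Cexp 0 = 1.
Proof. unfold Cexp; simpl. rewrite exp_0, cos_0, sin_0. unfold RtoC; f_equal; ring. Qed.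

Lemma Cexp_opp_l (a : C) : Cexp (- a) * Cexp a = 1.
Proof. rewrite <- Cexp_plus. replace (- a + a) with (RtoC 0) by ring. apply Cexp_0. Qed.

Lemma C1_neq_0 : RtoC 1 <> 0.
Proof. intros H; apply RtoC_inj in H; lra. Qed.

Lemma C2_neq_0 : RtoC 2 <> 0.
Proof. intros H; apply RtoC_inj in H; lra. Qed.

Lemma Ci_sqr : Ci * Ci = - 1.
Proof. unfold Ci, Cmult, Copp, RtoC; simpl; f_equal; ring. Qed.

Lemma Ci_neq_0 : Ci <> 0.
Proof. intros H; injection H; lra. Qed.

Lemma Cexp_neq_0 (a : C) : Cexp a <> 0.
Proof. intros H; pose proof (Cexp_opp_l a) as E; rewrite H, Cmult_0_r in E. now apply C1_neq_0. Qed.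

Lemma Cexp_opp (a : C) : Cexp (- a) = / Cexp a.
Proof.
pose proof (Cexp_opp_l a). pose proof (Cexp_neq_0 a).
rewrite <- (Cmult_1_l (/ Cexp a)), <- H. field. exact H0.
Qed.

Lemma Cmod_Cexp (z : C) : Cmod (Cexp z) = exp (Re z).
Proof.
unfold Cmod, Cexp; simpl. pose proof (exp_pos (Re z)). pose proof (sin2_cos2 (Im z)) as H1.
unfold Rsqr in H1.
match goal with |- sqrt ?a = _ => replace a with (exp (Re z) ^ 2)%R by nra end.
apply sqrt_pow2; lra.
Qed.

Lemma Cexp_RtoC (x : R) : Cexp x = exp x.
Proof. unfold Cexp, RtoC; simpl. rewrite cos_0, sin_0. f_equal; ring. Qed.

Lemma Cexp_pow (z : C) (n : nat) : Cexp (INR n * z) = Cexp z ^ n.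
Proof.
induction n as [|n IH].
- simpl. rewrite Cmult_0_l. apply Cexp_0.
- rewrite S_INR, RtoC_plus. replace ((INR n + 1) * z) with (z + INR n * z) by ring.
  rewrite Cexp_plus, IH. reflexivity.
Qed.

Lemma Cexp_iPI2 : Cexp (Ci * (PI / 2)) = Ci.
Proof.
unfold Cexp, Ci, Cmult, Cdiv, Cinv, RtoC; simpl.
(* [PI / 2] is here a quotient of complex numbers, whose real and imaginary parts have to be
   collapsed first. *)
replace (0 * (PI * (2 / (2 * (2 * 1) + 0 * (0 * 1))) - 0 * (- 0 / (2 * (2 * 1) + 0 * (0 * 1)))) -
 1 * (PI * (- 0 / (2 * (2 * 1) + 0 * (0 * 1))) + 0 * (2 / (2 * (2 * 1) + 0 * (0 * 1)))))%R with 0%R by field.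
replace (0 * (PI * (- 0 / (2 * (2 * 1) + 0 * (0 * 1))) + 0 * (2 / (2 * (2 * 1) + 0 * (0 * 1)))) +
  1 * (PI * (2 / (2 * (2 * 1) + 0 * (0 * 1))) - 0 * (- 0 / (2 * (2 * 1) + 0 * (0 * 1)))))%R with (PI / 2)%R by field.
rewrite exp_0, cos_PI2, sin_PI2. f_equal; ring.
Qed.

Lemma Ccosh_opp (z : C) : Ccosh (- z) = Ccosh z.
Proof. unfold Ccosh. replace (- - z) with z by ring. f_equal; ring. Qed.

Lemma Csinh_opp (z : C) : Csinh (- z) = - Csinh z.
Proof. unfold Csinh. replace (- - z) with z by ring. field. Qed.

Lemma Csinh_plus (a b : C) : Csinh (a + b) = Csinh a * Ccosh b + Ccosh a * Csinh b.
Proof.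
unfold Csinh, Ccosh. replace (- (a + b)) with (- a + - b) by ring.
rewrite !Cexp_plus. field.
Qed.

Lemma Ccosh_plus (a b : C) : Ccosh (a + b) = Ccosh a * Ccosh b + Csinh a * Csinh b.
Proof.
unfold Csinh, Ccosh. replace (- (a + b)) with (- a + - b) by ring.
rewrite !Cexp_plus. field.
Qed.

Lemma Csinh_minus (a b : C) : Csinh (a - b) = Csinh a * Ccosh b - Ccosh a * Csinh b.
Proof. unfold Cminus. rewrite Csinh_plus, Csinh_opp, Ccosh_opp. ring. Qed.

Lemma Ccosh2_Csinh2 (a : C) : Ccosh a * Ccosh a - Csinh a * Csinh a = 1.
Proof.
pose proof (Cexp_opp_l a) as H. unfold Csinh, Ccosh.
transitivity (Cexp (- a) * Cexp a); [field | exact H].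
Qed.

Lemma Csinh_iPI2 : Csinh (Ci * (PI / 2)) = Ci.
Proof.
unfold Csinh. rewrite Cexp_opp, Cexp_iPI2.
assert (E : / Ci = - Ci).
{ rewrite <- (Cmult_1_r (- Ci)), <- (Cinv_r Ci) by apply Ci_neq_0.
  rewrite Cmult_assoc. replace (- Ci * Ci) with (RtoC 1) by (transitivity (- (Ci * Ci)); [rewrite Ci_sqr|]; ring).
  ring. }
rewrite E. field.
Qed.

Lemma Ccosh_iPI2 : Ccosh (Ci * (PI / 2)) = 0.
Proof.
pose proof (Ccosh2_Csinh2 (Ci * (PI / 2))) as H. rewrite Csinh_iPI2, Ci_sqr in H.
assert (H1 : Ccosh (Ci * (PI / 2)) * Ccosh (Ci * (PI / 2)) = 0).
{ transitivity (Ccosh (Ci * (PI / 2)) * Ccosh (Ci * (PI / 2)) - - 1 - 1); [ring|]. rewrite H. ring. }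
destruct (Ceq_dec (Ccosh (Ci * (PI / 2))) 0) as [e|e]; [exact e|].
exfalso. apply (Cmult_neq_0 _ _ e e H1).
Qed.

Lemma Csinh_shift (z : C) : Csinh (z + Ci * (PI / 2)) = Ci * Ccosh z.
Proof. rewrite Csinh_plus, Csinh_iPI2, Ccosh_iPI2. ring. Qed.

Lemma Ccosh_shift (z : C) : Ccosh (z + Ci * (PI / 2)) = Ci * Csinh z.
Proof. rewrite Ccosh_plus, Csinh_iPI2, Ccosh_iPI2. ring. Qed.

Lemma Csinh_shift2 (z : C) : Csinh (z + Ci * PI) = - Csinh z.
Proof.
replace (z + Ci * PI) with (z + Ci * (PI / 2) + Ci * (PI / 2)) by (field).
rewrite Csinh_shift, Ccosh_shift, Cmult_assoc, Ci_sqr. ring.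
Qed.

Lemma Ccosh_shift2 (z : C) : Ccosh (z + Ci * PI) = - Ccosh z.
Proof.
replace (z + Ci * PI) with (z + Ci * (PI / 2) + Ci * (PI / 2)) by (field).
rewrite Ccosh_shift, Csinh_shift, Cmult_assoc, Ci_sqr. ring.
Qed.

Lemma Csinh_pair (x y : R) : Csinh (x, y) = (sinh x * cos y, cosh x * sin y)%R.
Proof.
unfold Csinh, Cexp, sinh, cosh, Cminus, Cplus, Copp, Cdiv, Cmult, Cinv; simpl.
rewrite cos_neg, sin_neg. f_equal; field.
Qed.

Lemma Ccosh_pair (x y : R) : Ccosh (x, y) = (cosh x * cos y, sinh x * sin y)%R.
Proof.
unfold Ccosh, Cexp, sinh, cosh, Cminus, Cplus, Copp, Cdiv, Cmult, Cinv; simpl.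
rewrite cos_neg, sin_neg. f_equal; field.
Qed.

Lemma Csinh_RtoC (x : R) : Csinh x = sinh x.
Proof. unfold RtoC at 1. rewrite Csinh_pair, cos_0, sin_0. unfold RtoC; f_equal; ring. Qed.

Lemma Ccosh_RtoC (x : R) : Ccosh x = cosh x.
Proof. unfold RtoC at 1. rewrite Ccosh_pair, cos_0, sin_0. unfold RtoC; f_equal; ring. Qed.

Lemma cosh2_sinh2 (x : R) : (cosh x ^ 2 = 1 + sinh x ^ 2)%R.
Proof.
pose proof (exp_plus x (- x)) as H. rewrite Rplus_opp_r, exp_0 in H.
unfold cosh, sinh. nra.
Qed.

Lemma cosh_pos (x : R) : (0 < cosh x)%R.
Proof. unfold cosh. pose proof (exp_pos x); pose proof (exp_pos (- x)); lra. Qed.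

(** Nonvanishing and all lower bounds of [Csinh] are read off this sum of squares, of which either
    term may be used alone. *)
Lemma Cmod_Csinh_sqr (x y : R) : (Cmod (Csinh (x, y)) ^ 2 = sinh x ^ 2 + sin y ^ 2)%R.
Proof.
rewrite Csinh_pair. unfold Cmod; simpl fst; simpl snd. rewrite pow2_sqrt by nra.
pose proof (sin2_cos2 y) as H; unfold Rsqr in H. pose proof (cosh2_sinh2 x).
replace ((sinh x * cos y) ^ 2 + (cosh x * sin y) ^ 2)%R
  with (sinh x ^ 2 * (cos y * cos y) + cosh x ^ 2 * (sin y * sin y))%R by ring.
rewrite H0. replace (cos y * cos y)%R with (1 - sin y * sin y)%R by lra. ring.
Qed.

Lemma Csinh_neq_0_Re (z : C) : Re z <> 0%R -> Csinh z <> 0.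
Proof.
destruct z as [x y]; simpl; intros hx H.
pose proof (Cmod_Csinh_sqr x y) as E. rewrite H, Cmod_0 in E.
assert (sinh x <> 0)%R.
{ destruct (Rlt_or_le x 0) as [h|h].
  - pose proof (sinh_lt x 0 h). rewrite sinh_0 in *. lra.
  - pose proof (sinh_lt 0 x ltac:(lra)). rewrite sinh_0 in *. lra. }
pose proof (pow2_ge_0 (sin y)). pose proof (pow2_gt_0 _ H0). simpl in *; nra.
Qed.

Lemma Csinh_neq_0_Im (z : C) : sin (Im z) <> 0%R -> Csinh z <> 0.
Proof.
destruct z as [x y]; simpl; intros hx H.
pose proof (Cmod_Csinh_sqr x y) as E. rewrite H, Cmod_0 in E.
pose proof (pow2_ge_0 (sinh x)). pose proof (pow2_gt_0 _ hx). simpl in *; nra.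
Qed.

Lemma exp_le (x y : R) : (x <= y -> exp x <= exp y)%R.
Proof. intros [h| ->]; [left; now apply exp_increasing | lra]. Qed.

(** For [1 <= s], [exp (- s) <= 1 <= exp s / 2]; what is left of [exp s] is divided by 2. *)
Lemma sinh_ge_exp (s : R) : (1 <= s -> exp s / 4 <= sinh s)%R.
Proof.
intros hs. unfold sinh.
assert (2 <= exp 1)%R by (pose proof (exp_ineq1 1 ltac:(lra)); lra).
assert (exp (- s) <= 1)%R by (rewrite <- exp_0; apply exp_le; lra).
assert (exp 1 <= exp s)%R by (apply exp_le; lra).
lra.
Qed.

Lemma Cmod_Csinh_ge (z : C) : (1 <= Rabs (Re z) -> exp (Rabs (Re z)) / 4 <= Cmod (Csinh z))%R.
Proof.
destruct z as [x y]; simpl Re; intros hx.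
apply Rle_trans with (sinh (Rabs x)); [now apply sinh_ge_exp|].
assert (0 <= sinh (Rabs x))%R.
{ pose proof (sinh_ge_exp _ hx). pose proof (exp_pos (Rabs x)); lra. }
apply Rsqr_incr_0; [|exact H|apply Cmod_ge_0].
rewrite !Rsqr_pow2, Cmod_Csinh_sqr. pose proof (pow2_ge_0 (sin y)).
assert (sinh (Rabs x) ^ 2 = sinh x ^ 2)%R; [|lra].
unfold Rabs; destruct (Rcase_abs x); [|reflexivity].
unfold sinh. rewrite Ropp_involutive. field.
Qed.

(** * Complex limits at 0, continuity and derivatives *)

(** The limit is punctured at 0, so that a single notion serves difference quotients, continuity and
    principal parts at a pole. *)
Definition Clim (g : C -> C) (l : C) : Prop :=
  forall eps : R, (0 < eps)%R -> exists d : R, (0 < d)%R /\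
    forall h : C, h <> 0 -> (Cmod h < d)%R -> (Cmod (g h - l) < eps)%R.

Definition Ccont (f : C -> C) (z : C) : Prop := Clim (fun h => f (z + h)) (f z).

Definition Cder (f : C -> C) (z l : C) : Prop := Clim (fun h => (f (z + h) - f z) / h) l.

Lemma Clim_const (c : C) : Clim (fun _ => c) c.
Proof.
intros eps he. exists 1%R; split; [lra|]. intros h _ _.
replace (c - c) with (RtoC 0) by ring. now rewrite Cmod_0.
Qed.

Lemma Clim_id : Clim (fun h => h) 0.
Proof.
intros eps he. exists eps; split; [easy|]. intros h _ hh.
replace (h - 0) with h by ring. exact hh.
Qed.

Lemma Clim_ext_loc (f g : C -> C) (l : C) (d0 : R) : (0 < d0)%R ->
  (forall h : C, h <> 0 -> (Cmod h < d0)%R -> f h = g h) -> Clim f l -> Clim g l.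
Proof.
intros hd E H eps he. destruct (H eps he) as [d [hd1 Hd]].
exists (Rmin d d0); split; [now apply Rmin_pos|]. intros h h0 hh.
rewrite <- (E h h0) by (eapply Rlt_le_trans; [exact hh | apply Rmin_r]). apply Hd; [easy|].
eapply Rlt_le_trans; [exact hh | apply Rmin_l].
Qed.

Lemma Clim_ext (f g : C -> C) (l : C) :
  (forall h : C, h <> 0 -> f h = g h) -> Clim f l -> Clim g l.
Proof. intros E. apply (Clim_ext_loc f g l 1); [lra|]. intros; now apply E. Qed.

Lemma Clim_eq (f : C -> C) (l m : C) : l = m -> Clim f l -> Clim f m.
Proof. now intros ->. Qed.

Lemma Clim_plus (f g : C -> C) (l m : C) :
  Clim f l -> Clim g m -> Clim (fun h => f h + g h) (l + m).
Proof.
intros Hf Hg eps he. destruct (Hf (eps / 2)%R ltac:(lra)) as [d1 [h1 H1]].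
destruct (Hg (eps / 2)%R ltac:(lra)) as [d2 [h2 H2]].
exists (Rmin d1 d2); split; [now apply Rmin_pos|]. intros h h0 hh.
specialize (H1 h h0 ltac:(eapply Rlt_le_trans; [exact hh | apply Rmin_l])).
specialize (H2 h h0 ltac:(eapply Rlt_le_trans; [exact hh | apply Rmin_r])).
replace (f h + g h - (l + m)) with ((f h - l) + (g h - m)) by ring.
eapply Rle_lt_trans; [apply Cmod_triangle|]. lra.
Qed.

Lemma Clim_scal (c : C) (f : C -> C) (l : C) : Clim f l -> Clim (fun h => c * f h) (c * l).
Proof.
intros Hf eps he. pose proof (Cmod_ge_0 c).
destruct (Hf (eps / (Cmod c + 1))%R) as [d [h1 H1]].
{ apply Rdiv_lt_0_compat; lra. }
exists d; split; [easy|]. intros h h0 hh. specialize (H1 h h0 hh).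
replace (c * f h - c * l) with (c * (f h - l)) by ring. rewrite Cmod_mult.
apply Rle_lt_trans with ((Cmod c) * (eps / (Cmod c + 1)))%R.
- apply Rmult_le_compat_l; lra.
- apply (Rmult_lt_reg_r (Cmod c + 1)); [lra|].
  replace (Cmod c * (eps / (Cmod c + 1)) * (Cmod c + 1))%R with (Cmod c * eps)%R by (field; lra).
  nra.
Qed.

Lemma Clim_opp (f : C -> C) (l : C) : Clim f l -> Clim (fun h => - f h) (- l).
Proof.
intros H. replace (- l) with (- 1 * l) by ring.
apply (Clim_ext (fun h => - 1 * f h)); [intros; ring|]. now apply Clim_scal.
Qed.

Lemma Clim_minus (f g : C -> C) (l m : C) :
  Clim f l -> Clim g m -> Clim (fun h => f h - g h) (l - m).
Proof. intros. apply Clim_plus; [easy|]. now apply Clim_opp. Qed.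

Lemma Clim_mult0 (f g : C -> C) :
  Clim f 0 -> Clim g 0 -> Clim (fun h => f h * g h) 0.
Proof.
intros Hf Hg eps he. destruct (Hf eps he) as [d1 [h1 H1]].
destruct (Hg 1%R ltac:(lra)) as [d2 [h2 H2]].
exists (Rmin d1 d2); split; [now apply Rmin_pos|]. intros h h0 hh.
specialize (H1 h h0 ltac:(eapply Rlt_le_trans; [exact hh | apply Rmin_l])).
specialize (H2 h h0 ltac:(eapply Rlt_le_trans; [exact hh | apply Rmin_r])).
replace (f h * g h - 0) with ((f h - 0) * (g h - 0)) by ring. rewrite Cmod_mult.
pose proof (Cmod_ge_0 (f h - 0)); pose proof (Cmod_ge_0 (g h - 0)). nra.
Qed.

Lemma Clim_mult (f g : C -> C) (l m : C) :
  Clim f l -> Clim g m -> Clim (fun h => f h * g h) (l * m).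
Proof.
intros Hf Hg.
assert (F : Clim (fun h => f h - l) 0).
{ replace (RtoC 0) with (l - l) by ring. apply Clim_minus; [easy|apply Clim_const]. }
assert (G : Clim (fun h => g h - m) 0).
{ replace (RtoC 0) with (m - m) by ring. apply Clim_minus; [easy|apply Clim_const]. }
apply (Clim_ext (fun h => (f h - l) * (g h - m) + (l * g h + m * f h - l * m)));
  [intros; ring|].
apply (Clim_eq _ (0 + (l * m + m * l - l * m))); [ring|].
apply Clim_plus; [now apply Clim_mult0|].
apply Clim_minus; [|apply Clim_const]. apply Clim_plus; now apply Clim_scal.
Qed.

Lemma Clim_inv (f : C -> C) (l : C) : l <> 0 -> Clim f l -> Clim (fun h => / f h) (/ l).
Proof.
intros l0 Hf eps he. assert (hl : (0 < Cmod l)%R) by now apply Cmod_gt_0.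
assert (hq : (0 < eps * Cmod l ^ 2 / 2)%R) by (assert (0 < Cmod l ^ 2)%R by (apply pow_lt; easy); nra).
destruct (Hf (Rmin (Cmod l / 2) (eps * Cmod l ^ 2 / 2))) as [d [h1 H1]].
{ apply Rmin_pos; lra. }
exists d; split; [easy|]. intros h h0 hh. specialize (H1 h h0 hh).
assert (H2 : (Cmod (f h - l) < Cmod l / 2)%R) by (eapply Rlt_le_trans; [exact H1|apply Rmin_l]).
assert (H3 : (Cmod (f h - l) < eps * Cmod l ^ 2 / 2)%R) by (eapply Rlt_le_trans; [exact H1|apply Rmin_r]).
assert (H4 : (Cmod l <= Cmod (f h) + Cmod (f h - l))%R).
{ replace l with (f h + - (f h - l)) at 1 by ring.
  eapply Rle_trans; [apply Cmod_triangle|]. rewrite Cmod_opp. lra. }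
assert (H5 : (Cmod l / 2 < Cmod (f h))%R) by lra.
assert (f0 : f h <> 0) by (apply Cmod_gt_0; lra).
replace (/ f h - / l) with (- (f h - l) / (f h * l)) by (field; split; assumption).
rewrite Cmod_div by (apply Cmult_neq_0; assumption). rewrite Cmod_opp, Cmod_mult.
apply (Rmult_lt_reg_r (Cmod (f h) * Cmod l)); [nra|].
unfold Rdiv. rewrite Rmult_assoc, Rinv_l, Rmult_1_r by nra.
assert (eps * Cmod l ^ 2 / 2 <= eps * (Cmod (f h) * Cmod l))%R; [|lra].
replace (eps * Cmod l ^ 2 / 2)%R with (eps * (Cmod l / 2 * Cmod l))%R by field.
apply Rmult_le_compat_l; [lra|]. apply Rmult_le_compat_r; lra.
Qed.

Lemma Clim_div (f g : C -> C) (l m : C) : m <> 0 ->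
  Clim f l -> Clim g m -> Clim (fun h => f h / g h) (l / m).
Proof. intros. apply Clim_mult; [easy|]. now apply Clim_inv. Qed.

Lemma Clim_scal_arg (f : C -> C) (l c : C) : c <> 0 ->
  Clim f l -> Clim (fun h => f (c * h)) l.
Proof.
intros c0 Hf eps he. destruct (Hf eps he) as [d [hd H]].
assert (hc : (0 < Cmod c)%R) by now apply Cmod_gt_0.
exists (d / Cmod c)%R; split; [now apply Rdiv_lt_0_compat|]. intros h h0 hh.
apply H; [now apply Cmult_neq_0|]. rewrite Cmod_mult.
apply (Rmult_lt_compat_l (Cmod c)) in hh; [|easy].
replace (Cmod c * (d / Cmod c))%R with d in hh by (field; lra). exact hh.
Qed.

Lemma Ccont_const (c z : C) : Ccont (fun _ => c) z.
Proof. apply Clim_const. Qed.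

Lemma Ccont_plus (f g : C -> C) (z : C) : Ccont f z -> Ccont g z -> Ccont (fun w => f w + g w) z.
Proof. intros; now apply Clim_plus. Qed.

Lemma Ccont_mult (f g : C -> C) (z : C) : Ccont f z -> Ccont g z -> Ccont (fun w => f w * g w) z.
Proof. intros; now apply Clim_mult. Qed.

Lemma Ccont_inv (f : C -> C) (z : C) : f z <> 0 -> Ccont f z -> Ccont (fun w => / f w) z.
Proof. intros; now apply Clim_inv. Qed.

Lemma Ccont_div (f g : C -> C) (z : C) : g z <> 0 -> Ccont f z -> Ccont g z ->
  Ccont (fun w => f w / g w) z.
Proof. intros; now apply Clim_div. Qed.

Lemma Ccont_translate (f : C -> C) (c z : C) : Ccont f (z + c) -> Ccont (fun w => f (w + c)) z.
Proof.
intros H. unfold Ccont. apply (Clim_ext (fun h => f (z + c + h))); [|exact H].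
intros; f_equal; ring.
Qed.

Lemma Ccont_scal_arg (f : C -> C) (c z : C) : c <> 0 -> Ccont f (c * z) -> Ccont (fun w => f (c * w)) z.
Proof.
intros c0 H. unfold Ccont. apply (Clim_ext (fun h => f (c * z + c * h))); [intros; f_equal; ring|].
exact (Clim_scal_arg (fun h => f (c * z + h)) _ c c0 H).
Qed.

Lemma Cder_const (c z : C) : Cder (fun _ => c) z 0.
Proof. apply (Clim_ext (fun _ => 0)); [|apply Clim_const]. intros; field; easy. Qed.

Lemma Cder_plus (f g : C -> C) (z a b : C) :
  Cder f z a -> Cder g z b -> Cder (fun w => f w + g w) z (a + b).
Proof.
intros Hf Hg. eapply Clim_ext; [|exact (Clim_plus _ _ _ _ Hf Hg)].
intros; simpl; field; easy.
Qed.

Lemma Cder_scal (c : C) (f : C -> C) (z a : C) : Cder f z a -> Cder (fun w => c * f w) z (c * a).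
Proof.
intros Hf. eapply Clim_ext; [|exact (Clim_scal c _ _ Hf)].
intros; simpl; field; easy.
Qed.

Lemma Cder_cont (f : C -> C) (z a : C) : Cder f z a -> Ccont f z.
Proof.
intros H. apply (Clim_eq _ (a * 0 + f z)); [ring|].
apply (Clim_ext (fun h => (f (z + h) - f z) / h * h + f z)).
- intros; field; easy.
- apply Clim_plus; [|apply Clim_const]. apply Clim_mult; [exact H | apply Clim_id].
Qed.

Lemma Cder_mult (f g : C -> C) (z a b : C) :
  Cder f z a -> Cder g z b -> Cder (fun w => f w * g w) z (a * g z + f z * b).
Proof.
intros Hf Hg. pose proof (Cder_cont _ _ _ Hg) as Cg.
apply (Clim_ext (fun h => (f (z + h) - f z) / h * g (z + h) + f z * ((g (z + h) - g z) / h))).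
- intros; field; easy.
- apply Clim_plus; [apply Clim_mult; [exact Hf|exact Cg] | apply Clim_scal; exact Hg].
Qed.

Lemma Cder_inv (f : C -> C) (z a : C) : f z <> 0 ->
  Cder f z a -> Cder (fun w => / f w) z (- a / (f z * f z)).
Proof.
intros f0 Hf. pose proof (Cder_cont _ _ _ Hf) as Cf.
destruct (Cf (Cmod (f z))) as [d [hd Hd]]; [now apply Cmod_gt_0|].
apply (Clim_ext_loc (fun h => - ((f (z + h) - f z) / h) / (f (z + h) * f z)) _ _ d hd).
- intros h h0 hh. specialize (Hd h h0 hh).
  assert (f (z + h) <> 0).
  { intros E; rewrite E in Hd. replace (0 - f z) with (- f z) in Hd by ring.
    rewrite Cmod_opp in Hd; lra. }
  field; auto.
- apply Clim_div; [now apply Cmult_neq_0 | now apply Clim_opp |].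
  apply Clim_mult; [exact Cf | apply Clim_const].
Qed.

Lemma Cder_scal_arg (f : C -> C) (c z a : C) : c <> 0 ->
  Cder f (c * z) a -> Cder (fun w => f (c * w)) z (c * a).
Proof.
intros c0 H.
apply (Clim_ext (fun h => c * ((f (c * z + c * h) - f (c * z)) / (c * h)))).
- intros h h0. replace (c * (z + h)) with (c * z + c * h) by ring. field; auto.
- apply Clim_scal. exact (Clim_scal_arg (fun h => (f (c * z + h) - f (c * z)) / h) a c c0 H).
Qed.

Lemma Cder_Cexp (z : C) : Cder Cexp z (Cexp z).
Proof.
(* Only the derivative at 0 is drawn from the Cauchy-Riemann equations; the functional equation
   carries it to [z]. *)
assert (H : Clim (fun h => (Cexp h - 1) / h) 1).
{ assert (D : is_derive (K := C_AbsRing) (V := C_NormedModule) Cexp (0, 0)%R (1, 0)%R).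
  { apply is_derive_C; unfold Cexp; simpl.
    - assert (E : is_derive exp 0 1) by (replace 1%R with (exp 0) by apply exp_0; apply is_derive_exp).
      assert (F : is_derive cos 0 0) by (auto_derive; [easy|]; rewrite sin_0; ring).
      pose proof (differentiable_pt_lim_mult (fun u _ => exp u) (fun _ v => cos v) 0 0 _ _ _ _
        (differentiable_pt_lim_fst exp 0 0 1 E) (differentiable_pt_lim_snd cos 0 0 0 F)) as G.
      simpl in G. rewrite cos_0, exp_0 in G.
      eapply differentiable_pt_lim_eq; [| |exact G]; ring.
    - assert (E : is_derive exp 0 1) by (replace 1%R with (exp 0) by apply exp_0; apply is_derive_exp).
      assert (F : is_derive sin 0 1) by (auto_derive; [easy|]; rewrite cos_0; ring).
      pose proof (differentiable_pt_lim_mult (fun u _ => exp u) (fun _ v => sin v) 0 0 _ _ _ _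
        (differentiable_pt_lim_fst exp 0 0 1 E) (differentiable_pt_lim_snd sin 0 0 1 F)) as G.
      simpl in G. rewrite sin_0, exp_0 in G.
      eapply differentiable_pt_lim_eq; [| |exact G]; ring. }
  intros eps he. destruct D as [_ D].
  specialize (D (0, 0)%R (fun P H => H)).
  assert (he2 : (0 < eps / 2)%R) by lra.
  destruct (D (mkposreal _ he2)) as [d Hd]. exists d; split; [apply cond_pos|].
  intros h h0 hh. specialize (Hd h).
  assert (B : (Cmod (h - (0, 0)%R)%C < d)%R) by (replace (h - (0, 0)%R) with h by (unfold Cminus, Cplus, Copp; destruct h; simpl; f_equal; ring); exact hh).
  specialize (Hd B).
  change (Cmod ((Cexp h - Cexp (0, 0)%R) - (h - (0, 0)%R) * (1, 0)%R)%C <= eps / 2 * Cmod (h - (0, 0)%R)%C)%R in Hd.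
  change ((0, 0)%R) with (RtoC 0) in Hd. change ((1, 0)%R) with (RtoC 1) in Hd.
  rewrite Cexp_0 in Hd. replace (h - 0) with h in Hd by ring. rewrite Cmult_1_r in Hd.
  assert (hp : (0 < Cmod h)%R) by now apply Cmod_gt_0.
  replace ((Cexp h - 1) / h - 1) with ((Cexp h - 1 - h) / h) by (field; easy).
  rewrite Cmod_div by easy. apply (Rmult_lt_reg_r (Cmod h)); [easy|].
  unfold Rdiv. rewrite Rmult_assoc, Rinv_l, Rmult_1_r by lra. simpl in Hd. nra. }
apply (Clim_ext (fun h => Cexp z * ((Cexp h - 1) / h))).
- intros h h0. rewrite Cexp_plus. field; easy.
- apply (Clim_eq _ (Cexp z * 1)); [ring|]. now apply Clim_scal.
Qed.

Lemma Cder_opp_arg (f : C -> C) (z a : C) : Cder f (- z) a -> Cder (fun w => f (- w)) z (- a).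
Proof.
intros H. replace (- a) with (- 1 * a) by ring.
apply (Clim_ext (fun h => (f (- 1 * (z + h)) - f (- 1 * z)) / h)).
- intros h h0. replace (- 1 * (z + h)) with (- (z + h)) by ring.
  replace (- 1 * z) with (- z) by ring. reflexivity.
- apply (Cder_scal_arg f (- 1) z a).
  + intros E. apply C1_neq_0. replace (RtoC 1) with (- (- 1)) by ring. rewrite E. ring.
  + now replace (- 1 * z) with (- z) by ring.
Qed.

Lemma Cder_eq (f : C -> C) (z a b : C) : a = b -> Cder f z a -> Cder f z b.
Proof. now intros ->. Qed.

Lemma Cder_ext (f g : C -> C) (z a : C) : (forall w : C, f w = g w) -> Cder f z a -> Cder g z a.
Proof. intros E. apply Clim_ext. intros; now rewrite !E. Qed.

Lemma Cder_Csinh (z : C) : Cder Csinh z (Ccosh z).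
Proof.
apply (Cder_ext (fun w => / 2 * (Cexp w + - 1 * Cexp (- w)))); [intros; unfold Csinh; field|].
eapply Cder_eq; cycle 1.
- apply Cder_scal, Cder_plus; [apply Cder_Cexp|]. apply Cder_scal, Cder_opp_arg, Cder_Cexp.
- unfold Ccosh; field.
Qed.

Lemma Cder_Ccosh (z : C) : Cder Ccosh z (Csinh z).
Proof.
apply (Cder_ext (fun w => / 2 * (Cexp w + Cexp (- w)))); [intros; unfold Ccosh; field|].
eapply Cder_eq; cycle 1.
- apply Cder_scal, Cder_plus; [apply Cder_Cexp|]. apply Cder_opp_arg, Cder_Cexp.
- unfold Csinh; field.
Qed.

Lemma Ccont_Csinh (z : C) : Ccont Csinh z.
Proof. exact (Cder_cont _ _ _ (Cder_Csinh z)). Qed.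

Lemma Ccont_Ccosh (z : C) : Ccont Ccosh z.
Proof. exact (Cder_cont _ _ _ (Cder_Ccosh z)). Qed.

(** * Geometrically dominated series *)

Definition CSeries (a : nat -> C) : C :=
  (Series (fun n => fst (a n)), Series (fun n => snd (a n))).

(** This stands for absolute convergence throughout: it is stable under all the operations below and
    yields remainders of an explicit rate. *)
Definition geom (a : nat -> C) : Prop :=
  exists M r : R, (0 < r < 1)%R /\ forall n, (Cmod (a n) <= M * r ^ n)%R.

Lemma Rabs_fst_le (z : C) : (Rabs (fst z) <= Cmod z)%R.
Proof. eapply Rle_trans; [apply Rmax_l | apply Rmax_Cmod]. Qed.

Lemma Rabs_snd_le (z : C) : (Rabs (snd z) <= Cmod z)%R.
Proof. eapply Rle_trans; [apply Rmax_r | apply Rmax_Cmod]. Qed.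

Lemma Cmod_le_abs (z : C) : (Cmod z <= Rabs (fst z) + Rabs (snd z))%R.
Proof.
destruct z as [x y]; simpl. replace (x, y) with (RtoC x + Ci * RtoC y).
- eapply Rle_trans; [apply Cmod_triangle|]. rewrite Cmod_mult, Cmod_Ci, !Cmod_R. lra.
- unfold Ci, RtoC, Cplus, Cmult; simpl; f_equal; ring.
Qed.

Lemma ex_series_Mgeom (M r : R) : (0 < r < 1)%R -> ex_series (fun n => M * r ^ n)%R.
Proof.
intros hr. apply (ex_series_scal_l M (fun n => r ^ n)%R), ex_series_geom.
rewrite Rabs_pos_eq; lra.
Qed.

Lemma Series_Mgeom (M r : R) : (0 < r < 1)%R -> Series (fun n => M * r ^ n)%R = (M / (1 - r))%R.
Proof.
intros hr. rewrite (Series_scal_l M (fun n => r ^ n)%R), Series_geom; [reflexivity|].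
rewrite Rabs_pos_eq; lra.
Qed.

Lemma Rabs_Series_le (a : nat -> R) (M r : R) : (0 < r < 1)%R ->
  (forall n, (Rabs (a n) <= M * r ^ n)%R) ->
  ex_series a /\ (Rabs (Series a) <= M / (1 - r))%R.
Proof.
intros hr H.
assert (E : ex_series (fun n => Rabs (a n))).
{ apply (ex_series_le (K := R_AbsRing) (V := R_CompleteNormedModule) _ (fun n => M * r ^ n)%R).
  - intros n. unfold norm; simpl; unfold abs; simpl. rewrite Rabs_Rabsolu. apply H.
  - now apply ex_series_Mgeom. }
split; [now apply ex_series_Rabs|].
eapply Rle_trans; [now apply Series_Rabs|].
rewrite <- Series_Mgeom by easy. apply Series_le; [|now apply ex_series_Mgeom].
intros n; split; [apply Rabs_pos | apply H].
Qed.

Lemma geom_fst (a : nat -> C) : geom a -> ex_series (fun n => fst (a n)).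
Proof.
intros [M [r [hr H]]]. apply (Rabs_Series_le _ M r hr).
intros n; eapply Rle_trans; [apply Rabs_fst_le | apply H].
Qed.

Lemma geom_snd (a : nat -> C) : geom a -> ex_series (fun n => snd (a n)).
Proof.
intros [M [r [hr H]]]. apply (Rabs_Series_le _ M r hr).
intros n; eapply Rle_trans; [apply Rabs_snd_le | apply H].
Qed.

(** The factor 2 comes from bounding the real and imaginary parts separately. *)
Lemma Cmod_CSeries_le (a : nat -> C) (M r : R) : (0 < r < 1)%R ->
  (forall n, (Cmod (a n) <= M * r ^ n)%R) -> (Cmod (CSeries a) <= 2 * (M / (1 - r)))%R.
Proof.
intros hr H. eapply Rle_trans; [apply Cmod_le_abs|]. simpl.
destruct (Rabs_Series_le (fun n => fst (a n)) M r hr) as [_ H1].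
{ intros n; eapply Rle_trans; [apply Rabs_fst_le | apply H]. }
destruct (Rabs_Series_le (fun n => snd (a n)) M r hr) as [_ H2].
{ intros n; eapply Rle_trans; [apply Rabs_snd_le | apply H]. }
lra.
Qed.

Lemma geom_plus (a b : nat -> C) : geom a -> geom b -> geom (fun n => a n + b n).
Proof.
intros [M [r [hr H]]] [N [s [hs K]]].
assert (M0 : (0 <= M)%R) by (specialize (H 0%nat); simpl in H; pose proof (Cmod_ge_0 (a 0%nat)); lra).
assert (N0 : (0 <= N)%R) by (specialize (K 0%nat); simpl in K; pose proof (Cmod_ge_0 (b 0%nat)); lra).
exists (M + N)%R, (Rmax r s). split.
- split; [eapply Rlt_le_trans; [apply hr|apply Rmax_l]|]. apply Rmax_lub_lt; lra.
- intros n. eapply Rle_trans; [apply Cmod_triangle|]. specialize (H n). specialize (K n).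
  assert (r ^ n <= Rmax r s ^ n)%R by (apply pow_incr; split; [lra|apply Rmax_l]).
  assert (s ^ n <= Rmax r s ^ n)%R by (apply pow_incr; split; [lra|apply Rmax_r]).
  nra.
Qed.

Lemma geom_bounded_mult (b a : nat -> C) (B : R) :
  (forall n, (Cmod (b n) <= B)%R) -> geom a -> geom (fun n => b n * a n).
Proof.
intros Hb [M [r [hr H]]]. exists (B * M)%R, r; split; [easy|]. intros n.
rewrite Cmod_mult, Rmult_assoc. apply Rmult_le_compat; try apply Cmod_ge_0; auto.
Qed.

Lemma geom_scal (c : C) (a : nat -> C) : geom a -> geom (fun n => c * a n).
Proof. apply (geom_bounded_mult (fun _ => c) a (Cmod c)). intros; lra. Qed.

Lemma geom_ext (a b : nat -> C) : (forall n, a n = b n) -> geom a -> geom b.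
Proof. intros E [M [r [hr H]]]. exists M, r; split; [easy|]. intros n; rewrite <- E; apply H. Qed.

Lemma geom_opp (a : nat -> C) : geom a -> geom (fun n => - a n).
Proof. intros H. apply (geom_ext (fun n => - 1 * a n)); [intros; ring|]. now apply geom_scal. Qed.

Lemma geom_minus (a b : nat -> C) : geom a -> geom b -> geom (fun n => a n - b n).
Proof. intros; apply geom_plus; [easy|]. now apply geom_opp. Qed.

Lemma geom_incr (a : nat -> C) : geom a -> geom (fun n => a (S n)).
Proof.
intros [M [r [hr H]]]. exists (M * r)%R, r; split; [easy|]. intros n.
eapply Rle_trans; [apply H|]. simpl; right; ring.
Qed.

Lemma geom_decr (a : nat -> C) : geom (fun n => a (S n)) -> geom a.
Proof.
intros [M [r [hr H]]]. exists (Rmax (Cmod (a 0%nat)) (M / r))%R, r; split; [easy|].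
intros [|n].
- simpl. rewrite Rmult_1_r. apply Rmax_l.
- eapply Rle_trans; [apply H|]. replace (M * r ^ n)%R with (M / r * r ^ S n)%R by (simpl; field; lra).
  apply Rmult_le_compat_r; [apply pow_le; lra | apply Rmax_r].
Qed.

Lemma geom_shift (a : nat -> C) (N : nat) : geom (fun n => a (N + n)%nat) -> geom a.
Proof.
induction N as [|N IH]; [easy|]. intros H. apply IH.
apply (geom_decr (fun n => a (N + n)%nat)).
apply (geom_ext (fun n => a (S N + n)%nat)); [|exact H]. intros n; f_equal; lia.
Qed.

(* [M] need not be nonnegative before rank [N]: finitely many terms never matter. *)
Lemma geom_eventually (a : nat -> C) (M r : R) (N : nat) : (0 < r < 1)%R ->
  (forall n, (N <= n)%nat -> (Cmod (a n) <= M * r ^ n)%R) -> geom a.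
Proof.
intros hr H. apply (geom_shift a N). exists (M * r ^ N)%R, r; split; [easy|].
intros n. rewrite Rmult_assoc, <- pow_add. apply H; lia.
Qed.

Lemma CSeries_ext (a b : nat -> C) : (forall n, a n = b n) -> CSeries a = CSeries b.
Proof. intros E. unfold CSeries. f_equal; apply Series_ext; intros n; now rewrite E. Qed.

Lemma CSeries_plus (a b : nat -> C) : geom a -> geom b ->
  CSeries (fun n => a n + b n) = CSeries a + CSeries b.
Proof.
intros Ha Hb. unfold CSeries, Cplus; simpl. f_equal; apply Series_plus;
  auto using geom_fst, geom_snd.
Qed.

Lemma CSeries_scal (c : C) (a : nat -> C) : geom a ->
  CSeries (fun n => c * a n) = c * CSeries a.
Proof.
intros Ha. pose proof (geom_fst _ Ha) as H1. pose proof (geom_snd _ Ha) as H2.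
assert (Q : forall (u : R) (b : nat -> R), ex_series b -> ex_series (fun n => u * b n)%R)
  by (intros u b; exact (ex_series_scal_l u b)).
destruct c as [x y]. unfold CSeries, Cmult; simpl. f_equal.
- rewrite Series_minus by (apply Q; assumption).
  now rewrite !Series_scal_l.
- rewrite Series_plus by (apply Q; assumption).
  now rewrite !Series_scal_l.
Qed.

Lemma CSeries_opp (a : nat -> C) : geom a -> CSeries (fun n => - a n) = - CSeries a.
Proof.
intros Ha. transitivity (CSeries (fun n => - 1 * a n)); [apply CSeries_ext; intros; ring|].
rewrite CSeries_scal by easy. ring.
Qed.

Lemma CSeries_minus (a b : nat -> C) : geom a -> geom b ->
  CSeries (fun n => a n - b n) = CSeries a - CSeries b.
Proof.
intros Ha Hb. unfold Cminus. rewrite CSeries_plus; [|easy|now apply geom_opp].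
now rewrite CSeries_opp.
Qed.

Lemma CSeries_incr (a : nat -> C) : geom a -> CSeries a = a 0%nat + CSeries (fun n => a (S n)).
Proof.
intros Ha. unfold CSeries, Cplus; simpl. f_equal; apply Series_incr_1;
  auto using geom_fst, geom_snd.
Qed.

Lemma CSeries_0 : CSeries (fun _ => 0) = 0.
Proof.
assert (E : Series (fun _ => 0%R) = 0%R).
{ rewrite (Series_ext _ (fun _ => 0 * 0)%R) by (intros; ring).
  rewrite (Series_scal_l 0 (fun _ => 0%R)). ring. }
unfold CSeries; simpl. now rewrite E.
Qed.

Lemma CSeries_geom (q : C) : (0 < Cmod q < 1)%R -> CSeries (fun n => q ^ n) = / (1 - q).
Proof.
intros hq.
assert (G : geom (fun n => q ^ n)).
{ exists 1%R, (Cmod q); split; [easy|]. intros n; rewrite Cmod_pow; lra. }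
pose proof (CSeries_incr _ G) as E. simpl in E. rewrite (CSeries_scal q (fun n => q ^ n) G) in E.
assert (1 - q <> 0).
{ intros H. assert (q = 1) by (replace q with (1 - (1 - q)) by ring; rewrite H; ring).
  subst q. rewrite Cmod_1 in hq; lra. }
set (S := CSeries (fun n => q ^ n)) in *.
assert (E2 : (1 - q) * S = 1) by (transitivity (S - q * S); [ring|]; rewrite E at 1; ring).
replace S with ((1 - q) * S / (1 - q)) by (field; easy). rewrite E2. field; easy.
Qed.

Fixpoint Csum (a : nat -> C) (N : nat) : C :=
  match N with O => 0 | S n => Csum a n + a n end.

Lemma CSeries_split (a : nat -> C) (N : nat) : geom a ->
  CSeries a = Csum a N + CSeries (fun n => a (N + n)%nat).
Proof.
intros Ha. induction N as [|N IH]; simpl; [change (fun n => a n) with a; ring|].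
assert (G : geom (fun n => a (N + n)%nat)).
{ clear IH. induction N as [|N IH]; [exact Ha|]. apply geom_incr in IH.
  eapply geom_ext; [|exact IH]. intros n; simpl; f_equal; lia. }
rewrite IH, (CSeries_incr _ G), Nat.add_0_r.
rewrite (CSeries_ext (fun n => a (N + S n)%nat) (fun n => a (S (N + n)))); [ring|].
intros n; f_equal; lia.
Qed.

Lemma Cmod_tail_le (a : nat -> C) (M r : R) (N : nat) : (0 < r < 1)%R ->
  (forall n, (N <= n)%nat -> (Cmod (a n) <= M * r ^ n)%R) ->
  (Cmod (CSeries (fun n => a (N + n)%nat)) <= 2 * (M / (1 - r)) * r ^ N)%R.
Proof.
intros hr H.
replace (2 * (M / (1 - r)) * r ^ N)%R with (2 * (M * r ^ N / (1 - r)))%R by (field; lra).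
apply Cmod_CSeries_le; [easy|]. intros n. rewrite Rmult_assoc, <- pow_add. apply H; lia.
Qed.

Lemma pow_lt_eps (r B eps : R) : (0 < r < 1)%R -> (0 < eps)%R ->
  exists N, forall n, (N <= n)%nat -> (B * r ^ n < eps)%R.
Proof.
intros hr he.
assert (hB : (0 < eps / (Rabs B + 1))%R) by (pose proof (Rabs_pos B); apply Rdiv_lt_0_compat; lra).
destruct (pow_lt_1_zero r ltac:(rewrite Rabs_pos_eq; lra) _ hB) as [N HN].
exists N. intros n hn. specialize (HN n hn). pose proof (Rabs_pos B). pose proof (Rle_abs B).
assert (0 < r ^ n)%R by (apply pow_lt; lra). rewrite Rabs_pos_eq in HN by lra.
apply Rle_lt_trans with ((Rabs B + 1) * r ^ n)%R; [nra|].
apply (Rmult_lt_compat_l (Rabs B + 1)) in HN; [|lra].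
replace ((Rabs B + 1) * (eps / (Rabs B + 1)))%R with eps in HN by (field; lra). exact HN.
Qed.

Lemma Clim_Csum (a : C -> nat -> C) (l : nat -> C) (N : nat) :
  (forall n, Clim (fun h => a h n) (l n)) -> Clim (fun h => Csum (a h) N) (Csum l N).
Proof.
intros H. induction N as [|N IH]; simpl; [apply Clim_const | now apply Clim_plus].
Qed.

(** Tannery's theorem. The domination is only asked from rank [N] on, because the lattice terms of
    small index, close to their poles, escape the geometric bound. *)
Lemma Clim_CSeries (a : C -> nat -> C) (l : nat -> C) (d M r : R) (N : nat) :
  (0 < r < 1)%R -> (0 < d)%R -> (forall n, Clim (fun h => a h n) (l n)) ->
  (forall (h : C) n, h <> 0 -> (Cmod h < d)%R -> (N <= n)%nat -> (Cmod (a h n) <= M * r ^ n)%R) ->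
  (forall n, (N <= n)%nat -> (Cmod (l n) <= M * r ^ n)%R) ->
  Clim (fun h => CSeries (a h)) (CSeries l).
Proof.
intros hr hd Hc Hb Hl eps he.
destruct (pow_lt_eps r (2 * (M / (1 - r))) (eps / 3) hr ltac:(lra)) as [N1 HN1].
set (N2 := (N + N1)%nat).
destruct (Clim_Csum a l N2 Hc (eps / 3)%R ltac:(lra)) as [d1 [hd1 Hd1]].
exists (Rmin d1 d); split; [now apply Rmin_pos|]. intros h h0 hh.
assert (hh1 : (Cmod h < d1)%R) by (eapply Rlt_le_trans; [exact hh | apply Rmin_l]).
assert (hh2 : (Cmod h < d)%R) by (eapply Rlt_le_trans; [exact hh | apply Rmin_r]).
rewrite (CSeries_split (a h) N2) by (apply (geom_eventually _ M r N hr); intros; now apply Hb).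
rewrite (CSeries_split l N2) by (apply (geom_eventually _ M r N hr); intros; now apply Hl).
specialize (Hd1 h h0 hh1).
assert (T1 := Cmod_tail_le (a h) M r N2 hr ltac:(intros; apply Hb; auto; lia)).
assert (T2 := Cmod_tail_le l M r N2 hr ltac:(intros; apply Hl; auto; lia)).
specialize (HN1 N2 ltac:(lia)).
match goal with |- (Cmod (?x + ?y - (?u + ?v)) < _)%R =>
  replace (x + y - (u + v)) with ((x - u) + (y + - v)) by ring end.
eapply Rle_lt_trans; [apply Cmod_triangle|].
eapply Rle_lt_trans; [apply Rplus_le_compat_l, Cmod_triangle|]. rewrite Cmod_opp. lra.
Qed.

Lemma Csum_CSeries (a : nat -> nat -> C) (N : nat) : (forall n, geom (a n)) ->
  geom (fun m => Csum (fun n => a n m) N) /\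
  Csum (fun n => CSeries (a n)) N = CSeries (fun m => Csum (fun n => a n m) N).
Proof.
intros H. induction N as [|N [IH1 IH2]]; simpl.
- split; [|now rewrite CSeries_0]. exists 1%R, (/ 2)%R; split; [lra|].
  intros n; rewrite Cmod_0. assert (0 < (/ 2) ^ n)%R by (apply pow_lt; lra). lra.
- split; [now apply geom_plus|]. rewrite IH2. symmetry. now apply CSeries_plus.
Qed.

Lemma eq_of_Cmod_lt (a b : C) : (forall eps, (0 < eps)%R -> (Cmod (a - b) < eps)%R) -> a = b.
Proof.
intros H. assert (E : a - b = 0).
{ apply Cmod_eq_0. destruct (Req_dec (Cmod (a - b)) 0) as [e|e]; [exact e|].
  pose proof (Cmod_ge_0 (a - b)). specialize (H (Cmod (a - b)) ltac:(lra)). lra. }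
replace a with (a - b + b) by ring. rewrite E. ring.
Qed.

(** The first [N] rows are exchanged exactly as a finite sum, and on both sides the remainder is of
    order [r ^ N]. *)
Lemma CSeries_Fubini (a : nat -> nat -> C) (M r : R) : (0 < r < 1)%R ->
  (forall n m, (Cmod (a n m) <= M * r ^ n * r ^ m)%R) ->
  CSeries (fun n => CSeries (a n)) = CSeries (fun m => CSeries (fun n => a n m)).
Proof.
intros hr H.
assert (M0 : (0 <= M)%R).
{ specialize (H 0%nat 0%nat); simpl in H. pose proof (Cmod_ge_0 (a 0%nat 0%nat)); lra. }
assert (Gr : forall n, geom (a n)) by (intros n; exists (M * r ^ n)%R, r; now split).
assert (Gc : forall m, geom (fun n => a n m)).
{ intros m; exists (M * r ^ m)%R, r; split; [easy|]. intros n.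
  eapply Rle_trans; [apply H|]. right; ring. }
assert (Br : forall n, (Cmod (CSeries (a n)) <= 2 * (M / (1 - r)) * r ^ n)%R).
{ intros n. replace (2 * (M / (1 - r)) * r ^ n)%R with (2 * (M * r ^ n / (1 - r)))%R by (field; lra).
  now apply Cmod_CSeries_le. }
assert (GR : geom (fun n => CSeries (a n))) by (exists (2 * (M / (1 - r)))%R, r; now split).
apply eq_of_Cmod_lt. intros eps he.
set (B := (2 * (M / (1 - r)))%R).
destruct (pow_lt_eps r (2 * (B / (1 - r)) + 2 * (B / (1 - r))) eps hr he) as [N HN].
rewrite (CSeries_split _ N GR).
destruct (Csum_CSeries a N Gr) as [G1 ->].
rewrite (CSeries_ext (fun m => CSeries (fun n => a n m))
  (fun m => Csum (fun n => a n m) N + CSeries (fun n => a (N + n)%nat m)))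
  by (intros m; apply (CSeries_split (fun n => a n m) N (Gc m))).
assert (Bt : forall m, (Cmod (CSeries (fun n => a (N + n)%nat m)) <= B * r ^ N * r ^ m)%R).
{ intros m. eapply Rle_trans; [apply (Cmod_tail_le (fun n => a n m) (M * r ^ m) r N hr)|].
  - intros n _. eapply Rle_trans; [apply H|]. right; ring.
  - right. unfold B. field. lra. }
rewrite CSeries_plus; [|easy|exists (B * r ^ N)%R, r; now split].
match goal with |- (Cmod (?x + ?y - (?x + ?v)) < _)%R =>
  replace (x + y - (x + v)) with (y + - v) by ring end.
eapply Rle_lt_trans; [apply Cmod_triangle|]. rewrite Cmod_opp.
assert (T1 := Cmod_tail_le (fun n => CSeries (a n)) B r N hr (fun n _ => Br n)).
assert (T2 := Cmod_CSeries_le _ _ r hr Bt).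
specialize (HN N ltac:(lia)).
replace (2 * (B * r ^ N / (1 - r)))%R with (2 * (B / (1 - r)) * r ^ N)%R in T2 by (field; lra).
lra.
Qed.

(** * Bilateral series *)

(** The indices [- n] and [1 + n] are symmetric about 1/2. Seen from [P / 2 + z], the corresponding
    lattice points lie on either side at mean distance [(n + 1 / 2) P], the grouping that the
    Fourier expansions require; [zsum_center] regroups about 0. *)
Definition zsum (a : Z -> C) : C :=
  CSeries (fun n => a (- Z.of_nat n)%Z + a (1 + Z.of_nat n)%Z).

Definition geomZ (a : Z -> C) : Prop :=
  geom (fun n => a (- Z.of_nat n)%Z) /\ geom (fun n => a (1 + Z.of_nat n)%Z).

Lemma zsum_split (a : Z -> C) : geomZ a ->
  zsum a = CSeries (fun n => a (- Z.of_nat n)%Z) + CSeries (fun n => a (1 + Z.of_nat n)%Z).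
Proof. intros [H1 H2]. unfold zsum. now apply CSeries_plus. Qed.

Lemma geomZ_pair (a : Z -> C) : geomZ a ->
  geom (fun n => a (- Z.of_nat n)%Z + a (1 + Z.of_nat n)%Z).
Proof. intros [H1 H2]. now apply geom_plus. Qed.

Lemma zsum_ext (a b : Z -> C) : (forall m, a m = b m) -> zsum a = zsum b.
Proof. intros E. apply CSeries_ext. intros n; now rewrite !E. Qed.

Lemma geomZ_ext (a b : Z -> C) : (forall m, a m = b m) -> geomZ a -> geomZ b.
Proof. intros E [H1 H2]. split; [eapply geom_ext; [|exact H1] | eapply geom_ext; [|exact H2]]; intros n; apply E. Qed.

Lemma geomZ_scal (c : C) (a : Z -> C) : geomZ a -> geomZ (fun m => c * a m).
Proof. intros [H1 H2]. split; now apply geom_scal. Qed.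

Lemma geomZ_bounded_mult (b a : Z -> C) (B : R) :
  (forall n, (Cmod (b n) <= B)%R) -> geomZ a -> geomZ (fun n => b n * a n).
Proof. intros Hb [H1 H2]. split; now apply (geom_bounded_mult _ _ B). Qed.

Lemma geomZ_minus (a b : Z -> C) : geomZ a -> geomZ b -> geomZ (fun m => a m - b m).
Proof. intros [H1 H2] [K1 K2]. split; now apply geom_minus. Qed.

Lemma zsum_scal (c : C) (a : Z -> C) : geomZ a -> zsum (fun m => c * a m) = c * zsum a.
Proof.
intros Ha. rewrite !zsum_split; [|easy|now apply geomZ_scal].
destruct Ha. rewrite !CSeries_scal by easy. ring.
Qed.

Lemma zsum_minus (a b : Z -> C) : geomZ a -> geomZ b ->
  zsum (fun m => a m - b m) = zsum a - zsum b.
Proof.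
intros Ha Hb. rewrite !zsum_split; [|easy|easy|now apply geomZ_minus].
destruct Ha, Hb. rewrite !CSeries_minus by easy. ring.
Qed.

Lemma geomZ_succ (a : Z -> C) : geomZ a -> geomZ (fun m => a (m + 1)%Z).
Proof.
intros [H1 H2]. split.
- apply geom_decr. eapply geom_ext; [|exact H1]. intros n; cbv beta; f_equal; lia.
- apply geom_incr in H2. eapply geom_ext; [|exact H2]. intros n; cbv beta; f_equal; lia.
Qed.

Lemma geomZ_pred (a : Z -> C) : geomZ a -> geomZ (fun m => a (m - 1)%Z).
Proof.
intros [H1 H2]. split.
- apply geom_incr in H1. eapply geom_ext; [|exact H1]. intros n; cbv beta; f_equal; lia.
- apply geom_decr. eapply geom_ext; [|exact H2]. intros n; cbv beta; f_equal; lia.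
Qed.

Lemma zsum_succ (a : Z -> C) : geomZ a -> zsum (fun m => a (m + 1)%Z) = zsum a.
Proof.
intros Ha. pose proof (geomZ_succ a Ha) as Hs. rewrite !zsum_split by easy.
destruct Ha as [H1 H2], Hs as [K1 K2].
rewrite (CSeries_incr _ K1), (CSeries_incr _ H2).
rewrite (CSeries_ext (fun n => a (- Z.of_nat (S n) + 1)%Z) (fun n => a (- Z.of_nat n)%Z))
  by (intros n; f_equal; lia).
rewrite (CSeries_ext (fun n => a (1 + Z.of_nat n + 1)%Z) (fun n => a (1 + Z.of_nat (S n))%Z))
  by (intros n; f_equal; lia).
simpl. ring.
Qed.

Lemma zsum_pred (a : Z -> C) : geomZ a -> zsum (fun m => a (m - 1)%Z) = zsum a.
Proof.
intros Ha. rewrite <- (zsum_succ _ (geomZ_pred a Ha)). apply zsum_ext. intros m; f_equal; lia.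
Qed.

Lemma zsum_shift (a : Z -> C) (r : Z) : geomZ a ->
  geomZ (fun m => a (m - r)%Z) /\ zsum (fun m => a (m - r)%Z) = zsum a.
Proof.
intros Ha.
induction r as [|r [IH1 IH2]|r [IH1 IH2]] using Z.peano_ind.
- split; [eapply geomZ_ext; [|exact Ha] | apply zsum_ext]; intros m; f_equal; lia.
- split.
  + eapply geomZ_ext; [|exact (geomZ_pred _ IH1)]. intros m; cbv beta; f_equal; lia.
  + rewrite <- IH2, <- (zsum_pred _ IH1). apply zsum_ext; intros m; f_equal; lia.
- split.
  + eapply geomZ_ext; [|exact (geomZ_succ _ IH1)]. intros m; cbv beta; f_equal; lia.
  + rewrite <- IH2, <- (zsum_succ _ IH1). apply zsum_ext; intros m; f_equal; lia.
Qed.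

Lemma zsum_refl (a : Z -> C) : geomZ a ->
  geomZ (fun m => a (- m)%Z) /\ zsum (fun m => a (- m)%Z) = zsum a.
Proof.
intros [H1 H2].
assert (K : geomZ (fun m => a (- m)%Z)).
{ split.
  - apply geom_decr. eapply geom_ext; [|exact H2]. intros n; cbv beta; f_equal; lia.
  - apply geom_incr in H1. eapply geom_ext; [|exact H1]. intros n; cbv beta; f_equal; lia. }
split; [exact K|]. rewrite !zsum_split by (easy || now split). destruct K as [K1 K2].
rewrite (CSeries_incr _ K1), (CSeries_incr _ H1).
rewrite (CSeries_ext (fun n => a (- - Z.of_nat (S n))%Z) (fun n => a (1 + Z.of_nat n)%Z))
  by (intros n; f_equal; lia).
rewrite (CSeries_ext (fun n => a (- (1 + Z.of_nat n))%Z) (fun n => a (- Z.of_nat (S n))%Z))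
  by (intros n; f_equal; lia).
simpl. ring.
Qed.

Lemma geomZ_of_bound (a : Z -> C) (M r : R) : (0 < r < 1)%R ->
  (forall m, (Cmod (a m) <= M * r ^ Z.abs_nat m)%R) -> geomZ a.
Proof.
intros hr H. split.
- exists M, r; split; [easy|]. intros n. eapply Rle_trans; [apply H|].
  replace (Z.abs_nat (- Z.of_nat n)) with n by lia. lra.
- exists (M * r)%R, r; split; [easy|]. intros n. eapply Rle_trans; [apply H|].
  replace (Z.abs_nat (1 + Z.of_nat n)) with (S n) by lia. simpl; right; ring.
Qed.

Lemma geomZ_bound (a : Z -> C) : geomZ a ->
  exists M r, (0 < r < 1)%R /\ forall m, (Cmod (a m) <= M * r ^ Z.abs_nat m)%R.
Proof.
intros [[M1 [r1 [hr1 H1]]] [M2 [r2 [hr2 H2]]]].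
set (r := Rmax r1 r2).
assert (hr : (0 < r < 1)%R).
{ split; [eapply Rlt_le_trans; [apply hr1|apply Rmax_l] | apply Rmax_lub_lt; lra]. }
assert (M10 : (0 <= M1)%R).
{ specialize (H1 0%nat). simpl in H1. match type of H1 with (Cmod ?x <= _)%R => pose proof (Cmod_ge_0 x) end. lra. }
assert (M20 : (0 <= M2)%R).
{ specialize (H2 0%nat). simpl in H2. match type of H2 with (Cmod ?x <= _)%R => pose proof (Cmod_ge_0 x) end. lra. }
exists (M1 + M2 / r)%R, r. split; [exact hr|].
assert (hq : (0 <= M2 / r)%R) by (apply Rdiv_le_0_compat; lra).
intros m. destruct (Z_le_gt_dec m 0) as [h|h].
- specialize (H1 (Z.abs_nat m)). replace (- Z.of_nat (Z.abs_nat m))%Z with m in H1 by lia.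
  assert (r1 ^ Z.abs_nat m <= r ^ Z.abs_nat m)%R by (apply pow_incr; split; [lra|apply Rmax_l]).
  assert (0 < r1 ^ Z.abs_nat m)%R by (apply pow_lt; lra). nra.
- specialize (H2 (Z.abs_nat (m - 1))). replace (1 + Z.of_nat (Z.abs_nat (m - 1)))%Z with m in H2 by lia.
  replace (Z.abs_nat m) with (S (Z.abs_nat (m - 1))) by lia.
  assert (r2 ^ Z.abs_nat (m - 1) <= r ^ Z.abs_nat (m - 1))%R by (apply pow_incr; split; [lra|apply Rmax_r]).
  assert (0 < r2 ^ Z.abs_nat (m - 1))%R by (apply pow_lt; lra). simpl.
  replace ((M1 + M2 / r) * (r * r ^ Z.abs_nat (m - 1)))%R
    with (M1 * r * r ^ Z.abs_nat (m - 1) + M2 * r ^ Z.abs_nat (m - 1))%R by (field; lra).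
  assert (0 <= M1 * r * r ^ Z.abs_nat (m - 1))%R by (apply Rmult_le_pos; nra). nra.
Qed.

Lemma zsum_Fubini (a : Z -> Z -> C) (M r : R) : (0 < r < 1)%R ->
  (forall m n, (Cmod (a m n) <= M * r ^ Z.abs_nat m * r ^ Z.abs_nat n)%R) ->
  zsum (fun m => zsum (a m)) = zsum (fun n => zsum (fun m => a m n)).
Proof.
intros hr H.
assert (M0 : (0 <= M)%R).
{ specialize (H 0%Z 0%Z); simpl in H. pose proof (Cmod_ge_0 (a 0%Z 0%Z)); lra. }
assert (Gr : forall m, geomZ (a m)).
{ intros m. apply (geomZ_of_bound _ (M * r ^ Z.abs_nat m) r hr). intros n; apply H. }
assert (Gc : forall n, geomZ (fun m => a m n)).
{ intros n. apply (geomZ_of_bound _ (M * r ^ Z.abs_nat n) r hr). intros m.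
  eapply Rle_trans; [apply H|]. right; ring. }
unfold zsum at 1 3.
rewrite (CSeries_ext (fun n => zsum (a (- Z.of_nat n)%Z) + zsum (a (1 + Z.of_nat n)%Z))
  (fun i => CSeries (fun j => a (- Z.of_nat i)%Z (- Z.of_nat j)%Z + a (- Z.of_nat i)%Z (1 + Z.of_nat j)%Z
    + (a (1 + Z.of_nat i)%Z (- Z.of_nat j)%Z + a (1 + Z.of_nat i)%Z (1 + Z.of_nat j)%Z)))).
2:{ intros i. symmetry. apply CSeries_plus; now apply geomZ_pair. }
rewrite (CSeries_ext (fun n => zsum (fun m => a m (- Z.of_nat n)%Z) + zsum (fun m => a m (1 + Z.of_nat n)%Z))
  (fun j => CSeries (fun i => a (- Z.of_nat i)%Z (- Z.of_nat j)%Z + a (1 + Z.of_nat i)%Z (- Z.of_nat j)%Z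
    + (a (- Z.of_nat i)%Z (1 + Z.of_nat j)%Z + a (1 + Z.of_nat i)%Z (1 + Z.of_nat j)%Z)))).
2:{ intros j. symmetry.
  apply (CSeries_plus (fun i => a (- Z.of_nat i)%Z (- Z.of_nat j)%Z + a (1 + Z.of_nat i)%Z (- Z.of_nat j)%Z)
    (fun i => a (- Z.of_nat i)%Z (1 + Z.of_nat j)%Z + a (1 + Z.of_nat i)%Z (1 + Z.of_nat j)%Z));
  [apply (geomZ_pair (fun m => a m (- Z.of_nat j)%Z)) | apply (geomZ_pair (fun m => a m (1 + Z.of_nat j)%Z))];
  apply Gc. }
(* A term of the folded double series collects one pair of indices from each of the four quadrants,
   hence [4 * M]. *)
rewrite (CSeries_Fubini _ (4 * M) r hr).
- apply CSeries_ext; intros j. apply CSeries_ext; intros i. ring.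
- intros i j.
  assert (Q : forall m n, (i <= Z.abs_nat m)%nat -> (j <= Z.abs_nat n)%nat ->
    (Cmod (a m n) <= M * r ^ i * r ^ j)%R).
  { intros m n hm hn. eapply Rle_trans; [apply H|].
    assert (P : forall p q, (p <= q)%nat -> (r ^ q <= r ^ p)%R).
    { intros p q hpq. replace q with (p + (q - p))%nat by lia. rewrite pow_add.
      assert (0 < r ^ p)%R by (apply pow_lt; lra).
      assert (r ^ (q - p) <= 1)%R by (rewrite <- (pow1 (q - p)); apply pow_incr; lra). nra. }
    pose proof (P _ _ hm). pose proof (P _ _ hn).
    assert (0 < r ^ Z.abs_nat m)%R by (apply pow_lt; lra).
    assert (0 < r ^ Z.abs_nat n)%R by (apply pow_lt; lra).
    rewrite !Rmult_assoc. apply Rmult_le_compat_l; [easy|]. apply Rmult_le_compat; lra. }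
  pose proof (Q (- Z.of_nat i)%Z (- Z.of_nat j)%Z ltac:(lia) ltac:(lia)).
  pose proof (Q (- Z.of_nat i)%Z (1 + Z.of_nat j)%Z ltac:(lia) ltac:(lia)).
  pose proof (Q (1 + Z.of_nat i)%Z (- Z.of_nat j)%Z ltac:(lia) ltac:(lia)).
  pose proof (Q (1 + Z.of_nat i)%Z (1 + Z.of_nat j)%Z ltac:(lia) ltac:(lia)).
  eapply Rle_trans; [apply Cmod_triangle|].
  eapply Rle_trans; [apply Rplus_le_compat; apply Cmod_triangle|]. lra.
Qed.

(** * The lattice sums *)

Definition csch (z : C) : C := / Csinh z.
Definition coth (z : C) : C := Ccosh z / Csinh z.
Definition sg (m : Z) : C := if Z.even m then 1 else - 1.
(** The limit of [coth (z - IZR m * P)] as [m] goes to either infinity. The subtracted series of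
    [sg m * coth_limit m] has Abel sum 1/2 + 1/2; this is the leading 1 of [latA], and it makes
    [latA] odd. *)
Definition coth_limit (m : Z) : C := if (m <=? 0)%Z then 1 else - 1.

(* With modulus [kappa] such that [P / PI = K(kappa) / K'(kappa)], these are, up
   to one common factor in value and argument, ns, ds and cs.  The terms of [latA]
   are renormalised to make the series converge absolutely. *)
Definition latA (P : R) (z : C) : C :=
  1 + zsum (fun m => sg m * (coth (z - IZR m * P) - coth_limit m)).
Definition latB (P : R) (z : C) : C := zsum (fun m => sg m * csch (z - IZR m * P)).
Definition latD (P : R) (z : C) : C := zsum (fun m => csch (z - IZR m * P)).

(** Off all the poles [m P + i n PI]. *)
Definition off (P : R) (z : C) : Prop := forall m : Z, Csinh (z - IZR m * P) <> 0.

Lemma Copp_0_inv (a : C) : - a = 0 -> a = 0.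
Proof. intros E. replace a with (- (- a)) by ring. rewrite E. ring. Qed.

Lemma sg_succ (m : Z) : sg (m + 1) = - sg m.
Proof. unfold sg. rewrite Z.even_add. simpl. destruct (Z.even m); simpl; ring. Qed.

Lemma sg_opp (m : Z) : sg (- m) = sg m.
Proof. unfold sg. now rewrite Z.even_opp. Qed.

Lemma Cmod_sg (m : Z) : Cmod (sg m) = 1%R.
Proof. unfold sg. destruct (Z.even m); [apply Cmod_1|]. rewrite Cmod_R, Rabs_left; lra. Qed.

Lemma off_opp (P : R) (z : C) : off P z -> off P (- z).
Proof.
intros H m E. apply (H (- m)%Z).
replace (z - IZR (- m) * P) with (- (- z - IZR m * P)) by (rewrite opp_IZR, RtoC_opp; ring).
rewrite Csinh_opp, E. ring.
Qed.

Lemma coth_minus_1 (w : C) : Csinh w <> 0 -> coth w - 1 = Cexp (- w) * csch w.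
Proof. intros H. unfold coth, csch. field_simplify_eq; [|easy]. unfold Ccosh, Csinh; field. Qed.

Lemma coth_plus_1 (w : C) : Csinh w <> 0 -> coth w + 1 = Cexp w * csch w.
Proof. intros H. unfold coth, csch. field_simplify_eq; [|easy]. unfold Ccosh, Csinh; field. Qed.

Lemma csch_opp (w : C) : Csinh w <> 0 -> csch (- w) = - csch w.
Proof.
intros H. unfold csch. rewrite Csinh_opp. field. exact H.
Qed.

Lemma coth_opp (w : C) : Csinh w <> 0 -> coth (- w) = - coth w.
Proof.
intros H. unfold coth. rewrite Csinh_opp, Ccosh_opp. field. exact H.
Qed.

Lemma csch_shift2 (w : C) : Csinh w <> 0 -> csch (w + Ci * PI) = - csch w.
Proof.
intros H. unfold csch. rewrite Csinh_shift2. field. exact H.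
Qed.

Lemma coth_shift2 (w : C) : Csinh w <> 0 -> coth (w + Ci * PI) = coth w.
Proof.
intros H. unfold coth. rewrite Csinh_shift2, Ccosh_shift2. field. exact H.
Qed.

(** The subtraction formula of sinh divided by both factors: the partial fractions from which the
    addition law comes. *)
Lemma csch_mult (a b : C) : Csinh a <> 0 -> Csinh b <> 0 -> Csinh (a - b) <> 0 ->
  csch a * csch b = csch (a - b) * (coth b - coth a).
Proof.
intros Ha Hb Hab. unfold csch, coth. rewrite Csinh_minus in *. field. auto.
Qed.

Lemma exp_pow_nat (x : R) (n : nat) : (exp x ^ n = exp (INR n * x))%R.
Proof.
induction n as [|n IH]; [simpl; now rewrite Rmult_0_l, exp_0|].
rewrite S_INR. simpl. rewrite IH, <- exp_plus. f_equal; ring.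
Qed.

Lemma Cmod_csch_le (w : C) : (1 <= Rabs (Re w))%R ->
  Csinh w <> 0 /\ (Cmod (csch w) <= 4 * exp (- Rabs (Re w)))%R.
Proof.
intros h. assert (h0 : Csinh w <> 0).
{ apply Csinh_neq_0_Re. intros E; rewrite E, Rabs_R0 in h; lra. }
split; [easy|]. unfold csch. rewrite Cmod_inv by easy.
pose proof (Cmod_Csinh_ge w h) as H. pose proof (exp_pos (Rabs (Re w))).
rewrite exp_Ropp. replace (4 * / exp (Rabs (Re w)))%R with (/ (exp (Rabs (Re w)) / 4))%R by (field; lra).
apply Rinv_le_contravar; lra.
Qed.

Lemma Re_lattice (P : R) (z : C) (m : Z) : Re (z - IZR m * P) = (Re z - IZR m * P)%R.
Proof. destruct z; simpl; ring. Qed.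

Lemma exp_range (P : R) : (0 < P)%R -> (0 < exp (- P) < 1)%R.
Proof. intros hP. split; [apply exp_pos|]. rewrite <- exp_0. apply exp_increasing; lra. Qed.

Lemma abs_nat_IZR (m : Z) : INR (Z.abs_nat m) = Rabs (IZR m).
Proof. rewrite INR_IZR_INZ, Zabs2Nat.id_abs. apply abs_IZR. Qed.

(** The real part of [z - IZR m * P] is at least [|m| P - X] in modulus, and this exceeds 1 as soon
    as [|m| > (X + 1) / P], which fixes [N]. For the coth terms, [coth w - 1] and [coth w + 1] are
    [csch w] times an exponential that is at most 1 on the side where each is used. *)
Lemma lattice_bounds (P X : R) : (0 < P)%R -> exists N : nat, forall (z : C) (m : Z),
  (Rabs (Re z) <= X)%R -> (N <= Z.abs_nat m)%nat ->
  Csinh (z - IZR m * P) <> 0 /\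
  (Cmod (csch (z - IZR m * P)) <= 4 * exp X * exp (- P) ^ Z.abs_nat m)%R /\
  (Cmod (coth (z - IZR m * P) - coth_limit m) <= 4 * exp X * exp (- P) ^ Z.abs_nat m)%R.
Proof.
intros hP. destruct (nfloor_ex (Rmax 0 ((X + 1) / P)) (Rmax_l _ _)) as [n [_ Hn]].
exists (S n). intros z m hz hm.
assert (Hm : (INR n + 1 <= Rabs (IZR m))%R).
{ rewrite <- S_INR, <- abs_nat_IZR. now apply le_INR. }
assert (HX : ((X + 1) / P < Rabs (IZR m))%R).
{ eapply Rle_lt_trans; [apply (Rmax_r 0)|]. lra. }
assert (HX2 : (X + 1 < Rabs (IZR m) * P)%R).
{ apply (Rmult_lt_compat_r P) in HX; [|easy]. unfold Rdiv in HX.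
  rewrite Rmult_assoc, Rinv_l, Rmult_1_r in HX by lra. exact HX. }
set (w := z - IZR m * P).
assert (Hw : (Rabs (IZR m) * P - X <= Rabs (Re w))%R).
{ unfold w. rewrite Re_lattice.
  replace (Rabs (IZR m) * P)%R with (Rabs (IZR m * P)) by (rewrite Rabs_mult, (Rabs_pos_eq P); lra).
  pose proof (Rabs_triang_inv (IZR m * P) (Re z)). rewrite Rabs_minus_sym. lra. }
destruct (Cmod_csch_le w ltac:(lra)) as [H0 H1].
assert (Hb : (exp (- Rabs (Re w)) <= exp X * exp (- P) ^ Z.abs_nat m)%R).
{ rewrite exp_pow_nat, abs_nat_IZR, <- exp_plus. apply exp_le. lra. }
split; [exact H0|]. split; [lra|].
unfold coth_limit. destruct (Z.leb_spec m 0) as [h|h].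
- rewrite coth_minus_1, Cmod_mult, Cmod_Cexp by easy.
  assert (Hr : (0 <= Re w)%R).
  { apply IZR_le in h. rewrite Rabs_left1 in HX2 by lra. unfold w. rewrite Re_lattice.
    pose proof (Rabs_maj2 (Re z)). lra. }
  assert (exp (Re (- w)) <= 1)%R by (rewrite <- exp_0; apply exp_le; destruct w; simpl in *; lra).
  pose proof (exp_pos (Re (- w))). pose proof (Cmod_ge_0 (csch w)). nra.
- replace (coth w - - 1) with (coth w + 1) by ring. rewrite coth_plus_1, Cmod_mult, Cmod_Cexp by easy.
  assert (Hr : (Re w <= 0)%R).
  { apply IZR_lt in h. rewrite Rabs_pos_eq in HX2 by lra. unfold w. rewrite Re_lattice.
    pose proof (Rle_abs (Re z)). lra. }
  assert (exp (Re w) <= 1)%R by (rewrite <- exp_0; apply exp_le; lra).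
  pose proof (exp_pos (Re w)). pose proof (Cmod_ge_0 (csch w)). nra.
Qed.

Lemma geomZ_eventually (a : Z -> C) (M r : R) (N : nat) : (0 < r < 1)%R ->
  (forall m, (N <= Z.abs_nat m)%nat -> (Cmod (a m) <= M * r ^ Z.abs_nat m)%R) -> geomZ a.
Proof.
intros hr H. split.
- apply (geom_eventually _ M r N hr). intros n hn. eapply Rle_trans; [apply H; lia|].
  replace (Z.abs_nat (- Z.of_nat n)) with n by lia. lra.
- apply (geom_eventually _ (M * r) r N hr). intros n hn. eapply Rle_trans; [apply H; lia|].
  replace (Z.abs_nat (1 + Z.of_nat n)) with (S n) by lia. simpl; right; ring.
Qed.

Lemma geomZ_csch (P : R) (z : C) : (0 < P)%R -> geomZ (fun m => csch (z - IZR m * P)).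
Proof.
intros hP. destruct (lattice_bounds P (Rabs (Re z)) hP) as [N H].
apply (geomZ_eventually _ (4 * exp (Rabs (Re z))) _ N (exp_range P hP)). intros m hm.
apply H; [lra|easy].
Qed.

Lemma geomZ_coth (P : R) (z : C) : (0 < P)%R ->
  geomZ (fun m => coth (z - IZR m * P) - coth_limit m).
Proof.
intros hP. destruct (lattice_bounds P (Rabs (Re z)) hP) as [N H].
apply (geomZ_eventually _ (4 * exp (Rabs (Re z))) _ N (exp_range P hP)). intros m hm.
apply H; [lra|easy].
Qed.

Lemma geomZ_sg (a : Z -> C) : geomZ a -> geomZ (fun m => sg m * a m).
Proof. apply (geomZ_bounded_mult sg a 1). intros; rewrite Cmod_sg; lra. Qed.

(** A one-term series, used to correct or to remove the term of index 0. *)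
Lemma zsum_delta (c : C) :
  geomZ (fun m => if (m =? 0)%Z then c else 0) /\ zsum (fun m => if (m =? 0)%Z then c else 0) = c.
Proof.
assert (G : geomZ (fun m => if (m =? 0)%Z then c else 0)).
{ apply (geomZ_eventually _ 1 (/ 2) 1); [lra|]. intros m hm.
  destruct (Z.eqb_spec m 0); [lia|]. rewrite Cmod_0.
  assert (0 < (/ 2) ^ Z.abs_nat m)%R by (apply pow_lt; lra). lra. }
split; [exact G|]. rewrite zsum_split by easy. destruct G as [G1 G2].
rewrite (CSeries_incr _ G1).
rewrite (CSeries_ext _ (fun _ => 0)) by (intros n; destruct (Z.eqb_spec (- Z.of_nat (S n)) 0); [lia|easy]).
rewrite (CSeries_ext (fun n => if (1 + Z.of_nat n =? 0)%Z then c else 0) (fun _ => 0))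
  by (intros n; destruct (Z.eqb_spec (1 + Z.of_nat n) 0); [lia|easy]).
rewrite CSeries_0. simpl. ring.
Qed.

Lemma latD_shift_P (P : R) (z : C) : (0 < P)%R -> latD P (z + P) = latD P z.
Proof.
intros hP. unfold latD. rewrite <- (zsum_pred _ (geomZ_csch P z hP)). apply zsum_ext. intros m.
f_equal. rewrite minus_IZR, RtoC_minus. ring.
Qed.

Lemma latB_shift_P (P : R) (z : C) : (0 < P)%R -> latB P (z + P) = - latB P z.
Proof.
intros hP. unfold latB. pose proof (geomZ_sg _ (geomZ_csch P z hP)) as G.
rewrite <- (zsum_pred _ G). pose proof (geomZ_pred _ G) as G'.
transitivity (zsum (fun m => - 1 * (sg (m - 1) * csch (z - IZR (m - 1) * P)))).
- apply zsum_ext. intros m. replace (z + P - IZR m * P) with (z - IZR (m - 1) * P)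
    by (rewrite minus_IZR, RtoC_minus; ring).
  replace (sg m) with (- sg (m - 1)) by (rewrite <- sg_succ; f_equal; lia). ring.
- rewrite zsum_scal by exact G'. ring.
Qed.

(** Reindexing changes the subtracted limit at index 0 only, by 2; since 1 - 2 = - 1, the leading
    constant changes sign along with the series. *)
Lemma latA_shift_P (P : R) (z : C) : (0 < P)%R -> latA P (z + P) = - latA P z.
Proof.
intros hP. unfold latA. pose proof (geomZ_sg _ (geomZ_coth P z hP)) as G.
destruct (zsum_delta 2) as [G0 E0].
rewrite <- (zsum_succ (fun m => sg m * (coth (z + P - IZR m * P) - coth_limit m)))
  by (apply geomZ_sg, geomZ_coth, hP).
transitivity (1 + zsum (fun m => - 1 * (sg m * (coth (z - IZR m * P) - coth_limit m))
  - (if (m =? 0)%Z then 2 else 0))).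
- f_equal. apply zsum_ext. intros m.
  replace (z + P - IZR (m + 1) * P) with (z - IZR m * P) by (rewrite plus_IZR, RtoC_plus; ring).
  rewrite sg_succ. unfold coth_limit.
  destruct (Z.leb_spec m 0), (Z.leb_spec (m + 1) 0), (Z.eqb_spec m 0); try lia; subst; try ring.
  change (sg 0) with (RtoC 1). ring.
- rewrite zsum_minus, zsum_scal, E0 by (auto; now apply geomZ_scal). ring.
Qed.

Lemma lat_shift_ind (f : C -> C) (P : R) (e : C) : e * e = 1 -> (forall z, f (z + P) = e * f z) ->
  forall (z : C) (r : Z), f (z + IZR r * P) = (if Z.even r then 1 else e) * f z.
Proof.
intros ee H z r. induction r as [|r IH|r IH] using Z.peano_ind.
- simpl. replace (z + 0 * P) with z by ring. ring.
- unfold Z.succ. rewrite plus_IZR, RtoC_plus. replace (z + (IZR r + 1) * P) with (z + IZR r * P + P) by ring.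
  rewrite H, IH, Z.even_add. simpl. destruct (Z.even r); simpl; [ring|].
  rewrite Cmult_assoc, ee. ring.
- assert (E : f (z + IZR (Z.pred r) * P) = e * f (z + IZR r * P)).
  { transitivity (e * (e * f (z + IZR (Z.pred r) * P))); [rewrite Cmult_assoc, ee; ring|].
    rewrite <- H. do 2 f_equal. unfold Z.pred. rewrite plus_IZR, RtoC_plus. simpl. ring. }
  rewrite E, IH. replace (Z.pred r) with (r + (- 1))%Z by lia. rewrite Z.even_add. simpl.
  destruct (Z.even r); simpl; [ring|]. rewrite Cmult_assoc, ee. ring.
Qed.

Lemma latA_shift (P : R) (z : C) (r : Z) : (0 < P)%R -> latA P (z + IZR r * P) = sg r * latA P z.
Proof.
intros hP. rewrite (lat_shift_ind (latA P) P (- 1)); [reflexivity|ring|].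
intros w. rewrite latA_shift_P by easy. ring.
Qed.

Lemma latB_shift (P : R) (z : C) (r : Z) : (0 < P)%R -> latB P (z + IZR r * P) = sg r * latB P z.
Proof.
intros hP. rewrite (lat_shift_ind (latB P) P (- 1)); [reflexivity|ring|].
intros w. rewrite latB_shift_P by easy. ring.
Qed.

Lemma latD_shift (P : R) (z : C) (r : Z) : (0 < P)%R -> latD P (z + IZR r * P) = latD P z.
Proof.
intros hP. rewrite (lat_shift_ind (latD P) P 1); [destruct (Z.even r); ring|ring|].
intros w. rewrite latD_shift_P by easy. ring.
Qed.

Lemma latA_shift_PI (P : R) (z : C) : (0 < P)%R -> off P z -> latA P (z + Ci * PI) = latA P z.
Proof.
intros hP H. unfold latA. f_equal. apply zsum_ext. intros m.
replace (z + Ci * PI - IZR m * P) with (z - IZR m * P + Ci * PI) by ring.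
now rewrite coth_shift2.
Qed.

Lemma latB_shift_PI (P : R) (z : C) : (0 < P)%R -> off P z -> latB P (z + Ci * PI) = - latB P z.
Proof.
intros hP H. unfold latB. transitivity (zsum (fun m => - 1 * (sg m * csch (z - IZR m * P)))).
- apply zsum_ext. intros m. replace (z + Ci * PI - IZR m * P) with (z - IZR m * P + Ci * PI) by ring.
  rewrite csch_shift2 by easy. ring.
- rewrite zsum_scal by (apply geomZ_sg, geomZ_csch, hP). ring.
Qed.

Lemma latD_shift_PI (P : R) (z : C) : (0 < P)%R -> off P z -> latD P (z + Ci * PI) = - latD P z.
Proof.
intros hP H. unfold latD. transitivity (zsum (fun m => - 1 * csch (z - IZR m * P))).
- apply zsum_ext. intros m. replace (z + Ci * PI - IZR m * P) with (z - IZR m * P + Ci * PI) by ring.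
  rewrite csch_shift2 by easy. ring.
- rewrite zsum_scal by (apply geomZ_csch, hP). ring.
Qed.

Lemma lattice_opp (P : R) (z : C) (m : Z) : - z - IZR m * P = - (z - IZR (- m) * P).
Proof. rewrite opp_IZR, RtoC_opp. ring. Qed.

Lemma latD_opp (P : R) (z : C) : (0 < P)%R -> off P z -> latD P (- z) = - latD P z.
Proof.
intros hP H. unfold latD. pose proof (geomZ_csch P z hP) as G.
destruct (zsum_refl _ G) as [G' E']. rewrite <- E'.
transitivity (zsum (fun m => - 1 * csch (z - IZR (- m) * P))).
- apply zsum_ext. intros m. rewrite lattice_opp, csch_opp by apply H. ring.
- rewrite zsum_scal by exact G'. ring.
Qed.

Lemma latB_opp (P : R) (z : C) : (0 < P)%R -> off P z -> latB P (- z) = - latB P z.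
Proof.
intros hP H. unfold latB. pose proof (geomZ_sg _ (geomZ_csch P z hP)) as G.
destruct (zsum_refl _ G) as [G' E']. rewrite <- E'.
transitivity (zsum (fun m => - 1 * (sg (- m) * csch (z - IZR (- m) * P)))).
- apply zsum_ext. intros m. rewrite lattice_opp, csch_opp, sg_opp by apply H. ring.
- rewrite zsum_scal by exact G'. ring.
Qed.

Lemma latA_opp (P : R) (z : C) : (0 < P)%R -> off P z -> latA P (- z) = - latA P z.
Proof.
intros hP H. unfold latA. pose proof (geomZ_sg _ (geomZ_coth P z hP)) as G.
destruct (zsum_refl _ G) as [G' E'].
destruct (zsum_delta 2) as [G0 E0].
transitivity (1 + zsum (fun m => - 1 * (sg (- m) * (coth (z - IZR (- m) * P) - coth_limit (- m)))
  - (if (m =? 0)%Z then 2 else 0))).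
- f_equal. apply zsum_ext. intros m. rewrite lattice_opp, coth_opp, sg_opp by apply H.
  unfold coth_limit.
  destruct (Z.leb_spec m 0), (Z.leb_spec (- m) 0), (Z.eqb_spec m 0); try lia; subst; try ring.
  change (sg 0) with (RtoC 1). ring.
- rewrite zsum_minus, zsum_scal, E', E0 by (auto; now apply geomZ_scal). ring.
Qed.

(** * The addition identity and its consequences *)

(** From [|n| <= |m| + |m - n|]: passing to the square root of the rate trades decay in [m] and
    [m - n] for decay in [m] and [n], the form wanted by [zsum_Fubini]. *)
Lemma convolution_bound (a b : Z -> C) : geomZ a -> geomZ b ->
  exists M r, (0 < r < 1)%R /\
    forall m n, (Cmod (a m * b (m - n)%Z) <= M * r ^ Z.abs_nat m * r ^ Z.abs_nat n)%R.
Proof.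
intros Ha Hb. destruct (geomZ_bound _ Ha) as [M1 [r1 [h1 H1]]].
destruct (geomZ_bound _ Hb) as [M2 [r2 [h2 H2]]].
assert (M10 : (0 <= M1)%R) by (specialize (H1 0%Z); simpl in H1; pose proof (Cmod_ge_0 (a 0%Z)); lra).
assert (M20 : (0 <= M2)%R) by (specialize (H2 0%Z); simpl in H2; pose proof (Cmod_ge_0 (b 0%Z)); lra).
set (q := Rmax r1 r2).
assert (hq : (0 < q < 1)%R).
{ split; [eapply Rlt_le_trans; [apply h1|apply Rmax_l] | apply Rmax_lub_lt; lra]. }
set (r := sqrt q).
assert (hr : (0 < r < 1)%R).
{ split; [apply sqrt_lt_R0; lra|]. rewrite <- sqrt_1. apply sqrt_lt_1; lra. }
assert (rr : (r * r = q)%R) by (apply sqrt_sqrt; lra).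
exists (M1 * M2)%R, r. split; [easy|]. intros m n. rewrite Cmod_mult.
assert (Q : forall s k, (0 < s < 1)%R -> (s <= q)%R -> (s ^ k <= r ^ (k + k))%R).
{ intros s k hs hsq. rewrite pow_add, <- Rpow_mult_distr, rr. apply pow_incr; lra. }
specialize (H1 m). specialize (H2 (m - n)%Z).
pose proof (Q r1 (Z.abs_nat m) h1 (Rmax_l _ _)).
pose proof (Q r2 (Z.abs_nat (m - n)) h2 (Rmax_r _ _)).
assert (E : (r ^ (Z.abs_nat m + Z.abs_nat m) * r ^ (Z.abs_nat (m - n) + Z.abs_nat (m - n))
  <= r ^ Z.abs_nat m * r ^ Z.abs_nat n)%R).
{ rewrite <- !pow_add.
  assert (k : (Z.abs_nat m + Z.abs_nat n <= Z.abs_nat m + Z.abs_nat m + (Z.abs_nat (m - n) + Z.abs_nat (m - n)))%nat) by lia.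
  replace (Z.abs_nat m + Z.abs_nat m + (Z.abs_nat (m - n) + Z.abs_nat (m - n)))%nat with
   ((Z.abs_nat m + Z.abs_nat n) + (Z.abs_nat m + Z.abs_nat m + (Z.abs_nat (m - n) + Z.abs_nat (m - n)) - (Z.abs_nat m + Z.abs_nat n)))%nat by lia.
  rewrite pow_add. match goal with |- (?x * ?y ^ ?k <= _)%R =>
    assert (0 < x)%R by (apply pow_lt; lra);
    assert (y ^ k <= 1)%R by (rewrite <- (pow1 k); apply pow_incr; lra) end. nra. }
assert (0 < r1 ^ Z.abs_nat m)%R by (apply pow_lt; lra).
assert (0 < r2 ^ Z.abs_nat (m - n))%R by (apply pow_lt; lra).
apply Rle_trans with ((M1 * r ^ (Z.abs_nat m + Z.abs_nat m)) * (M2 * r ^ (Z.abs_nat (m - n) + Z.abs_nat (m - n))))%R.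
- apply Rmult_le_compat; try apply Cmod_ge_0; (eapply Rle_trans; [eassumption|]); apply Rmult_le_compat_l; lra.
- replace (M1 * r ^ (Z.abs_nat m + Z.abs_nat m) * (M2 * r ^ (Z.abs_nat (m - n) + Z.abs_nat (m - n))))%R
    with (M1 * M2 * (r ^ (Z.abs_nat m + Z.abs_nat m) * r ^ (Z.abs_nat (m - n) + Z.abs_nat (m - n))))%R by ring.
  rewrite (Rmult_assoc (M1 * M2)). apply Rmult_le_compat_l; [nra|exact E].
Qed.

(** The product is a double series over [m] and [m - n]. By [csch_mult], all the terms with the same
    [n] share the factor [csch (z - w - IZR n * P)], and their sum over [m] is a difference of two
    values of [latA]. *)
Theorem lat_addition (P : R) (z w : C) : (0 < P)%R -> off P z -> off P w -> off P (z - w) ->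
  latB P z * latD P w = latB P (z - w) * latA P w - latD P (z - w) * latA P z.
Proof.
intros hP hz hw hzw.
pose proof (geomZ_sg _ (geomZ_csch P z hP)) as Gz. pose proof (geomZ_csch P w hP) as Gw.
destruct (convolution_bound _ _ Gz Gw) as [M [r [hr HM]]].
transitivity (zsum (fun m => zsum (fun n => sg m * csch (z - IZR m * P) * csch (w - IZR (m - n) * P)))).
{ unfold latB. rewrite Cmult_comm, <- zsum_scal by exact Gz. apply zsum_ext. intros m.
  destruct (zsum_refl _ Gw) as [G' E'].
  destruct (zsum_shift _ m G') as [G'' E''].
  rewrite zsum_scal.
  - rewrite Cmult_comm. f_equal. unfold latD. rewrite <- E', <- E''. apply zsum_ext. intros n.
    do 4 f_equal. f_equal. lia.
  - eapply geomZ_ext; [|exact G'']. intros n; cbv beta. do 4 f_equal. f_equal; lia. }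
rewrite (zsum_Fubini _ M r hr HM).
pose proof (geomZ_sg _ (geomZ_coth P z hP)) as Az.
transitivity (zsum (fun n => csch (z - w - IZR n * P) * (sg n * latA P w - latA P z))).
(* [sg n * latA P w] is the value of [latA] at the translate [w']; in the difference of the two
   values the renormalising limits cancel term by term. *)
{ apply zsum_ext. intros n. rewrite <- (latA_shift P w n hP). set (w' := w + IZR n * P).
  pose proof (geomZ_sg _ (geomZ_coth P w' hP)) as Aw.
  replace (latA P w' - latA P z) with
   (zsum (fun m => sg m * (coth (w' - IZR m * P) - coth_limit m)
     - sg m * (coth (z - IZR m * P) - coth_limit m)))
   by (rewrite zsum_minus by assumption; unfold latA; ring).
  rewrite <- zsum_scal by (now apply geomZ_minus). apply zsum_ext. intros m.
  assert (E : w - IZR (m - n) * P = w' - IZR m * P) by (unfold w'; rewrite minus_IZR, RtoC_minus; ring).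
  rewrite <- Cmult_assoc, E.
  assert (E2 : z - IZR m * P - (w' - IZR m * P) = z - w - IZR n * P) by (unfold w'; ring).
  rewrite csch_mult; rewrite ?E2.
  - ring.
  - apply hz.
  - rewrite <- E. apply hw.
  - apply hzw. }
pose proof (geomZ_csch P (z - w) hP) as G.
transitivity (zsum (fun n => latA P w * (sg n * csch (z - w - IZR n * P)) - latA P z * csch (z - w - IZR n * P))).
{ apply zsum_ext; intros n; ring. }
rewrite zsum_minus, !zsum_scal by (try apply geomZ_scal; try apply geomZ_sg; exact G).
unfold latB, latD. ring.
Qed.

(* The three forms below are [lat_addition] at [(z + h, z)], [(- h, z)] and [(h, - z)]. *)
Lemma lat_addition_A (P : R) (z h : C) : (0 < P)%R -> off P z -> off P h -> off P (z + h) ->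
  latD P h * latA P (z + h) = latB P h * latA P z - latB P (z + h) * latD P z.
Proof.
intros hP hz hh hzh. pose proof (lat_addition P (z + h) z hP hzh hz) as E.
replace (z + h - z) with h in E by ring. rewrite (E hh). ring.
Qed.

Lemma lat_addition_B (P : R) (z h : C) : (0 < P)%R -> off P z -> off P h -> off P (z + h) ->
  latD P h * latB P (z + h) = latA P h * latB P z - latA P (z + h) * latD P z.
Proof.
intros hP hz hh hzh. pose proof (lat_addition P (z + h) h hP hzh hh) as E.
replace (z + h - h) with z in E by ring. rewrite Cmult_comm, (E hz). ring.
Qed.

Lemma lat_addition_D (P : R) (z h : C) : (0 < P)%R -> off P z -> off P h -> off P (z + h) ->
  latB P h * latD P (z + h) = latA P h * latD P z - latA P (z + h) * latB P z.
Proof.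
intros hP hz hh hzh. pose proof (lat_addition P (- h) z hP (off_opp _ _ hh) hz) as E.
pose proof (lat_addition P h (z + h) hP hh hzh) as F.
replace (h - (z + h)) with (- z) in F by ring. rewrite (F (off_opp _ _ hz)), latB_opp, latD_opp by easy.
ring.
Qed.

(** The union of two open strips free of poles. It contains the real and the imaginary segments on
    which the sums get identified, and it is connected, so that first integrals are constant on
    it. *)
Definition good (P : R) (z : C) : Prop := (0 < Re z < P)%R \/ (0 < Im z < PI)%R.

Lemma off_Re (P : R) (z : C) : (0 < Re z < P)%R -> off P z.
Proof.
intros hz m. apply Csinh_neq_0_Re. rewrite Re_lattice. intros E.
destruct (Z_le_gt_dec m 0) as [h|h].
- apply IZR_le in h. nra.
- assert (1 <= m)%Z by lia. apply IZR_le in H. nra.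
Qed.

Lemma off_Im (P : R) (z : C) : (0 < Im z < PI)%R -> off P z.
Proof.
intros hz m. apply Csinh_neq_0_Im.
replace (Im (z - IZR m * P)) with (Im z) by (destruct z; simpl; ring).
apply Rgt_not_eq, sin_gt_0; lra.
Qed.

Lemma good_off (P : R) (z : C) : good P z -> off P z.
Proof. intros [h|h]; [now apply off_Re | now apply off_Im]. Qed.

Lemma good_open (P : R) (z : C) : good P z ->
  exists d, (0 < d)%R /\ forall h : C, (Cmod h < d)%R -> good P (z + h).
Proof.
assert (Q : forall a b x y d : R, (0 < d)%R -> (d <= x - a)%R -> (d <= b - x)%R -> (Rabs y < d)%R ->
  (a < x + y < b)%R).
{ intros a b x y d hd h1 h2 h3. apply Rabs_def2 in h3. lra. }
intros [H|H].
- exists (Rmin (Re z) (P - Re z)); split; [apply Rmin_pos; lra|]. intros h hh. left.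
  replace (Re (z + h)) with (Re z + Re h)%R by (destruct z, h; reflexivity).
  eapply Q; [| | |eapply Rle_lt_trans; [apply Rabs_fst_le|exact hh]].
  + apply Rmin_pos; lra.
  + rewrite Rminus_0_r. apply Rmin_l.
  + apply Rmin_r.
- exists (Rmin (Im z) (PI - Im z)); split; [apply Rmin_pos; lra|]. intros h hh. right.
  replace (Im (z + h)) with (Im z + Im h)%R by (destruct z, h; reflexivity).
  eapply Q; [| | |eapply Rle_lt_trans; [apply Rabs_snd_le|exact hh]].
  + apply Rmin_pos; lra.
  + rewrite Rminus_0_r. apply Rmin_l.
  + apply Rmin_r.
Qed.

Lemma Clim_zsum (a : C -> Z -> C) (l : Z -> C) (d M r : R) (N : nat) :
  (0 < r < 1)%R -> (0 < d)%R -> (0 <= M)%R -> (forall m, Clim (fun h => a h m) (l m)) ->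
  (forall (h : C) m, h <> 0 -> (Cmod h < d)%R -> (N <= Z.abs_nat m)%nat -> (Cmod (a h m) <= M * r ^ Z.abs_nat m)%R) ->
  (forall m, (N <= Z.abs_nat m)%nat -> (Cmod (l m) <= M * r ^ Z.abs_nat m)%R) ->
  Clim (fun h => zsum (a h)) (zsum l).
Proof.
intros hr hd hM Hc Hb Hl.
assert (Q : forall f : Z -> C, (forall m, (N <= Z.abs_nat m)%nat -> (Cmod (f m) <= M * r ^ Z.abs_nat m)%R) ->
  forall n, (N <= n)%nat -> (Cmod (f (- Z.of_nat n)%Z + f (1 + Z.of_nat n)%Z) <= 2 * M * r ^ n)%R).
{ intros f Hf n hn. eapply Rle_trans; [apply Cmod_triangle|].
  pose proof (Hf (- Z.of_nat n)%Z ltac:(lia)) as H1. pose proof (Hf (1 + Z.of_nat n)%Z ltac:(lia)) as H2.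
  replace (Z.abs_nat (- Z.of_nat n)) with n in H1 by lia.
  replace (Z.abs_nat (1 + Z.of_nat n)) with (S n) in H2 by lia. rewrite <- tech_pow_Rmult in H2.
  assert (0 < r ^ n)%R by (apply pow_lt; lra).
  assert (M * (r * r ^ n) <= M * r ^ n)%R by (apply Rmult_le_compat_l; [exact hM|]; rewrite <- (Rmult_1_l (r ^ n)) at 2; apply Rmult_le_compat_r; lra). lra. }
unfold zsum. apply (Clim_CSeries _ _ d (2 * M) r N hr hd).
- intros n. now apply Clim_plus.
- intros h n h0 hh hn. apply Q; [|easy]. intros; now apply Hb.
- intros n hn. now apply Q.
Qed.

Lemma Ccont_csch (z : C) : Csinh z <> 0 -> Ccont csch z.
Proof. intros H. apply Ccont_inv; [easy|apply Ccont_Csinh]. Qed.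

Lemma Ccont_coth (z : C) : Csinh z <> 0 -> Ccont coth z.
Proof. intros H. apply Ccont_div; [easy|apply Ccont_Ccosh|apply Ccont_Csinh]. Qed.

Lemma Rabs_Re_plus_le (z h : C) (d : R) : (Cmod h < d)%R -> (Rabs (Re (z + h)) <= Rabs (Re z) + d)%R.
Proof.
intros hh. replace (Re (z + h)) with (Re z + Re h)%R by (destruct z, h; reflexivity).
eapply Rle_trans; [apply Rabs_triang|]. pose proof (Rabs_fst_le h). unfold Re at 2. lra.
Qed.

(* [mask] switches off the terms that are singular at [z]. *)
Lemma Clim_lat_terms (P : R) (z : C) (mask : Z -> bool) (c : Z -> C) : (0 < P)%R ->
  (forall m, mask m = true -> Csinh (z - IZR m * P) <> 0) ->
  Clim (fun h => zsum (fun m => if mask m then csch (z + h - IZR m * P) else 0))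
    (zsum (fun m => if mask m then csch (z - IZR m * P) else 0)) /\
  Clim (fun h => zsum (fun m => if mask m then sg m * csch (z + h - IZR m * P) else 0))
    (zsum (fun m => if mask m then sg m * csch (z - IZR m * P) else 0)) /\
  Clim (fun h => zsum (fun m => if mask m then sg m * (coth (z + h - IZR m * P) - coth_limit m) else
       if (m =? 0)%Z then c m else 0))
    (zsum (fun m => if mask m then sg m * (coth (z - IZR m * P) - coth_limit m) else
       if (m =? 0)%Z then c m else 0)).
Proof.
intros hP H0. destruct (lattice_bounds P (Rabs (Re z) + 1) hP) as [N H].
set (M := (4 * exp (Rabs (Re z) + 1))%R).
assert (hM : (0 <= M)%R) by (unfold M; pose proof (exp_pos (Rabs (Re z) + 1)); lra).
assert (hpow : forall n, (0 <= M * exp (- P) ^ n)%R).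
{ intros n. apply Rmult_le_pos; [easy|]. apply pow_le, Rlt_le, exp_pos. }
assert (Cc : forall m, Csinh (z - IZR m * P) <> 0 ->
  Clim (fun h => csch (z + h - IZR m * P)) (csch (z - IZR m * P))).
{ intros m hm. apply (Clim_ext (fun h => csch (z - IZR m * P + h))); [intros; f_equal; ring|].
  now apply Ccont_csch. }
assert (Cd : forall m, Csinh (z - IZR m * P) <> 0 ->
  Clim (fun h => coth (z + h - IZR m * P)) (coth (z - IZR m * P))).
{ intros m hm. apply (Clim_ext (fun h => coth (z - IZR m * P + h))); [intros; f_equal; ring|].
  now apply Ccont_coth. }
split; [|split]; apply (Clim_zsum _ _ 1 M (exp (- P)) (S N) (exp_range P hP) Rlt_0_1 hM).
- intros m. specialize (H0 m). destruct (mask m); [now apply Cc, H0|apply Clim_const].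
- intros h m h0 hh hm. destruct (mask m); [|rewrite Cmod_0; apply hpow].
  apply H; [now apply Rabs_Re_plus_le|lia].
- intros m hm. destruct (mask m); [|rewrite Cmod_0; apply hpow]. apply H; [lra|lia].
- intros m. specialize (H0 m). destruct (mask m); [apply Clim_scal; now apply Cc, H0|apply Clim_const].
- intros h m h0 hh hm. destruct (mask m); [|rewrite Cmod_0; apply hpow].
  rewrite Cmod_mult, Cmod_sg, Rmult_1_l. apply H; [now apply Rabs_Re_plus_le|lia].
- intros m hm. destruct (mask m); [|rewrite Cmod_0; apply hpow].
  rewrite Cmod_mult, Cmod_sg, Rmult_1_l. apply H; [lra|lia].
- intros m. specialize (H0 m). destruct (mask m); [|apply Clim_const].
  apply Clim_scal, Clim_minus; [now apply Cd, H0 | apply Clim_const].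
- intros h m h0 hh hm. destruct (mask m).
  + rewrite Cmod_mult, Cmod_sg, Rmult_1_l. apply H; [now apply Rabs_Re_plus_le|lia].
  + destruct (Z.eqb_spec m 0); [lia|]. rewrite Cmod_0; apply hpow.
- intros m hm. destruct (mask m).
  + rewrite Cmod_mult, Cmod_sg, Rmult_1_l. apply H; [lra|lia].
  + destruct (Z.eqb_spec m 0); [lia|]. rewrite Cmod_0; apply hpow.
Qed.

Lemma Ccont_latA (P : R) (z : C) : (0 < P)%R -> off P z -> Ccont (latA P) z.
Proof.
intros hP H. apply Clim_plus; [apply Clim_const|].
apply (Clim_lat_terms P z (fun _ => true) (fun _ => 0) hP). intros; apply H.
Qed.

Lemma Ccont_latB (P : R) (z : C) : (0 < P)%R -> off P z -> Ccont (latB P) z.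
Proof. intros hP H. apply (Clim_lat_terms P z (fun _ => true) (fun _ => 0) hP). intros; apply H. Qed.

Lemma Ccont_latD (P : R) (z : C) : (0 < P)%R -> off P z -> Ccont (latD P) z.
Proof. intros hP H. apply (Clim_lat_terms P z (fun _ => true) (fun _ => 0) hP). intros; apply H. Qed.

(** Lets oddness, instead of a summation, evaluate the regular parts at the pole. *)
Lemma Clim_odd (f : C -> C) (l : C) (d : R) : (0 < d)%R ->
  (forall h : C, h <> 0 -> (Cmod h < d)%R -> f (- h) = - f h) -> Clim f l -> l = 0.
Proof.
intros hd Ho Hf. apply eq_of_Cmod_lt. intros eps he. destruct (Hf (eps / 2)%R ltac:(lra)) as [d1 [h1 H1]].
set (x := (Rmin d d1 / 2)%R).
assert (hx : (0 < x)%R) by (unfold x; pose proof (Rmin_pos d d1 hd h1); lra).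
assert (x0 : RtoC x <> 0) by (intros E; apply RtoC_inj in E; lra).
assert (xd : (Cmod x < d)%R).
{ rewrite Cmod_R, Rabs_pos_eq by lra. unfold x in *. pose proof (Rmin_l d d1). lra. }
assert (xd1 : (Cmod x < d1)%R).
{ rewrite Cmod_R, Rabs_pos_eq by lra. unfold x in *. pose proof (Rmin_r d d1). lra. }
pose proof (H1 x x0 xd1) as K1.
assert (xo : - RtoC x <> 0) by (intros E; now apply x0, Copp_0_inv).
pose proof (H1 (- x) xo ltac:(now rewrite Cmod_opp)) as K2. rewrite (Ho x x0 xd) in K2.
replace (l - 0) with (/ 2 * (- (f x - l) - (- f x - l))) by field.
rewrite Cmod_mult.
assert (Cmod (/ 2) = / 2)%R as -> by (rewrite <- RtoC_inv by lra; rewrite Cmod_R, Rabs_pos_eq; lra).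
eapply Rle_lt_trans; [apply Rmult_le_compat_l; [lra|]; apply Cmod_triangle|]. rewrite !Cmod_opp. lra.
Qed.

Lemma small_off (P : R) : (0 < P)%R -> exists d, (0 < d)%R /\
  forall h : C, h <> 0 -> (Cmod h < d)%R -> off P h.
Proof.
(* A radius at most [P] excludes the other columns of poles; at most 1, which is below [PI], it
   excludes the other poles of the column of 0. *)
intros hP. exists (Rmin P 1); split; [apply Rmin_pos; lra|]. intros h h0 hh m.
pose proof (Rabs_fst_le h). pose proof (Rabs_snd_le h).
pose proof (Rmin_l P 1). pose proof (Rmin_r P 1).
assert (hP1 : (Rabs (fst h) < P)%R) by lra. assert (h1 : (Rabs (snd h) < 1)%R) by lra.
apply Rabs_def2 in hP1, h1.
destruct (Z.eq_dec m 0) as [->|hm].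
- replace (h - 0 * P) with h by ring. destruct (Req_dec (Re h) 0) as [e|e]; [|now apply Csinh_neq_0_Re].
  apply Csinh_neq_0_Im. assert (e2 : Im h <> 0%R).
  { intros e2. apply h0. destruct h; simpl in *; subst; reflexivity. }
  pose proof PI_RGT_0. assert (1 < PI)%R by (pose proof PI2_1; lra). unfold Im in *.
  destruct (Rlt_or_le (snd h) 0).
  + replace (snd h) with (- (- snd h))%R by ring. rewrite sin_neg.
    pose proof (sin_gt_0 (- snd h) ltac:(lra) ltac:(lra)). lra.
  + pose proof (sin_gt_0 (snd h) ltac:(lra) ltac:(lra)). lra.
- apply Csinh_neq_0_Re. rewrite Re_lattice. unfold Re. intros E.
  destruct (Z_le_gt_dec m (- 1)) as [k|k].
  + apply IZR_le in k. nra.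
  + assert (1 <= m)%Z by lia. apply IZR_le in H3. nra.
Qed.

Lemma Cder_0_lim (f : C -> C) (l : C) : Cder f 0 l -> Clim (fun h => (f h - f 0) / h) l.
Proof. apply Clim_ext. intros h _. now replace (0 + h) with h by ring. Qed.

Lemma Csinh_0 : Csinh 0 = 0.
Proof. unfold Csinh. replace (- 0) with (RtoC 0) by ring. rewrite Cexp_0. field. Qed.

Lemma Ccosh_0 : Ccosh 0 = 1.
Proof. unfold Ccosh. replace (- 0) with (RtoC 0) by ring. rewrite Cexp_0. field. Qed.

Lemma Clim_csch_0 : Clim (fun h => h * csch h) 1.
Proof.
assert (H : Clim (fun h => Csinh h / h) 1).
{ apply (Clim_ext (fun h => (Csinh h - Csinh 0) / h)); [intros; rewrite Csinh_0; f_equal; ring|].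
  apply Cder_0_lim. eapply Cder_eq; [|apply Cder_Csinh]. apply Ccosh_0. }
destruct (small_off 1 Rlt_0_1) as [d [hd Hd]].
apply (Clim_eq _ (/ 1)); [field|].
apply (Clim_ext_loc (fun h => / (Csinh h / h)) _ _ d hd); [|apply Clim_inv; [apply C1_neq_0|exact H]].
intros h h0 hh. specialize (Hd h h0 hh 0%Z). replace (h - 0 * 1) with h in Hd by ring.
unfold csch. field. now split.
Qed.

Lemma Clim_coth_csch_0 : Clim (fun h => coth h - csch h) 0.
Proof.
assert (H : Clim (fun h => (Ccosh h - 1) / h) 0).
{ apply (Clim_ext (fun h => (Ccosh h - Ccosh 0) / h)); [intros; now rewrite Ccosh_0|].
  apply Cder_0_lim. eapply Cder_eq; [|apply Cder_Ccosh]. apply Csinh_0. }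
destruct (small_off 1 Rlt_0_1) as [d [hd Hd]].
apply (Clim_eq _ (0 * 1)); [ring|].
apply (Clim_ext_loc (fun h => (Ccosh h - 1) / h * (h * csch h)) _ _ d hd).
- intros h h0 hh. specialize (Hd h h0 hh 0%Z). replace (h - 0 * 1) with h in Hd by ring.
  unfold coth, csch. field. now split.
- apply Clim_mult; [exact H|apply Clim_csch_0].
Qed.

(** Deprived of its singular term, each series has a limit at 0 by domination, and this limit
    vanishes by oddness. *)
Lemma lat_pole (P : R) : (0 < P)%R ->
  Clim (fun h => latA P h - coth h) 0 /\ Clim (fun h => latB P h - csch h) 0 /\
  Clim (fun h => latD P h - csch h) 0.
Proof.
intros hP. destruct (small_off P hP) as [d [hd Hd]].
set (mask := fun m : Z => negb (m =? 0)%Z).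
(* In [latA] only coth is removed from the term of index 0: its [- coth_limit 0], which is - 1,
   remains. *)
destruct (Clim_lat_terms P 0 mask (fun _ => - 1) hP) as [HD [HB HA]].
{ intros m hm. unfold mask in hm. destruct (Z.eqb_spec m 0); [easy|].
  apply Csinh_neq_0_Re. rewrite Re_lattice. simpl. intros E.
  assert (IZR m * P <> 0)%R; [|lra]. apply Rmult_integral_contrapositive; split; [|lra].
  now apply not_0_IZR. }
assert (Sh : forall h : C, h <> 0 -> (Cmod h < d)%R -> Csinh h <> 0).
{ intros h h0 hh. specialize (Hd h h0 hh 0%Z). now replace (h - 0 * P) with h in Hd by ring. }
assert (SA : forall h : C, latA P h - coth h = 1 + zsum (fun m => if mask m then
   sg m * (coth (0 + h - IZR m * P) - coth_limit m) else if (m =? 0)%Z then - 1 else 0)).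
{ intros h. destruct (zsum_delta (coth h)) as [G E].
  transitivity (1 + (zsum (fun m => sg m * (coth (h - IZR m * P) - coth_limit m))
     - zsum (fun m => if (m =? 0)%Z then coth h else 0))); [rewrite E; unfold latA; ring|].
  rewrite <- zsum_minus by (try apply geomZ_sg; try apply geomZ_coth; auto). f_equal. apply zsum_ext. intros m.
  unfold mask. destruct (Z.eqb_spec m 0) as [->|]; simpl.
  - change (sg 0) with (RtoC 1). change (coth_limit 0) with (RtoC 1).
    replace (h - 0 * P) with h by ring. ring.
  - replace (0 + h - IZR m * P) with (h - IZR m * P) by ring. ring. }
assert (SB : forall h : C, latB P h - csch h = zsum (fun m => if mask m then
   sg m * csch (0 + h - IZR m * P) else 0)).
{ intros h. destruct (zsum_delta (csch h)) as [G E]. rewrite <- E. unfold latB.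
  rewrite <- zsum_minus by (try apply geomZ_sg; try apply geomZ_csch; auto). apply zsum_ext. intros m.
  unfold mask. destruct (Z.eqb_spec m 0) as [->|]; simpl.
  - change (sg 0) with (RtoC 1). replace (h - 0 * P) with h by ring. ring.
  - replace (0 + h - IZR m * P) with (h - IZR m * P) by ring. ring. }
assert (SD : forall h : C, latD P h - csch h = zsum (fun m => if mask m then
   csch (0 + h - IZR m * P) else 0)).
{ intros h. destruct (zsum_delta (csch h)) as [G E]. rewrite <- E. unfold latD.
  rewrite <- zsum_minus by (try apply geomZ_csch; auto). apply zsum_ext. intros m.
  unfold mask. destruct (Z.eqb_spec m 0) as [->|]; simpl.
  - replace (h - 0 * P) with h by ring. ring.
  - replace (0 + h - IZR m * P) with (h - IZR m * P) by ring. ring. }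
split; [|split].
- match type of HA with Clim _ ?l => assert (L : Clim (fun h => latA P h - coth h) (1 + l)) end.
  { eapply Clim_ext; [|apply Clim_plus; [apply (Clim_const 1)|exact HA]]. intros h _. symmetry. apply SA. }
  eapply Clim_eq; [|exact L]. apply (Clim_odd _ _ d hd) in L; [exact L|].
  intros h h0 hh. rewrite latA_opp, coth_opp by auto. ring.
- match type of HB with Clim _ ?l => assert (L : Clim (fun h => latB P h - csch h) l) end.
  { eapply Clim_ext; [|exact HB]. intros h _. symmetry. apply SB. }
  eapply Clim_eq; [|exact L]. apply (Clim_odd _ _ d hd) in L; [exact L|].
  intros h h0 hh. rewrite latB_opp, csch_opp by auto. ring.
- match type of HD with Clim _ ?l => assert (L : Clim (fun h => latD P h - csch h) l) end.
  { eapply Clim_ext; [|exact HD]. intros h _. symmetry. apply SD. }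
  eapply Clim_eq; [|exact L]. apply (Clim_odd _ _ d hd) in L; [exact L|].
  intros h h0 hh. rewrite latD_opp, csch_opp by auto. ring.
Qed.

(* If [p f(z + h) = q f(z) - g(z + h) c], where [p ~ 1/h] and [q - p -> 0], then
   [h -> 0] gives [f' = - c g]. *)
Lemma Cder_of_addition (f g p q : C -> C) (z c : C) (d : R) : (0 < d)%R -> Ccont g z ->
  Clim (fun h => h * p h) 1 -> Clim (fun h => q h - p h) 0 ->
  (forall h : C, h <> 0 -> (Cmod h < d)%R -> p h * f (z + h) = q h * f z - g (z + h) * c) ->
  Cder f z (- (g z * c)).
Proof.
intros hd Hg Hp Hq E. destruct (Hp 1%R Rlt_0_1) as [d1 [hd1 H1]].
apply (Clim_eq _ ((0 * f z - g z * c) / 1)); [field|].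
apply (Clim_ext_loc (fun h => ((q h - p h) * f z - g (z + h) * c) / (h * p h)) _ _ (Rmin d d1)).
- now apply Rmin_pos.
- intros h h0 hh. pose proof (Rmin_l d d1). pose proof (Rmin_r d d1).
  specialize (E h h0 ltac:(lra)). specialize (H1 h h0 ltac:(lra)).
  assert (p0 : p h <> 0).
  { intros e. rewrite e in H1. replace (h * 0 - 1) with (RtoC (- 1)) in H1 by ring.
    rewrite Cmod_R, Rabs_left in H1; lra. }
  replace ((q h - p h) * f z - g (z + h) * c) with (q h * f z - g (z + h) * c - p h * f z) by ring.
  rewrite <- E. field. now split.
- apply Clim_div; [apply C1_neq_0| |exact Hp].
  apply Clim_minus; [|apply Clim_mult; [exact Hg|apply Clim_const]].
  apply Clim_mult; [exact Hq|apply Clim_const].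
Qed.

(** The three sums have the same principal part at 0 and their differences tend to 0 there,
    [coth - csch] included; each form of the addition law thus passes to the limit through
    [Cder_of_addition]. *)
Lemma lat_der (P : R) (z : C) : (0 < P)%R -> good P z ->
  Cder (latA P) z (- (latB P z * latD P z)) /\ Cder (latB P) z (- (latA P z * latD P z)) /\
  Cder (latD P) z (- (latA P z * latB P z)).
Proof.
intros hP hz. pose proof (good_off _ _ hz) as oz.
destruct (lat_pole P hP) as [LA [LB LD]].
destruct (small_off P hP) as [d1 [hd1 Hd1]].
destruct (good_open P z hz) as [d2 [hd2 Hd2]].
assert (hd : (0 < Rmin d1 d2)%R) by now apply Rmin_pos.
assert (O : forall h : C, h <> 0 -> (Cmod h < Rmin d1 d2)%R -> off P h /\ off P (z + h)).
{ intros h h0 hh. pose proof (Rmin_l d1 d2). pose proof (Rmin_r d1 d2). split.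
  - apply Hd1; [easy|lra].
  - apply good_off, Hd2; lra. }
assert (h1 : forall f : C -> C, Clim (fun h => f h - csch h) 0 -> Clim (fun h => h * f h) 1).
{ intros f Hf. apply (Clim_eq _ (0 * 0 + 1)); [ring|].
  apply (Clim_ext (fun h => h * (f h - csch h) + h * csch h)); [intros; ring|].
  apply Clim_plus; [apply Clim_mult; [apply Clim_id|easy]|apply Clim_csch_0]. }
assert (Sub : forall f g k l : C -> C, Clim (fun h => f h - k h) 0 -> Clim (fun h => g h - l h) 0 ->
  Clim (fun h => k h - l h) 0 -> Clim (fun h => f h - g h) 0).
{ intros f g k l H1 H2 H3. apply (Clim_eq _ (0 - 0 + 0)); [ring|].
  apply (Clim_ext (fun h => (f h - k h) - (g h - l h) + (k h - l h))); [intros; ring|].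
  apply Clim_plus; [now apply Clim_minus|easy]. }
assert (cc : Clim (fun h => csch h - csch h) 0).
{ apply (Clim_ext (fun _ => 0)); [intros; ring|apply Clim_const]. }
split; [|split].
- apply (Cder_of_addition _ (latB P) (latD P) (latB P) z _ _ hd).
  + now apply Ccont_latB.
  + now apply h1.
  + exact (Sub _ _ _ _ LB LD cc).
  + intros h h0 hh. destruct (O h h0 hh). now apply lat_addition_A.
- apply (Cder_of_addition _ (latA P) (latD P) (latA P) z _ _ hd).
  + now apply Ccont_latA.
  + now apply h1.
  + exact (Sub _ _ _ _ LA LD Clim_coth_csch_0).
  + intros h h0 hh. destruct (O h h0 hh). now apply lat_addition_B.
- apply (Cder_of_addition _ (latA P) (latB P) (latA P) z _ _ hd).
  + now apply Ccont_latA.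
  + now apply h1.
  + exact (Sub _ _ _ _ LA LB Clim_coth_csch_0).
  + intros h h0 hh. destruct (O h h0 hh). now apply lat_addition_D.
Qed.

(** * Restriction to lines and first integrals *)

(** Taken with [c = 1] and [c = Ci], it turns questions on complex derivatives into real
    one-variable calculus, such as the mean value theorem. *)
Lemma Cder_line (f : C -> C) (z0 v c l : C) (t : R) : v <> 0 -> c <> 0 -> Cder f (z0 + t * v) l ->
  is_derive (fun s : R => Re (c * f (z0 + s * v))) t (Re (c * (v * l))).
Proof.
intros v0 c0 H. apply is_derive_Reals. intros eps he.
assert (hv : (0 < Cmod v)%R) by now apply Cmod_gt_0.
assert (hc : (0 < Cmod c)%R) by now apply Cmod_gt_0.
destruct (H (eps / (Cmod c * Cmod v))%R) as [d [hd Hd]]; [apply Rdiv_lt_0_compat; nra|].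
assert (hdv : (0 < d / Cmod v)%R) by now apply Rdiv_lt_0_compat.
exists (mkposreal _ hdv). intros h h0 hh. simpl in hh.
assert (hC : RtoC h <> 0) by (intros E; now apply RtoC_inj in E).
specialize (Hd (h * v)).
assert (K : (Cmod ((f (z0 + t * v + h * v) - f (z0 + t * v)) / (h * v) - l)%C < eps / (Cmod c * Cmod v))%R).
{ apply Hd; [now apply Cmult_neq_0|]. rewrite Cmod_mult, Cmod_R.
  apply (Rmult_lt_compat_r (Cmod v)) in hh; [|easy].
  replace (d / Cmod v * Cmod v)%R with d in hh by (field; lra). exact hh. }
set (w := (f (z0 + t * v + h * v) - f (z0 + t * v)) / (h * v) - l) in K.
assert (E : ((Re (c * f (z0 + (t + h)%R * v))%C - Re (c * f (z0 + t * v))%C) / h - Re (c * (v * l))%C)%R = Re (c * v * w)).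
{ assert (E1 : c * f (z0 + (t + h)%R * v) = c * f (z0 + t * v) + h * (c * v * w + c * (v * l))).
  { rewrite RtoC_plus. replace (z0 + (t + h) * v) with (z0 + t * v + h * v) by ring.
    unfold w. field. now split. }
  rewrite E1. destruct (c * f (z0 + t * v)) as [p1 p2], (c * v * w) as [q1 q2], (c * (v * l)) as [s1 s2].
  simpl. field. exact h0. }
rewrite E. eapply Rle_lt_trans; [apply re_le_Cmod|]. rewrite !Cmod_mult.
apply (Rmult_lt_compat_l (Cmod c * Cmod v)) in K; [|nra].
replace (Cmod c * Cmod v * (eps / (Cmod c * Cmod v)))%R with eps in K by (field; lra). exact K.
Qed.

Lemma Cder_0_segment (f : C -> C) (z0 v : C) : v <> 0 ->
  (forall t : R, (0 <= t <= 1)%R -> Cder f (z0 + t * v) 0) -> f (z0 + v) = f z0.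
Proof.
intros v0 H.
assert (Q : forall c : C, c <> 0 -> Re (c * f (z0 + v)) = Re (c * f z0)).
{ intros c c0.
  destruct (MVT_gen (fun s : R => Re (c * f (z0 + s * v))) 0 1 (fun _ => 0%R)) as [x [_ Hx]].
  - intros x hx. rewrite Rmin_left, Rmax_right in hx by lra.
    replace 0%R with (Re (c * (v * 0))) by (rewrite !Cmult_0_r; reflexivity).
    apply Cder_line; [easy|easy|]. apply H; lra.
  - intros x hx. rewrite Rmin_left, Rmax_right in hx by lra.
    apply continuity_pt_filterlim. apply (ex_derive_continuous (V := R_NormedModule)).
    eexists. apply (Cder_line f z0 v c 0 x v0 c0). apply H; lra.
  - rewrite Rmult_0_l in Hx.
    replace (z0 + 1 * v) with (z0 + v) in Hx by ring. replace (z0 + 0 * v) with z0 in Hx by ring. lra. }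
pose proof (Q 1 C1_neq_0) as H1. pose proof (Q Ci Ci_neq_0) as H2.
destruct (f (z0 + v)) as [a b], (f z0) as [a' b']. simpl in H1, H2. f_equal; lra.
Qed.

(** The path is vertical up to the line Im = PI / 2, within whichever strip contains [z], then
    horizontal to [Ci * (PI / 2)]. *)
Lemma good_path_const (P : R) (f : C -> C) (z : C) :
  (forall w, good P w -> Cder f w 0) -> good P z -> f z = f (Ci * (PI / 2)).
Proof.
intros H hz. pose proof PI_RGT_0 as hpi.
assert (S : forall z0 z1 : C, (forall t, (0 <= t <= 1)%R -> good P (z0 + t * (z1 - z0))) -> f z1 = f z0).
{ intros z0 z1 G. destruct (Ceq_dec (z1 - z0) 0) as [e|e].
  - replace z1 with (z1 - z0 + z0) by ring. now rewrite e, Cplus_0_l.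
  - replace z1 with (z0 + (z1 - z0)) at 1 by ring. apply Cder_0_segment; [easy|]. intros; now apply H, G. }
assert (I2 : Ci * (PI / 2) = (0, PI / 2)%R).
{ unfold Ci, Cdiv, Cmult, Cinv, RtoC; simpl; f_equal; field. }
rewrite I2. destruct z as [x y]. transitivity (f (x, (PI / 2)%R)).
- apply S. intros t ht. unfold good in *; simpl in *.
  replace (x + (t * (x + - x) - 0 * (y + - (PI / 2))))%R with x by ring.
  replace (PI / 2 + (t * (y + - (PI / 2)) + 0 * (x + - x)))%R with ((1 - t) * (PI / 2) + t * y)%R by ring.
  destruct hz as [hz|hz]; [now left|right].
  assert (0 <= t * y)%R by nra. assert (0 <= (1 - t) * (PI / 2))%R by nra.
  assert (t * y <= t * PI)%R by nra. destruct (Req_dec t 0) as [->|]; [lra|]. nra.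
- apply S. intros t ht. right; simpl. rewrite !Rplus_opp_r. lra.
Qed.

(** [latA] vanishes at [Ci * (PI / 2)], so these two values determine both first integrals. [lat_b]
    will be the scale of the Jacobi functions, in value and in argument, and [lat_a / lat_b] their
    modulus. *)
Definition lat_a (P : R) : R := Re (Ci * latB P (Ci * (PI / 2))).
Definition lat_b (P : R) : R := Re (Ci * latD P (Ci * (PI / 2))).

Lemma CSeries_RtoC (x : nat -> R) : CSeries (fun n => RtoC (x n)) = RtoC (Series x).
Proof.
unfold CSeries, RtoC. f_equal.
rewrite (Series_ext _ (fun n => 0 * x n)%R) by (intros; simpl; ring).
rewrite Series_scal_l. ring.
Qed.

Lemma Im_iPI2 : Im (Ci * (PI / 2)) = (PI / 2)%R.
Proof. unfold Ci, Cdiv, Cmult, Cinv, RtoC; simpl; field. Qed.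

Lemma good_iPI2 (P : R) : good P (Ci * (PI / 2)).
Proof. right. rewrite Im_iPI2. pose proof PI_RGT_0; lra. Qed.

Lemma csch_iPI2 (x : R) : Ci * csch (Ci * (PI / 2) - x) = (/ cosh x)%R.
Proof.
unfold csch. replace (Ci * (PI / 2) - x) with (- x + Ci * (PI / 2)) by ring.
rewrite Csinh_shift, Ccosh_opp, Ccosh_RtoC, RtoC_inv by (apply Rgt_not_eq, cosh_pos).
field. split; [|apply Ci_neq_0]. intros E; apply RtoC_inj in E. pose proof (cosh_pos x); lra.
Qed.

Definition rsg (m : Z) : R := if Z.even m then 1%R else (- 1)%R.

Lemma RtoC_rsg (m : Z) : RtoC (rsg m) = sg m.
Proof. unfold rsg, sg. now destruct (Z.even m). Qed.

Lemma iD_series (P : R) : (0 < P)%R -> Ci * latD P (Ci * (PI / 2)) =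
  RtoC (Series (fun n => / cosh (IZR (- Z.of_nat n) * P) + / cosh (IZR (1 + Z.of_nat n) * P))%R).
Proof.
intros hP. rewrite <- CSeries_RtoC. unfold latD. rewrite <- zsum_scal by (apply geomZ_csch, hP).
apply CSeries_ext. intros n. rewrite RtoC_plus, <- !csch_iPI2, !RtoC_mult. reflexivity.
Qed.

Lemma iB_series (P : R) : (0 < P)%R -> Ci * latB P (Ci * (PI / 2)) =
  RtoC (Series (fun n => rsg (- Z.of_nat n) * / cosh (IZR (- Z.of_nat n) * P)
     + rsg (1 + Z.of_nat n) * / cosh (IZR (1 + Z.of_nat n) * P))%R).
Proof.
intros hP. rewrite <- CSeries_RtoC. unfold latB. rewrite <- zsum_scal by (apply geomZ_sg, geomZ_csch, hP).
apply CSeries_ext. intros n. rewrite RtoC_plus, !RtoC_mult, <- !csch_iPI2, !RtoC_rsg, !RtoC_mult. ring.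
Qed.

Lemma lat_values_iPI2 (P : R) : (0 < P)%R ->
  latA P (Ci * (PI / 2)) = 0 /\ Ci * latB P (Ci * (PI / 2)) = lat_a P /\
  Ci * latD P (Ci * (PI / 2)) = lat_b P.
Proof.
intros hP. split; [|split].
(* [latA] is odd with period [Ci * PI], and [Ci * (PI / 2)] differs from its opposite by that
   period. *)
- pose proof (good_off _ _ (good_iPI2 P)) as o. pose proof (off_opp _ _ o) as o'.
  pose proof (latA_shift_PI P (- (Ci * (PI / 2))) hP o') as E.
  rewrite latA_opp in E by easy. replace (- (Ci * (PI / 2)) + Ci * PI) with (Ci * (PI / 2)) in E by field.
  set (a := latA P (Ci * (PI / 2))) in *.
  assert (2 * a = 0). { transitivity (a + a); [ring|]. rewrite E at 1. ring. }
  destruct (Ceq_dec a 0) as [e|e]; [exact e|]. exfalso. exact (Cmult_neq_0 _ _ C2_neq_0 e H).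
- unfold lat_a. now rewrite iB_series by easy.
- unfold lat_b. now rewrite iD_series by easy.
Qed.

Lemma sech_geom (P : R) : (0 < P)%R ->
  ex_series (fun n => / cosh (IZR (- Z.of_nat n) * P) + / cosh (IZR (1 + Z.of_nat n) * P))%R /\
  ex_series (fun n => rsg (- Z.of_nat n) * / cosh (IZR (- Z.of_nat n) * P)
     + rsg (1 + Z.of_nat n) * / cosh (IZR (1 + Z.of_nat n) * P))%R.
Proof.
intros hP. pose proof (geomZ_csch P (Ci * (PI / 2)) hP) as G.
split.
- pose proof (geom_fst _ (geomZ_pair _ (geomZ_scal Ci _ G))) as H.
  eapply ex_series_ext; [|exact H]. intros n. cbv beta.
  rewrite <- !RtoC_mult, !csch_iPI2. reflexivity.
- pose proof (geom_fst _ (geomZ_pair _ (geomZ_scal Ci _ (geomZ_sg _ G)))) as H.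
  eapply ex_series_ext; [|exact H]. intros n. cbv beta.
  replace (Ci * (sg (- Z.of_nat n) * csch (Ci * (PI / 2) - IZR (- Z.of_nat n) * P)))
   with (sg (- Z.of_nat n) * (Ci * csch (Ci * (PI / 2) - IZR (- Z.of_nat n) * P))) by ring.
  replace (Ci * (sg (1 + Z.of_nat n) * csch (Ci * (PI / 2) - IZR (1 + Z.of_nat n) * P)))
   with (sg (1 + Z.of_nat n) * (Ci * csch (Ci * (PI / 2) - IZR (1 + Z.of_nat n) * P))) by ring.
  rewrite <- !RtoC_mult, !csch_iPI2, <- !RtoC_rsg. simpl. ring.
Qed.

Lemma Series_pos (a : nat -> R) : ex_series a -> (forall n, (0 <= a n)%R) -> (0 < a 0%nat)%R ->
  (0 < Series a)%R.
Proof.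
intros Ha Hp H0. rewrite (Series_incr_1 a Ha).
assert (0 <= Series (fun k => a (S k)))%R; [|lra].
assert (E : Series (fun _ : nat => 0%R) = 0%R).
{ rewrite (Series_ext _ (fun _ => 0 * 0)%R) by (intros; ring).
  rewrite (Series_scal_l 0 (fun _ => 0%R)). ring. }
rewrite <- E. apply Series_le; [intros n; split; [lra|apply Hp]|]. now apply ex_series_incr_1 in Ha.
Qed.

(** [lat_b] is the sum of sech over the multiples of [P], and [lat_a] the same sum with alternating
    signs: the sum and the difference of both are series of nonnegative terms, positive at the first
    rank. *)
Lemma lat_a_lt_b (P : R) : (0 < P)%R -> (Rabs (lat_a P) < lat_b P)%R.
Proof.
intros hP. unfold lat_a, lat_b. rewrite iB_series, iD_series by easy.
assert (RR : forall x : R, Re x = x) by easy. rewrite !RR.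
destruct (sech_geom P hP) as [G1 G2].
assert (s0 : forall x, (0 < / cosh x)%R) by (intros; apply Rinv_0_lt_compat, cosh_pos).
apply Rabs_def1.
- apply Rlt_0_minus. rewrite <- Series_minus by easy. apply Series_pos.
  + apply (ex_series_minus (K := R_AbsRing) (V := R_NormedModule)); easy.
  + intros n. set (p := (/ cosh (IZR (- Z.of_nat n) * P))%R). set (q := (/ cosh (IZR (1 + Z.of_nat n) * P))%R).
    assert (0 < p)%R by apply s0. assert (0 < q)%R by apply s0.
    unfold rsg. destruct (Z.even (- Z.of_nat n)), (Z.even (1 + Z.of_nat n)); lra.
  + simpl. set (p := (/ cosh (0 * P))%R). set (q := (/ cosh (1 * P))%R).
    assert (0 < q)%R by apply s0. unfold rsg; simpl. lra.
- apply Rlt_0_minus. unfold Rminus. rewrite Ropp_involutive, <- Series_plus by easy. apply Series_pos.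
  + apply (ex_series_plus (K := R_AbsRing) (V := R_NormedModule)); easy.
  + intros n. set (p := (/ cosh (IZR (- Z.of_nat n) * P))%R). set (q := (/ cosh (IZR (1 + Z.of_nat n) * P))%R).
    assert (0 < p)%R by apply s0. assert (0 < q)%R by apply s0.
    unfold rsg. destruct (Z.even (- Z.of_nat n)), (Z.even (1 + Z.of_nat n)); lra.
  + simpl. set (p := (/ cosh (0 * P))%R). set (q := (/ cosh (1 * P))%R).
    assert (0 < p)%R by apply s0. unfold rsg; simpl. lra.
Qed.

Lemma lat_invariants (P : R) (z : C) : (0 < P)%R -> good P z ->
  latA P z * latA P z - latD P z * latD P z = lat_b P * lat_b P /\
  latA P z * latA P z - latB P z * latB P z = lat_a P * lat_a P.
Proof.
intros hP hz. destruct (lat_values_iPI2 P hP) as [V1 [V2 V3]].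
split.
- rewrite <- !V3.
  transitivity ((fun w => latA P w * latA P w + - 1 * (latD P w * latD P w)) z); [simpl; ring|].
  rewrite (good_path_const P (fun w => latA P w * latA P w + - 1 * (latD P w * latD P w)) z); [| |easy].
  + rewrite V1. replace (Ci * latD P (Ci * (PI / 2)) * (Ci * latD P (Ci * (PI / 2)))) with
     (Ci * Ci * (latD P (Ci * (PI / 2)) * latD P (Ci * (PI / 2)))) by ring. rewrite Ci_sqr. ring.
  + intros w hw. destruct (lat_der P w hP hw) as [DA [DB DD]].
    eapply Cder_eq; [|apply Cder_plus; [apply Cder_mult; exact DA|apply Cder_scal, Cder_mult; exact DD]]. ring.
- rewrite <- !V2.
  transitivity ((fun w => latA P w * latA P w + - 1 * (latB P w * latB P w)) z); [simpl; ring|].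
  rewrite (good_path_const P (fun w => latA P w * latA P w + - 1 * (latB P w * latB P w)) z); [| |easy].
  + rewrite V1. replace (Ci * latB P (Ci * (PI / 2)) * (Ci * latB P (Ci * (PI / 2)))) with
     (Ci * Ci * (latB P (Ci * (PI / 2)) * latB P (Ci * (PI / 2)))) by ring. rewrite Ci_sqr. ring.
  + intros w hw. destruct (lat_der P w hP hw) as [DA [DB DD]].
    eapply Cder_eq; [|apply Cder_plus; [apply Cder_mult; exact DA|apply Cder_scal, Cder_mult; exact DB]]. ring.
Qed.

Lemma Cconj_zsum (a : Z -> C) : Cconj (zsum a) = zsum (fun m => Cconj (a m)).
Proof.
unfold zsum, CSeries, Cconj; simpl. f_equal. rewrite <- Series_opp. apply Series_ext. intros; ring.
Qed.

Lemma Cconj_Csinh (z : C) : Cconj (Csinh z) = Csinh (Cconj z).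
Proof.
destruct z as [x y]. unfold Cconj at 2; simpl. rewrite !Csinh_pair. unfold Cconj; simpl.
rewrite cos_neg, sin_neg. f_equal; ring.
Qed.

Lemma Cconj_Ccosh (z : C) : Cconj (Ccosh z) = Ccosh (Cconj z).
Proof.
destruct z as [x y]. unfold Cconj at 2; simpl. rewrite !Ccosh_pair. unfold Cconj; simpl.
rewrite cos_neg, sin_neg. f_equal; ring.
Qed.

Lemma Cconj_RtoC (x : R) : Cconj x = x.
Proof. unfold Cconj, RtoC; simpl. f_equal; ring. Qed.

Lemma Cconj_lattice (P : R) (z : C) (m : Z) : Cconj (z - IZR m * P) = Cconj z - IZR m * P.
Proof. now rewrite Cminus_conj, Cmult_conj, !Cconj_RtoC. Qed.

Lemma Cconj_sg (m : Z) : Cconj (sg m) = sg m.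
Proof. rewrite <- RtoC_rsg. apply Cconj_RtoC. Qed.

Lemma Cconj_lat (P : R) (z : C) : off P z -> Cconj (latA P z) = latA P (Cconj z) /\
  Cconj (latB P z) = latB P (Cconj z) /\ Cconj (latD P z) = latD P (Cconj z).
Proof.
intros H.
assert (S : forall m, Cconj (csch (z - IZR m * P)) = csch (Cconj z - IZR m * P)).
{ intros m. unfold csch. now rewrite Cinv_conj, Cconj_Csinh, Cconj_lattice by apply H. }
assert (T : forall m, Cconj (coth (z - IZR m * P)) = coth (Cconj z - IZR m * P)).
{ intros m. unfold coth. now rewrite Cdiv_conj, Cconj_Csinh, Cconj_Ccosh, Cconj_lattice by apply H. }
assert (L : forall m, Cconj (coth_limit m) = coth_limit m).
{ intros m. unfold coth_limit. destruct (m <=? 0)%Z; apply Cconj_RtoC. }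
split; [|split].
- unfold latA. rewrite Cplus_conj, Cconj_RtoC, Cconj_zsum. f_equal. apply zsum_ext. intros m.
  now rewrite Cmult_conj, Cminus_conj, Cconj_sg, T, L.
- unfold latB. rewrite Cconj_zsum. apply zsum_ext. intros m. now rewrite Cmult_conj, Cconj_sg, S.
- unfold latD. rewrite Cconj_zsum. apply zsum_ext. intros m. apply S.
Qed.

Lemma Cconj_real (w : C) : Cconj w = w -> w = RtoC (Re w).
Proof. destruct w as [x y]; unfold Cconj, RtoC; simpl; intros H; injection H; intros. f_equal; lra. Qed.

Lemma Cconj_imag (w : C) : Cconj w = - w -> w = - Ci * Re (Ci * w).
Proof.
destruct w as [x y]; unfold Cconj, RtoC, Copp, Cmult, Ci; simpl; intros H; injection H; intros.
f_equal; lra.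
Qed.

Lemma lat_real (P x : R) : (0 < x < P)%R -> latA P x = Re (latA P x) /\
  latB P x = Re (latB P x) /\ latD P x = Re (latD P x).
Proof.
intros hx. destruct (Cconj_lat P x) as [H1 [H2 H3]]; [now apply off_Re|].
rewrite Cconj_RtoC in *. repeat split; now apply Cconj_real.
Qed.

(** Conjugation sends [Ci * y] to its opposite, so oddness makes the values purely imaginary. *)
Lemma lat_imag (P y : R) : (0 < P)%R -> (0 < y < PI)%R ->
  latA P (Ci * y) = - Ci * Re (Ci * latA P (Ci * y)) /\
  latB P (Ci * y) = - Ci * Re (Ci * latB P (Ci * y)) /\
  latD P (Ci * y) = - Ci * Re (Ci * latD P (Ci * y)).
Proof.
intros hP hy. assert (o : off P (Ci * y)).
{ apply off_Im. destruct hy; simpl; split; lra. }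
destruct (Cconj_lat P (Ci * y) o) as [H1 [H2 H3]].
replace (Cconj (Ci * y)) with (- (Ci * y)) in * by (unfold Cconj, Copp, Ci, Cmult, RtoC; simpl; f_equal; ring).
rewrite latA_opp in H1 by easy. rewrite latB_opp in H2 by easy. rewrite latD_opp in H3 by easy.
repeat split; now apply Cconj_imag.
Qed.

Local Open Scope R_scope.

(** * Identification of the lattice sums with Jacobi functions *)

Lemma is_derive_continuous (f : R -> R) (x l : R) : is_derive f x l -> continuous f x.
Proof. intros H. apply (ex_derive_continuous (V := R_NormedModule)). now exists l. Qed.

Lemma const_of_is_derive_0 (g : R -> R) (a b : R) :
  (forall x, a < x < b -> is_derive g x 0) -> forall x y, a < x < b -> a < y < b -> g x = g y.
Proof.
intros H x y hx hy.
destruct (MVT_gen g x y (fun _ => 0)) as [c [_ Hc]].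
- intros t ht. apply H. destruct (Rle_dec x y).
  + rewrite Rmin_left, Rmax_right in ht by lra. lra.
  + rewrite Rmin_right, Rmax_left in ht by lra. lra.
- intros t ht. apply continuity_pt_filterlim, (ex_derive_continuous (V := R_NormedModule)).
  eexists; apply H. destruct (Rle_dec x y).
  + rewrite Rmin_left, Rmax_right in ht by lra. lra.
  + rewrite Rmin_right, Rmax_left in ht by lra. lra.
- lra.
Qed.

(* [u = l cs(l x)] solves [u' = - sqrt (l^2 + u^2) sqrt (l^2 (1 - m^2) + u^2)];
   its angle [PI/2 - atan (u / l)] is the amplitude of [l x]. *)
Lemma cs_characterization (l m L : R) (u : R -> R) : 0 < l -> 0 < m < 1 -> 0 < L ->
  (forall x, 0 < x < L ->
     is_derive u x (- (sqrt (l ^ 2 + u x ^ 2) * sqrt (l ^ 2 * (1 - m ^ 2) + u x ^ 2)))) ->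
  (forall M, exists d, 0 < d /\ forall x, 0 < x < d -> x < L -> M < u x) ->
  u (L / 2) = 0 ->
  ellipticK m = l * L / 2 /\
  forall x, 0 < x < L -> Rsn (l * x) m = l / sqrt (l ^ 2 + u x ^ 2) /\
    Rcn (l * x) m = u x / sqrt (l ^ 2 + u x ^ 2).
Proof.
intros hl hm hL Hu Hinf H0.
set (phi := fun x => PI / 2 - atan (u x / l)).
assert (Hpos : forall x, 0 < l ^ 2 + u x ^ 2) by (intros; nra).
assert (Hs : forall x, 0 < sqrt (l ^ 2 + u x ^ 2)) by (intros; now apply sqrt_lt_R0).
assert (Hsq : forall x, sqrt (1 + Rsqr (u x / l)) = sqrt (l ^ 2 + u x ^ 2) / l).
{ intros x. replace (1 + Rsqr (u x / l)) with ((l ^ 2 + u x ^ 2) / l ^ 2) by (unfold Rsqr; field; lra).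
  rewrite sqrt_div_alt, sqrt_pow2; [reflexivity|lra|nra]. }
assert (Hsin : forall x, sin (phi x) = l / sqrt (l ^ 2 + u x ^ 2)).
{ intros x. unfold phi. rewrite sin_shift, cos_atan, Hsq. field. specialize (Hs x). split; lra. }
assert (Hcos : forall x, cos (phi x) = u x / sqrt (l ^ 2 + u x ^ 2)).
{ intros x. unfold phi. rewrite cos_shift, sin_atan, Hsq. field. specialize (Hs x). split; lra. }
assert (HF : forall x, 0 < x < L -> is_derive (fun t => ellipticF (phi t) m - l * t) x 0).
{ intros x hx. specialize (Hu x hx). set (Q := l ^ 2 * (1 - m ^ 2) + u x ^ 2) in *.
  assert (hQ : 0 < Q).
  { assert (0 < l ^ 2 * (1 - m ^ 2)) by (apply Rmult_lt_0_compat; nra). pose proof (pow2_ge_0 (u x)). unfold Q; lra. } assert (hq := sqrt_lt_R0 _ hQ).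
  set (S := l ^ 2 + u x ^ 2) in *. specialize (Hpos x). fold S in Hpos.
  specialize (Hs x). fold S in Hs.
  assert (Dphi : is_derive phi x (l * sqrt Q / sqrt S)).
  { unfold phi. evar_last.
    - apply (is_derive_minus (V := R_NormedModule) (fun _ => PI / 2)); [apply is_derive_const|].
      apply (is_derive_comp atan (fun t => u t / l)).
      + apply is_derive_Reals, derivable_pt_lim_atan.
      + apply (is_derive_ext (fun t => / l * u t)); [intros; unfold Rdiv; apply Rmult_comm|].
        apply (is_derive_scal u x (/ l)). exact Hu.
    - unfold minus, plus, opp, zero, scal; simpl. unfold mult; simpl.
      replace (1 + u x / l * (u x / l * 1)) with (sqrt S * sqrt S / l ^ 2)
        by (rewrite sqrt_sqrt by lra; unfold S; field; lra).
      field. repeat split; lra. }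
  assert (E : sqrt (1 - m ^ 2 * sin (phi x) ^ 2) = sqrt Q / sqrt S).
  { rewrite <- sqrt_div_alt by easy. f_equal. rewrite Hsin. fold S.
    replace ((l / sqrt S) ^ 2) with (l ^ 2 / S).
    - unfold Q, S. field. fold S. lra.
    - unfold Rdiv. rewrite Rpow_mult_distr, pow_inv, pow2_sqrt by lra. reflexivity. }
  evar_last.
  - apply (is_derive_minus (V := R_NormedModule) (fun t => ellipticF (phi t) m) (fun t => l * t)).
    + apply (is_derive_comp (fun p => ellipticF p m) phi); [now apply is_derive_ellipticF|exact Dphi].
    + apply (is_derive_scal (fun t => t) x l). apply is_derive_id.
  - rewrite E. unfold minus, plus, opp, one, scal; simpl. unfold mult; simpl. field. lra. }
(* The difference is a constant [c]. Near 0, [u] is large and [phi] small, so there is a [y] with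
   [|ellipticF (phi y) m| < |c| / 2] and [l * y <= |c| / 4]; together these contradict [c <> 0]. *)
assert (HC : forall x, 0 < x < L -> ellipticF (phi x) m = l * x).
{ intros x hx. set (c := ellipticF (phi x) m - l * x).
  destruct (Req_dec c 0) as [e|e]; [unfold c in e; lra|]. exfalso.
  assert (Hc : forall y, 0 < y < L -> ellipticF (phi y) m - l * y = c)
    by (intros y hy; exact (const_of_is_derive_0 _ 0 L HF y x hy hx)).
  assert (he : 0 < Rabs c / 2) by (pose proof (Rabs_pos_lt c e); lra).
  assert (Cont : continuity_pt (fun p => ellipticF p m) 0).
  { apply continuity_pt_filterlim. exact (is_derive_continuous _ _ _ (is_derive_ellipticF m 0 hm)). }
  destruct (Cont (Rabs c / 2) he) as [d [hd Hd]]. simpl in Hd. unfold R_dist in Hd.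
  set (d' := Rmin d (PI / 4)). pose proof PI_RGT_0.
  assert (hd' : 0 < d') by (apply Rmin_pos; lra).
  pose proof (Rmin_l d (PI / 4)). pose proof (Rmin_r d (PI / 4)). fold d' in H1, H2.
  destruct (Hinf (l * tan (PI / 2 - d'))) as [d2 [hd2 Hd2]].
  set (d3 := Rabs c / (4 * l)).
  assert (hd3 : 0 < d3) by (apply Rdiv_lt_0_compat; lra).
  set (y := Rmin (Rmin (d2 / 2) (L / 2)) d3).
  assert (hy : 0 < y) by (repeat apply Rmin_pos; lra).
  assert (y <= d2 / 2) by (unfold y; eapply Rle_trans; [apply Rmin_l|apply Rmin_l]).
  assert (y <= L / 2) by (unfold y; eapply Rle_trans; [apply Rmin_l|apply Rmin_r]).
  assert (y <= d3) by (unfold y; apply Rmin_r).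
  specialize (Hd2 y ltac:(lra) ltac:(lra)).
  assert (T : PI / 2 - d' < atan (u y / l)).
  { rewrite <- (atan_tan (PI / 2 - d')) by lra. apply atan_increasing.
    apply (Rmult_lt_reg_l l); [easy|]. replace (l * (u y / l)) with (u y) by (field; lra). exact Hd2. }
  pose proof (atan_bound (u y / l)).
  assert (P1 : 0 < phi y < d') by (unfold phi; lra).
  specialize (Hd (phi y)). rewrite ellipticF_0, !Rminus_0_r in Hd.
  assert (B : Rabs (ellipticF (phi y) m) < Rabs c / 2).
  { apply Hd. split; [split; [exact I|lra]|]. rewrite Rabs_pos_eq; lra. }
  specialize (Hc y ltac:(lra)).
  assert (ly : l * y <= Rabs c / 4).
  { apply Rle_trans with (l * d3); [apply Rmult_le_compat_l; lra|]. unfold d3. right; field; lra. }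
  assert (Rabs c <= Rabs (ellipticF (phi y) m) + l * y).
  { rewrite <- Hc. eapply Rle_trans; [apply Rabs_triang|]. rewrite Rabs_Ropp, (Rabs_pos_eq (l * y)) by nra. lra. }
  lra. }
split.
(* [u] vanishes at the midpoint, where the angle is thus [PI / 2]. *)
- unfold ellipticK. replace (l * L / 2) with (l * (L / 2)) by field. rewrite <- HC by lra.
  f_equal. unfold phi. rewrite H0. replace (0 / l) with 0 by (field; lra). rewrite atan_0. ring.
- intros x hx. unfold Rsn, Rcn. rewrite <- (HC x hx), am_ellipticF by easy. now split.
Qed.

Lemma positive_of_nonzero (g : R -> R) (L : R) : (forall x, 0 < x < L -> continuous g x) ->
  (forall x, 0 < x < L -> g x <> 0) -> (exists d, 0 < d /\ forall x, 0 < x < d -> 0 < g x) ->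
  forall x, 0 < x < L -> 0 < g x.
Proof.
intros Hc Hn [d [hd Hd]] x hx. destruct (Rlt_or_le 0 (g x)) as [h|h]; [exact h|exfalso].
set (y := Rmin (d / 2) (x / 2)).
assert (hy : 0 < y) by (apply Rmin_pos; lra).
pose proof (Rmin_l (d / 2) (x / 2)). pose proof (Rmin_r (d / 2) (x / 2)). fold y in H, H0.
pose proof (Hd y ltac:(lra)).
destruct (IVT_interv (fun t => - g t) y x) as [t [ht Ht]].
- intros t ht. apply continuity_pt_opp. apply continuity_pt_filterlim, Hc. lra.
- lra.
- lra.
- destruct (Req_dec (g x) 0) as [e|e]; [|lra]. exfalso. now apply (Hn x hx).
- apply (Hn t); lra.
Qed.

Lemma Cinv_Ci : (/ Ci = - Ci)%C.
Proof.
replace (- Ci)%C with (- (Ci * Ci) * / Ci)%C by (field; apply Ci_neq_0).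
rewrite Ci_sqr. field. apply Ci_neq_0.
Qed.

(** With residue 1, [f (x * v)] is close to [1 / (x * v)], so that [r] is close to [1 / x]. The
    directions used are [v = 1] and [v = Ci]. *)
Lemma pole_line (f : C -> C) (v : C) : Cmod v = 1 ->
  Clim (fun h => (h * f h)%C) 1%C -> forall M, exists d, 0 < d /\ forall x r : R, 0 < x < d ->
  f (x * v)%C = (/ v * r)%C -> M < r.
Proof.
intros hv Hf M. destruct (Hf (/ 2) ltac:(lra)) as [d [hd Hd]].
assert (v0 : v <> 0%C) by (intros e; rewrite e, Cmod_0 in hv; lra).
pose proof (Rabs_pos M) as hM. assert (hk : 0 < / (2 * (Rabs M + 1))) by (apply Rinv_0_lt_compat; lra).
exists (Rmin d (/ (2 * (Rabs M + 1)))). split; [now apply Rmin_pos|].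
intros x r hx e. pose proof (Rmin_l d (/ (2 * (Rabs M + 1)))).
pose proof (Rmin_r d (/ (2 * (Rabs M + 1)))).
assert (x0 : RtoC x <> 0%C) by (intros E; apply RtoC_inj in E; lra).
specialize (Hd (x * v)%C ltac:(now apply Cmult_neq_0)).
rewrite Cmod_mult, hv, Rmult_1_r, Cmod_R, Rabs_pos_eq in Hd by lra.
specialize (Hd ltac:(lra)). rewrite e in Hd.
replace (x * v * (/ v * r) - 1)%C with (RtoC (x * r - 1)) in Hd
  by (rewrite RtoC_minus, RtoC_mult; field; easy).
rewrite Cmod_R in Hd. apply Rabs_def2 in Hd. pose proof (Rle_abs M).
assert (x * (2 * (Rabs M + 1)) < 1).
{ apply Rlt_le_trans with (/ (2 * (Rabs M + 1)) * (2 * (Rabs M + 1))).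
  - apply Rmult_lt_compat_r; lra.
  - right; field; lra. }
nra.
Qed.

Lemma lat_pole_1 (P : R) : 0 < P -> Clim (fun h => (h * latA P h)%C) 1%C /\
  Clim (fun h => (h * latB P h)%C) 1%C /\ Clim (fun h => (h * latD P h)%C) 1%C.
Proof.
intros hP. destruct (lat_pole P hP) as [LA [LB LD]].
assert (h1 : forall f : C -> C, Clim (fun h => (f h - csch h)%C) 0%C -> Clim (fun h => (h * f h)%C) 1%C).
{ intros f Hf. apply (Clim_eq _ (0 * 0 + 1)%C); [ring|].
  apply (Clim_ext (fun h => (h * (f h - csch h) + h * csch h)%C)); [intros; ring|].
  apply Clim_plus; [apply Clim_mult; [apply Clim_id|easy]|apply Clim_csch_0]. }
repeat split; apply h1; try easy.
apply (Clim_eq _ (0 + 0)%C); [ring|].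
apply (Clim_ext (fun h => ((latA P h - coth h) + (coth h - csch h))%C)); [intros; ring|].
apply Clim_plus; [easy|apply Clim_coth_csch_0].
Qed.

Lemma good_imag (P y : R) : 0 < y < PI -> good P (Ci * y)%C.
Proof. intros hy. right. simpl. lra. Qed.

Lemma good_real (P x : R) : 0 < x < P -> good P x.
Proof. intros hx. left. exact hx. Qed.

Lemma is_derive_real_line (f g k : C -> C) (x : R) : Cder f x (- (g x * k x))%C ->
  g x = Re (g x) -> k x = Re (k x) ->
  is_derive (fun t : R => Re (f t)) x (- (Re (g x) * Re (k x))).
Proof.
intros H Hg Hk.
assert (E := Cder_line f 0 1 1 (- (g x * k x))%C x C1_neq_0 C1_neq_0).
replace (0 + x * 1)%C with (RtoC x) in E by ring. specialize (E H).
apply (is_derive_ext (fun s : R => Re (1 * f (0 + s * 1))%C)).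
- intros t. replace (0 + t * 1)%C with (RtoC t) by ring. now rewrite Cmult_1_l.
- evar_last; [exact E|]. rewrite Hg, Hk at 1. simpl. ring.
Qed.

Lemma is_derive_imag_line (f g k : C -> C) (y : R) : Cder f (Ci * y)%C (- (g (Ci * y)%C * k (Ci * y)%C))%C ->
  g (Ci * y)%C = (- Ci * Re (Ci * g (Ci * y)%C)%C)%C -> k (Ci * y)%C = (- Ci * Re (Ci * k (Ci * y)%C)%C)%C ->
  is_derive (fun t : R => Re (Ci * f (Ci * t)%C)%C) y
    (- (Re (Ci * g (Ci * y)%C)%C * Re (Ci * k (Ci * y)%C)%C)).
Proof.
intros H Hg Hk.
assert (E := Cder_line f 0 Ci Ci (- (g (Ci * y)%C * k (Ci * y)%C))%C y Ci_neq_0 Ci_neq_0).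
replace (0 + y * Ci)%C with (Ci * y)%C in E by ring. specialize (E H).
apply (is_derive_ext (fun s : R => Re (Ci * f (0 + s * Ci))%C)).
- intros t. now replace (0 + t * Ci)%C with (Ci * t)%C by ring.
- evar_last; [exact E|]. rewrite Hg, Hk at 1.
  set (p := Re (Ci * g (Ci * y)%C)%C). set (q := Re (Ci * k (Ci * y)%C)%C). simpl. ring.
Qed.

Definition imA (P y : R) : R := Re (Ci * latA P (Ci * y)%C)%C.
Definition imB (P y : R) : R := Re (Ci * latB P (Ci * y)%C)%C.
Definition imD (P y : R) : R := Re (Ci * latD P (Ci * y)%C)%C.

Lemma lat_imag_facts (P : R) : 0 < P ->
  (forall y, 0 < y < PI -> is_derive (imA P) y (- (imB P y * imD P y)) /\
     is_derive (imB P) y (- (imA P y * imD P y)) /\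
     is_derive (imD P) y (- (imA P y * imB P y)) /\ imD P y ^ 2 = lat_b P ^ 2 + imA P y ^ 2 /\
     imB P y ^ 2 = lat_a P ^ 2 + imA P y ^ 2) /\
  (forall M, exists e, 0 < e /\ forall y, 0 < y < e -> y < PI -> M < imA P y /\ M < imB P y /\ M < imD P y) /\
  imA P (PI / 2) = 0 /\ imB P (PI / 2) = lat_a P.
Proof.
intros hP.
split; [|split; [|split]].
- intros y hy. destruct (lat_imag P y hP hy) as [E1 [E2 E3]].
  destruct (lat_der P _ hP (good_imag P y hy)) as [D1 [D2 D3]].
  destruct (lat_invariants P _ hP (good_imag P y hy)) as [I1 I2].
  split; [|split; [|split]].
  + now apply is_derive_imag_line.
  + now apply is_derive_imag_line.
  + now apply is_derive_imag_line.
  + rewrite E1, E2, E3 in *. fold (imA P y) (imB P y) (imD P y) in *.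
    set (r := imA P) in *. set (b := imB P) in *. set (d := imD P) in *.
    replace (- Ci * r y * (- Ci * r y) - - Ci * d y * (- Ci * d y))%C with (Ci * Ci * (r y * r y - d y * d y))%C in I1 by ring.
    replace (- Ci * r y * (- Ci * r y) - - Ci * b y * (- Ci * b y))%C with (Ci * Ci * (r y * r y - b y * b y))%C in I2 by ring.
    rewrite Ci_sqr, <- !RtoC_mult, <- RtoC_minus, <- RtoC_mult in I1, I2.
    apply RtoC_inj in I1, I2. split; lra.
- intros M. destruct (lat_pole_1 P hP) as [L1 [L2 L3]].
  destruct (pole_line _ Ci Cmod_Ci L1 M) as [e1 [h1 H1]].
  destruct (pole_line _ Ci Cmod_Ci L2 M) as [e2 [h2 H2]].
  destruct (pole_line _ Ci Cmod_Ci L3 M) as [e3 [h3 H3]].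
  exists (Rmin e1 (Rmin e2 e3)). split; [repeat apply Rmin_pos; easy|]. intros y hy hpi.
  pose proof (Rmin_l e1 (Rmin e2 e3)). pose proof (Rmin_r e1 (Rmin e2 e3)).
  pose proof (Rmin_l e2 e3). pose proof (Rmin_r e2 e3).
  destruct (lat_imag P y hP ltac:(lra)) as [E1 [E2 E3]].
  pose proof Cinv_Ci as Q.
  split; [|split].
  + apply (H1 y); [lra|]. rewrite Q, (Cmult_comm y Ci). exact E1.
  + apply (H2 y); [lra|]. rewrite Q, (Cmult_comm y Ci). exact E2.
  + apply (H3 y); [lra|]. rewrite Q, (Cmult_comm y Ci). exact E3.
- unfold imA. replace (RtoC (PI / 2)) with (PI / 2)%C by (now rewrite RtoC_div by lra).
  destruct (lat_values_iPI2 P hP) as [V1 _]. rewrite V1, Cmult_0_r. reflexivity.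
- unfold imB. replace (RtoC (PI / 2)) with (PI / 2)%C by (now rewrite RtoC_div by lra). reflexivity.
Qed.

(* [u = r + b] solves the linear equation [u' = - d u], is positive near 0 and
   takes the value [lat_a] at [PI / 2]. *)
Lemma lat_a_pos (P : R) : 0 < P -> 0 < lat_a P.
Proof.
intros hP. destruct (lat_imag_facts P hP) as [F1 [F2 [F3 F4]]].
set (r := imA P) in *. set (b := imB P) in *. set (d := imD P) in *.
clearbody r b d. pose proof PI_RGT_0 as hpi.
destruct (F2 0) as [e [he He]].
set (y0 := Rmin (e / 2) (PI / 4)).
assert (hy0 : 0 < y0) by (apply Rmin_pos; lra).
pose proof (Rmin_l (e / 2) (PI / 4)) as m1. pose proof (Rmin_r (e / 2) (PI / 4)) as m2. fold y0 in m1, m2.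
destruct (He y0 ltac:(lra) ltac:(lra)) as [p1 [p2 p3]].
set (u := fun y => r y + b y).
assert (Du : forall y, 0 < y < PI -> is_derive u y (- (d y * u y))).
{ intros y hy. destruct (F1 y hy) as [D1 [D2 _]]. unfold u.
  evar_last; [exact (is_derive_plus _ _ _ _ _ D1 D2)|]. unfold plus; simpl. ring. }
assert (Cd : forall y, 0 < y < PI -> continuity_pt d y).
{ intros y hy. destruct (F1 y hy) as [_ [_ [D3 _]]]. apply continuity_pt_filterlim.
  exact (is_derive_continuous _ _ _ D3). }
destruct (continuity_ab_maj d y0 (PI / 2) ltac:(lra)) as [x [Hx _]]; [intros; apply Cd; lra|].
set (M := d x) in *.
(* Gronwall's argument: as [M] is the maximum of [d] on the interval, [u ^ 2] times this exponential
   weight is nondecreasing, and [u] cannot reach 0. *)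
assert (Hmono : forall y, y0 <= y <= PI / 2 -> u y0 ^ 2 * exp (2 * M * y0) <= u y ^ 2 * exp (2 * M * y)).
{ intros y hy. destruct (Req_dec y0 y) as [<-|ne]; [lra|].
  assert (Dw : forall t, 0 < t < PI -> is_derive (fun t => u t ^ 2 * exp (2 * M * t)) t
    (2 * u t ^ 2 * exp (2 * M * t) * (M - d t))).
  { intros t ht. pose proof (Du t ht) as D. auto_derive; [now exists (- (d t * u t))|].
    rewrite (is_derive_unique (fun x : R => u x) t _ D). ring. }
  destruct (MVT_gen (fun t => u t ^ 2 * exp (2 * M * t)) y0 y
    (fun t => 2 * u t ^ 2 * exp (2 * M * t) * (M - d t))) as [c [hc Hc]].
  - intros t ht. rewrite Rmin_left, Rmax_right in ht by lra. apply Dw; lra.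
  - intros t ht. rewrite Rmin_left, Rmax_right in ht by lra.
    apply continuity_pt_filterlim. exact (is_derive_continuous _ _ _ (Dw t ltac:(lra))).
  - rewrite Rmin_left, Rmax_right in hc by lra. specialize (Hx c ltac:(lra)). fold M in Hx.
    assert (0 <= 2 * u c ^ 2 * exp (2 * M * c) * (M - d c)).
    { apply Rmult_le_pos; [|lra]. apply Rmult_le_pos; [|apply Rlt_le, exp_pos].
      pose proof (pow2_ge_0 (u c)). lra. }
    nra. }
assert (u0 : 0 < u y0) by (unfold u; lra).
assert (nz : forall y, y0 <= y <= PI / 2 -> u y <> 0).
{ intros y hy E. specialize (Hmono y hy). rewrite E in Hmono.
  pose proof (exp_pos (2 * M * y0)). assert (0 < u y0 ^ 2) by (apply pow_lt; easy). simpl in *. nra. }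
assert (E : u (PI / 2) = lat_a P) by (unfold u; rewrite F3, F4; ring).
rewrite <- E. destruct (Rlt_or_le 0 (u (PI / 2))) as [h|h]; [exact h|exfalso].
destruct (IVT_interv (fun t => - u t) y0 (PI / 2)) as [t [ht Ht]].
- intros t ht. apply continuity_pt_opp, continuity_pt_filterlim.
  apply (is_derive_continuous _ _ _ (Du t ltac:(lra))).
- lra.
- lra.
- pose proof (nz (PI / 2) ltac:(lra)). lra.
- apply (nz t ht). lra.
Qed.

(** The modulus intrinsic to the lattice; its link with [k] is only established in [kap_period]. *)
Definition kap (P : R) : R := lat_a P / lat_b P.

Lemma kap_range (P : R) : 0 < P -> 0 < kap P < 1.
Proof.
intros hP. pose proof (lat_a_pos P hP). pose proof (lat_a_lt_b P hP). rewrite Rabs_pos_eq in H0 by lra.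
unfold kap. split; [apply Rdiv_lt_0_compat; lra|]. apply (Rmult_lt_reg_r (lat_b P)); [lra|].
unfold Rdiv. rewrite Rmult_assoc, Rinv_l; lra.
Qed.

Lemma lat_b_pos (P : R) : 0 < P -> 0 < lat_b P.
Proof. intros hP. pose proof (lat_a_lt_b P hP). pose proof (Rabs_pos (lat_a P)). lra. Qed.

Lemma lat_a_kap (P : R) : 0 < P -> lat_a P = kap P * lat_b P.
Proof. intros hP. pose proof (lat_b_pos P hP). unfold kap. field. lra. Qed.

Lemma pow2_eq_sqrt (x y : R) : 0 < x -> x ^ 2 = y -> sqrt y = x.
Proof. intros hx <-. apply sqrt_pow2; lra. Qed.

(** On the imaginary axis [Ci * latA] plays the part of [u] in [cs_characterization]. The first
    integrals give [l = lat_b P] and [l ^ 2 * (1 - m ^ 2) = lat_a P ^ 2], so [m] is the complement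
    of [kap P]. *)
Lemma lat_imag_jacobi (P : R) : 0 < P ->
  ellipticK (compl_modulus (kap P)) = lat_b P * PI / 2 /\
  forall y, 0 < y < PI ->
  let s := Rsn (lat_b P * y) (compl_modulus (kap P)) in
  let c := Rcn (lat_b P * y) (compl_modulus (kap P)) in
  let d := Rdn (lat_b P * y) (compl_modulus (kap P)) in
  s <> 0 /\ latA P (Ci * y)%C = (- Ci * lat_b P * (c / s)%R)%C /\
  latB P (Ci * y)%C = (- Ci * lat_b P * (d / s)%R)%C /\ latD P (Ci * y)%C = (- Ci * lat_b P * (1 / s)%R)%C.
Proof.
intros hP. destruct (lat_imag_facts P hP) as [F1 [F2 [F3 F4]]].
assert (EE : forall y, 0 < y < PI -> latA P (Ci * y)%C = (- Ci * imA P y)%C /\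
  latB P (Ci * y)%C = (- Ci * imB P y)%C /\ latD P (Ci * y)%C = (- Ci * imD P y)%C)
  by (intros y hy; exact (lat_imag P y hP hy)).
set (r := imA P) in *. set (b := imB P) in *. set (d := imD P) in *. clearbody r b d.
pose proof PI_RGT_0 as hpi.
pose proof (lat_a_pos P hP) as ha. pose proof (lat_b_pos P hP) as hb.
pose proof (kap_range P hP) as hk. pose proof (compl_modulus_range _ hk) as hk'.
pose proof (compl_modulus_sqr _ hk) as ek. pose proof (lat_a_kap P hP) as ea.
assert (pb : forall y, 0 < y < PI -> 0 < b y).
{ apply positive_of_nonzero.
  - intros y hy. destruct (F1 y hy) as [_ [D _]]. exact (is_derive_continuous _ _ _ D).
  - intros y hy. destruct (F1 y hy) as [_ [_ [_ [_ I]]]]. intros E. rewrite E in I. nra.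
  - destruct (F2 0) as [e [he He]]. exists (Rmin e PI). split; [now apply Rmin_pos|]. intros x hx.
    pose proof (Rmin_l e PI). pose proof (Rmin_r e PI). apply He; lra. }
assert (pd : forall y, 0 < y < PI -> 0 < d y).
{ apply positive_of_nonzero.
  - intros y hy. destruct (F1 y hy) as [_ [_ [D _]]]. exact (is_derive_continuous _ _ _ D).
  - intros y hy. destruct (F1 y hy) as [_ [_ [_ [I _]]]]. intros E. rewrite E in I. nra.
  - destruct (F2 0) as [e [he He]]. exists (Rmin e PI). split; [now apply Rmin_pos|]. intros x hx.
    pose proof (Rmin_l e PI). pose proof (Rmin_r e PI). apply He; lra. }
assert (sd : forall y, 0 < y < PI -> sqrt (lat_b P ^ 2 + r y ^ 2) = d y).
{ intros y hy. apply pow2_eq_sqrt; [now apply pd|]. destruct (F1 y hy) as [_ [_ [_ [I _]]]]. exact I. }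
assert (sb : forall y, 0 < y < PI ->
  sqrt (lat_b P ^ 2 * (1 - compl_modulus (kap P) ^ 2) + r y ^ 2) = b y).
{ intros y hy. apply pow2_eq_sqrt; [now apply pb|]. destruct (F1 y hy) as [_ [_ [_ [_ I]]]].
  rewrite I, ek, ea. ring. }
destruct (cs_characterization (lat_b P) (compl_modulus (kap P)) PI r) as [HK H]; try easy.
- intros y hy. rewrite sd, sb, Rmult_comm by easy. now apply F1.
- intros M. destruct (F2 M) as [e [he He]]. exists e; split; [easy|]. intros; now apply He.
- split; [exact HK|]. intros y hy s c dd. destruct (H y hy) as [Hs Hc]. rewrite sd in Hs, Hc by easy.
  fold s in Hs. fold c in Hc. pose proof (pd y hy) as pdy. pose proof (pb y hy) as pby.
  destruct (F1 y hy) as [_ [_ [_ [I1 I2]]]].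
  destruct (EE y hy) as [E1 [E2 E3]].
  assert (s0 : 0 < s) by (rewrite Hs; now apply Rdiv_lt_0_compat).
  assert (Hd : dd = b y / d y).
  { unfold dd, Rdn. fold s. apply pow2_eq_sqrt; [now apply Rdiv_lt_0_compat|].
    rewrite Hs, ek. unfold Rdiv. rewrite !Rpow_mult_distr, pow_inv, I2, I1, ea. field. nra. }
  split; [lra|]. rewrite E1, E2, E3. rewrite <- !Cmult_assoc, <- !RtoC_mult.
  split; [|split]; do 2 f_equal; rewrite ?Hd, ?Hc, Hs; field; lra.
Qed.

Lemma lat_real_facts (P x : R) : 0 < P -> 0 < x < P ->
  is_derive (fun t : R => Re (latD P t)) x (- (Re (latA P x) * Re (latB P x))) /\
  continuous (fun t : R => Re (latA P t)) x /\ continuous (fun t : R => Re (latB P t)) x /\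
  Re (latA P x) ^ 2 = lat_b P ^ 2 + Re (latD P x) ^ 2 /\
  Re (latB P x) ^ 2 = lat_b P ^ 2 * (1 - kap P ^ 2) + Re (latD P x) ^ 2.
Proof.
intros hP hx. destruct (lat_real P x hx) as [E1 [E2 E3]].
destruct (lat_der P _ hP (good_real P x hx)) as [D1 [D2 D3]].
destruct (lat_invariants P _ hP (good_real P x hx)) as [I1 I2].
rewrite E1, E3 in I1. rewrite E1, E2 in I2.
rewrite <- !RtoC_mult, <- RtoC_minus in I1, I2. apply RtoC_inj in I1, I2.
pose proof (lat_a_kap P hP) as ea.
split; [|split; [|split]].
- now apply is_derive_real_line.
- eapply is_derive_continuous. apply (is_derive_real_line _ (latB P) (latD P)); easy.
- eapply is_derive_continuous. apply (is_derive_real_line _ (latA P) (latD P)); easy.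
- rewrite ea in I2. split; lra.
Qed.

Lemma lat_D_half (P : R) : 0 < P -> latD P (P / 2)%C = 0%C.
Proof.
intros hP. assert (o : off P (P / 2)%C).
{ apply off_Re. rewrite <- RtoC_div by lra. simpl. lra. }
pose proof (latD_shift_P P (- (P / 2))%C hP) as E. rewrite latD_opp in E by easy.
replace (- (P / 2) + P)%C with (P / 2)%C in E by field.
set (a := latD P (P / 2)%C) in *.
assert (2 * a = 0)%C. { transitivity (a + a)%C; [ring|]. rewrite E at 1. ring. }
destruct (Ceq_dec a 0%C) as [e|e]; [exact e|]. exfalso. exact (Cmult_neq_0 _ _ C2_neq_0 e H).
Qed.

(** On the real segment it is [latD] that plays the part of [u], vanishing at [P / 2]. Now
    [l ^ 2 * (1 - m ^ 2)] is the difference of the squares of [lat_b] and [lat_a], so the modulus is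
    [kap P] itself. *)
Lemma lat_real_jacobi (P : R) : 0 < P ->
  ellipticK (kap P) = lat_b P * P / 2 /\
  forall x, 0 < x < P ->
  let s := Rsn (lat_b P * x) (kap P) in
  let c := Rcn (lat_b P * x) (kap P) in
  let d := Rdn (lat_b P * x) (kap P) in
  s <> 0 /\ latA P x = (lat_b P * (1 / s)%R)%C /\
  latB P x = (lat_b P * (d / s)%R)%C /\ latD P x = (lat_b P * (c / s)%R)%C.
Proof.
intros hP.
pose proof (lat_b_pos P hP) as hb. pose proof (kap_range P hP) as hk.
destruct (lat_pole_1 P hP) as [L1 [L2 L3]].
assert (near : forall f : C -> C, Clim (fun h => (h * f h)%C) 1%C ->
  (forall x, 0 < x < P -> f x = Re (f x)) ->
  forall M, exists e, 0 < e /\ forall x, 0 < x < e -> x < P -> M < Re (f x)).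
{ intros f Hf Hr M. destruct (pole_line f 1 Cmod_1 Hf M) as [e [he He]]. exists e; split; [easy|].
  intros x hx hx2. apply (He x); [easy|]. rewrite Cmult_1_r, (Hr x) by lra. simpl Re. field. }
assert (rA : forall x, 0 < x < P -> latA P x = Re (latA P x)) by (intros; now apply lat_real).
assert (rB : forall x, 0 < x < P -> latB P x = Re (latB P x)) by (intros x hx; exact (proj1 (proj2 (lat_real P x hx)))).
assert (rD : forall x, 0 < x < P -> latD P x = Re (latD P x)) by (intros; now apply lat_real).
pose proof (near _ L1 rA 0) as NA. pose proof (near _ L2 rB 0) as NB. pose proof (near _ L3 rD) as ND.
assert (d0 : Re (latD P (P / 2)%R) = 0)
  by (rewrite RtoC_div by lra; rewrite lat_D_half by easy; reflexivity).
assert (F := fun x => lat_real_facts P x hP).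
clear near L1 L2 L3.
set (a := fun x : R => Re (latA P x)) in *. set (b := fun x : R => Re (latB P x)) in *.
set (d := fun x : R => Re (latD P x)) in *.
change (forall x, 0 < x < P -> latA P x = a x) in rA.
change (forall x, 0 < x < P -> latB P x = b x) in rB.
change (forall x, 0 < x < P -> latD P x = d x) in rD.
change (forall x, 0 < x < P -> is_derive d x (- (a x * b x)) /\ continuous a x /\ continuous b x /\
  a x ^ 2 = lat_b P ^ 2 + d x ^ 2 /\ b x ^ 2 = lat_b P ^ 2 * (1 - kap P ^ 2) + d x ^ 2) in F.
change (exists e, 0 < e /\ forall x, 0 < x < e -> x < P -> 0 < a x) in NA.
change (exists e, 0 < e /\ forall x, 0 < x < e -> x < P -> 0 < b x) in NB.
change (forall M, exists e, 0 < e /\ forall x, 0 < x < e -> x < P -> M < d x) in ND.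
change (d (P / 2) = 0) in d0.
clearbody a b d.
assert (pa : forall y, 0 < y < P -> 0 < a y).
{ apply positive_of_nonzero.
  - intros y hy. now apply F.
  - intros y hy. destruct (F y hy) as [_ [_ [_ [I _]]]]. intros E. rewrite E in I. nra.
  - destruct NA as [e [he He]]. exists (Rmin e P). split; [now apply Rmin_pos|]. intros x hx.
    pose proof (Rmin_l e P). pose proof (Rmin_r e P). apply He; lra. }
assert (pb : forall y, 0 < y < P -> 0 < b y).
{ apply positive_of_nonzero.
  - intros y hy. now apply F.
  - intros y hy. destruct (F y hy) as [_ [_ [_ [_ I]]]]. intros E. rewrite E in I.
    assert (0 < lat_b P ^ 2 * (1 - kap P ^ 2)) by (apply Rmult_lt_0_compat; nra). nra.
  - destruct NB as [e [he He]]. exists (Rmin e P). split; [now apply Rmin_pos|]. intros x hx.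
    pose proof (Rmin_l e P). pose proof (Rmin_r e P). apply He; lra. }
assert (sa : forall y, 0 < y < P -> sqrt (lat_b P ^ 2 + d y ^ 2) = a y).
{ intros y hy. apply pow2_eq_sqrt; [now apply pa|]. now apply F. }
assert (sb : forall y, 0 < y < P -> sqrt (lat_b P ^ 2 * (1 - kap P ^ 2) + d y ^ 2) = b y).
{ intros y hy. apply pow2_eq_sqrt; [now apply pb|]. now apply F. }
destruct (cs_characterization (lat_b P) (kap P) P d) as [HK H]; try easy.
- intros y hy. rewrite sa, sb by easy. now apply F.
- split; [exact HK|]. intros y hy s c dd. destruct (H y hy) as [Hs Hc]. rewrite sa in Hs, Hc by easy.
  fold s in Hs. fold c in Hc. pose proof (pa y hy) as pay. pose proof (pb y hy) as pby.
  destruct (F y hy) as [_ [_ [_ [I1 I2]]]].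
  rewrite (rA y hy), (rB y hy), (rD y hy).
  assert (s0 : 0 < s) by (rewrite Hs; now apply Rdiv_lt_0_compat).
  assert (Hd : dd = b y / a y).
  { unfold dd, Rdn. fold s. apply pow2_eq_sqrt; [now apply Rdiv_lt_0_compat|].
    rewrite Hs. unfold Rdiv. rewrite !Rpow_mult_distr, pow_inv, I2, I1. field. nra. }
  split; [lra|]. rewrite <- !RtoC_mult.
  split; [|split]; f_equal; rewrite ?Hd, ?Hc, Hs; field; lra.
Qed.

(** * The period attached to a modulus *)

Lemma continuous_F_integrand (k t : R) : 0 < k < 1 ->
  continuous (fun theta => / sqrt (1 - k ^ 2 * sin theta ^ 2)) t.
Proof.
intros hk. pose proof (ellipticF_radicand_pos k t hk).
apply (ex_derive_continuous (V := R_NormedModule)). auto_derive.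
replace (1 + - (k * (k * 1) * (sin t * (sin t * 1)))) with (1 - k ^ 2 * sin t ^ 2) by ring.
repeat split; [easy|]. now apply Rgt_not_eq, sqrt_lt_R0.
Qed.

Lemma ellipticK_incr (k m : R) : 0 < k < 1 -> 0 < m < 1 -> k < m -> ellipticK k < ellipticK m.
Proof.
intros hk hm h. unfold ellipticK, ellipticF. pose proof PI_RGT_0. apply RInt_lt; [lra| | |].
- intros; now apply continuous_F_integrand.
- intros; now apply continuous_F_integrand.
- intros x hx. pose proof (ellipticF_radicand_pos m x hm) as Hm.
  pose proof (sin_gt_0 x ltac:(lra) ltac:(lra)) as hs.
  apply Rinv_lt_contravar.
  + apply Rmult_lt_0_compat; apply sqrt_lt_R0; [easy|now apply ellipticF_radicand_pos].
  + apply sqrt_lt_1_alt. split; [lra|]. assert (k ^ 2 < m ^ 2) by nra.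
    assert (0 < sin x ^ 2) by (apply pow_lt; easy). nra.
Qed.

Lemma ellipticK_pos (k : R) : 0 < k < 1 -> 0 < ellipticK k.
Proof.
intros hk. pose proof PI_RGT_0. pose proof (ellipticF_expand k 0 (PI / 2) hk ltac:(lra)).
rewrite ellipticF_0 in H0. unfold ellipticK. lra.
Qed.

Lemma compl_modulus_decr (k m : R) : 0 < k < 1 -> 0 < m < 1 -> k < m -> compl_modulus m < compl_modulus k.
Proof. intros hk hm h. unfold compl_modulus. apply sqrt_lt_1_alt. nra. Qed.

Lemma compl_modulus_involutive (k : R) : 0 < k < 1 -> compl_modulus (compl_modulus k) = k.
Proof.
intros hk. unfold compl_modulus at 1. rewrite compl_modulus_sqr by easy.
replace (1 - (1 - k ^ 2)) with (k ^ 2) by ring. apply sqrt_pow2; lra.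
Qed.

Definition period (k : R) : R := PI * ellipticK (compl_modulus k) / ellipticK k.

Lemma period_pos (k : R) : 0 < k < 1 -> 0 < period k.
Proof.
intros hk. pose proof PI_RGT_0. pose proof (ellipticK_pos k hk).
pose proof (ellipticK_pos _ (compl_modulus_range k hk)).
apply Rdiv_lt_0_compat; [now apply Rmult_lt_0_compat|easy].
Qed.

(** The two identifications evaluate the complete integrals of [kap P] and of its complement, in the
    ratio [P / PI], which by definition of [period] is that of the integrals of [compl_modulus k]
    and [k]. This ratio is strictly increasing in the modulus. *)
Lemma kap_period (k : R) : 0 < k < 1 -> kap (period k) = compl_modulus k.
Proof.
intros hk. pose proof (period_pos k hk) as hP. set (P := period k) in *.
pose proof (compl_modulus_range k hk) as hk'. pose proof (kap_range P hP) as hm.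
pose proof (compl_modulus_range _ hm) as hm'.
destruct (lat_real_jacobi P hP) as [E1 _]. destruct (lat_imag_jacobi P hP) as [E2 _].
pose proof (lat_b_pos P hP) as hb. pose proof PI_RGT_0.
assert (E : ellipticK (kap P) * ellipticK k = ellipticK (compl_modulus k) * ellipticK (compl_modulus (kap P))).
{ rewrite E1, E2. unfold P, period at 2. field. pose proof (ellipticK_pos k hk); lra. }
pose proof (ellipticK_pos k hk). pose proof (ellipticK_pos _ hk').
pose proof (ellipticK_pos _ hm). pose proof (ellipticK_pos _ hm').
destruct (Rtotal_order (kap P) (compl_modulus k)) as [h|[h|h]]; [exfalso|exact h|exfalso].
- pose proof (ellipticK_incr _ _ hm hk' h). pose proof (compl_modulus_decr _ _ hm hk' h) as h'.
  rewrite compl_modulus_involutive in h' by easy. pose proof (ellipticK_incr _ _ hk hm' h'). nra.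
- pose proof (ellipticK_incr _ _ hk' hm h). pose proof (compl_modulus_decr _ _ hk' hm h) as h'.
  rewrite compl_modulus_involutive in h' by easy. pose proof (ellipticK_incr _ _ hm' hk h'). nra.
Qed.

Lemma lat_b_period (k : R) : 0 < k < 1 -> lat_b (period k) = 2 * ellipticK k / PI.
Proof.
intros hk. pose proof (period_pos k hk) as hP. destruct (lat_imag_jacobi _ hP) as [E _].
rewrite kap_period, compl_modulus_involutive in E by easy. rewrite E. field. apply PI_neq0.
Qed.

Lemma lat_b_period_P (k : R) : 0 < k < 1 ->
  lat_b (period k) * period k = 2 * ellipticK (compl_modulus k).
Proof.
intros hk. rewrite lat_b_period by easy. unfold period. pose proof (ellipticK_pos k hk).
pose proof PI_RGT_0. field. split; lra.
Qed.

Lemma lat_a_period (k : R) : 0 < k < 1 -> lat_a (period k) = compl_modulus k * lat_b (period k).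
Proof. intros hk. rewrite lat_a_kap by (now apply period_pos). now rewrite kap_period. Qed.

(** * Periodicity of the real functions *)

Lemma ellipticF_const (k : R) (g : R -> R) : (forall x, is_derive g x 0) -> forall x y, g x = g y.
Proof.
intros H x y. pose proof (Rabs_def2 x (Rabs x + Rabs y + 1)). pose proof (Rle_abs x). pose proof (Rle_abs y).
pose proof (Rle_abs (- x)). pose proof (Rle_abs (- y)). rewrite Rabs_Ropp in *.
apply (const_of_is_derive_0 g (- (Rabs x + Rabs y + 1)) (Rabs x + Rabs y + 1)); [intros; apply H| |];
 pose proof (Rabs_pos x); pose proof (Rabs_pos y); lra.
Qed.

Lemma ellipticF_opp (k x : R) : 0 < k < 1 -> ellipticF (- x) k = - ellipticF x k.
Proof.
intros hk. assert (H : ellipticF x k + ellipticF (- x) k = ellipticF 0 k + ellipticF (- 0) k).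
{ apply (ellipticF_const k (fun x => ellipticF x k + ellipticF (- x) k)). intros t.
  evar_last.
  - apply (is_derive_plus (V := R_NormedModule) (fun x => ellipticF x k) (fun x => ellipticF (- x) k)).
    + now apply is_derive_ellipticF.
    + apply (is_derive_comp (fun x => ellipticF x k) (fun x => - x)); [now apply is_derive_ellipticF|].
      apply (is_derive_opp (V := R_NormedModule) (fun x => x)), is_derive_id.
  - rewrite sin_neg. replace ((- sin t) ^ 2) with (sin t ^ 2) by ring.
    unfold plus, scal, opp, one; simpl. unfold mult; simpl. ring. }
rewrite Ropp_0, ellipticF_0 in H. lra.
Qed.

Lemma ellipticF_shift (k x : R) : 0 < k < 1 -> ellipticF (x + PI) k = ellipticF x k + 2 * ellipticK k.
Proof.
intros hk. assert (H : ellipticF (x + PI) k - ellipticF x k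
   = ellipticF (- (PI / 2) + PI) k - ellipticF (- (PI / 2)) k).
{ apply (ellipticF_const k (fun x => ellipticF (x + PI) k - ellipticF x k)). intros t.
  evar_last.
  - apply (is_derive_minus (V := R_NormedModule) (fun x => ellipticF (x + PI) k) (fun x => ellipticF x k)).
    + apply (is_derive_comp (fun x => ellipticF x k) (fun x => x + PI)); [now apply is_derive_ellipticF|].
      apply (is_derive_plus (V := R_NormedModule) (fun x => x) (fun _ => PI)); [apply is_derive_id|apply is_derive_const].
    + now apply is_derive_ellipticF.
  - rewrite neg_sin. replace ((- sin t) ^ 2) with (sin t ^ 2) by ring.
    unfold minus, plus, scal, opp, one, zero; simpl. unfold mult; simpl. ring. }
rewrite ellipticF_opp in H by easy. replace (- (PI / 2) + PI) with (PI / 2) in H by field.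
unfold ellipticK. lra.
Qed.

Lemma am_shift (k u : R) : 0 < k < 1 -> am (u + 2 * ellipticK k) k = am u k + PI.
Proof.
intros hk. apply (ellipticF_inj k); [easy|]. rewrite ellipticF_shift, !ellipticF_am; easy.
Qed.

Lemma R_shift_ind (f : R -> R) (T e : R) : e * e = 1 -> (forall z, f (z + T) = e * f z) ->
  forall (z : R) (r : Z), f (z + IZR r * T) = (if Z.even r then 1 else e) * f z.
Proof.
intros ee H z r. induction r as [|r IH|r IH] using Z.peano_ind.
- simpl. replace (z + 0 * T) with z by ring. ring.
- unfold Z.succ. rewrite plus_IZR. replace (z + (IZR r + 1) * T) with (z + IZR r * T + T) by ring.
  rewrite H, IH, Z.even_add. simpl. destruct (Z.even r); simpl; [ring|]. rewrite <- Rmult_assoc, ee. ring.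
- assert (E : f (z + IZR (Z.pred r) * T) = e * f (z + IZR r * T)).
  { transitivity (e * (e * f (z + IZR (Z.pred r) * T))); [rewrite <- Rmult_assoc, ee; ring|].
    rewrite <- H. do 2 f_equal. unfold Z.pred. rewrite plus_IZR. simpl. ring. }
  rewrite E, IH. replace (Z.pred r) with (r + (- 1))%Z by lia. rewrite Z.even_add. simpl.
  destruct (Z.even r); simpl; [ring|]. rewrite <- Rmult_assoc, ee. ring.
Qed.

Lemma R_jacobi_shift (k u : R) (r : Z) : 0 < k < 1 ->
  Rsn (u + IZR r * (2 * ellipticK k)) k = rsg r * Rsn u k /\
  Rcn (u + IZR r * (2 * ellipticK k)) k = rsg r * Rcn u k /\
  Rdn (u + IZR r * (2 * ellipticK k)) k = Rdn u k.
Proof.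
intros hk.
assert (S : Rsn (u + IZR r * (2 * ellipticK k)) k = rsg r * Rsn u k).
{ apply (R_shift_ind (fun u => Rsn u k)); [ring|]. intros z. unfold Rsn.
  rewrite am_shift, neg_sin by easy. ring. }
split; [exact S|split].
- apply (R_shift_ind (fun u => Rcn u k)); [ring|]. intros z. unfold Rcn.
  rewrite am_shift, neg_cos by easy. ring.
- unfold Rdn. rewrite S. do 2 f_equal. unfold rsg. destruct (Z.even r); ring.
Qed.

Lemma R_jacobi_K (k : R) : 0 < k < 1 ->
  Rsn (ellipticK k) k = 1 /\ Rcn (ellipticK k) k = 0 /\ Rdn (ellipticK k) k = compl_modulus k.
Proof.
intros hk. assert (E : am (ellipticK k) k = PI / 2) by (unfold ellipticK; now apply am_ellipticF).
unfold Rdn, Rsn, Rcn, compl_modulus. rewrite E, sin_PI2, cos_PI2. repeat split. do 2 f_equal. ring.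
Qed.

Local Open Scope C_scope.

(** * Translations by half periods *)

Lemma RtoC_neq_0 (x : R) : x <> 0%R -> RtoC x <> 0.
Proof. intros h E. apply h. now apply RtoC_inj. Qed.

Lemma Cmult_eq_compat_cancel (a b c : C) : c <> 0 -> a * c = b * c -> a = b.
Proof.
intros hc E. replace a with (a * c / c) by (field; easy). rewrite E. field; easy.
Qed.

(** Kept free of division, because the nonvanishing of [latA] is deduced from these relations. *)
Lemma lat_shift_iPI2_aux (P : R) (z : C) : (0 < P)%R -> (0 < Re z < P)%R ->
  (0 < Re (z + Ci * (PI / 2)) < P)%R /\
  latA P (z + Ci * (PI / 2)) * (latA P z * latA P z) = lat_a P * lat_b P * latA P z /\
  latB P (z + Ci * (PI / 2)) * lat_b P = - Ci * latA P (z + Ci * (PI / 2)) * latD P z /\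
  latD P (z + Ci * (PI / 2)) * lat_a P = - Ci * latA P (z + Ci * (PI / 2)) * latB P z.
Proof.
intros hP hz. pose proof (lat_a_pos P hP) as ha. pose proof (lat_b_pos P hP) as hb.
assert (g : good P z) by now left.
set (h := Ci * (PI / 2)).
assert (r1 : (0 < Re (z + h) < P)%R).
{ unfold h. destruct z as [x y]; simpl in *.
  replace (x + (0 * (PI * (2 / (2 * (2 * 1) + 0 * (0 * 1))) - 0 * (- 0 / (2 * (2 * 1) + 0 * (0 * 1)))) -
     1 * (PI * (- 0 / (2 * (2 * 1) + 0 * (0 * 1))) + 0 * (2 / (2 * (2 * 1) + 0 * (0 * 1))))))%R with x by field.
  exact hz. }
assert (g1 : good P (z + h)) by now left.
split; [exact r1|].
pose proof (good_iPI2 P) as gh. fold h in gh.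
destruct (lat_values_iPI2 P hP) as [V1 [V2 V3]]. fold h in V1, V2, V3.
pose proof (lat_addition_A P z h hP (good_off _ _ g) (good_off _ _ gh) (good_off _ _ g1)) as EA.
pose proof (lat_addition_B P z h hP (good_off _ _ g) (good_off _ _ gh) (good_off _ _ g1)) as EB.
pose proof (lat_addition_D P z h hP (good_off _ _ g) (good_off _ _ gh) (good_off _ _ g1)) as ED.
destruct (lat_invariants P z hP g) as [I1 I2].
assert (VB : latB P h = - Ci * lat_a P).
{ rewrite <- V2. transitivity (- (Ci * Ci) * latB P h); [rewrite Ci_sqr|]; ring. }
assert (VD : latD P h = - Ci * lat_b P).
{ rewrite <- V3. transitivity (- (Ci * Ci) * latD P h); [rewrite Ci_sqr|]; ring. }
rewrite V1, VB, VD in *.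
set (A := latA P z) in *. set (B := latB P z) in *. set (D := latD P z) in *.
set (A' := latA P (z + h)) in *. set (B' := latB P (z + h)) in *. set (D' := latD P (z + h)) in *.
assert (a0 : RtoC (lat_a P) <> 0) by (apply RtoC_neq_0; lra).
assert (b0 : RtoC (lat_b P) <> 0) by (apply RtoC_neq_0; lra).
set (a := RtoC (lat_a P)) in *. set (b := RtoC (lat_b P)) in *.
assert (EB2 : B' * b = - Ci * A' * D).
{ replace (- Ci * A' * D) with (Ci * (0 * B - A' * D)) by ring. rewrite <- EB.
  transitivity (- (Ci * Ci) * b * B'); [rewrite Ci_sqr|]; ring. }
assert (ED2 : D' * a = - Ci * A' * B).
{ replace (- Ci * A' * B) with (Ci * (0 * D - A' * B)) by ring. rewrite <- ED.
  transitivity (- (Ci * Ci) * a * D'); [rewrite Ci_sqr|]; ring. }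
(* D A' = B A - B' D with B' b = - i A' D gives A' (b^2 + D^2) = a b A. *)
assert (KA : A' * (A * A) = a * b * A).
{ replace (A * A) with (b * b + D * D) by (rewrite <- I1; ring).
  assert (A' * b = a * A - Ci * (B' * D)).
  { transitivity (Ci * (- Ci * b * A')); [transitivity (- (Ci * Ci) * b * A'); [rewrite Ci_sqr|]; ring|].
    rewrite EA. transitivity (- (Ci * Ci) * (a * A) - Ci * (B' * D)); [ring|]. rewrite Ci_sqr. ring. }
  transitivity ((A' * b) * b + A' * (D * D)); [ring|]. rewrite H.
  transitivity (a * b * A - Ci * (B' * b) * D + A' * (D * D)); [ring|]. rewrite EB2.
  transitivity (a * b * A + (Ci * Ci) * (A' * D * D) + A' * (D * D)); [ring|]. rewrite Ci_sqr. ring. }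
repeat split; easy.
Qed.

(** Two shifts by [Ci * (PI / 2)] lead back to [z] up to sign. If [latA] vanished at [z], the
    relations at the intermediate point would make [latD] vanish there too, against the first
    integral with [lat_b P <> 0]. *)
Lemma latA_neq_0 (P : R) (z : C) : (0 < P)%R -> (0 < Re z < P)%R -> latA P z <> 0.
Proof.
intros hP hz E. pose proof (lat_a_pos P hP) as ha. pose proof (lat_b_pos P hP) as hb.
destruct (lat_shift_iPI2_aux P z hP hz) as [hz' _]. set (z' := z + Ci * (PI / 2)) in *.
destruct (lat_shift_iPI2_aux P z' hP hz') as [_ [KA [KB KD]]].
destruct (lat_invariants P z' hP ltac:(now left)) as [I1 I2].
destruct (lat_invariants P z hP ltac:(now left)) as [J1 J2].
replace (z' + Ci * (PI / 2)) with (z + Ci * PI) in * by (unfold z'; field).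
pose proof (off_Re P z hz) as o.
rewrite latA_shift_PI, latB_shift_PI, latD_shift_PI in * by easy.
rewrite E in *. replace (- Ci * 0 * latD P z') with (RtoC 0) in KB by ring.
replace (- Ci * 0 * latB P z') with (RtoC 0) in KD by ring.
assert (b0 : RtoC (lat_b P) <> 0) by (apply RtoC_neq_0; lra).
assert (a0 : RtoC (lat_a P) <> 0) by (apply RtoC_neq_0; lra).
assert (D0 : latD P z = 0).
{ apply (Cmult_eq_compat_cancel _ _ (- lat_a P)).
  - intros e. now apply a0, Copp_0_inv.
  - rewrite Cmult_0_l. rewrite <- KD. ring. }
rewrite D0 in J1. apply (Cmult_neq_0 _ _ b0 b0). rewrite <- J1. ring.
Qed.

Lemma lat_shift_iPI2 (P : R) (z : C) : (0 < P)%R -> (0 < Re z < P)%R ->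
  latA P (z + Ci * (PI / 2)) = lat_a P * lat_b P / latA P z /\
  latB P (z + Ci * (PI / 2)) = - Ci * lat_a P * latD P z / latA P z /\
  latD P (z + Ci * (PI / 2)) = - Ci * lat_b P * latB P z / latA P z.
Proof.
intros hP hz. pose proof (latA_neq_0 P z hP hz) as A0.
destruct (lat_shift_iPI2_aux P z hP hz) as [_ [KA [KB KD]]].
pose proof (lat_a_pos P hP) as ha. pose proof (lat_b_pos P hP) as hb.
assert (b0 : RtoC (lat_b P) <> 0) by (apply RtoC_neq_0; lra).
assert (a0 : RtoC (lat_a P) <> 0) by (apply RtoC_neq_0; lra).
assert (E : latA P (z + Ci * (PI / 2)) = lat_a P * lat_b P / latA P z).
{ apply (Cmult_eq_compat_cancel _ _ (latA P z * latA P z)); [now apply Cmult_neq_0|].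
  rewrite KA. field. exact A0. }
rewrite E in *. split; [reflexivity|split].
- apply (Cmult_eq_compat_cancel _ _ _ b0). rewrite KB. field. exact A0.
- apply (Cmult_eq_compat_cancel _ _ _ a0). rewrite KD. field. exact A0.
Qed.

Lemma lat_half_values (P : R) : (0 < P)%R -> latA P (P / 2) = lat_b P /\
  latB P (P / 2) = lat_b P * compl_modulus (kap P) /\ latD P (P / 2) = 0.
Proof.
intros hP. destruct (lat_real_jacobi P hP) as [HK H].
destruct (H (P / 2)%R ltac:(lra)) as [_ [HA [HB HD]]].
replace (lat_b P * (P / 2))%R with (ellipticK (kap P)) in * by (rewrite HK; field).
destruct (R_jacobi_K (kap P) (kap_range P hP)) as [E1 [E2 E3]].
rewrite E1, E2, E3, RtoC_div in * by lra. rewrite HA, HB, HD.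
split; [|split].
- replace (1 / 1)%R with 1%R by field. ring.
- replace (compl_modulus (kap P) / 1)%R with (compl_modulus (kap P)) by field. ring.
- replace (0 / 1)%R with 0%R by field. ring.
Qed.

(** The product of [latD] at [z] and at [z + P / 2] is a nonzero constant; the nonvanishing of
    [latD P z] follows and allows the divisions. *)
Lemma lat_shift_half (P : R) (z : C) : (0 < P)%R -> good P z -> off P (z + P / 2) ->
  latD P z <> 0 /\ latA P (z + P / 2) = lat_b P * latB P z / latD P z /\
  latB P (z + P / 2) = lat_b P * compl_modulus (kap P) * latA P z / latD P z /\
  latD P (z + P / 2) = - (lat_b P * lat_b P * compl_modulus (kap P)) / latD P z.
Proof.
intros hP g o1. pose proof (good_off _ _ g) as o.
assert (oh : off P (P / 2)) by (apply off_Re; rewrite <- RtoC_div by lra; simpl; lra).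
pose proof (lat_addition_A P z (P / 2) hP o oh o1) as EA.
pose proof (lat_addition_B P z (P / 2) hP o oh o1) as EB.
pose proof (lat_addition_D P z (P / 2) hP o oh o1) as ED.
destruct (lat_half_values P hP) as [V1 [V2 V3]]. rewrite V1, V2, V3 in *.
destruct (lat_invariants P z hP g) as [I1 I2].
pose proof (lat_b_pos P hP) as hb. pose proof (kap_range P hP) as hk.
pose proof (compl_modulus_range _ hk) as hk'. pose proof (compl_modulus_sqr _ hk) as ek.
pose proof (lat_a_kap P hP) as ea.
assert (b0 : RtoC (lat_b P) <> 0) by (apply RtoC_neq_0; lra).
assert (k0 : RtoC (compl_modulus (kap P)) <> 0) by (apply RtoC_neq_0; lra).
set (A := latA P z) in *. set (B := latB P z) in *. set (D := latD P z) in *.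
set (A' := latA P (z + P / 2)) in *. set (B' := latB P (z + P / 2)) in *. set (D' := latD P (z + P / 2)) in *.
set (b := RtoC (lat_b P)) in *. set (q := RtoC (compl_modulus (kap P))) in *.
assert (W : B * B - D * D = b * b * (q * q)).
{ transitivity ((A * A - D * D) - (A * A - B * B)); [ring|]. rewrite I1, I2, ea.
  unfold b, q. rewrite <- !RtoC_mult, <- RtoC_minus. f_equal. simpl in ek. nra. }
assert (EA' : B' * D = b * q * A).
{ transitivity (b * q * A - (b * q * A - B' * D)); [ring|]. rewrite <- EA. ring. }
assert (EB' : A' * D = b * B).
{ transitivity (b * B - (b * B - A' * D)); [ring|]. rewrite <- EB. ring. }
assert (ED' : D' * D = - (b * b * q)).
{ apply (Cmult_eq_compat_cancel _ _ (b * q)); [now apply Cmult_neq_0|].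
  transitivity ((b * q * D') * D); [ring|]. rewrite ED.
  transitivity (b * (D * D) - (A' * D) * B); [ring|]. rewrite EB'.
  transitivity (- b * (B * B - D * D)); [ring|]. rewrite W. ring. }
assert (D0 : D <> 0).
{ intros E. rewrite E, Cmult_0_r in ED'. apply (Cmult_neq_0 _ _ (Cmult_neq_0 _ _ b0 b0) k0).
  transitivity (- - (b * b * q)); [ring|]. rewrite <- ED'. ring. }
split; [exact D0|].
split; [|split]; apply (Cmult_eq_compat_cancel _ _ _ D0).
- rewrite EB'. field. exact D0.
- rewrite EA'. field. exact D0.
- rewrite ED'. field. exact D0.
Qed.

(** * Jacobi functions of modulus [compl_modulus k] on the real line *)

(** Periodicity brings the real part into [[0, P)], and the shift by [Ci * (PI / 2)] transports the
    identification of the real segment to the line. *)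
Lemma lat_on_Im_PI2 (k y : R) : (0 < k < 1)%R ->
  let P := period k in let k' := compl_modulus k in let v := (2 * ellipticK k * y)%R in
  let z := PI * y + Ci * (PI / 2) in
  latA P z = lat_a P * Rsn v k' /\ latB P z = - Ci * lat_a P * Rcn v k' /\
  latD P z = - Ci * lat_b P * Rdn v k'.
Proof.
intros hk P k' v z. pose proof (period_pos k hk) as hP. fold P in hP.
pose proof (compl_modulus_range k hk) as hk'. fold k' in hk'.
pose proof PI_RGT_0 as hpi.
destruct (floor_ex (PI * y / P)) as [r Hr].
set (x := (PI * y - IZR r * P)%R).
assert (hx : (0 <= x < P)%R).
{ unfold x. destruct Hr as [H1 H2].
  apply (Rmult_le_compat_r P) in H1; [|lra]. apply (Rmult_lt_compat_r P) in H2; [|lra].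
  replace (PI * y / P * P)%R with (PI * y)%R in * by (field; lra). lra. }
assert (ez : z = x + Ci * (PI / 2) + IZR r * P).
{ unfold z, x. rewrite RtoC_minus, !RtoC_mult. ring. }
assert (eb : lat_b P = (2 * ellipticK k / PI)%R) by (now apply lat_b_period).
assert (ev : v = (lat_b P * x + IZR r * (2 * ellipticK k'))%R).
{ unfold k'. rewrite <- lat_b_period_P by easy. fold P. unfold x, v. rewrite eb. field. lra. }
destruct (R_jacobi_shift k' (lat_b P * x) r hk') as [S1 [S2 S3]].
rewrite ev, S1, S2, S3, ez, latA_shift, latB_shift, latD_shift, !RtoC_mult, RtoC_rsg by easy.
assert (H : latA P (x + Ci * (PI / 2)) = lat_a P * Rsn (lat_b P * x) k' /\
  latB P (x + Ci * (PI / 2)) = - Ci * lat_a P * Rcn (lat_b P * x) k' /\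
  latD P (x + Ci * (PI / 2)) = - Ci * lat_b P * Rdn (lat_b P * x) k').
(* The point 0 is a pole, outside the real segment; the shifted point is [Ci * (PI / 2)], whose
   values are known. *)
{ destruct (Req_dec x 0) as [e|e].
  - rewrite e, Rmult_0_r. destruct (jacobi_R_init k' hk') as [-> [-> ->]].
    destruct (lat_values_iPI2 P hP) as [V1 [V2 V3]].
    rewrite Cplus_0_l, V1, <- V2, <- V3. split; [ring|].
    split; [transitivity (- (Ci * Ci) * latB P (Ci * (PI / 2))) | transitivity (- (Ci * Ci) * latD P (Ci * (PI / 2)))];
    try (rewrite Ci_sqr; ring); ring.
  - destruct (lat_real_jacobi P hP) as [_ H]. destruct (H x ltac:(lra)) as [s0 [HA [HB HD]]].
    unfold P in s0, HA, HB, HD. rewrite kap_period in s0, HA, HB, HD by easy. fold P k' in s0, HA, HB, HD.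
    destruct (lat_shift_iPI2 P x hP ltac:(simpl; lra)) as [-> [-> ->]].
    rewrite HA, HB, HD, !RtoC_div by easy.
    assert (RtoC (Rsn (lat_b P * x) k') <> 0) by now apply RtoC_neq_0.
    assert (RtoC (lat_b P) <> 0) by (apply RtoC_neq_0; pose proof (lat_b_pos P hP); lra).
    repeat split; field; now split. }
destruct H as [-> [-> ->]]. repeat split; ring.
Qed.

(** * Jacobi functions of modulus [k] in the complex strip *)

Lemma pair_C (a b : R) : (a, b) = RtoC a + Ci * RtoC b.
Proof. unfold Ci, RtoC, Cplus, Cmult; simpl. f_equal; ring. Qed.

Lemma lat_reflect (P : R) (z : C) : (0 < P)%R -> off P z ->
  latA P (P - z) = latA P z /\ latB P (P - z) = latB P z /\ latD P (P - z) = - latD P z.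
Proof.
intros hP o. replace (P - z) with (- z + P) by ring.
rewrite latA_shift_P, latB_shift_P, latD_shift_P, latA_opp, latB_opp, latD_opp by easy.
repeat split; ring.
Qed.

(** [P / 2 - y] is the reflection of [P / 2 + y], a half-period translate of the point [y] of the
    real segment. *)
Lemma lat_left_half (k y : R) : (0 < k < 1)%R -> (0 < y < period k / 2)%R ->
  let P := period k in let k' := compl_modulus k in let b := lat_b P in
  let s := Rsn (b * y) k' in let c := Rcn (b * y) k' in let d := Rdn (b * y) k' in
  s <> 0%R /\ c <> 0%R /\ latA P (P / 2 - y) = b * d / c /\ latB P (P / 2 - y) = b * k / c /\
  latD P (P / 2 - y) = b * k * s / c.
Proof.
intros hk hy P k' b s c d. pose proof (period_pos k hk) as hP. fold P in hP, hy.
destruct (lat_real_jacobi P hP) as [_ H]. destruct (H y ltac:(lra)) as [s0 [HA [HB HD]]].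
assert (ek : kap P = k') by now apply kap_period.
rewrite ek in *. fold b in s0, HA, HB, HD. fold s c d in HA, HB, HD. fold s in s0.
assert (o : off P (y + P / 2)).
{ apply off_Re. rewrite <- RtoC_div, <- RtoC_plus by lra. simpl. lra. }
destruct (lat_shift_half P y hP (good_real P y ltac:(lra)) o) as [D0 [EA [EB ED]]].
rewrite ek in *. unfold k' in EB, ED. rewrite compl_modulus_involutive in EB, ED by easy.
fold b in EA, EB, ED.
assert (hb : RtoC b <> 0) by (apply RtoC_neq_0; pose proof (lat_b_pos P hP); unfold b; lra).
assert (c0 : c <> 0%R).
{ intros E. apply D0. rewrite HD, E. replace (0 / s)%R with 0%R by (field; easy). ring. }
destruct (lat_reflect P _ hP o) as [RA [RB RD]].
replace (P - (y + P / 2)) with (P / 2 - y) in * by field.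
rewrite RA, RB, RD, EA, EB, ED, HA, HB, HD, !RtoC_div by easy.
assert (RtoC s <> 0) by now apply RtoC_neq_0. assert (RtoC c <> 0) by now apply RtoC_neq_0.
split; [easy|split; [easy|]]. split; [|split]; field; repeat split; easy.
Qed.

(** Obtained by eliminating [latB P (z + h)] between two forms of the addition law. *)
Lemma lat_addition_solved (P : R) (z h : C) : (0 < P)%R -> off P z -> off P h -> off P (z + h) ->
  latA P (z + h) * (latD P z * latD P z - latD P h * latD P h)
  = latA P h * latB P z * latD P z - latA P z * latB P h * latD P h.
Proof.
intros hP hz hh hzh.
pose proof (lat_addition_A P z h hP hz hh hzh) as EA. pose proof (lat_addition_B P z h hP hz hh hzh) as EB.
transitivity (latA P (z + h) * latD P z * latD P z - latD P h * (latD P h * latA P (z + h))); [ring|].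
rewrite EA.
transitivity (latA P (z + h) * latD P z * latD P z - latA P z * latB P h * latD P h
  + (latD P h * latB P (z + h)) * latD P z); [ring|].
rewrite EB. ring.
Qed.

(** The addition law is applied to the real point [P / 2 - y], where the values have modulus
    [compl_modulus k], and to the imaginary point [Ci * t], where they have modulus [k]. It
    reproduces the formulas by which [sn], [cn] and [dn] are continued, with [jacobi_den] as
    denominator. *)
Lemma jacobi_strip_cell (k y t : R) : (0 < k < 1)%R -> (0 < y < period k / 2)%R -> (0 <= t < PI)%R ->
  let P := period k in let b := lat_b P in let w := P / 2 - y + Ci * t in
  latA P w = b * dn (b * t, b * y)%R k /\ latB P w = b * k * cn (b * t, b * y)%R k /\
  latD P w = - Ci * b * k * sn (b * t, b * y)%R k.
Proof.
intros hk hy ht P b w. pose proof (period_pos k hk) as hP. fold P in hP, hy.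
pose proof (compl_modulus_range k hk) as hk'.
destruct (lat_left_half k y hk hy) as [s10 [c10 [A1 [B1 D1]]]]. fold P b in s10, c10, A1, B1, D1.
unfold dn, cn, sn, jacobi_den, Re, Im; simpl fst; simpl snd; cbv zeta.
pose proof (Rsn2_Rcn2 (b * y) (compl_modulus k)) as T1. pose proof (Rdn2 (b * y) _ hk') as T2.
rewrite compl_modulus_sqr in T2 by easy.
set (s1 := Rsn (b * y) (compl_modulus k)) in *. set (c1 := Rcn (b * y) (compl_modulus k)) in *.
set (d1 := Rdn (b * y) (compl_modulus k)) in *.
assert (hb : (0 < b)%R) by now apply lat_b_pos.
assert (b0 : RtoC b <> 0) by (apply RtoC_neq_0; lra).
assert (k0 : RtoC k <> 0) by (apply RtoC_neq_0; lra).
assert (c1n : RtoC c1 <> 0) by now apply RtoC_neq_0.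
assert (s1n : RtoC s1 <> 0) by now apply RtoC_neq_0.
(* At [t = 0] the second point is a pole and the addition law does not apply, but the values are
   those of [lat_left_half]. *)
destruct (Req_dec t 0) as [e|e].
{ unfold w. rewrite e, Rmult_0_r. destruct (jacobi_R_init k hk) as [-> [-> ->]].
  replace (P / 2 - y + Ci * 0) with (P / 2 - y) by ring. rewrite A1, B1, D1.
  assert (Hden : (c1 ^ 2 + k ^ 2 * 0 ^ 2 * s1 ^ 2 <> 0)%R) by (apply Rgt_not_eq; assert (0 < c1 ^ 2)%R by (now apply pow2_gt_0); lra).
  rewrite !pair_C.
  replace (1 * c1 * d1 / (c1 ^ 2 + k ^ 2 * 0 ^ 2 * s1 ^ 2))%R with (d1 / c1)%R by (field; easy).
  replace (- (k ^ 2 * 0 * 1 * s1) / (c1 ^ 2 + k ^ 2 * 0 ^ 2 * s1 ^ 2))%R with 0%R by (field; easy).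
  replace (1 * c1 / (c1 ^ 2 + k ^ 2 * 0 ^ 2 * s1 ^ 2))%R with (1 / c1)%R by (field; easy).
  replace (- (0 * 1 * s1 * d1) / (c1 ^ 2 + k ^ 2 * 0 ^ 2 * s1 ^ 2))%R with 0%R by (field; easy).
  replace (0 * d1 / (c1 ^ 2 + k ^ 2 * 0 ^ 2 * s1 ^ 2))%R with 0%R by (field; easy).
  replace (1 * 1 * s1 * c1 / (c1 ^ 2 + k ^ 2 * 0 ^ 2 * s1 ^ 2))%R with (s1 / c1)%R by (field; easy).
  rewrite !RtoC_div by easy. split; [field; easy|]. split; [field; easy|].
  transitivity (- (Ci * Ci) * b * k * s1 / c1); [rewrite Ci_sqr|]; field; easy. }
destruct (lat_imag_jacobi P hP) as [_ H]. destruct (H t ltac:(lra)) as [s0 [A2 [B2 D2]]].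
assert (ek : kap P = compl_modulus k) by now apply kap_period.
rewrite ek, compl_modulus_involutive in s0, A2, B2, D2 by easy. fold b in s0, A2, B2, D2.
pose proof (Rsn2_Rcn2 (b * t) k) as T3. pose proof (Rdn2 (b * t) _ hk) as T4.
pose proof (Rdn_pos (b * t) _ hk) as dp.
set (s := Rsn (b * t) k) in *. set (c := Rcn (b * t) k) in *. set (d := Rdn (b * t) k) in *.
set (den := (c1 ^ 2 + k ^ 2 * s ^ 2 * s1 ^ 2)%R).
assert (Hden : (0 < den)%R).
{ unfold den. assert (0 < c1 ^ 2)%R by (now apply pow2_gt_0).
  assert (0 <= k ^ 2 * s ^ 2 * s1 ^ 2)%R by (replace (k ^ 2 * s ^ 2 * s1 ^ 2)%R with ((k * s * s1) ^ 2)%R by ring; apply pow2_ge_0). lra. }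
assert (dn0 : RtoC den <> 0) by (apply RtoC_neq_0; lra).
assert (sn0 : RtoC s <> 0) by now apply RtoC_neq_0.
assert (d0 : RtoC d <> 0) by (apply RtoC_neq_0; lra).
assert (oz : off P (P / 2 - y)).
{ apply off_Re. rewrite <- RtoC_div, <- RtoC_minus by lra. simpl. lra. }
assert (oh : off P (Ci * t)) by (apply good_off, good_imag; lra).
assert (ow : off P w).
{ apply off_Re. unfold w. rewrite <- RtoC_div, <- RtoC_minus by lra. simpl. lra. }
pose proof (lat_addition_solved P _ _ hP oz oh ow) as EA.
pose proof (lat_addition_A P _ _ hP oz oh ow) as EA'.
pose proof (lat_addition_D P _ _ hP oz oh ow) as ED.
fold w in EA, EA', ED. rewrite A1, B1, D1, A2, B2, D2, !RtoC_div in * by easy.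
assert (U : RtoC den = c1 * c1 + k * k * s * s * s1 * s1).
{ unfold den. rewrite <- !RtoC_mult, <- RtoC_plus. f_equal. ring. }
(* The difference of the squares of [latD] at the two points is [b ^ 2 den / (s ^ 2 c1 ^ 2)], which
   gives [latA]; the other two sums then follow from forms A and D of the addition law. *)
assert (VA : latA P w = b * (d * c1 * d1 - Ci * (k * k * s * c * s1)) / den).
{ assert (Q : (b * k * s1 / c1) * (b * k * s1 / c1) - (- Ci * b * (1 / s)) * (- Ci * b * (1 / s))
    = b * b * den / (s * s * c1 * c1)).
  { rewrite U. transitivity (b * b * (k * k * s1 * s1 / (c1 * c1) - (Ci * Ci) / (s * s))); [field; repeat split; assumption|].
    rewrite Ci_sqr. field; repeat split; assumption. }
  rewrite Q in EA. apply (Cmult_eq_compat_cancel _ _ (b * b * den / (s * s * c1 * c1))).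
  - apply Cmult_neq_0; [repeat apply Cmult_neq_0; assumption|].
    intros E. apply (Cmult_neq_0 (/ (s * s * c1 * c1)) (s * s * c1 * c1)).
    + intros E'. rewrite E' in E. apply C1_neq_0. rewrite <- (Cinv_r (s * s * c1 * c1)), E'; [ring|repeat apply Cmult_neq_0; assumption].
    + repeat apply Cmult_neq_0; assumption.
    + rewrite E. ring.
  - rewrite EA. transitivity (- Ci * b * b * b * k * k * s1 * c / (s * c1 * c1) - (Ci * Ci) * b * b * b * d * d1 / (s * s * c1)); [field; repeat split; assumption|].
    rewrite Ci_sqr. field. repeat split; assumption. }
assert (b1 : RtoC (b * k * s1 / c1)%R <> 0).
{ apply RtoC_neq_0. unfold Rdiv. repeat apply Rmult_integral_contrapositive_currified; try lra; auto.
  now apply Rinv_neq_0_compat. }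
rewrite !RtoC_div, !RtoC_mult in b1 by easy.
assert (VB : latB P w = b * k * (c * c1 - Ci * (s * d * s1 * d1)) / den).
{ apply (Cmult_eq_compat_cancel _ _ _ b1).
  transitivity ((- Ci * b * (d / s)) * (b * d1 / c1) - (- Ci * b * (1 / s)) * latA P w); [rewrite EA'; ring|].
  rewrite VA.
  transitivity (- Ci * (b * b * d * d1 * den / (s * c1 * den)) + Ci * (b * b * d * c1 * d1 / (s * den))
     - (Ci * Ci) * (b * b * k * k * c * s1 / den)); [field; repeat split; assumption|].
  rewrite Ci_sqr. field_simplify_eq; [ring [U]|repeat split; assumption]. }
assert (VD : latD P w = - Ci * b * k * (s * d1 + Ci * (c * d * s1 * c1)) / den).
{ assert (n : - Ci * b * (d / s) <> 0).
  { repeat apply Cmult_neq_0; try assumption.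
    - intros E. apply Ci_neq_0. now apply Copp_0_inv.
    - intros E. apply C1_neq_0. rewrite <- (Cinv_r s), E by easy. ring. }
  apply (Cmult_eq_compat_cancel _ _ _ n). rewrite Cmult_comm, ED, VA.
  assert (C1 : RtoC c1 * c1 = 1 - s1 * s1).
  { rewrite <- !RtoC_mult, <- RtoC_minus. f_equal. clear - T1. simpl in T1. lra. }
  assert (C2 : RtoC d * d = 1 - k * k * s * s).
  { rewrite <- !RtoC_mult, <- RtoC_minus. f_equal. clear - T4. simpl in T4. lra. }
  (* A second expression of the denominator, through the Pythagorean relations, with which the
     numerator of form D simplifies. *)
  assert (Den2 : RtoC den = k * k * s * s + c1 * c1 * (d * d)).
  { rewrite C2, U. transitivity (c1 * c1 + k * k * s * s * (1 - c1 * c1)); [rewrite C1; ring|ring]. }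
  transitivity (b * b * k * (- Ci * (c * s1 * den) / (s * c1 * den) - d * d1 / den + Ci * (k * k * s * c * s1) / (c1 * den))); [field; repeat split; assumption|].
  transitivity (b * b * k * ((Ci * Ci) * (d * d1) / den + (Ci * Ci * Ci) * (c * (d * d) * s1 * c1) / (s * den))); [|field; repeat split; assumption].
  rewrite Ci_sqr. rewrite Den2 at 1.
  transitivity (b * b * k * (- d * d1 / den + - Ci * (c * d * d * s1 * c1) / (s * den))); [field; repeat split; assumption|]. field; repeat split; assumption. }
rewrite VA, VB, VD, !pair_C, !RtoC_div by (unfold den in *; lra).
fold den. rewrite !RtoC_opp, !RtoC_mult, !RtoC_pow.
split; [|split]; field; repeat split; assumption.
Qed.

Lemma RC_shift_ind (f : R -> C) (T : R) (e : C) : e * e = 1 -> (forall t : R, f (t + T)%R = e * f t) ->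
  forall (t : R) (r : Z), f (t + IZR r * T)%R = (if Z.even r then 1 else e) * f t.
Proof.
intros ee H t r. induction r as [|r IH|r IH] using Z.peano_ind.
- simpl. replace (t + 0 * T)%R with t by ring. ring.
- unfold Z.succ. rewrite plus_IZR. replace (t + (IZR r + 1) * T)%R with (t + IZR r * T + T)%R by ring.
  rewrite H, IH, Z.even_add. simpl. destruct (Z.even r); simpl; [ring|]. rewrite Cmult_assoc, ee. ring.
- assert (E : f (t + IZR (Z.pred r) * T)%R = e * f (t + IZR r * T)%R).
  { transitivity (e * (e * f (t + IZR (Z.pred r) * T)%R)); [rewrite Cmult_assoc, ee; ring|].
    rewrite <- H. do 2 f_equal. unfold Z.pred. rewrite plus_IZR. simpl. ring. }
  rewrite E, IH. replace (Z.pred r) with (r + (- 1))%Z by lia. rewrite Z.even_add. simpl.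
  destruct (Z.even r); simpl; [ring|]. rewrite Cmult_assoc, ee. ring.
Qed.

Lemma C_jacobi_shift (k X Y : R) (r : Z) : (0 < k < 1)%R ->
  dn (X + IZR r * (2 * ellipticK k), Y)%R k = dn (X, Y) k /\
  cn (X + IZR r * (2 * ellipticK k), Y)%R k = sg r * cn (X, Y) k /\
  sn (X + IZR r * (2 * ellipticK k), Y)%R k = sg r * sn (X, Y) k.
Proof.
intros hk. destruct (R_jacobi_shift k X r hk) as [S1 [S2 S3]].
unfold dn, cn, sn, jacobi_den, Re, Im; simpl fst; simpl snd; cbv zeta. rewrite S1, S2, S3, <- RtoC_rsg.
assert (rs : (rsg r * rsg r = 1)%R) by (unfold rsg; destruct (Z.even r); ring).
set (s := Rsn X k). set (c := Rcn X k). set (d := Rdn X k). set (e := rsg r) in *.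
replace ((e * s) ^ 2)%R with (s ^ 2)%R by (replace ((e * s) ^ 2)%R with ((e * e) * s ^ 2)%R by ring; rewrite rs; ring).
match goal with |- context [Rdiv _ ?m] => set (den := m) end. clearbody den.
unfold Cmult, RtoC; simpl fst; simpl snd. split; [|split]; f_equal; unfold Rdiv; try ring.
replace (k ^ 2 * (e * s) * (e * c))%R with (e * e * (k ^ 2 * s * c))%R by ring. rewrite rs. ring.
Qed.

(** Since [b * PI] is [2 * ellipticK k], moving [w] by [Ci * PI] moves the Jacobi argument by
    [2 * ellipticK k]. Both sides take the same signs, and one cell is enough. *)
Lemma jacobi_strip (k : R) (x : C) : (0 < k < 1)%R -> (0 < Im x < 1 / 2)%R ->
  let P := period k in let b := lat_b P in let w := P / 2 + Ci * P * x in
  let u := 2 * ellipticK (compl_modulus k) * x in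
  (0 < Re w < P / 2)%R /\ dn u k = latA P w / b /\ cn u k = latB P w / (b * k) /\
  sn u k = Ci * latD P w / (b * k).
Proof.
intros hk hx P b w u. pose proof (period_pos k hk) as hP. fold P in hP. pose proof PI_RGT_0 as hpi.
pose proof (lat_b_pos P hP) as hb. fold b in hb.
destruct x as [t0 ep]. simpl in hx.
set (y := (P * ep)%R). assert (hy : (0 < y < P / 2)%R) by (unfold y; nra).
destruct (floor_ex (P * t0 / PI)) as [r [Hr1 Hr2]].
set (t := (P * t0 - IZR r * PI)%R).
assert (ht : (0 <= t < PI)%R).
{ unfold t. apply (Rmult_le_compat_r PI) in Hr1; [|lra]. apply (Rmult_lt_compat_r PI) in Hr2; [|lra].
  replace (P * t0 / PI * PI)%R with (P * t0)%R in * by (field; lra). lra. }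
assert (eK : (b * PI = 2 * ellipticK k)%R).
{ unfold b, P. rewrite lat_b_period by easy. field. lra. }
assert (eu : u = (b * t + IZR r * (2 * ellipticK k), b * y)%R).
{ unfold u, y, t. rewrite <- eK.
  replace (b * (P * t0 - IZR r * PI) + IZR r * (b * PI))%R with ((b * P) * t0)%R by ring.
  replace (b * (P * ep))%R with ((b * P) * ep)%R by ring.
  unfold b, P. rewrite lat_b_period_P by easy. unfold Cmult, RtoC; simpl. f_equal; ring. }
assert (ew : w = P / 2 - y + Ci * (t + IZR r * PI)%R).
{ unfold w, y, t. replace (P * t0 - IZR r * PI + IZR r * PI)%R with (P * t0)%R by ring.
  rewrite (pair_C t0 ep), !RtoC_mult.
  transitivity (P / 2 + Ci * P * t0 + (Ci * Ci) * P * ep); [ring|]. rewrite Ci_sqr. ring. }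
assert (rw : forall q : R, Re (P / 2 - y + Ci * q) = (P / 2 - y)%R).
{ intros q. rewrite <- RtoC_div, <- RtoC_minus by lra. simpl. ring. }
assert (ow : forall q : R, off P (P / 2 - y + Ci * q)) by (intros q; apply off_Re; rewrite rw; lra).
destruct (jacobi_strip_cell k y t hk hy ht) as [EA [EB ED]]. fold P b in EA, EB, ED.
destruct (C_jacobi_shift k (b * t) (b * y) r hk) as [SA [SB SD]].
assert (b0 : RtoC b <> 0) by (apply RtoC_neq_0; lra).
assert (k0 : RtoC k <> 0) by (apply RtoC_neq_0; lra).
split; [rewrite ew, rw; lra|]. rewrite eu, SA, SB, SD, ew.
rewrite (RC_shift_ind (fun q => latA P (P / 2 - y + Ci * q)) PI 1), (RC_shift_ind (fun q => latB P (P / 2 - y + Ci * q)) PI (- 1)),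
  (RC_shift_ind (fun q => latD P (P / 2 - y + Ci * q)) PI (- 1)), EA, EB, ED; try ring.
- split; [destruct (Z.even r); field; easy|]. unfold sg. split; [destruct (Z.even r); field; split; easy|].
  transitivity (sg r * (- (Ci * Ci)) * sn (b * t, b * y)%R k); [rewrite Ci_sqr; unfold sg; ring|].
  unfold sg; field; split; easy.
- intros q. rewrite RtoC_plus. replace (P / 2 - y + Ci * (q + PI)) with (P / 2 - y + Ci * q + Ci * PI) by ring.
  rewrite latD_shift_PI by easy. ring.
- intros q. rewrite RtoC_plus. replace (P / 2 - y + Ci * (q + PI)) with (P / 2 - y + Ci * q + Ci * PI) by ring.
  rewrite latB_shift_PI by easy. ring.
- intros q. rewrite RtoC_plus. replace (P / 2 - y + Ci * (q + PI)) with (P / 2 - y + Ci * q + Ci * PI) by ring.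
  rewrite latA_shift_PI by easy. ring.
Qed.

(* [x] and [x - i/2] sit at distance [P / 2] in the lattice variable. *)
Lemma glaisher_strip (k : R) (x : C) : (0 < k < 1)%R -> (0 < Im x < 1 / 2)%R ->
  let P := period k in let b := lat_b P in let k' := compl_modulus k in
  let w := P / 2 + Ci * P * x in let w' := P / 2 + Ci * P * (x - Ci / 2) in
  let u := 2 * ellipticK k' * x in
  (dn u k = latA P w / b /\ cn u k = latB P w / (b * k) /\ sn u k = Ci * latD P w / (b * k)) /\
  (nd u k = latA P (w + Ci * (PI / 2)) / (k' * b) /\ sd u k = - latB P (w + Ci * (PI / 2)) / (k * k' * b) /\
   cd u k = Ci * latD P (w + Ci * (PI / 2)) / (k * b)) /\
  (cs u k = - Ci * latA P w' / b /\ ds u k = - Ci * latB P w' / b /\ ns u k = Ci * latD P w' / b) /\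
  (sc u k = Ci * latA P (w' + Ci * (PI / 2)) / (k' * b) /\
   nc u k = - Ci * latB P (w' + Ci * (PI / 2)) / (k' * b) /\
   dc u k = Ci * latD P (w' + Ci * (PI / 2)) / b).
Proof.
intros hk hx P b k' w w' u. pose proof (period_pos k hk) as hP. fold P in hP.
pose proof (lat_b_pos P hP) as hb. fold b in hb. pose proof (compl_modulus_range k hk) as hk'. fold k' in hk'.
pose proof (jacobi_strip k x hk hx) as J. cbv zeta in J. fold P in J. fold b w k' in J. fold u in J.
destruct J as [hw [EA [EB ED]]].
assert (ew : w' = w + P / 2).
{ unfold w, w'. transitivity (P / 2 + Ci * P * x - (Ci * Ci) * P / 2); [field|]. rewrite Ci_sqr. field. }
assert (hw' : (0 < Re w' < P)%R).
{ rewrite ew. replace (Re (w + P / 2)) with (Re w + P / 2)%R by (rewrite <- RtoC_div by lra; destruct w; reflexivity). lra. }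
assert (A0 : latA P w <> 0) by (apply latA_neq_0; lra).
assert (A0' : latA P w' <> 0) by (apply latA_neq_0; lra).
destruct (lat_shift_iPI2 P w hP ltac:(lra)) as [FA [FB FD]].
destruct (lat_shift_iPI2 P w' hP ltac:(lra)) as [FA' [FB' FD']].
assert (g : good P w) by (left; lra). assert (o : off P (w + P / 2)) by (rewrite <- ew; now apply off_Re).
destruct (lat_shift_half P w hP g o) as [D0 [GA [GB GD]]]. rewrite <- ew in GA, GB, GD.
unfold P in GB, GD. rewrite kap_period, compl_modulus_involutive in GB, GD by easy. fold P b in GA, GB, GD.
assert (ea : lat_a P = (k' * b)%R) by now apply lat_a_period.
rewrite ea, RtoC_mult in FA, FB, FA', FB'. fold b in FA, FD, FA', FD'.
assert (b0 : RtoC b <> 0) by (apply RtoC_neq_0; lra).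
assert (k0 : RtoC k <> 0) by (apply RtoC_neq_0; lra).
assert (k0' : RtoC k' <> 0) by (apply RtoC_neq_0; lra).
pose proof Ci_neq_0 as i0.
assert (B0 : latB P w <> 0).
{ intros E. apply A0'. rewrite GA, E. field. easy. }
set (A := latA P w) in *. set (B := latB P w) in *. set (D := latD P w) in *.
unfold nd, sd, cd, cs, ds, ns, sc, nc, dc. rewrite EA, EB, ED.
rewrite FA', FB', FD', FA, FB, FD, GA, GB, GD.
split; [repeat split; reflexivity|].
split; [split; [field; repeat split; easy|split]|].
- field; repeat split; easy.
- transitivity (- (Ci * Ci) * B / (k * A)); [rewrite Ci_sqr|]; field; repeat split; easy.
- pose proof Cinv_Ci as iv.
  split; [split; [|split]|split; [|split]].
  + transitivity (B / D * / Ci); [field; repeat split; easy|]. rewrite iv. field; repeat split; easy.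
  + transitivity (k * A / D * / Ci); [field; repeat split; easy|]. rewrite iv. field; repeat split; easy.
  + transitivity (b * k / D * / Ci); [field; repeat split; easy|]. rewrite iv. field; repeat split; easy.
  + field; repeat split; easy.
  + transitivity (- (Ci * Ci) * (b * k / B)); [rewrite Ci_sqr|]; field; repeat split; easy.
  + transitivity (- (Ci * Ci) * (k * A / B)); [rewrite Ci_sqr|]; field; repeat split; easy.
Qed.

(** * Fourier expansions of the lattice sums *)

Lemma csch_geometric (v : C) : (0 < Re v)%R ->
  csch v = CSeries (fun j => 2 * Cexp (- v) ^ (2 * j + 1)) /\
  coth v - 1 = CSeries (fun j => 2 * Cexp (- v) ^ (2 * j + 2)).
Proof.
intros hv. set (W := Cexp (- v)).
assert (hW : (0 < Cmod W < 1)%R).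
{ unfold W. rewrite Cmod_Cexp. split; [apply exp_pos|]. rewrite <- exp_0. apply exp_increasing. destruct v; simpl in *; lra. }
assert (hW2 : (0 < Cmod (W * W) < 1)%R) by (rewrite Cmod_mult; nra).
assert (V : Cexp v = / W).
{ unfold W. rewrite Cexp_opp. field. apply Cexp_neq_0. }
assert (W0 : W <> 0) by apply Cexp_neq_0.
assert (N : 1 - W * W <> 0).
{ intros E. assert (E1 : W * W = 1) by (transitivity (1 - (1 - W * W)); [ring|rewrite E; ring]).
  rewrite E1, Cmod_1 in hW2. lra. }
assert (S : csch v = 2 * W / (1 - W * W)).
{ unfold csch, Csinh. fold W. rewrite V. field. split; [|easy].
  intros E; apply N. rewrite <- E. ring. }
assert (v0 : Csinh v <> 0) by (apply Csinh_neq_0_Re; lra).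
assert (G : geom (fun j => (W * W) ^ j)).
{ exists 1%R, (Cmod (W * W)). split; [easy|]. intros n. rewrite Cmod_pow. lra. }
split.
- rewrite S. rewrite (CSeries_ext _ (fun j => (2 * W) * (W * W) ^ j)).
  + rewrite CSeries_scal, CSeries_geom by easy. field. easy.
  + intros j. rewrite Cpow_add_r, Cpow_mult_r. simpl. rewrite !Cmult_1_r. ring.
- rewrite coth_minus_1, S by easy. fold W. rewrite (CSeries_ext _ (fun j => (2 * (W * W)) * (W * W) ^ j)).
  + rewrite CSeries_scal, CSeries_geom by easy. field. easy.
  + intros j. rewrite Cpow_add_r, Cpow_mult_r. simpl. rewrite !Cmult_1_r. ring.
Qed.

(** After the exchange, the sum over [n] is geometric of ratio [e * q ^ l j]. Here [e] carries the
    signs of the lattice sum and [f] the relative sign of its two halves; [j < l j] provides decay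
    in both indices. *)
Lemma lambert (V U q e f : C) (l : nat -> nat) : (0 < Cmod V < 1)%R -> (0 < Cmod U < 1)%R ->
  (0 < Cmod q < 1)%R -> Cmod e = 1%R -> Cmod f = 1%R -> (forall j, (j < l j)%nat) ->
  CSeries (fun n => CSeries (fun j => 2 * e ^ n * ((V * q ^ n) ^ l j + f * (U * q ^ n) ^ l j))) =
  CSeries (fun j => 2 * (V ^ l j + f * U ^ l j) / (1 - e * q ^ l j)).
Proof.
intros hV hU hq he hf hl.
set (r := Rmax (Cmod V) (Rmax (Cmod U) (Cmod q))).
assert (hr : (0 < r < 1)%R).
{ unfold r. split; [eapply Rlt_le_trans; [apply hV|apply Rmax_l]|]. repeat apply Rmax_lub_lt; lra. }
assert (rV : (Cmod V <= r)%R) by apply Rmax_l.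
assert (rU : (Cmod U <= r)%R) by (eapply Rle_trans; [apply Rmax_l|apply Rmax_r]).
assert (rq : (Cmod q <= r)%R) by (eapply Rle_trans; [apply Rmax_r|apply Rmax_r]).
assert (P1 : forall (x : R) (m n : nat), (0 < x <= r)%R -> (m <= n)%nat -> (x ^ n <= r ^ m)%R).
{ intros x m n hx hmn. apply Rle_trans with (r ^ n)%R; [apply pow_incr; lra|].
  replace n with (m + (n - m))%nat by lia. rewrite pow_add.
  assert (0 < r ^ m)%R by (apply pow_lt; lra).
  assert (r ^ (n - m) <= 1)%R by (rewrite <- (pow1 (n - m)); apply pow_incr; lra). nra. }
rewrite (CSeries_Fubini _ 4 r hr).
- apply CSeries_ext. intros j.
  assert (hQ : (0 < Cmod (e * q ^ l j) < 1)%R).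
  { rewrite Cmod_mult, he, Rmult_1_l, Cmod_pow. split; [apply pow_lt; lra|].
    apply Rle_lt_trans with (r ^ 1)%R; [apply P1; [lra|specialize (hl j); lia]|lra]. }
  rewrite (CSeries_ext _ (fun n => 2 * (V ^ l j + f * U ^ l j) * (e * q ^ l j) ^ n)).
  + rewrite CSeries_scal, CSeries_geom; [reflexivity|easy|].
    exists 1%R, (Cmod (e * q ^ l j)). split; [easy|]. intros n. rewrite Cmod_pow. lra.
  + intros n. rewrite !Cpow_mult_l, <- !Cpow_mult_r, (Nat.mul_comm (l j) n). ring.
- intros n j. rewrite !Cmod_mult, Cmod_pow, he, pow1, Rmult_1_r, Cmod_R, Rabs_pos_eq by lra.
  assert (T : forall X : C, (0 < Cmod X <= r)%R -> (Cmod ((X * q ^ n) ^ l j) <= r ^ n * r ^ j)%R).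
  { intros X hX. rewrite Cpow_mult_l, Cmod_mult, !Cmod_pow, <- pow_mult.
    rewrite Rmult_comm. specialize (hl j).
    assert (0 < Cmod X ^ l j)%R by (apply pow_lt; lra).
    assert (0 < Cmod q ^ (n * l j))%R by (apply pow_lt; lra).
    apply Rmult_le_compat; try lra; apply P1; try lra; [|lia].
    rewrite <- (Nat.mul_1_r n) at 1. apply Nat.mul_le_mono_l. lia. }
  pose proof (T V ltac:(lra)). pose proof (T U ltac:(lra)).
  assert (Cmod ((V * q ^ n) ^ l j + f * (U * q ^ n) ^ l j) <= 2 * (r ^ n * r ^ j))%R; [|lra].
  eapply Rle_trans; [apply Cmod_triangle|]. rewrite (Cmod_mult f), hf. lra.
Qed.

Local Open Scope R_scope.

(** * Improper integrals dominated by [M / (1 + t^2)] *)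

Definition intR (f : R -> C) (l : C) : Prop :=
  is_RInt_gen (V := C_R_NormedModule) f (Rbar_locally m_infty) (Rbar_locally p_infty) l.

Definition isI (f : R -> C) (a b : R) (l : C) : Prop := is_RInt (V := C_R_NormedModule) f a b l.

Lemma norm_C_R (x : C) : @norm R_AbsRing C_R_NormedModule x = Cmod x.
Proof.
destruct x as [x y]. unfold norm; simpl. unfold prod_norm, Cmod, norm; simpl. unfold abs; simpl.
f_equal. rewrite !Rmult_1_r, <- !Rabs_mult. rewrite !Rabs_pos_eq; nra.
Qed.

Lemma intR_iff (f : R -> C) (l : C) : intR f l <->
  forall eps, 0 < eps -> exists T, forall a b, a < - T -> T < b ->
    exists I, isI f a b I /\ Cmod (I - l) < eps.
Proof.
split.
- intros H eps he. assert (he2 : 0 < eps / 2) by lra.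
  destruct (H (fun y => Cmod (y - l) < eps)) as [Q1 Q2 [M1 H1] [M2 H2] H3].
  { exists (mkposreal _ he2). intros y [B1 B2]. eapply Rle_lt_trans; [apply Cmod_le_abs|].
    unfold ball in B1, B2; simpl in B1, B2. unfold AbsRing_ball, abs, minus, plus, opp in B1, B2; simpl in B1, B2.
    destruct y as [y1 y2], l as [l1 l2]. simpl in *. lra. }
  exists (Rmax (- M1) M2). intros a b ha hb. pose proof (Rmax_l (- M1) M2). pose proof (Rmax_r (- M1) M2).
  exact (H3 a b (H1 a ltac:(lra)) (H2 b ltac:(lra))).
- intros H Q [e He]. destruct (H e (cond_pos e)) as [T HT].
  exists (fun a => a < - T) (fun b => T < b).
  + exists (- T). easy.
  + now exists T.
  + intros a b ha hb. destruct (HT a b ha hb) as [I [I1 I2]]. exists I. split; [exact I1|]. apply He.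
    split; unfold ball; simpl; unfold AbsRing_ball, abs, minus, plus, opp; simpl.
    * eapply Rle_lt_trans; [|exact I2]. exact (Rabs_fst_le (I - l)%C).
    * eapply Rle_lt_trans; [|exact I2]. exact (Rabs_snd_le (I - l)%C).
Qed.

Lemma isI_unique (f : R -> C) (a b : R) (I J : C) : isI f a b I -> isI f a b J -> I = J.
Proof.
intros H K. apply (is_RInt_unique (V := C_R_CompleteNormedModule)) in H.
apply (is_RInt_unique (V := C_R_CompleteNormedModule)) in K. congruence.
Qed.

Lemma isI_minus (f g : R -> C) (a b : R) (I J : C) : isI f a b I -> isI g a b J ->
  isI (fun t => f t - g t)%C a b (I - J)%C.
Proof. apply (is_RInt_minus (V := C_R_NormedModule)). Qed.

(** Complex numbers are not scalars of [C_R_NormedModule], hence the passage through the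
    components. *)
Lemma isI_scal (c : C) (f : R -> C) (a b : R) (I : C) : isI f a b I -> isI (fun t => c * f t)%C a b (c * I)%C.
Proof.
intros H. pose proof (is_RInt_fct_extend_fst f a b I H) as H1. pose proof (is_RInt_fct_extend_snd f a b I H) as H2.
destruct c as [x y]. apply (is_RInt_fct_extend_pair (U := R_NormedModule) (V := R_NormedModule)); simpl.
- exact (is_RInt_minus _ _ _ _ _ _ (is_RInt_scal _ _ _ x _ H1) (is_RInt_scal _ _ _ y _ H2)).
- exact (is_RInt_plus _ _ _ _ _ _ (is_RInt_scal _ _ _ x _ H2) (is_RInt_scal _ _ _ y _ H1)).
Qed.

Lemma isI_conj (f : R -> C) (a b : R) (I : C) : isI f a b I -> isI (fun t => Cconj (f t)) a b (Cconj I).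
Proof.
intros H. pose proof (is_RInt_fct_extend_fst f a b I H) as H1. pose proof (is_RInt_fct_extend_snd f a b I H) as H2.
apply (is_RInt_fct_extend_pair (U := R_NormedModule) (V := R_NormedModule)); simpl; [exact H1|].
exact (is_RInt_opp _ _ _ _ H2).
Qed.

Lemma is_RInt_bell (M a b : R) : is_RInt (fun t => M / (1 + t ^ 2)) a b (M * (atan b - atan a)).
Proof.
apply (is_RInt_scal (V := R_NormedModule) (fun t => / (1 + t ^ 2)) a b M (atan b - atan a)).
apply (is_RInt_derive (V := R_CompleteNormedModule) atan).
- intros x _. apply is_derive_Reals. replace (/ (1 + x ^ 2)) with (/ (1 + Rsqr x)) by (unfold Rsqr; f_equal; ring).
  replace (/ (1 + Rsqr x)) with (1 / (1 + x ^ 2)) by (unfold Rsqr; field; nra).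
  pose proof (derivable_pt_lim_atan x) as H. unfold Rsqr in *. simpl in *.
  replace (1 / (1 + x * (x * 1))) with (/ (1 + x * (x * 1))) by (field; nra).
  exact H || (replace (x * (x * 1)) with (x * x) by ring; exact H).
- intros x _. apply (ex_derive_continuous (V := R_NormedModule)). auto_derive. nra.
Qed.

Lemma isI_bound (f : R -> C) (a b M : R) (I : C) : a <= b -> isI f a b I ->
  (forall t, Cmod (f t) <= M / (1 + t ^ 2)) -> Cmod I <= M * (atan b - atan a).
Proof.
intros hab H Hb. rewrite <- norm_C_R.
apply (norm_RInt_le (V := C_R_NormedModule) f (fun t => M / (1 + t ^ 2)) a b); [easy| |exact H|apply is_RInt_bell].
intros x _. now rewrite norm_C_R.
Qed.

Lemma bell_nonneg (f : R -> C) (M : R) : (forall t, Cmod (f t) <= M / (1 + t ^ 2)) -> 0 <= M.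
Proof.
intros H. specialize (H 0). replace (M / (1 + 0 ^ 2)) with M in H by field.
pose proof (Cmod_ge_0 (f 0)). lra.
Qed.

Lemma isI_bound_PI (f : R -> C) (a b M : R) (I : C) : a <= b -> isI f a b I ->
  (forall t, Cmod (f t) <= M / (1 + t ^ 2)) -> Cmod I <= M * PI.
Proof.
intros hab H Hb. pose proof (bell_nonneg f M Hb) as hM.
eapply Rle_trans; [now apply (isI_bound f a b M)|]. apply Rmult_le_compat_l; [easy|].
pose proof (atan_bound a). pose proof (atan_bound b). lra.
Qed.

Lemma atan_tail (eps : R) : 0 < eps -> exists T, 0 < T /\ forall x, T < x -> PI / 2 - eps < atan x.
Proof.
intros he. pose proof PI_RGT_0. set (d := Rmin eps (PI / 4)).
assert (hd : 0 < d) by (apply Rmin_pos; lra).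
pose proof (Rmin_l eps (PI / 4)). pose proof (Rmin_r eps (PI / 4)). fold d in H0, H1.
exists (Rmax 1 (tan (PI / 2 - d))). pose proof (Rmax_l 1 (tan (PI / 2 - d))).
pose proof (Rmax_r 1 (tan (PI / 2 - d))). split; [lra|]. intros x hx.
apply Rle_lt_trans with (PI / 2 - d); [lra|].
rewrite <- (atan_tan (PI / 2 - d)) by lra. apply atan_increasing. lra.
Qed.

(** Cauchy's criterion: the integral between two points far out on the same side is at most [M]
    times a difference of arctangents, both close to the same limit. *)
Lemma intR_exists (f : R -> C) (M : R) : (forall a b, exists I, isI f a b I) ->
  (forall t, Cmod (f t) <= M / (1 + t ^ 2)) -> exists l, intR f l.
Proof.
intros Hex Hb. pose proof (bell_nonneg f M Hb) as hM.
set (I := fun ab : R * R => RInt (V := C_R_CompleteNormedModule) f (fst ab) (snd ab)).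
assert (HI : forall a b, isI f a b (I (a, b))).
{ intros a b. apply (RInt_correct (V := C_R_CompleteNormedModule)). destruct (Hex a b) as [J HJ]. now exists J. }
assert (small : forall eps, 0 < eps -> exists T, 0 < T /\ forall a b a' b', a < - T -> T < b -> a' < - T -> T < b' ->
  Cmod (I (a', b') - I (a, b))%C < eps).
{ intros eps he. destruct (atan_tail (eps / (4 * (M + 1)))) as [T [hT HT]]; [apply Rdiv_lt_0_compat; lra|].
  exists T. split; [easy|]. intros a b a' b' ha hb ha' hb'.
  assert (Q : forall u v, T < u -> T < v -> Rabs (atan u - atan v) < eps / (4 * (M + 1))).
  { intros u v hu hv. pose proof (HT u hu). pose proof (HT v hv).
    pose proof (atan_bound u). pose proof (atan_bound v). apply Rabs_def1; lra. }
  assert (B : forall u v, Cmod (I (u, v)) <= M * Rabs (atan v - atan u)).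
  { intros u v. destruct (Rle_dec u v) as [h|h].
    - eapply Rle_trans; [apply (isI_bound f u v M); [easy|apply HI|easy]|].
      apply Rmult_le_compat_l; [easy|apply Rle_abs].
    - assert (E : I (u, v) = (- I (v, u))%C).
      { apply (isI_unique f u v); [apply HI|]. apply (is_RInt_swap (V := C_R_NormedModule)). apply HI. }
      rewrite E, Cmod_opp, Rabs_minus_sym. eapply Rle_trans; [apply (isI_bound f v u M); [lra|apply HI|easy]|].
      apply Rmult_le_compat_l; [easy|apply Rle_abs]. }
  assert (E : (I (a', b') - I (a, b) = I (a', a) + I (b, b'))%C).
  { assert (E2 : I (a', b') = (I (a', a) + I (a, b) + I (b, b'))%C).
    { apply (isI_unique f a' b'); [apply HI|].
      apply (is_RInt_Chasles (V := C_R_NormedModule) f a' b b'); [|apply HI].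
      apply (is_RInt_Chasles (V := C_R_NormedModule) f a' a b); apply HI. }
    rewrite E2. ring. }
  rewrite E. eapply Rle_lt_trans; [apply Cmod_triangle|].
  pose proof (B a' a) as B1. pose proof (B b b') as B2.
  pose proof (Q b' b hb' hb) as Q2. pose proof (Q (- a') (- a) ltac:(lra) ltac:(lra)) as Q1.
  rewrite !atan_opp in Q1. replace (- atan a' - - atan a) with (atan a - atan a') in Q1 by ring.
  set (e := eps / (4 * (M + 1))) in *.
  assert (M * e <= eps / 4).
  { apply Rle_trans with ((M + 1) * e); [apply Rmult_le_compat_r; [|lra]|unfold e; right; field; lra].
    apply Rlt_le, Rdiv_lt_0_compat; lra. }
  assert (M * Rabs (atan a - atan a') <= M * e) by (apply Rmult_le_compat_l; lra).
  assert (M * Rabs (atan b' - atan b) <= M * e) by (apply Rmult_le_compat_l; lra). lra. }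
destruct (filterlim_locally_cauchy (U := C_R_CompleteNormedModule)
  (F := filter_prod (Rbar_locally m_infty) (Rbar_locally p_infty)) I) as [HC _].
destruct HC as [l Hl].
{ intros eps. destruct (small eps (cond_pos eps)) as [T [hT HT]].
  exists (fun ab => fst ab < - T /\ T < snd ab). split.
  - exists (fun a => a < - T) (fun b => T < b); [now exists (- T)|now exists T|easy].
  - intros [a b] [a' b'] [h1 h2] [h3 h4]. specialize (HT a b a' b' h1 h2 h3 h4).
    split; unfold ball; simpl; unfold AbsRing_ball, abs, minus, plus, opp; simpl.
    + eapply Rle_lt_trans; [|exact HT]. exact (Rabs_fst_le (I (a', b') - I (a, b))%C).
    + eapply Rle_lt_trans; [|exact HT]. exact (Rabs_snd_le (I (a', b') - I (a, b))%C). }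
exists l. intros Q HQ. specialize (Hl Q HQ). unfold filtermap in Hl. unfold filtermapi.
destruct Hl as [Q1 Q2 H1 H2 H3]. exists Q1 Q2; [easy|easy|]. intros a b ha hb. exists (I (a, b)).
split; [apply HI|now apply H3].
Qed.

Lemma intR_ext (f g : R -> C) (l : C) : (forall t, f t = g t) -> intR f l -> intR g l.
Proof.
intros E H. apply intR_iff. intros eps he. destruct (proj1 (intR_iff f l) H eps he) as [T HT].
exists T. intros a b ha hb. destruct (HT a b ha hb) as [I [I1 I2]]. exists I; split; [|easy].
apply (is_RInt_ext (V := C_R_NormedModule) f); [|easy]. intros; apply E.
Qed.

Lemma intR_plus (f g : R -> C) (l m : C) : intR f l -> intR g m -> intR (fun t => f t + g t)%C (l + m)%C.
Proof. intros H K. exact (is_RInt_gen_plus f g l m H K). Qed.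

Lemma intR_scal (c : C) (f : R -> C) (l : C) : intR f l -> intR (fun t => c * f t)%C (c * l)%C.
Proof.
intros H. apply intR_iff. intros eps he. pose proof (Cmod_ge_0 c) as hc.
destruct (proj1 (intR_iff f l) H (eps / (Cmod c + 1)) ltac:(apply Rdiv_lt_0_compat; lra)) as [T HT].
exists T. intros a b ha hb. destruct (HT a b ha hb) as [I [I1 I2]]. exists (c * I)%C.
split; [now apply isI_scal|]. replace (c * I - c * l)%C with (c * (I - l))%C by ring. rewrite Cmod_mult.
apply Rle_lt_trans with (Cmod c * (eps / (Cmod c + 1))).
- apply Rmult_le_compat_l; lra.
- apply (Rmult_lt_reg_r (Cmod c + 1)); [lra|].
  replace (Cmod c * (eps / (Cmod c + 1)) * (Cmod c + 1)) with (Cmod c * eps) by (field; lra). nra.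
Qed.

Lemma intR_conj (f : R -> C) (l : C) : intR f l -> intR (fun t => Cconj (f t)) (Cconj l).
Proof.
intros H. apply intR_iff. intros eps he. destruct (proj1 (intR_iff f l) H eps he) as [T HT].
exists T. intros a b ha hb. destruct (HT a b ha hb) as [I [I1 I2]]. exists (Cconj I).
split; [now apply isI_conj|]. rewrite <- Cminus_conj, Cmod_conj. exact I2.
Qed.

Lemma intR_refl (f : R -> C) (l : C) : intR f l -> intR (fun t => f (- t)) l.
Proof.
intros H. apply intR_iff. intros eps he. destruct (proj1 (intR_iff f l) H eps he) as [T HT].
exists T. intros a b ha hb. destruct (HT (- b) (- a) ltac:(lra) ltac:(lra)) as [I [I1 I2]].
exists I. split; [|easy].
apply (is_RInt_swap (V := C_R_NormedModule)) in I1.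
apply (is_RInt_comp_opp (V := C_R_NormedModule)) in I1.
apply (is_RInt_opp (V := C_R_NormedModule)) in I1. rewrite opp_opp in I1.
apply (is_RInt_ext (V := C_R_NormedModule)) with (2 := I1). intros t _. now rewrite opp_opp.
Qed.

Lemma intR_unique (f : R -> C) (l m : C) : intR f l -> intR f m -> l = m.
Proof.
intros H K. apply eq_of_Cmod_lt. intros eps he.
destruct (proj1 (intR_iff f l) H (eps / 2) ltac:(lra)) as [T HT].
destruct (proj1 (intR_iff f m) K (eps / 2) ltac:(lra)) as [S HS].
set (X := Rabs T + Rabs S + 1). pose proof (Rabs_pos T). pose proof (Rabs_pos S).
pose proof (Rle_abs T). pose proof (Rle_abs S).
destruct (HT (- X) X ltac:(unfold X; lra) ltac:(unfold X; lra)) as [I [I1 I2]].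
destruct (HS (- X) X ltac:(unfold X; lra) ltac:(unfold X; lra)) as [J [J1 J2]].
rewrite (isI_unique _ _ _ _ _ J1 I1) in J2.
replace (l - m)%C with (- (I - l) + (I - m))%C by ring.
eapply Rle_lt_trans; [apply Cmod_triangle|]. rewrite Cmod_opp. lra.
Qed.

(** Termwise integration: an error of [K * r ^ n / (1 + t ^ 2)] on the integrand costs at most
    [K * r ^ n * PI] on any interval. *)
Lemma intR_limit (f : R -> C) (g : nat -> R -> C) (l : C) (m : nat -> C) (K r : R) : 0 < r < 1 ->
  (forall a b, exists I, isI f a b I) -> (forall n, intR (g n) (m n)) ->
  (forall n t, Cmod (f t - g n t) <= K * r ^ n / (1 + t ^ 2)) ->
  (forall n, Cmod (l - m n) <= K * r ^ n) -> intR f l.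
Proof.
intros hr Hex Hg Hfg Hm. apply intR_iff. intros eps he.
(* [PI] accounts for the integral of the error, 1 for the distance between [l] and [m N]. *)
destruct (pow_lt_eps r (K * (PI + 1)) (eps / 2) hr ltac:(lra)) as [N HN].
specialize (HN N ltac:(lia)).
destruct (proj1 (intR_iff _ _) (Hg N) (eps / 2) ltac:(lra)) as [T HT].
exists (Rabs T). pose proof (Rabs_pos T). pose proof (Rle_abs T). intros a b ha hb.
destruct (HT a b ltac:(lra) ltac:(lra)) as [J [J1 J2]]. destruct (Hex a b) as [I HI].
exists I. split; [easy|]. pose proof (isI_minus _ _ _ _ _ _ HI J1) as D.
pose proof (isI_bound_PI _ a b (K * r ^ N) _ ltac:(lra) D (Hfg N)) as B.
replace (I - l)%C with ((I - J) + ((J - m N) + - (l - m N)))%C by ring.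
eapply Rle_lt_trans; [apply Cmod_triangle|].
eapply Rle_lt_trans; [apply Rplus_le_compat_l, Cmod_triangle|]. rewrite Cmod_opp.
specialize (Hm N). lra.
Qed.

Lemma Ccont_line (f : C -> C) (z0 v : C) (t : R) : v <> 0%C -> Ccont f (z0 + t * v)%C ->
  continuous (U := C_R_NormedModule) (fun s : R => f (z0 + s * v)%C) t.
Proof.
intros v0 H Q [e He]. destruct (H e (cond_pos e)) as [d [hd Hd]].
assert (hv : 0 < Cmod v) by now apply Cmod_gt_0.
assert (hdv : 0 < d / Cmod v) by now apply Rdiv_lt_0_compat.
exists (mkposreal _ hdv). intros s hs. apply He.
change (Rabs (s - t) < d / Cmod v) in hs.
destruct (Req_dec s t) as [->|ne]; [apply ball_center|].
assert (K : Cmod (f (z0 + s * v) - f (z0 + t * v))%C < e).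
{ specialize (Hd ((s - t)%R * v)%C). replace (z0 + t * v + (s - t)%R * v)%C with (z0 + s * v)%C in Hd
    by (rewrite RtoC_minus; ring).
  apply Hd.
  - apply Cmult_neq_0; [|easy]. apply RtoC_neq_0. lra.
  - rewrite Cmod_mult, Cmod_R. apply (Rmult_lt_compat_r (Cmod v)) in hs; [|easy].
    replace (d / Cmod v * Cmod v) with d in hs by (field; lra). exact hs. }
split; unfold ball; simpl; unfold AbsRing_ball, abs, minus, plus, opp; simpl.
- eapply Rle_lt_trans; [|exact K]. exact (Rabs_fst_le (f (z0 + s * v) - f (z0 + t * v))%C).
- eapply Rle_lt_trans; [|exact K]. exact (Rabs_snd_le (f (z0 + s * v) - f (z0 + t * v))%C).
Qed.

Lemma isI_of_Ccont (f : C -> C) (y : R) : (forall t : R, Ccont f (t, y)) ->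
  forall a b, exists I, isI (fun t => f (t, y)) a b I.
Proof.
intros H a b.
assert (E : forall t : R, ((0, y) + t * 1)%C = (t, y)) by (intros t; unfold Cplus, Cmult, RtoC; simpl; f_equal; ring).
destruct (ex_RInt_continuous (V := C_R_CompleteNormedModule) (fun t : R => f ((0, y) + t * 1)%C) a b) as [I HI].
- intros t _. apply (Ccont_line f (0, y) 1 t C1_neq_0). rewrite E. apply H.
- exists I. apply (is_RInt_ext (V := C_R_NormedModule) (fun t : R => f ((0, y) + t * 1)%C)); [|exact HI].
  intros t _. now rewrite E.
Qed.

(** * Fourier transforms of the hyperbolic kernels *)

Lemma Cder_vertical (f : C -> C) (c l : C) (t y : R) : c <> 0%C -> Cder f (t, y) l ->
  is_derive (fun s : R => Re (c * f (t, s))%C) y (Re (c * (Ci * l))%C).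
Proof.
intros c0 H.
assert (E : forall s : R, ((t, 0) + s * Ci)%C = (t, s)) by (intros s; unfold Cplus, Cmult, RtoC, Ci; simpl; f_equal; ring).
apply (is_derive_ext (fun s : R => Re (c * f ((t, 0) + s * Ci)%C)%C)); [intros s; now rewrite E|].
apply Cder_line; [apply Ci_neq_0|easy|]. now rewrite E.
Qed.

Lemma Cder_horizontal (f : C -> C) (c l : C) (t y : R) : c <> 0%C -> Cder f (t, y) l ->
  is_derive (fun s : R => Re (c * f (s, y))%C) t (Re (c * l)%C).
Proof.
intros c0 H.
assert (E : forall s : R, ((0, y) + s * 1)%C = (s, y)) by (intros s; unfold Cplus, Cmult, RtoC; simpl; f_equal; ring).
apply (is_derive_ext (fun s : R => Re (c * f ((0, y) + s * 1)%C)%C)); [intros s; now rewrite E|].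
evar_last; [apply (Cder_line f (0, y) 1 c l t C1_neq_0 c0); now rewrite E|]. now rewrite Cmult_1_l.
Qed.

Lemma Ccont_horizontal (f : C -> C) (c : C) (t y : R) : Ccont f (t, y) ->
  continuous (fun s : R => Re (c * f (s, y))%C) t.
Proof.
intros H.
assert (E : forall s : R, ((0, y) + s * 1)%C = (s, y)) by (intros s; unfold Cplus, Cmult, RtoC; simpl; f_equal; ring).
pose proof (Ccont_line (fun z => c * f z)%C (0, y) 1 t C1_neq_0) as K. rewrite E in K.
specialize (K (Ccont_mult _ _ _ (Ccont_const c _) H)).
apply (continuous_ext (fun s : R => fst (c * f ((0, y) + s * 1)%C)%C)); [intros s; now rewrite E|].
apply (continuous_comp (V := C_R_NormedModule) (W := R_UniformSpace) (fun s : R => (c * f ((0, y) + s * 1)%C)%C) fst); [exact K|].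
apply continuous_fst.
Qed.

(** Cauchy's theorem on an infinitely thin rectangle: the derivative of [h] in [y] is [Ci] times its
    derivative in [t], so its integral reduces to the values at both ends. *)
Lemma is_derive_line_integral (h h1 : C -> C) (c : C) (lo hi a b y : R) : c <> 0%C -> lo < y < hi ->
  (forall z, lo < Im z < hi -> Cder h z (h1 z) /\ Ccont h1 z) ->
  is_derive (fun y => RInt (fun t => Re (c * h (t, y))%C) a b) y
    (Re (c * Ci * h (b, y))%C - Re (c * Ci * h (a, y))%C).
Proof.
intros c0 hy H.
assert (V : forall t u, lo < u < hi -> is_derive (fun s : R => Re (c * h (t, s))%C) u (Re (c * (Ci * h1 (t, u)))%C)).
{ intros t u hu. apply Cder_vertical; [easy|]. now apply H. }
assert (hd : 0 < Rmin (y - lo) (hi - y)) by (apply Rmin_pos; lra).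
assert (near : forall u, Rabs (u - y) < Rmin (y - lo) (hi - y) -> lo < u < hi).
{ intros u hu. pose proof (Rmin_l (y - lo) (hi - y)). pose proof (Rmin_r (y - lo) (hi - y)).
  apply Rabs_def2 in hu. lra. }
evar_last.
- apply (is_derive_RInt_param (fun u t => Re (c * h (t, u))%C) a b y).
  + exists (mkposreal _ hd). intros u hu t _. eexists. apply V. now apply near.
  + intros t _. intros eps.
    destruct (H (t, y) ltac:(simpl; lra)) as [_ Cn].
    assert (Cc : Ccont (fun z => c * (Ci * h1 z))%C (t, y)).
    { apply (Ccont_mult (fun _ => c)); [apply Ccont_const|].
      apply (Ccont_mult (fun _ => Ci)); [apply Ccont_const|exact Cn]. }
    destruct (Cc eps (cond_pos eps)) as [d [hd1 Hd]].
    assert (hd2 : 0 < Rmin (d / 2) (Rmin (y - lo) (hi - y))) by (apply Rmin_pos; lra).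
    exists (mkposreal _ hd2). intros u v hu hv. cbv beta.
    change (Rabs (u - y) < Rmin (d / 2) (Rmin (y - lo) (hi - y))) in hu.
    change (Rabs (v - t) < Rmin (d / 2) (Rmin (y - lo) (hi - y))) in hv.
    pose proof (Rmin_l (d / 2) (Rmin (y - lo) (hi - y))). pose proof (Rmin_r (d / 2) (Rmin (y - lo) (hi - y))).
    change (Rabs (Derive (fun s : R => Re (c * h (v, s))%C) u - Derive (fun s : R => Re (c * h (t, s))%C) y) < eps).
    rewrite (is_derive_unique _ _ _ (V v u (near u ltac:(lra)))).
    rewrite (is_derive_unique _ _ _ (V t y hy)).
    destruct (Ceq_dec ((v, u) - (t, y))%C 0%C) as [e|e].
    * assert (v = t /\ u = y) as [-> ->] by (injection e; intros; split; lra).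
      rewrite Rminus_diag, Rabs_R0. apply cond_pos.
    * specialize (Hd _ e).
      replace ((t, y) + ((v, u) - (t, y)))%C with (v, u) in Hd by (unfold Cplus, Cminus, Copp; simpl; f_equal; ring).
      eapply Rle_lt_trans; [|apply Hd].
      -- exact (Rabs_fst_le (c * (Ci * h1 (v, u)) - c * (Ci * h1 (t, y)))%C).
      -- eapply Rle_lt_trans; [apply Cmod_le_abs|]. simpl. fold (v - t) (u - y). lra.
  + exists (mkposreal _ hd). intros u hu. apply (ex_RInt_continuous (V := R_CompleteNormedModule)).
    intros t _. apply Ccont_horizontal. apply Cder_cont with (h1 (t, u)). apply H. simpl. now apply near.
- rewrite (RInt_ext _ (fun t => Re (c * Ci * h1 (t, y))%C)).
  + apply is_RInt_unique.
    apply (is_RInt_derive (V := R_CompleteNormedModule) (fun t => Re (c * Ci * h (t, y))%C)).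
    * intros t _. apply Cder_horizontal; [apply Cmult_neq_0; [easy|apply Ci_neq_0]|]. now apply H.
    * intros t _. apply Ccont_horizontal. now apply H.
  + intros t _. transitivity (Re (c * (Ci * h1 (t, y)))%C); [|now rewrite Cmult_assoc].
    exact (is_derive_unique _ _ _ (V t y hy)).
Qed.

(** Shift of the contour: by the mean value theorem, the integrals over [[a, b]] at the two heights
    differ by at most the distance of the lines times the values of [h] at both ends, which
    decay. *)
Lemma strip_shift (h h1 : C -> C) (lo hi y0 y1 M : R) (l : C) : lo < y0 < hi -> lo < y1 < hi ->
  (forall z, lo < Im z < hi -> Cder h z (h1 z) /\ Ccont h1 z) ->
  (forall t y, Rmin y0 y1 <= y <= Rmax y0 y1 -> Cmod (h (t, y)) <= M / (1 + t ^ 2)) ->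
  intR (fun t => h (t, y0)) l -> intR (fun t => h (t, y1)) l.
Proof.
intros hy0 hy1 H Hb Hi.
assert (hM : 0 <= M).
{ apply (bell_nonneg (fun t => h (t, y0))). intros t. apply Hb. split; [apply Rmin_l|apply Rmax_l]. }
apply intR_iff. intros eps he.
destruct (proj1 (intR_iff _ _) Hi (eps / 2) ltac:(lra)) as [T HT].
set (L := Rabs (y1 - y0)). assert (hL : 0 <= L) by apply Rabs_pos.
(* Beyond [T2] each end costs at most [eps / 8]; two ends and two components make [eps / 2]. *)
set (T2 := 8 * L * M / eps + 1).
assert (hT2 : 0 <= 8 * L * M / eps) by (apply Rdiv_le_0_compat; [repeat apply Rmult_le_pos; lra|lra]).
assert (hT3 : 1 <= T2) by (unfold T2; lra).
exists (Rmax T T2). intros a b ha hb. pose proof (Rmax_l T T2). pose proof (Rmax_r T T2).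
destruct (HT a b ltac:(lra) ltac:(lra)) as [I [I1 I2]].
assert (CC : forall y, lo < y < hi -> forall t, Ccont h (t, y)).
{ intros y hy t. apply Cder_cont with (h1 (t, y)). now apply H. }
destruct (isI_of_Ccont h y1 (CC y1 hy1) a b) as [J HJ]. exists J. split; [easy|].
assert (tail : forall x, T2 < Rabs x -> M / (1 + x ^ 2) * L <= eps / 8).
{ intros x hx. assert (T2 <= x ^ 2).
  { replace (x ^ 2) with (Rabs x * Rabs x) by (rewrite <- Rabs_mult, Rabs_pos_eq; nra). unfold T2 in *. nra. }
  replace (M / (1 + x ^ 2) * L) with (L * M / (1 + x ^ 2)) by (field; nra).
  apply (Rmult_le_reg_r (1 + x ^ 2)); [nra|]. unfold Rdiv at 1. rewrite Rmult_assoc, Rinv_l, Rmult_1_r by nra.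
  apply Rle_trans with (eps / 8 * (8 * L * M / eps)); [right; field; lra|].
  apply Rmult_le_compat_l; [lra|]. unfold T2 in *. lra. }
assert (Q : forall c : C, Cmod c = 1 -> Rabs (Re (c * J)%C - Re (c * I)%C) <= eps / 4).
{ intros c hc. assert (c0 : c <> 0%C) by (intros e; rewrite e, Cmod_0 in hc; lra).
  assert (R0 : forall y K, isI (fun t => h (t, y)) a b K -> RInt (fun t => Re (c * h (t, y))%C) a b = Re (c * K)%C).
  { intros y K HK. apply is_RInt_unique. exact (is_RInt_fct_extend_fst _ _ _ _ (isI_scal c _ _ _ _ HK)). }
  rewrite <- (R0 _ _ HJ), <- (R0 _ _ I1).
  set (W := fun y => RInt (fun t => Re (c * h (t, y))%C) a b).
  assert (DW : forall y, lo < y < hi -> is_derive W y (Re (c * Ci * h (b, y))%C - Re (c * Ci * h (a, y))%C)).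
  { intros y hy. now apply (is_derive_line_integral h h1 c lo hi). }
  change (Rabs (W y1 - W y0) <= eps / 4).
  assert (between : forall x, Rmin y0 y1 <= x <= Rmax y0 y1 -> lo < x < hi).
  { intros x [h2 h3]. split.
    - eapply Rlt_le_trans; [|exact h2]. apply Rmin_glb_lt; lra.
    - eapply Rle_lt_trans; [exact h3|]. apply Rmax_lub_lt; lra. }
  destruct (MVT_gen W y0 y1 (fun y => Re (c * Ci * h (b, y))%C - Re (c * Ci * h (a, y))%C)) as [x [hx Hx]].
  - intros x hx. apply DW, between. lra.
  - intros x hx. apply continuity_pt_filterlim. exact (is_derive_continuous _ _ _ (DW x (between x hx))).
  - rewrite Hx, Rabs_mult. fold L.
    assert (B : forall s, Rabs (Re (c * Ci * h (s, x))%C) <= M / (1 + s ^ 2)).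
    { intros s. eapply Rle_trans; [apply re_le_Cmod|]. rewrite !Cmod_mult, hc, Cmod_Ci, !Rmult_1_l. now apply Hb. }
    pose proof (B a). pose proof (B b).
    pose proof (tail a ltac:(rewrite Rabs_left; lra)). pose proof (tail b ltac:(rewrite Rabs_pos_eq; lra)).
    apply Rle_trans with ((M / (1 + b ^ 2) + M / (1 + a ^ 2)) * L); [|lra].
    apply Rmult_le_compat_r; [easy|]. unfold Rminus. eapply Rle_trans; [apply Rabs_triang|]. rewrite Rabs_Ropp. lra. }
pose proof (Q 1%C Cmod_1) as Q1. pose proof (Q Ci Cmod_Ci) as Q2.
replace (J - l)%C with ((J - I) + (I - l))%C by ring.
eapply Rle_lt_trans; [apply Cmod_triangle|].
assert (Cmod (J - I) <= eps / 2); [|lra].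
eapply Rle_trans; [apply Cmod_le_abs|].
destruct I as [i1 i2], J as [j1 j2]. simpl in *.
replace (1 * j1 - 0 * j2 - (1 * i1 - 0 * i2)) with (j1 + - i1) in Q1 by ring.
replace (0 * j1 - 1 * j2 - (0 * i1 - 1 * i2)) with (- (j2 + - i2)) in Q2 by ring. rewrite Rabs_Ropp in Q2. lra.
Qed.

Definition wave (b : R) (x : C) : C := Cexp (2 * PI * Ci * x * b)%C.

Lemma Cmod_wave (b t y : R) : Cmod (wave b (t, y)) = exp (- (2 * PI * b * y)).
Proof. unfold wave. rewrite Cmod_Cexp. f_equal. simpl. ring. Qed.

Lemma wave_plus (b : R) (x z : C) : wave b (x + z)%C = (wave b x * wave b z)%C.
Proof. unfold wave. rewrite <- Cexp_plus. f_equal. ring. Qed.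

Lemma Cder_wave (b : R) (z : C) : Cder (wave b) z (2 * PI * Ci * b * wave b z)%C.
Proof.
apply (Cder_ext (fun x => Cexp (2 * PI * Ci * b * x)%C)); [intros w; unfold wave; f_equal; ring|].
destruct (Ceq_dec (2 * PI * Ci * b)%C 0%C) as [e|e].
- rewrite e, Cmult_0_l. apply (Cder_ext (fun _ => 1%C)); [intros; now rewrite Cmult_0_l, Cexp_0|]. apply Cder_const.
- unfold wave. replace (2 * PI * Ci * z * b)%C with (2 * PI * Ci * b * z)%C by ring.
  apply (Cder_scal_arg Cexp); [easy|apply Cder_Cexp].
Qed.

Lemma CPI_neq_0 : RtoC PI <> 0%C.
Proof. apply RtoC_neq_0, PI_neq0. Qed.

Lemma Im_PI_mult (z : C) : Im (PI * z)%C = PI * Im z.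
Proof. destruct z; simpl; ring. Qed.

Lemma Csinh_PI_neq_0 (z : C) : 0 < Im z < 1 -> Csinh (PI * z)%C <> 0%C.
Proof.
intros hz. apply Csinh_neq_0_Im. rewrite Im_PI_mult. pose proof PI_RGT_0. apply Rgt_not_eq, sin_gt_0; nra.
Qed.

Lemma csch_wave_der (b : R) (z : C) : 0 < Im z < 1 ->
  let h1 := fun z => (2 * PI * Ci * b * wave b z * csch (PI * z) +
    wave b z * (PI * (- Ccosh (PI * z) / (Csinh (PI * z) * Csinh (PI * z)))))%C in
  Cder (fun z => wave b z * csch (PI * z))%C z (h1 z) /\ Ccont h1 z.
Proof.
intros hz h1. pose proof (Csinh_PI_neq_0 z hz) as s0.
assert (D1 := Cder_wave b z).
assert (D2 : Cder (fun z => csch (PI * z))%C z (PI * (- Ccosh (PI * z) / (Csinh (PI * z) * Csinh (PI * z))))%C).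
{ apply (Cder_scal_arg csch); [apply CPI_neq_0|]. apply (Cder_inv Csinh); [easy|apply Cder_Csinh]. }
split; [exact (Cder_mult (wave b) (fun z => csch (PI * z))%C z _ _ D1 D2)|].
assert (CS : Ccont (fun z => Csinh (PI * z))%C z) by (apply (Ccont_scal_arg Csinh); [apply CPI_neq_0|apply Ccont_Csinh]).
assert (CC : Ccont (fun z => Ccosh (PI * z))%C z) by (apply (Ccont_scal_arg Ccosh); [apply CPI_neq_0|apply Ccont_Ccosh]).
pose proof (Cder_cont _ _ _ D1) as CW. pose proof (Cder_cont _ _ _ D2) as CD.
unfold h1. apply Ccont_plus.
- apply Ccont_mult; [apply Ccont_mult; [apply Ccont_const|exact CW]|exact CD].
- apply Ccont_mult; [exact CW|]. apply Ccont_mult; [apply Ccont_const|].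
  apply Ccont_div; [now apply Cmult_neq_0| |now apply Ccont_mult].
  apply (Clim_ext (fun h => - 1 * Ccosh (PI * (z + h)))%C); [intros; ring|].
  apply (Clim_eq _ (- 1 * Ccosh (PI * z))%C); [ring|]. now apply Clim_scal.
Qed.

Lemma sinh_ge_id (x : R) : 0 <= x -> x <= sinh x.
Proof.
intros hx. destruct (Req_dec x 0) as [->|ne]; [rewrite sinh_0; lra|].
destruct (MVT_gen (fun t => sinh t - t) 0 x (fun t => cosh t - 1)) as [c [hc Hc]].
- intros t _. auto_derive; [easy|]. unfold cosh, sinh. field || ring.
- intros t _. apply continuity_pt_filterlim, (ex_derive_continuous (V := R_NormedModule) (fun t => sinh t - t)). auto_derive. easy.
- rewrite sinh_0 in Hc. assert (1 <= cosh c).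
  { pose proof (cosh2_sinh2 c). pose proof (cosh_pos c). nra. }
  nra.
Qed.

Lemma sinh_double (x : R) : sinh (2 * x) = 2 * sinh x * cosh x.
Proof.
unfold sinh, cosh. replace (2 * x) with (x + x) by ring. replace (- (x + x)) with (- x + - x) by ring.
rewrite !exp_plus. field.
Qed.

Lemma cosh_double (x : R) : cosh (2 * x) = 1 + 2 * sinh x ^ 2.
Proof.
pose proof (cosh2_sinh2 x). assert (cosh (2 * x) = cosh x ^ 2 + sinh x ^ 2); [|lra].
unfold sinh, cosh. replace (2 * x) with (x + x) by ring. replace (- (x + x)) with (- x + - x) by ring.
rewrite !exp_plus. field.
Qed.

(** Two duplications, and [sinh x >= x] at quarter argument. The constant 1/8 is enough to reach
    [1 + t ^ 2] at [x = PI * t], since [PI ^ 2 > 8]. *)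
Lemma sinh_ge_cubic (x : R) : 0 <= x -> x * (1 + x ^ 2 / 8) <= sinh x.
Proof.
intros hx. replace x with (2 * (x / 2)) at 3 by field. rewrite sinh_double.
pose proof (sinh_ge_id (x / 2) ltac:(lra)) as H1.
pose proof (sinh_ge_id (x / 4) ltac:(lra)) as H2.
assert (H3 : 1 + x ^ 2 / 8 <= cosh (x / 2)).
{ replace (x / 2) with (2 * (x / 4)) by field. rewrite cosh_double. nra. }
assert (0 <= x ^ 2 / 8) by nra.
replace (x * (1 + x ^ 2 / 8)) with (2 * (x / 2) * (1 + x ^ 2 / 8)) by field.
apply Rmult_le_compat; lra.
Qed.

Lemma sinh_opp (x : R) : sinh (- x) = - sinh x.
Proof. unfold sinh. rewrite Ropp_involutive. field. Qed.

Lemma cosh_opp (x : R) : cosh (- x) = cosh x.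
Proof. unfold cosh. rewrite Ropp_involutive. field. Qed.

Lemma PI_gt_3 : 3 < PI.
Proof. pose proof PI2_3_2. lra. Qed.

Lemma sinh_PI_ge (t : R) : Rabs t * (1 + t ^ 2) <= Rabs (sinh (PI * t)).
Proof.
assert (Q : forall t, 0 <= t -> t * (1 + t ^ 2) <= sinh (PI * t)).
{ clear t; intros t ht. pose proof PI_gt_3. eapply Rle_trans; [|apply sinh_ge_cubic; nra].
  assert (9 * t ^ 2 <= (PI * t) ^ 2) by (rewrite Rpow_mult_distr; apply Rmult_le_compat_r; nra).
  apply Rmult_le_compat; nra. }
destruct (Rle_dec 0 t) as [h|h].
- rewrite (Rabs_pos_eq t) by lra. eapply Rle_trans; [now apply Q|apply Rle_abs].
- specialize (Q (- t) ltac:(lra)). rewrite (Rabs_left t) by lra.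
  replace (PI * - t) with (- (PI * t)) in Q by ring. rewrite sinh_opp in Q.
  replace ((- t) ^ 2) with (t ^ 2) in Q by ring. eapply Rle_trans; [exact Q|]. rewrite <- Rabs_Ropp. apply Rle_abs.
Qed.

Lemma cosh_PI_le (t : R) : t ^ 2 * (1 + t ^ 2) * cosh (PI * t) <= sinh (PI * t) ^ 2.
Proof.
assert (Q : forall t, 0 <= t -> t ^ 2 * (1 + t ^ 2) * cosh (PI * t) <= sinh (PI * t) ^ 2).
{ clear t; intros t ht. pose proof PI_gt_3.
  replace (PI * t) with (2 * (PI * t / 2)) by field. set (u := PI * t / 2).
  assert (hu : 3 / 2 * t <= u) by (unfold u; nra).
  rewrite sinh_double, cosh_double. pose proof (cosh2_sinh2 u). pose proof (sinh_ge_cubic u ltac:(lra)) as S.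
  assert (S2 : t ^ 2 * (1 + t ^ 2) <= 2 * sinh u ^ 2).
  { assert ((u * (1 + u ^ 2 / 8)) ^ 2 <= sinh u ^ 2) by (apply pow_incr; split; [apply Rmult_le_pos; nra|easy]).
    assert (u ^ 2 * (1 + u ^ 2 / 4) <= (u * (1 + u ^ 2 / 8)) ^ 2) by (assert (0 <= u ^ 2 * u ^ 4) by (apply Rmult_le_pos; apply pow_le; lra); nra).
    assert (9 / 4 * t ^ 2 <= u ^ 2) by nra.
    assert (9 / 4 * t ^ 2 * (1 + 9 / 16 * t ^ 2) <= u ^ 2 * (1 + u ^ 2 / 4)) by (apply Rmult_le_compat; nra).
    assert (0 <= t ^ 2 * t ^ 2) by nra. nra. }
  replace ((2 * sinh u * cosh u) ^ 2) with (4 * sinh u ^ 2 * cosh u ^ 2) by ring. rewrite H0.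
  assert (1 + 2 * sinh u ^ 2 <= 2 * (1 + sinh u ^ 2)) by lra.
  replace (4 * sinh u ^ 2 * (1 + sinh u ^ 2)) with ((2 * sinh u ^ 2) * (2 * (1 + sinh u ^ 2))) by ring.
  apply Rmult_le_compat; nra. }
destruct (Rle_dec 0 t) as [h|h]; [now apply Q|].
specialize (Q (- t) ltac:(lra)). replace (PI * - t) with (- (PI * t)) in Q by ring.
rewrite sinh_opp, cosh_opp in Q. replace ((- t) ^ 2) with (t ^ 2) in Q by ring.
replace ((- sinh (PI * t)) ^ 2) with (sinh (PI * t) ^ 2) in Q by ring. exact Q.
Qed.

Lemma csch_line_bound (t y s : R) : 0 < s <= 1 -> s <= Rabs (sin (PI * y)) ->
  Cmod (csch (PI * (t, y))%C) <= (2 / s) / (1 + t ^ 2).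
Proof.
intros hs hy.
assert (E : (PI * (t, y))%C = (PI * t, PI * y)) by (unfold Cmult, RtoC; simpl; f_equal; ring).
assert (s0 : sin (PI * y) <> 0) by (intros e; rewrite e, Rabs_R0 in hy; lra).
assert (n0 : Csinh (PI * (t, y))%C <> 0%C) by (apply Csinh_neq_0_Im; now rewrite Im_PI_mult).
unfold csch. rewrite Cmod_inv by easy.
replace (2 / s / (1 + t ^ 2)) with (/ (s / 2 * (1 + t ^ 2))) by (field; nra).
apply Rinv_le_contravar; [nra|].
apply Rsqr_incr_0; [|nra|apply Cmod_ge_0]. rewrite !Rsqr_pow2, E, Cmod_Csinh_sqr.
assert (s2 : s ^ 2 <= sin (PI * y) ^ 2).
{ replace (sin (PI * y) ^ 2) with (Rabs (sin (PI * y)) ^ 2) by (apply pow2_abs).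
  apply pow_incr; lra. }
assert (t2 : t ^ 2 * (1 + t ^ 2) ^ 2 <= sinh (PI * t) ^ 2).
{ replace (sinh (PI * t) ^ 2) with (Rabs (sinh (PI * t)) ^ 2) by (apply pow2_abs).
  replace (t ^ 2 * (1 + t ^ 2) ^ 2) with ((Rabs t * (1 + t ^ 2)) ^ 2)
    by (rewrite Rpow_mult_distr, pow2_abs; reflexivity).
  apply pow_incr. split; [apply Rmult_le_pos; [apply Rabs_pos|nra]|apply sinh_PI_ge]. }
assert (u1 : 1 <= (1 + t ^ 2) ^ 2) by nra.
replace ((s / 2 * (1 + t ^ 2)) ^ 2) with (s ^ 2 / 4 * (1 + t ^ 2) ^ 2) by field.
assert (s1 : s ^ 2 <= 1) by nra.
(* For [|t| >= 1] the term in sinh carries the bound; otherwise [(1 + t ^ 2) ^ 2 <= 4] and the term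
   in sin does, hence the constant 2. *)
destruct (Rle_dec 1 (t ^ 2)) as [h|h].
- assert (s ^ 2 / 4 * (1 + t ^ 2) ^ 2 <= t ^ 2 * (1 + t ^ 2) ^ 2) by (apply Rmult_le_compat_r; lra).
  pose proof (pow2_ge_0 (sin (PI * y))). lra.
- assert ((1 + t ^ 2) ^ 2 <= 4) by (pose proof (pow2_ge_0 t); nra).
  pose proof (pow2_ge_0 (sinh (PI * t))). nra.
Qed.

Definition kern (b : R) (x : C) : C := (wave b x * csch (PI * x))%C.

Lemma exp_wave_le (b y : R) : Rabs y <= 1 -> exp (- (2 * PI * b * y)) <= exp (2 * PI * Rabs b).
Proof.
intros hy. apply exp_le. pose proof PI_RGT_0.
assert (- (b * y) <= Rabs b).
{ eapply Rle_trans; [apply Rle_abs|]. rewrite Rabs_Ropp, Rabs_mult. pose proof (Rabs_pos b). pose proof (Rabs_pos y). nra. }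
nra.
Qed.

Lemma kern_bound (b t y s : R) : Rabs y <= 1 -> 0 < s <= 1 -> s <= Rabs (sin (PI * y)) ->
  Cmod (kern b (t, y)) <= exp (2 * PI * Rabs b) * (2 / s) / (1 + t ^ 2).
Proof.
intros hy hs h. unfold kern. rewrite Cmod_mult, Cmod_wave.
replace (exp (2 * PI * Rabs b) * (2 / s) / (1 + t ^ 2)) with (exp (2 * PI * Rabs b) * ((2 / s) / (1 + t ^ 2))) by (unfold Rdiv; ring).
apply Rmult_le_compat; [apply Rlt_le, exp_pos|apply Cmod_ge_0|now apply exp_wave_le|].
now apply csch_line_bound.
Qed.

Lemma kern_der (b : R) : exists h1, forall z, 0 < Im z < 1 -> Cder (kern b) z (h1 z) /\ Ccont h1 z.
Proof. eexists. intros z hz. exact (csch_wave_der b z hz). Qed.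

Lemma kern_exists (b : R) : exists V, forall y, 0 < y < 1 -> intR (fun t => kern b (t, y)) V.
Proof.
pose proof PI_RGT_0 as hpi. destruct (kern_der b) as [h1 H].
destruct (intR_exists (fun t => kern b (t, / 2)) (exp (2 * PI * Rabs b) * (2 / 1))) as [V HV].
- apply isI_of_Ccont. intros t. apply Cder_cont with (h1 (t, / 2)). apply H. simpl. lra.
- intros t. apply kern_bound; [rewrite Rabs_pos_eq; lra|lra|].
  replace (PI * / 2) with (PI / 2) by field. rewrite sin_PI2, Rabs_pos_eq; lra.
- exists V. intros y hy.
  assert (sy : forall u, 0 < u < 1 -> 0 < sin (PI * u)) by (intros; apply sin_gt_0; nra).
  (* Between 1/2 and [y], the sine of [PI * u] is smallest at [u = y], so one bound serves all the
     lines crossed. *)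
  set (s := sin (PI * y)). assert (hs : 0 < s) by (now apply sy).
  apply (strip_shift (kern b) h1 0 1 (/ 2) y (exp (2 * PI * Rabs b) * (2 / s))); [lra|easy|exact H| |exact HV].
  intros t u hu. assert (hu1 : 0 < u < 1).
  { destruct hu as [h2 h3]. split.
    - eapply Rlt_le_trans; [|exact h2]. apply Rmin_pos; lra.
    - eapply Rle_lt_trans; [exact h3|]. apply Rmax_lub_lt; lra. }
  apply kern_bound; [rewrite Rabs_pos_eq; lra|split; [easy|unfold s; apply SIN_bound]|].
  rewrite Rabs_pos_eq by (apply Rlt_le, sy; lra). unfold s.
  destruct (Rle_dec y (/ 2)) as [h|h].
  + rewrite Rmin_right, Rmax_left in hu by lra. apply sin_incr_1; nra.
  + rewrite Rmin_left, Rmax_right in hu by lra. apply sin_decr_1; nra.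
Qed.

(** This symmetry makes the transform purely imaginary. *)
Lemma kern_conj (b t y : R) : 0 < y < 1 -> kern b (- t, y) = (- Cconj (kern b (t, y)))%C.
Proof.
intros hy. unfold kern. rewrite Cmult_conj.
assert (W : wave b (- t, y) = Cconj (wave b (t, y))).
{ unfold wave, Cexp, Cconj; simpl.
  match goal with |- (exp ?p * cos ?q, _) = (exp ?r * cos ?s, _) => replace p with r by ring; replace q with (- s) by ring end.
  rewrite cos_neg, sin_neg. f_equal; ring. }
assert (n0 : Csinh (PI * (t, y))%C <> 0%C) by (now apply Csinh_PI_neq_0).
assert (S : csch (PI * ((- t)%R, y))%C = (- Cconj (csch (PI * (t, y))))%C).
{ unfold csch. rewrite Cinv_conj, Cconj_Csinh by easy.
  replace (PI * ((- t)%R, y))%C with (- Cconj (PI * (t, y)))%C by (unfold Cconj, Copp, Cmult, RtoC; simpl; f_equal; ring).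
  rewrite Csinh_opp. field. rewrite <- Cconj_Csinh. intros E. apply n0.
  rewrite <- (Cconj_conj (Csinh _)), E. apply Cconj_RtoC. }
rewrite W, S. ring.
Qed.

(** The reflection of [x] into [Ci - x] preserves the line Im = 1/2 and [csch (PI * x)]; it links
    the transforms at [b] and [- b]. *)
Lemma kern_reflect (b t : R) : kern b (t, / 2) = (exp (- (2 * PI * b)) * kern (- b) ((- t)%R, (/ 2)%R))%C.
Proof.
set (x := (- t, / 2) : C).
assert (E : (t, / 2) = (Ci + - x)%C) by (unfold x, Ci, Cplus, Copp; simpl; f_equal; field).
assert (n0 : Csinh (PI * x)%C <> 0%C) by (apply Csinh_PI_neq_0; simpl; lra).
rewrite E. unfold kern. rewrite wave_plus.
assert (W1 : wave b Ci = exp (- (2 * PI * b))).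
{ rewrite <- Cexp_RtoC. unfold wave. f_equal. transitivity (2 * PI * b * (Ci * Ci))%C; [ring|].
  rewrite Ci_sqr, RtoC_opp, !RtoC_mult. ring. }
assert (W2 : wave b (- x) = wave (- b) x) by (unfold wave; f_equal; rewrite RtoC_opp; ring).
assert (S : csch (PI * (Ci + - x))%C = csch (PI * x)%C).
{ replace (PI * (Ci + - x))%C with (- (PI * x) + Ci * PI)%C by ring.
  rewrite csch_shift2, csch_opp; [ring|easy|]. rewrite Csinh_opp. intros e; now apply n0, Copp_0_inv. }
rewrite W1, W2, S. ring.
Qed.

Lemma abs_sin_le (x : R) : Rabs (sin x) <= Rabs x.
Proof.
assert (Q : forall x, 0 <= x -> Rabs (sin x) <= x).
{ clear x; intros x hx. destruct (Req_dec x 0) as [->|ne]; [rewrite sin_0, Rabs_R0; lra|].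
  pose proof (sin_lt_x x ltac:(lra)). destruct (Rle_dec x 1) as [h|h].
  - pose proof PI_gt_3. rewrite Rabs_pos_eq; [lra|]. apply sin_ge_0; lra.
  - pose proof (SIN_bound x). apply Rabs_le. lra. }
destruct (Rle_dec 0 x) as [h|h]; [rewrite (Rabs_pos_eq x) by lra; now apply Q|].
rewrite <- (Rabs_Ropp x), <- (Rabs_Ropp (sin x)), <- sin_neg, (Rabs_pos_eq (- x)) by lra. apply Q; lra.
Qed.

Lemma one_minus_cos_le (x : R) : 0 <= 1 - cos x <= x ^ 2 / 2.
Proof.
pose proof (COS_bound x). split; [lra|]. replace x with (2 * (x / 2)) at 1 by field. rewrite cos_2a_sin.
pose proof (abs_sin_le (x / 2)) as h.
assert (sin (x / 2) ^ 2 <= (x / 2) ^ 2).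
{ rewrite <- (pow2_abs (sin (x / 2))), <- (pow2_abs (x / 2)). apply pow_incr. split; [apply Rabs_pos|easy]. }
nra.
Qed.

Lemma cosh_ge_1 (x : R) : 1 <= cosh x.
Proof. pose proof (cosh2_sinh2 x). pose proof (cosh_pos x). nra. Qed.

Lemma sinh_nonneg (x : R) : 0 <= x -> 0 <= sinh x.
Proof. intros h. pose proof (sinh_ge_id x h). lra. Qed.

Lemma kern_even_Im (b t d : R) : 0 < d < 1 ->
  let B := 2 * PI * b in let S := sinh (PI * t) ^ 2 + sin (PI * d) ^ 2 in
  0 < S /\
  snd (/ 2 * (kern b (t, d) + kern (- b) (t, d)))%C =
  (- (cos (B * t) * cosh (B * d) * (cosh (PI * t) * sin (PI * d)))
   - sin (B * t) * sinh (B * d) * (sinh (PI * t) * cos (PI * d))) / S.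
Proof.
intros hd B S. pose proof PI_RGT_0.
assert (hs : 0 < sin (PI * d)) by (apply sin_gt_0; nra).
assert (S0 : 0 < S) by (unfold S; assert (0 < sin (PI * d) ^ 2) by (now apply pow_lt); pose proof (pow2_ge_0 (sinh (PI * t))); lra).
split; [exact S0|].
assert (W : forall c, wave c (t, d) = (exp (- (2 * PI * c * d)) * cos (2 * PI * c * t), exp (- (2 * PI * c * d)) * sin (2 * PI * c * t))).
{ intros c. unfold wave, Cexp; simpl. f_equal; f_equal; f_equal; ring. }
assert (ES : csch (PI * (t, d))%C = (sinh (PI * t) * cos (PI * d) / S, - (cosh (PI * t) * sin (PI * d)) / S)).
{ unfold csch. replace (PI * (t, d))%C with (PI * t, PI * d) by (unfold Cmult, RtoC; simpl; f_equal; ring).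
  rewrite Csinh_pair. unfold Cinv; simpl.
  assert (E : sinh (PI * t) * cos (PI * d) * (sinh (PI * t) * cos (PI * d) * 1) +
     cosh (PI * t) * sin (PI * d) * (cosh (PI * t) * sin (PI * d) * 1) = S).
  { unfold S. pose proof (cosh2_sinh2 (PI * t)). pose proof (sin2_cos2 (PI * d)) as h. unfold Rsqr in h.
    replace (sinh (PI * t) * cos (PI * d) * (sinh (PI * t) * cos (PI * d) * 1) +
     cosh (PI * t) * sin (PI * d) * (cosh (PI * t) * sin (PI * d) * 1)) with
     (sinh (PI * t) ^ 2 * (cos (PI * d) * cos (PI * d)) + cosh (PI * t) ^ 2 * (sin (PI * d) * sin (PI * d))) by ring.
    rewrite H0. replace (cos (PI * d) * cos (PI * d)) with (1 - sin (PI * d) * sin (PI * d)) by lra. ring. }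
  rewrite E. reflexivity. }
unfold kern. rewrite !W, ES.
replace (2 * PI * - b * d) with (- (B * d)) by (unfold B; ring).
replace (2 * PI * - b * t) with (- (B * t)) by (unfold B; ring).
fold B. rewrite cos_neg, sin_neg, Ropp_involutive.
change (cosh (B * d)) with ((exp (B * d) + exp (- (B * d))) / 2).
change (sinh (B * d)) with ((exp (B * d) - exp (- (B * d))) / 2).
clearbody S B.
unfold Cmult, Cplus, Cinv, RtoC; simpl. field. lra.
Qed.

(* As the line approaches the real axis, the even part in [b] concentrates like the
   Poisson-type kernel of the case [b = 0], whose primitive is an arctangent. *)
Lemma kern_even_close (b t d : R) : 0 < d < 1 / 2 ->
  let B := 2 * PI * b in let S := sinh (PI * t) ^ 2 + sin (PI * d) ^ 2 in
  let q := cosh (PI * t) * sin (PI * d) / S in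
  Rabs (snd (/ 2 * (kern b (t, d) + kern (- b) (t, d)))%C + q) <=
  (cosh (B * d) - 1) * q + (B ^ 2 / 2 * sin (PI * d) + Rabs B * sinh (Rabs B * d)) / (1 + t ^ 2).
Proof.
intros hd B S q. pose proof PI_RGT_0.
destruct (kern_even_Im b t d ltac:(lra)) as [S0 E]. fold B S in S0, E. rewrite E.
assert (hs : 0 < sin (PI * d)) by (apply sin_gt_0; nra).
pose proof (cosh_pos (PI * t)) as hc.
set (s := sin (PI * d)) in *. set (sh := sinh (PI * t)) in *. set (ch := cosh (PI * t)) in *.
assert (T0 : 0 < 1 + t ^ 2) by nra.
assert (I1 : t ^ 2 * (1 + t ^ 2) * ch <= S).
{ unfold S. pose proof (cosh_PI_le t). fold sh ch in H0. pose proof (pow2_ge_0 s). lra. }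
assert (I2 : Rabs t * (1 + t ^ 2) * Rabs sh <= S).
{ pose proof (sinh_PI_ge t). fold sh in H0. unfold S. pose proof (pow2_ge_0 s).
  assert (Rabs t * (1 + t ^ 2) * Rabs sh <= Rabs sh * Rabs sh) by (apply Rmult_le_compat_r; [apply Rabs_pos|easy]).
  rewrite <- (pow2_abs sh). nra. }
(* The second term keeps the singular kernel [q], but with the factor [cosh (B * d) - 1], which
   vanishes with [d]. The other two contain [1 - cos (B * t)] or [sin (B * t)], whose powers of [t]
   absorb the singularity of [1 / S] through [I1] and [I2]. *)
replace ((- (cos (B * t) * cosh (B * d) * (ch * s)) - sin (B * t) * sinh (B * d) * (sh * cos (PI * d))) / S + q)
 with ((1 - cos (B * t)) * (ch * s / S) - cos (B * t) * ((cosh (B * d) - 1) * q)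
   + - (sin (B * t) * sinh (B * d) * (sh * cos (PI * d)) / S)) by (unfold q; field; lra).
assert (hq : 0 < q) by (unfold q; apply Rdiv_lt_0_compat; [now apply Rmult_lt_0_compat|easy]).
pose proof (cosh_ge_1 (B * d)) as c1.
assert (B1 : Rabs ((1 - cos (B * t)) * (ch * s / S)) <= B ^ 2 / 2 * s / (1 + t ^ 2)).
{ destruct (one_minus_cos_le (B * t)) as [h1 h2]. rewrite Rabs_pos_eq by (apply Rmult_le_pos; [lra|now apply Rlt_le]).
  apply Rle_trans with ((B * t) ^ 2 / 2 * (ch * s / S)); [apply Rmult_le_compat_r; [now apply Rlt_le|easy]|].
  apply (Rmult_le_reg_r (S * (1 + t ^ 2))); [now apply Rmult_lt_0_compat|].
  replace ((B * t) ^ 2 / 2 * (ch * s / S) * (S * (1 + t ^ 2))) with (B ^ 2 / 2 * s * (t ^ 2 * (1 + t ^ 2) * ch)) by (field; lra).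
  replace (B ^ 2 / 2 * s / (1 + t ^ 2) * (S * (1 + t ^ 2))) with (B ^ 2 / 2 * s * S) by (field; lra).
  apply Rmult_le_compat_l; [|easy]. pose proof (pow2_ge_0 B). nra. }
assert (B2 : Rabs (cos (B * t) * ((cosh (B * d) - 1) * q)) <= (cosh (B * d) - 1) * q).
{ assert (0 <= (cosh (B * d) - 1) * q) by (apply Rmult_le_pos; lra).
  rewrite Rabs_mult, (Rabs_pos_eq ((cosh (B * d) - 1) * q)) by easy.
  pose proof (COS_bound (B * t)). assert (Rabs (cos (B * t)) <= 1) by (apply Rabs_le; lra).
  pose proof (Rabs_pos (cos (B * t))). nra. }
assert (B3 : Rabs (- (sin (B * t) * sinh (B * d) * (sh * cos (PI * d)) / S)) <= Rabs B * sinh (Rabs B * d) / (1 + t ^ 2)).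
{ rewrite Rabs_Ropp. unfold Rdiv. rewrite !Rabs_mult, (Rabs_pos_eq (/ S)) by (apply Rlt_le, Rinv_0_lt_compat; easy).
  assert (E1 : Rabs (sinh (B * d)) = sinh (Rabs B * d)).
  { destruct (Rle_dec 0 B) as [h|h].
    - rewrite (Rabs_pos_eq B) by easy. apply Rabs_pos_eq, sinh_nonneg. nra.
    - rewrite (Rabs_left B) by lra. replace (- B * d) with (- (B * d)) by ring. rewrite sinh_opp.
      rewrite <- Rabs_Ropp, <- sinh_opp. apply Rabs_pos_eq, sinh_nonneg. nra. }
  rewrite E1. pose proof (abs_sin_le (B * t)) as hsn. rewrite Rabs_mult in hsn.
  pose proof (COS_bound (PI * d)). assert (hcs : Rabs (cos (PI * d)) <= 1) by (apply Rabs_le; lra).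
  assert (sp : 0 <= sinh (Rabs B * d)) by (apply sinh_nonneg, Rmult_le_pos; [apply Rabs_pos|lra]).
  pose proof (Rabs_pos B). pose proof (Rabs_pos t). pose proof (Rabs_pos sh). pose proof (Rabs_pos (sin (B * t))).
  pose proof (Rabs_pos (cos (PI * d))).
  apply Rle_trans with (Rabs B * Rabs t * sinh (Rabs B * d) * (Rabs sh * 1) * / S).
  - apply Rmult_le_compat_r; [apply Rlt_le, Rinv_0_lt_compat; easy|].
    apply Rmult_le_compat; [now apply Rmult_le_pos|now apply Rmult_le_pos| |].
    + now apply Rmult_le_compat_r.
    + now apply Rmult_le_compat_l.
  - apply (Rmult_le_reg_r (S * (1 + t ^ 2))); [now apply Rmult_lt_0_compat|].
    replace (Rabs B * Rabs t * sinh (Rabs B * d) * (Rabs sh * 1) * / S * (S * (1 + t ^ 2))) with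
      (Rabs B * sinh (Rabs B * d) * (Rabs t * (1 + t ^ 2) * Rabs sh)) by (field; lra).
    replace (Rabs B * sinh (Rabs B * d) * / (1 + t ^ 2) * (S * (1 + t ^ 2))) with (Rabs B * sinh (Rabs B * d) * S) by (field; lra).
    apply Rmult_le_compat_l; [now apply Rmult_le_pos|easy]. }
eapply Rle_trans; [apply Rabs_triang|]. unfold Rminus at 1.
eapply Rle_trans; [apply Rplus_le_compat_r, Rabs_triang|]. rewrite Rabs_Ropp.
replace ((B ^ 2 / 2 * s + Rabs B * sinh (Rabs B * d)) / (1 + t ^ 2)) with
 (B ^ 2 / 2 * s / (1 + t ^ 2) + Rabs B * sinh (Rabs B * d) / (1 + t ^ 2)) by (field; lra). lra.
Qed.

Lemma is_RInt_poisson (d a b : R) : 0 < d < 1 / 2 ->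
  is_RInt (fun t => cosh (PI * t) * sin (PI * d) / (sinh (PI * t) ^ 2 + sin (PI * d) ^ 2)) a b
    (atan (sinh (PI * b) / sin (PI * d)) / PI - atan (sinh (PI * a) / sin (PI * d)) / PI).
Proof.
intros hd. pose proof PI_RGT_0. assert (hs : 0 < sin (PI * d)) by (apply sin_gt_0; nra).
set (s := sin (PI * d)) in *.
assert (S0 : forall t, 0 < sinh (PI * t) ^ 2 + s ^ 2).
{ intros t. assert (0 < s ^ 2) by (now apply pow_lt). pose proof (pow2_ge_0 (sinh (PI * t))). lra. }
assert (Dsh : forall t, is_derive (fun t => sinh (PI * t)) t (PI * cosh (PI * t))).
{ intros t. unfold sinh, cosh. auto_derive; [easy|]. field. }
assert (Dch : forall t, is_derive (fun t => cosh (PI * t)) t (PI * sinh (PI * t))).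
{ intros t. unfold sinh, cosh. auto_derive; [easy|]. field. }
apply (is_RInt_derive (V := R_CompleteNormedModule) (fun t => atan (sinh (PI * t) / s) / PI)).
- intros t _. specialize (S0 t).
  assert (D1 : is_derive (fun t => sinh (PI * t) / s) t (PI * cosh (PI * t) / s)).
  { apply (is_derive_ext (fun t => / s * sinh (PI * t))); [intros u; apply Rmult_comm|].
    evar_last; [apply is_derive_scal, Dsh|]. apply Rmult_comm. }
  apply (is_derive_ext (fun t => / PI * atan (sinh (PI * t) / s))); [intros u; apply Rmult_comm|].
  evar_last; [apply is_derive_scal, (is_derive_comp atan (fun t => sinh (PI * t) / s)); [|exact D1]|].
  + apply is_derive_Reals, derivable_pt_lim_atan.
  + unfold scal; simpl; unfold mult; simpl. simpl in S0. field. repeat split; lra.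
- intros t _. specialize (S0 t).
  apply (continuous_mult (K := R_AbsRing) (fun t => cosh (PI * t) * s) (fun t => / (sinh (PI * t) ^ 2 + s ^ 2))).
  + apply (continuous_mult (K := R_AbsRing) (fun t => cosh (PI * t)) (fun _ => s)); [|apply continuous_const].
    exact (is_derive_continuous _ _ _ (Dch t)).
  + apply (ex_derive_continuous (V := R_NormedModule) (fun t => / (sinh (PI * t) ^ 2 + s ^ 2))).
    auto_derive. simpl in S0. lra.
Qed.

(** [A] is the same at all heights, so the estimate of [kern_even_close] may be used at arbitrarily
    small [d]. The kernel [q] has total mass 1, whence - 1, and the error [om d] is continuous and
    vanishes at [d = 0]. *)
Lemma kern_even_value (b : R) (A : C) : (forall y, 0 < y < 1 ->
  intR (fun t => / 2 * (kern b (t, y) + kern (- b) (t, y)))%C A) -> snd A = - 1.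
Proof.
intros H. pose proof PI_RGT_0 as hpi. set (B := 2 * PI * b).
set (om := fun d => (cosh (B * d) - 1) + PI * (B ^ 2 / 2 * sin (PI * d) + Rabs B * sinh (Rabs B * d))).
assert (Key : forall d, 0 < d < 1 / 2 -> Rabs (snd A + 1) <= om d).
{ intros d hd. apply Rnot_lt_le. intros hlt. set (eps := (Rabs (snd A + 1) - om d) / 4).
  assert (he : 0 < eps) by (unfold eps; lra).
  assert (hs : 0 < sin (PI * d)) by (apply sin_gt_0; nra).
  destruct (proj1 (intR_iff _ _) (H d ltac:(lra)) eps he) as [T HT].
  destruct (atan_tail eps he) as [T2 [hT2 HT2]].
  set (X := Rabs T + T2 + 1). pose proof (Rabs_pos T). pose proof (Rle_abs T).
  destruct (HT (- X) X ltac:(unfold X; lra) ltac:(unfold X; lra)) as [I [I1 I2]].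
  pose proof (is_RInt_fct_extend_snd _ _ _ _ I1) as J1.
  pose proof (is_RInt_poisson d (- X) X hd) as J2.
  set (g := atan (sinh (PI * X) / sin (PI * d)) / PI - atan (sinh (PI * - X) / sin (PI * d)) / PI) in J2.
  assert (hX : T2 < X) by (unfold X; lra).
  assert (hg : 1 - eps <= g <= 1).
  { unfold g. replace (PI * - X) with (- (PI * X)) by ring. rewrite sinh_opp.
    replace (- sinh (PI * X) / sin (PI * d)) with (- (sinh (PI * X) / sin (PI * d))) by (field; lra). rewrite atan_opp.
    assert (X <= sinh (PI * X) / sin (PI * d)).
    { apply (Rmult_le_reg_r (sin (PI * d))); [easy|]. unfold Rdiv. rewrite Rmult_assoc, Rinv_l, Rmult_1_r by lra.
      pose proof (SIN_bound (PI * d)). pose proof (sinh_ge_id (PI * X) ltac:(nra)). pose proof PI_gt_3. nra. }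
    pose proof (HT2 _ hX) as h1.
    assert (h2 : atan X <= atan (sinh (PI * X) / sin (PI * d))).
    { destruct (Req_dec X (sinh (PI * X) / sin (PI * d))) as [<-|ne]; [lra|]. left; apply atan_increasing; lra. }
    pose proof (atan_bound (sinh (PI * X) / sin (PI * d))) as h3.
    set (v := atan (sinh (PI * X) / sin (PI * d))) in *. pose proof PI_gt_3.
    replace (v / PI - - v / PI) with (2 * v / PI) by (field; lra).
    split.
    - apply (Rmult_le_reg_r PI); [easy|]. replace (2 * v / PI * PI) with (2 * v) by (field; lra). nra.
    - apply (Rmult_le_reg_r PI); [easy|]. replace (2 * v / PI * PI) with (2 * v) by (field; lra). lra. }
  pose proof (is_RInt_plus _ _ _ _ _ _ J1 J2) as J3.
  pose proof (is_RInt_plus _ _ _ _ _ _ (is_RInt_scal _ _ _ (cosh (B * d) - 1) _ J2)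
    (is_RInt_bell (B ^ 2 / 2 * sin (PI * d) + Rabs B * sinh (Rabs B * d)) (- X) X)) as J4.
  assert (hXX : - X <= X) by (unfold X; lra).
  assert (L := norm_RInt_le (V := R_NormedModule) _ _ _ _ _ _ hXX
    (fun t _ => kern_even_close b t d hd) J3 J4).
  unfold norm, plus, scal in L; simpl in L. unfold abs, mult in L; simpl in L.
  pose proof (cosh_ge_1 (B * d)).
  set (K := B * (B * 1) / 2 * sin (PI * d) + Rabs B * sinh (Rabs B * d)) in *.
  assert (hK : 0 <= K).
  { unfold K. assert (0 <= sinh (Rabs B * d)) by (apply sinh_nonneg, Rmult_le_pos; [apply Rabs_pos|lra]).
    pose proof (Rabs_pos B). assert (0 <= B * (B * 1) / 2) by nra.
    assert (0 <= Rabs B * sinh (Rabs B * d)) by (now apply Rmult_le_pos).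
    assert (0 <= B * (B * 1) / 2 * sin (PI * d)) by (apply Rmult_le_pos; lra). lra. }
  assert (L2 : (cosh (B * d) - 1) * g + K * (atan X - atan (- X)) <= om d).
  { unfold om. replace (PI * (B ^ 2 / 2 * sin (PI * d) + Rabs B * sinh (Rabs B * d))) with (K * PI) by (change K with (B ^ 2 / 2 * sin (PI * d) + Rabs B * sinh (Rabs B * d)); ring).
    apply Rplus_le_compat; [rewrite <- (Rmult_1_r (cosh (B * d) - 1)) at 2; apply Rmult_le_compat_l; lra|].
    apply Rmult_le_compat_l; [easy|]. rewrite atan_opp. pose proof (atan_bound X). lra. }
  assert (L3 : Rabs (snd I - snd A) < eps) by (eapply Rle_lt_trans; [exact (Rabs_snd_le (I - A)%C)|exact I2]).
  assert (Rabs (snd A + 1) <= Rabs (snd I + g) + Rabs (snd I - snd A) + eps).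
  { replace (snd A + 1) with ((snd I + g) + (- (snd I - snd A) + (1 - g))) by ring.
    eapply Rle_trans; [apply Rabs_triang|].
    assert (Rabs (- (snd I - snd A) + (1 - g)) <= Rabs (snd I - snd A) + eps); [|lra].
    eapply Rle_trans; [apply Rabs_triang|]. rewrite Rabs_Ropp, (Rabs_pos_eq (1 - g)); lra. }
  assert (Rabs (snd I + g) <= om d) by (eapply Rle_trans; [exact L|exact L2]).
  unfold eps in *. lra. }
assert (Com : continuity_pt om 0).
{ apply continuity_pt_filterlim, (ex_derive_continuous (V := R_NormedModule) om). unfold om, cosh, sinh. auto_derive. easy. }
assert (om0 : om 0 = 0).
{ unfold om. rewrite !Rmult_0_r, cosh_0, sin_0, sinh_0. ring. }
destruct (Req_dec (snd A) (- 1)) as [e|e]; [exact e|exfalso].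
assert (hp : 0 < Rabs (snd A + 1)) by (apply Rabs_pos_lt; lra).
destruct (Com (Rabs (snd A + 1)) hp) as [d [hd Hd]]. simpl in Hd. unfold R_dist in Hd.
set (u := Rmin (d / 2) (/ 4)). assert (hu : 0 < u) by (apply Rmin_pos; lra).
pose proof (Rmin_l (d / 2) (/ 4)). pose proof (Rmin_r (d / 2) (/ 4)). fold u in H0, H1.
specialize (Hd u). rewrite om0, !Rminus_0_r in Hd.
assert (Rabs (om u) < Rabs (snd A + 1)).
{ apply Hd. split; [split; [exact I|lra]|]. rewrite Rabs_pos_eq; lra. }
pose proof (Key u ltac:(lra)). pose proof (Rle_abs (om u)). lra.
Qed.

(** The transforms [V] at [b] and [W] at [- b] solve a linear system: both are imaginary, [V] is
    [exp (- (2 * PI * b))] times [W], and their mean has imaginary part - 1. *)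
Theorem FT_csch_upper (b y : R) : 0 < y < 1 ->
  intR (fun t => kern b (t, y)) (- 2 * Ci / (1 + exp (2 * PI * b)))%C.
Proof.
intros hy. destruct (kern_exists b) as [V HV]. destruct (kern_exists (- b)) as [W HW].
assert (CV : forall c U, (forall y, 0 < y < 1 -> intR (fun t => kern c (t, y)) U) -> fst U = 0).
{ intros c U HU. assert (E : U = (- Cconj U)%C).
  { apply (intR_unique (fun t => kern c (t, / 2))); [apply HU; lra|].
    apply (intR_ext (fun t => - 1 * Cconj (kern c ((- t)%R, (/ 2)%R)))%C).
    - intros t. rewrite kern_conj by lra. rewrite Copp_conj, Cconj_conj. ring.
    - replace (- Cconj U)%C with (- 1 * Cconj U)%C by ring. apply intR_scal.
      apply (intR_refl (fun t => Cconj (kern c (t, / 2)))), intR_conj, HU. lra. }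
  destruct U as [u1 u2]. unfold Cconj, Copp in E; simpl in E. injection E. simpl. lra. }
assert (E1 : V = (exp (- (2 * PI * b)) * W)%C).
{ apply (intR_unique (fun t => kern b (t, / 2))); [apply HV; lra|].
  apply (intR_ext (fun t => exp (- (2 * PI * b)) * kern (- b) ((- t)%R, (/ 2)%R))%C).
  - intros t. symmetry. apply kern_reflect.
  - apply intR_scal, (intR_refl (fun t => kern (- b) (t, / 2))), HW. lra. }
assert (E2 : snd (/ 2 * (V + W))%C = - 1).
{ apply (kern_even_value b). intros u hu. apply intR_scal, intR_plus; [now apply HV|now apply HW]. }
pose proof (CV b V HV) as V1. pose proof (CV (- b) W HW) as W1.
replace (- 2 * Ci / (1 + exp (2 * PI * b)))%C with V; [now apply HV|].
rewrite exp_Ropp in E1. pose proof (exp_pos (2 * PI * b)) as hp. set (p := exp (2 * PI * b)) in *.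
rewrite E1 in E2 |- *. destruct W as [w1 w2]. simpl in W1, E2. subst w1.
assert (w : w2 = - 2 * p / (1 + p)).
{ field_simplify in E2; [|lra]. apply (Rmult_eq_reg_r (1 + p)); [|lra].
  replace (- 2 * p / (1 + p) * (1 + p)) with (- 2 * p) by (field; lra).
  apply (Rmult_eq_reg_r (/ (2 * p))); [|apply Rinv_neq_0_compat; lra].
  transitivity (- (1)); [|field; lra]. rewrite <- E2. field. lra. }
rewrite <- RtoC_plus.
assert (n : RtoC (1 + p) <> 0%C) by (apply RtoC_neq_0; lra).
apply (Cmult_eq_compat_cancel _ _ _ n). transitivity (- 2 * Ci)%C; [|field; exact n].
unfold Cmult, RtoC, Ci; simpl. rewrite w. f_equal; field; lra.
Qed.

(** * Transforms of trigonometric series *)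

(** Besides the transform at every frequency, it records what the domination and the continuity
    along the line Im = [e] require of the kernel. *)
Definition kernel (kappa : C -> C) (e : R) (phi : R -> C) : Prop :=
  (forall b, intR (fun t => wave b (t, e) * kappa (t, e))%C (phi b)) /\
  (exists M, forall t, Cmod (kappa (t, e)) <= M / (1 + t ^ 2)) /\
  (forall t, Ccont kappa (t, e)).

Lemma tanh_exp (x : R) : tanh x = 1 - 2 / (1 + exp (2 * x)).
Proof.
unfold tanh, sinh, cosh. replace (2 * x) with (x + x) by ring. rewrite exp_plus, exp_Ropp.
pose proof (exp_pos x). field. nra.
Qed.

Lemma tanh_opp (x : R) : tanh (- x) = - tanh x.
Proof. unfold tanh. rewrite sinh_opp, cosh_opp. pose proof (cosh_pos x). field. lra. Qed.

Lemma csch_kernel_regular (e : R) : sin (PI * e) <> 0 ->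
  (exists M, forall t, Cmod (csch (PI * (t, e))%C) <= M / (1 + t ^ 2)) /\
  (forall t, Ccont (fun x => csch (PI * x)%C) (t, e)).
Proof.
intros h. split.
- exists (2 / Rabs (sin (PI * e))). intros t. apply csch_line_bound; [split|lra].
  + now apply Rabs_pos_lt.
  + apply Rabs_le, SIN_bound.
- intros t. apply (Ccont_scal_arg csch); [apply CPI_neq_0|]. apply Ccont_csch, Csinh_neq_0_Im.
  rewrite Im_PI_mult. exact h.
Qed.

Lemma kernel_csch_upper (e : R) : 0 < e < 1 ->
  kernel (fun x => csch (PI * x)%C) e (fun b => Ci * (tanh (PI * b) - 1))%C.
Proof.
intros he. pose proof PI_RGT_0. split.
- intros b. rewrite tanh_exp. replace (2 * (PI * b)) with (2 * PI * b) by ring.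
  pose proof (FT_csch_upper b e he) as F. unfold kern in F.
  replace (Ci * (RtoC (1 - 2 / (1 + exp (2 * PI * b))) - 1))%C with (- 2 * Ci / (1 + exp (2 * PI * b)))%C; [exact F|].
  clear F.
  pose proof (exp_pos (2 * PI * b)) as hp. rewrite <- RtoC_plus.
  assert (n : RtoC (1 + exp (2 * PI * b)) <> 0%C) by (apply RtoC_neq_0; lra).
  rewrite RtoC_minus, RtoC_div by lra. field. exact n.
- apply csch_kernel_regular, Rgt_not_eq, sin_gt_0; nra.
Qed.

(** Oddness of csch exchanges the two sides of the pole. The two transforms differ by [2 * Ci], the
    contribution of the residue at 0. *)
Lemma kernel_csch_lower (e : R) : - 1 < e < 0 ->
  kernel (fun x => csch (PI * x)%C) e (fun b => Ci * (tanh (PI * b) + 1))%C.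
Proof.
intros he. pose proof PI_RGT_0.
assert (hs : sin (PI * e) <> 0).
{ replace (PI * e) with (- (PI * - e)) by ring. rewrite sin_neg. apply Rlt_not_eq.
  assert (0 < sin (PI * - e)) by (apply sin_gt_0; nra). lra. }
split; [|now apply csch_kernel_regular].
intros b. destruct (kernel_csch_upper (- e) ltac:(lra)) as [F _]. specialize (F (- b)).
apply intR_refl in F. apply (intR_scal (- 1)%C) in F.
replace (Ci * (tanh (PI * b) + 1))%C with (- 1 * (Ci * (RtoC (tanh (PI * - b)) - 1)))%C.
- eapply intR_ext; [|exact F]. intros t. cbv beta.
  assert (E : ((- t)%R, (- e)%R) = (- (t, e))%C) by reflexivity.
  rewrite E. replace (PI * - (t, e))%C with (- (PI * (t, e)))%C by ring.
  rewrite csch_opp by (apply Csinh_neq_0_Im; now rewrite Im_PI_mult).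
  replace (wave (- b) (- (t, e))) with (wave b (t, e)) by (unfold wave; f_equal; rewrite RtoC_opp; ring). ring.
- replace (PI * - b) with (- (PI * b)) by ring. rewrite tanh_opp, RtoC_opp. ring.
Qed.

Lemma Ccosh_PI_neq_0 (z : C) : - (1 / 2) < Im z < 1 / 2 -> Ccosh (PI * z)%C <> 0%C.
Proof.
intros hz E. pose proof PI_RGT_0.
assert (n : Csinh (PI * z + Ci * (PI / 2))%C <> 0%C).
{ replace (PI * z + Ci * (PI / 2))%C with (PI * (z + (0%R, (/ 2)%R)))%C.
  - apply Csinh_PI_neq_0. simpl. unfold Im in hz. lra.
  - destruct z. unfold Ci, Cplus, Cmult, Cdiv, Cinv, RtoC; simpl. f_equal; field. }
apply n. rewrite Csinh_shift, E. ring.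
Qed.

(** sech at [x] is [Ci] times csch at [x + i / 2], a point above the pole; the wave brings the
    factor [exp (PI * b)]. *)
Lemma kernel_sech (e : R) : - (1 / 2) < e < 1 / 2 ->
  kernel (fun x => / Ccosh (PI * x))%C e (fun b => RtoC (/ cosh (PI * b))).
Proof.
intros he. pose proof PI_RGT_0.
assert (Sh : forall t, (t, e + / 2) = ((t, e) + (0%R, (/ 2)%R))%C) by (intros t; unfold Cplus; simpl; f_equal; ring).
assert (S : forall t, (/ Ccosh (PI * (t, e)))%C = (Ci * csch (PI * (t, (e + / 2)%R)))%C).
{ intros t. pose proof (Ccosh_PI_neq_0 (t, e) he) as n. rewrite Sh.
  replace (PI * ((t, e) + (0%R, (/ 2)%R)))%C with (PI * (t, e) + Ci * (PI / 2))%C.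
  - unfold csch. rewrite Csinh_shift. field. split; [exact n|apply Ci_neq_0].
  - unfold Ci, Cplus, Cmult, Cdiv, Cinv, RtoC; simpl. f_equal; field. }
destruct (kernel_csch_upper (e + / 2) ltac:(lra)) as [F [[M HM] _]]. split; [|split].
- intros b. specialize (F b). apply (intR_scal (Ci * exp (PI * b)))%C in F.
  replace (RtoC (/ cosh (PI * b))) with (Ci * exp (PI * b) * (Ci * (RtoC (tanh (PI * b)) - 1)))%C.
  + eapply intR_ext; [|exact F]. intros t. cbv beta. rewrite S, Sh at 1. rewrite wave_plus.
    replace (wave b (0%R, (/ 2)%R)) with (RtoC (exp (- (PI * b)))).
    * rewrite exp_Ropp. pose proof (exp_pos (PI * b)). rewrite RtoC_inv by lra. field. apply RtoC_neq_0. lra.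
    * unfold wave. rewrite <- Cexp_RtoC. f_equal. unfold Ci, Cmult, RtoC; simpl. f_equal; field.
  + transitivity (RtoC (exp (PI * b) * (1 - tanh (PI * b)))).
    * rewrite RtoC_mult, RtoC_minus. transitivity ((Ci * Ci) * (exp (PI * b) * (tanh (PI * b) - 1)))%C; [ring|].
      rewrite Ci_sqr. ring.
    * f_equal. unfold tanh, sinh, cosh. rewrite exp_Ropp. pose proof (exp_pos (PI * b)). field. repeat split; try lra; try nra.
- exists M. intros t. rewrite S, Cmod_mult, Cmod_Ci, Rmult_1_l. apply HM.
- intros t. apply Ccont_inv; [now apply Ccosh_PI_neq_0|].
  apply (Ccont_scal_arg Ccosh); [apply CPI_neq_0|apply Ccont_Ccosh].
Qed.

Lemma intR_Csum (f : nat -> R -> C) (l : nat -> C) (N : nat) : (forall n, intR (f n) (l n)) ->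
  intR (fun _ => 0%C) 0%C -> intR (fun t => Csum (fun n => f n t) N) (Csum l N).
Proof.
intros H H0. induction N as [|N IH]; [exact H0|]. simpl. apply (intR_plus _ (f N)); [exact IH|apply H].
Qed.

(** Each wave of the series shifts the frequency of the kernel by [lam n]. The exponential weights
    on the coefficients bound the waves on the line Im = [e], so that the remainders are geometric
    uniformly in [t]. *)
Lemma FT_trig (kappa G : C -> C) (e : R) (phi : R -> C) (c0 : C) (p q : nat -> C) (lam : nat -> R)
  (M L r y : R) : kernel kappa e phi -> 0 < r < 1 -> (forall b, Cmod (phi b) <= L) ->
  (forall n, Cmod (p n) * exp (2 * PI * Rabs (lam n) * Rabs e) <= M * r ^ n) ->
  (forall n, Cmod (q n) * exp (2 * PI * Rabs (lam n) * Rabs e) <= M * r ^ n) ->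
  (forall t, Ccont G (t, e)) ->
  (forall t, G (t, e) = c0 + CSeries (fun n => p n * wave (lam n) (t, e) + q n * wave (- lam n)%R (t, e)))%C ->
  intR (fun t => wave y (t, e) * (G (t, e) * kappa (t, e)))%C
   (c0 * phi y + CSeries (fun n => p n * phi (y + lam n)%R + q n * phi (y - lam n)%R))%C.
Proof.
intros [K1 [[B HB] K3]] hr hL hp hq CG HG.
pose proof PI_RGT_0 as hpi.
assert (E1 : forall n, 1 <= exp (2 * PI * Rabs (lam n) * Rabs e)).
{ intros n. rewrite <- exp_0. apply exp_le. pose proof (Rabs_pos (lam n)). pose proof (Rabs_pos e).
  apply Rmult_le_pos; [apply Rmult_le_pos; lra|lra]. }
assert (p1 : forall n, Cmod (p n) <= M * r ^ n).
{ intros n. eapply Rle_trans; [|apply hp]. pose proof (E1 n). pose proof (Cmod_ge_0 (p n)). nra. }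
assert (q1 : forall n, Cmod (q n) <= M * r ^ n).
{ intros n. eapply Rle_trans; [|apply hq]. pose proof (E1 n). pose proof (Cmod_ge_0 (q n)). nra. }
assert (W1 : forall c t, Cmod (wave c (t, e)) <= exp (2 * PI * Rabs c * Rabs e)).
{ intros c t. rewrite Cmod_wave. apply exp_le.
  assert (- (c * e) <= Rabs c * Rabs e) by (rewrite <- Rabs_mult, <- Rabs_Ropp; apply Rle_abs). nra. }
set (a := fun t n => (p n * wave (lam n) (t, e) + q n * wave (- lam n)%R (t, e))%C).
set (v := fun n => (p n * phi (y + lam n)%R + q n * phi (y - lam n)%R)%C).
assert (Ha : forall t n, Cmod (a t n) <= 2 * M * r ^ n).
{ intros t n. eapply Rle_trans; [apply Cmod_triangle|]. rewrite !Cmod_mult.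
  assert (Cmod (p n) * Cmod (wave (lam n) (t, e)) <= M * r ^ n).
  { eapply Rle_trans; [|apply hp]. apply Rmult_le_compat_l; [apply Cmod_ge_0|apply W1]. }
  assert (Cmod (q n) * Cmod (wave (- lam n)%R (t, e)) <= M * r ^ n).
  { eapply Rle_trans; [|apply hq]. apply Rmult_le_compat_l; [apply Cmod_ge_0|]. rewrite <- (Rabs_Ropp (lam n)). apply W1. }
  lra. }
assert (L0 : 0 <= L) by (eapply Rle_trans; [apply Cmod_ge_0|apply (hL 0)]).
assert (Hv : forall n, Cmod (v n) <= 2 * M * L * r ^ n).
{ intros n. eapply Rle_trans; [apply Cmod_triangle|]. rewrite !Cmod_mult.
  assert (Cmod (p n) * Cmod (phi (y + lam n)%R) <= M * r ^ n * L) by (apply Rmult_le_compat; auto using Cmod_ge_0).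
  assert (Cmod (q n) * Cmod (phi (y - lam n)%R) <= M * r ^ n * L) by (apply Rmult_le_compat; auto using Cmod_ge_0).
  lra. }
assert (Ga : forall t, geom (a t)) by (intros t; exists (2 * M), r; split; [easy|apply Ha]).
assert (Gv : geom v) by (exists (2 * M * L), r; split; [easy|apply Hv]).
set (K0 := 2 * (2 * M / (1 - r))). set (Ey := exp (2 * PI * Rabs y * Rabs e)).
assert (M0 : 0 <= M) by (specialize (p1 0%nat); pose proof (Cmod_ge_0 (p 0%nat)); simpl in p1; lra).
assert (K00 : 0 <= K0) by (unfold K0; apply Rmult_le_pos; [lra|]; apply Rdiv_le_0_compat; lra).
assert (B0 : 0 <= B) by (apply (bell_nonneg (fun t => kappa (t, e))); exact HB).
assert (y0 : 0 < Ey) by apply exp_pos.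
apply (intR_limit _ (fun N t => c0 * (wave y (t, e) * kappa (t, e)) + Csum (fun n =>
   p n * (wave (y + lam n)%R (t, e) * kappa (t, e)) + q n * (wave (y - lam n)%R (t, e) * kappa (t, e))) N)%C
  _ (fun N => c0 * phi y + Csum v N)%C (Ey * K0 * B + K0 * L) r hr).
- apply (isI_of_Ccont (fun x => wave y x * (G x * kappa x))%C e). intros t.
  apply Ccont_mult; [exact (Cder_cont _ _ _ (Cder_wave y (t, e)))|]. now apply Ccont_mult.
- intros N. apply intR_plus; [now apply intR_scal|]. apply intR_Csum.
  + intros n. apply intR_plus; now apply intR_scal.
  + replace (RtoC 0) with (0 * phi 0%R)%C by ring.
    apply (intR_ext (fun t => 0 * (wave 0%R (t, e) * kappa (t, e)))%C); [intros; ring|]. now apply intR_scal.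
- intros N t. rewrite HG. fold (a t). rewrite (CSeries_split (a t) N (Ga t)).
  assert (E : (Csum (fun n => p n * (wave (y + lam n)%R (t, e) * kappa (t, e)) + q n * (wave (y - lam n)%R (t, e) * kappa (t, e))) N
    = wave y (t, e) * kappa (t, e) * Csum (a t) N)%C).
  { clear - N. induction N as [|N IH]; [simpl; ring|]. simpl. rewrite IH. unfold a.
    assert (WP : forall c d, wave (c + d)%R (t, e) = (wave c (t, e) * wave d (t, e))%C).
    { intros c d. unfold wave. rewrite <- Cexp_plus. f_equal. rewrite RtoC_plus. ring. }
    unfold Rminus. rewrite !WP. ring. }
  rewrite E.
  replace (wave y (t, e) * ((c0 + (Csum (a t) N + CSeries (fun n => a t (N + n)%nat))) * kappa (t, e)) -
    (c0 * (wave y (t, e) * kappa (t, e)) + wave y (t, e) * kappa (t, e) * Csum (a t) N))%C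
   with (wave y (t, e) * (kappa (t, e) * CSeries (fun n => a t (N + n)%nat)))%C by ring.
  rewrite !Cmod_mult.
  pose proof (Cmod_tail_le (a t) (2 * M) r N hr (fun n _ => Ha t n)) as T. fold K0 in T.
  assert (r0 : 0 < r ^ N) by (apply pow_lt; lra).
  apply Rle_trans with (Ey * (B / (1 + t ^ 2) * (K0 * r ^ N))).
  + apply Rmult_le_compat; [apply Cmod_ge_0|apply Rmult_le_pos; apply Cmod_ge_0|apply W1|].
    apply Rmult_le_compat; auto using Cmod_ge_0.
  + replace (Ey * (B / (1 + t ^ 2) * (K0 * r ^ N))) with (Ey * K0 * B * r ^ N / (1 + t ^ 2)) by (field; nra).
    apply Rmult_le_compat_r; [apply Rlt_le, Rinv_0_lt_compat; nra|].
    apply Rmult_le_compat_r; [lra|]. assert (0 <= K0 * L) by (now apply Rmult_le_pos). lra.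
- intros N. fold v. rewrite (CSeries_split v N Gv).
  replace (c0 * phi y + (Csum v N + CSeries (fun n => v (N + n)%nat)) - (c0 * phi y + Csum v N))%C
   with (CSeries (fun n => v (N + n)%nat)) by ring.
  eapply Rle_trans; [apply (Cmod_tail_le v (2 * M * L) r N hr (fun n _ => Hv n))|].
  apply Rmult_le_compat_r; [apply pow_le; lra|].
  replace (2 * (2 * M * L / (1 - r))) with (K0 * L) by (unfold K0; field; lra).
  assert (0 <= Ey * K0 * B) by (apply Rmult_le_pos; [apply Rmult_le_pos; lra|lra]). lra.
Qed.

(** Provides the continuity in [y] on which the values 0 / 0 rely. *)
Lemma trigsum_lipschitz (phi : R -> C) (c0 : C) (p q : nat -> C) (lam : nat -> R) (M L D r : R) : 0 < r < 1 ->
  (forall b, Cmod (phi b) <= L) -> (forall a b, Cmod (phi a - phi b) <= D * Rabs (a - b)) ->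
  (forall n, Cmod (p n) <= M * r ^ n) -> (forall n, Cmod (q n) <= M * r ^ n) ->
  let F y := (c0 * phi y + CSeries (fun n => p n * phi (y + lam n)%R + q n * phi (y - lam n)%R))%C in
  exists K, forall a b, Cmod (F a - F b)%C <= K * Rabs (a - b).
Proof.
intros hr hL hD p1 q1 F.
exists (Cmod c0 * D + 2 * (2 * M * D / (1 - r))). intros a b.
set (v := fun y n => (p n * phi (y + lam n)%R + q n * phi (y - lam n)%R)%C).
assert (Gv : forall y, geom (v y)).
{ intros y. exists (2 * M * L), r. split; [easy|]. intros n. eapply Rle_trans; [apply Cmod_triangle|]. rewrite !Cmod_mult.
  assert (Cmod (p n) * Cmod (phi (y + lam n)%R) <= M * r ^ n * L) by (apply Rmult_le_compat; auto using Cmod_ge_0).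
  assert (Cmod (q n) * Cmod (phi (y - lam n)%R) <= M * r ^ n * L) by (apply Rmult_le_compat; auto using Cmod_ge_0).
  lra. }
assert (E : (F a - F b = c0 * (phi a - phi b) + CSeries (fun n => v a n - v b n))%C).
{ rewrite CSeries_minus by apply Gv. unfold F. fold (v a) (v b). ring. }
rewrite E. eapply Rle_trans; [apply Cmod_triangle|]. rewrite Cmod_mult.
assert (Cmod c0 * Cmod (phi a - phi b) <= Cmod c0 * (D * Rabs (a - b))) by (apply Rmult_le_compat_l; [apply Cmod_ge_0|apply hD]).
assert (Cmod (CSeries (fun n => v a n - v b n)%C) <= 2 * (2 * M * D * Rabs (a - b) / (1 - r))).
{ apply Cmod_CSeries_le; [easy|]. intros n.
  replace (v a n - v b n)%C with (p n * (phi (a + lam n)%R - phi (b + lam n)%R) + q n * (phi (a - lam n)%R - phi (b - lam n)%R))%C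
    by (unfold v; ring).
  eapply Rle_trans; [apply Cmod_triangle|]. rewrite !Cmod_mult.
  pose proof (hD (a + lam n) (b + lam n)) as d1. pose proof (hD (a - lam n) (b - lam n)) as d2.
  replace (a + lam n - (b + lam n)) with (a - b) in d1 by ring. replace (a - lam n - (b - lam n)) with (a - b) in d2 by ring.
  assert (Cmod (p n) * Cmod (phi (a + lam n)%R - phi (b + lam n)%R) <= M * r ^ n * (D * Rabs (a - b))) by (apply Rmult_le_compat; auto using Cmod_ge_0).
  assert (Cmod (q n) * Cmod (phi (a - lam n)%R - phi (b - lam n)%R) <= M * r ^ n * (D * Rabs (a - b))) by (apply Rmult_le_compat; auto using Cmod_ge_0).
  lra. }
replace ((Cmod c0 * D + 2 * (2 * M * D / (1 - r))) * Rabs (a - b)) with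
  (Cmod c0 * (D * Rabs (a - b)) + 2 * (2 * M * D * Rabs (a - b) / (1 - r))) by (field; lra). lra.
Qed.

Lemma lipschitz_of_derive (f f' : R -> R) (D : R) : (forall x, is_derive f x (f' x)) -> (forall x, Rabs (f' x) <= D) ->
  forall a b, Rabs (f a - f b) <= D * Rabs (a - b).
Proof.
intros H HD a b. destruct (MVT_gen f b a f') as [c [_ E]].
- intros; apply H.
- intros x _. apply continuity_pt_filterlim. exact (is_derive_continuous _ _ _ (H x)).
- rewrite E, Rabs_mult. apply Rmult_le_compat_r; [apply Rabs_pos|apply HD].
Qed.

Lemma sech_le_1 (x : R) : 0 < / cosh x <= 1.
Proof.
pose proof (cosh_ge_1 x). split; [apply Rinv_0_lt_compat; lra|]. rewrite <- Rinv_1. apply Rinv_le_contravar; lra.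
Qed.

Lemma abs_tanh_le_1 (x : R) : Rabs (tanh x) <= 1.
Proof.
rewrite tanh_exp. pose proof (exp_pos (2 * x)). assert (0 < / (1 + exp (2 * x)) < 1).
{ split; [apply Rinv_0_lt_compat; lra|]. rewrite <- Rinv_1 at 2. apply Rinv_lt_contravar; lra. }
apply Rabs_le. unfold Rdiv. lra.
Qed.

Lemma tanh_lipschitz (a b : R) : Rabs (tanh (PI * a) - tanh (PI * b)) <= PI * Rabs (a - b).
Proof.
apply (lipschitz_of_derive (fun x => tanh (PI * x)) (fun x => PI * (/ cosh (PI * x) * / cosh (PI * x)))).
- intros x. pose proof (cosh_pos (PI * x)). unfold tanh. auto_derive; [lra|]. field_simplify; try lra.
  rewrite cosh2_sinh2. field. rewrite <- cosh2_sinh2. nra.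
- intros x. pose proof (sech_le_1 (PI * x)). pose proof PI_RGT_0. rewrite Rabs_pos_eq.
  + apply Rle_trans with (PI * 1); [|lra]. apply Rmult_le_compat_l; nra.
  + apply Rmult_le_pos; [lra|apply Rmult_le_pos; lra].
Qed.

Lemma sech_lipschitz (a b : R) : Rabs (/ cosh (PI * a) - / cosh (PI * b)) <= PI * Rabs (a - b).
Proof.
apply (lipschitz_of_derive (fun x => / cosh (PI * x)) (fun x => - (PI * (tanh (PI * x) * / cosh (PI * x))))).
- intros x. pose proof (cosh_pos (PI * x)). unfold tanh. auto_derive; [lra|]. field. lra.
- intros x. pose proof (sech_le_1 (PI * x)). pose proof (abs_tanh_le_1 (PI * x)). pose proof PI_RGT_0.
  rewrite Rabs_Ropp, !Rabs_mult, (Rabs_pos_eq PI), (Rabs_pos_eq (/ _)) by lra.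
  apply Rle_trans with (PI * 1); [|lra]. apply Rmult_le_compat_l; [lra|]. pose proof (Rabs_pos (tanh (PI * x))). nra.
Qed.

Local Open Scope C_scope.

(** * Lattice sums as trigonometric series in a strip, and their transforms *)

Definition trig (c0 : C) (p q : nat -> C) (l : nat -> nat) (z : C) : C :=
  c0 + CSeries (fun j => p j * Cexp (INR (l j) * z) + q j * Cexp (- (INR (l j) * z))).

Definition odds (j : nat) : nat := (2 * j + 1)%nat.
Definition evens (j : nat) : nat := (2 * j + 2)%nat.
Definition sech_at (P : R) (l : nat -> nat) (j : nat) : C := RtoC (/ cosh (INR (l j) * P / 2)).
Definition csch_at (P : R) (l : nat -> nat) (j : nat) : C := RtoC (/ sinh (INR (l j) * P / 2)).

Lemma geom_Cexp_pow (v : C) (l : nat -> nat) : (0 < Re v)%R -> (forall j, (j < l j)%nat) ->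
  geom (fun j => 2 * Cexp (- v) ^ l j).
Proof.
intros hv hl. exists 2%R, (Cmod (Cexp (- v))).
assert (hW : (0 < Cmod (Cexp (- v)) < 1)%R).
{ rewrite Cmod_Cexp. split; [apply exp_pos|]. rewrite <- exp_0. apply exp_increasing. destruct v; simpl in *; lra. }
split; [easy|]. intros j. rewrite Cmod_mult, Cmod_R, Rabs_pos_eq, Cmod_pow by lra.
apply Rmult_le_compat_l; [lra|]. replace (l j) with (j + (l j - j))%nat by (specialize (hl j); lia).
rewrite pow_add. assert (Cmod (Cexp (- v)) ^ (l j - j) <= 1)%R.
{ rewrite <- (pow1 (l j - j)). apply pow_incr. lra. }
assert (0 < Cmod (Cexp (- v)) ^ j)%R by (apply pow_lt; lra). nra.
Qed.

Lemma lattice_row (P : R) (w e f : C) (n : nat) (l : nat -> nat) : (0 < P)%R -> (0 < Re w < P)%R ->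
  (forall j, (j < l j)%nat) ->
  e ^ n * (CSeries (fun j => 2 * Cexp (- (w + INR n * P)) ^ l j) +
    f * CSeries (fun j => 2 * Cexp (- (P - w + INR n * P)) ^ l j)) =
  CSeries (fun j => 2 * e ^ n * ((Cexp (- w) * Cexp (- P) ^ n) ^ l j + f * (Cexp (- (P - w)) * Cexp (- P) ^ n) ^ l j)).
Proof.
intros hP hw hl.
assert (hn : (0 <= INR n * P)%R) by (apply Rmult_le_pos; [apply pos_INR|lra]).
assert (G1 : geom (fun j => 2 * Cexp (- (w + INR n * P)) ^ l j)).
{ apply geom_Cexp_pow; [|easy]. destruct w; simpl in *. rewrite Rmult_0_l, Rminus_0_r. lra. }
assert (G2 : geom (fun j => 2 * Cexp (- (P - w + INR n * P)) ^ l j)).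
{ apply geom_Cexp_pow; [|easy]. destruct w; simpl in *. rewrite Rmult_0_l, Rminus_0_r. lra. }
rewrite <- (CSeries_scal f) by exact G2. rewrite <- CSeries_plus; [|exact G1|now apply geom_scal].
rewrite <- CSeries_scal by (apply geom_plus; [exact G1|now apply geom_scal]).
apply CSeries_ext. intros j.
assert (E : forall v : C, Cexp (- (v + INR n * P)) = Cexp (- v) * Cexp (- P) ^ n).
{ intros v. rewrite <- Cexp_pow, <- Cexp_plus. f_equal. ring. }
rewrite !E. ring.
Qed.

(** [w] and [P - w] are the offsets of the two halves of the lattice. Their exponentials share the
    factor [exp (- P / 2)], the origin of the arguments [l P / 2] in [sech_at] and [csch_at]. *)
Lemma lambert_lattice (P : R) (z e f : C) (l : nat -> nat) : (0 < P)%R -> (Rabs (Re z) < P / 2)%R ->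
  Cmod e = 1%R -> Cmod f = 1%R -> (forall j, (j < l j)%nat) -> let w := P / 2 + z in
  CSeries (fun n => e ^ n * (CSeries (fun j => 2 * Cexp (- (w + INR n * P)) ^ l j) +
    f * CSeries (fun j => 2 * Cexp (- (P - w + INR n * P)) ^ l j))) =
  CSeries (fun j => 2 * Cexp (- (INR (l j) * P / 2)%R) / (1 - e * Cexp (- (INR (l j) * P)%R)) *
    (f * Cexp (INR (l j) * z) + Cexp (- (INR (l j) * z)))).
Proof.
intros hP hz he hf hl w. apply Rabs_def2 in hz.
assert (hw : (0 < Re w < P)%R).
{ assert (Re w = P / 2 + Re z)%R; [|lra]. unfold w. destruct z. unfold Cdiv, Cinv, Cmult, Cplus, RtoC; simpl. field. }
assert (M1 : forall v : C, (0 < Re v)%R -> (0 < Cmod (Cexp (- v)) < 1)%R).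
{ intros v hv. rewrite Cmod_Cexp. split; [apply exp_pos|]. rewrite <- exp_0. apply exp_increasing. destruct v; simpl in *; lra. }
transitivity (CSeries (fun n => CSeries (fun j => 2 * e ^ n * ((Cexp (- w) * Cexp (- P) ^ n) ^ l j + f * (Cexp (- (P - w)) * Cexp (- P) ^ n) ^ l j)))).
{ apply CSeries_ext. intros n. now apply lattice_row. }
rewrite lambert; [|apply M1; lra|apply M1; destruct w; simpl in *; lra|apply M1; simpl; lra|easy|easy|easy].
apply CSeries_ext. intros j. rewrite <- !Cexp_pow.
assert (E1 : Cexp (INR (l j) * - w) = Cexp (- (INR (l j) * P / 2)%R) * Cexp (- (INR (l j) * z))).
{ rewrite <- Cexp_plus. f_equal. unfold w. rewrite RtoC_div, RtoC_mult by lra. field. }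
assert (E2 : Cexp (INR (l j) * - (P - w)) = Cexp (- (INR (l j) * P / 2)%R) * Cexp (INR (l j) * z)).
{ rewrite <- Cexp_plus. f_equal. unfold w. rewrite RtoC_div, RtoC_mult by lra. field. }
replace (INR (l j) * - P) with (- (INR (l j) * P)%R) by (rewrite RtoC_mult; ring).
rewrite E1, E2. unfold Cdiv. ring.
Qed.

Lemma csch_coef (a : R) : (0 < a)%R -> 2 * Cexp (- (a / 2)%R) / (1 - 1 * Cexp (- a)) = RtoC (/ sinh (a / 2)).
Proof.
intros ha. replace (- a) with (- (a / 2)%R + - (a / 2)%R) by (rewrite RtoC_div by lra; field).
rewrite Cexp_plus, <- RtoC_opp, Cexp_RtoC. set (x := exp (- (a / 2))).
assert (hx : (0 < x < 1)%R) by (unfold x; split; [apply exp_pos|rewrite <- exp_0; apply exp_increasing; lra]).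
unfold sinh. replace (exp (a / 2)) with (/ x)%R by (unfold x; rewrite exp_Ropp, Rinv_inv; reflexivity). fold x.
replace (1 - 1 * (x * x)) with (RtoC (1 - x * x)) by (rewrite RtoC_minus, RtoC_mult; ring).
rewrite <- RtoC_mult, <- RtoC_div by nra. f_equal. field. repeat split; nra.
Qed.

Lemma sech_coef (a : R) : 2 * Cexp (- (a / 2)%R) / (1 - - 1 * Cexp (- a)) = RtoC (/ cosh (a / 2)).
Proof.
replace (- a) with (- (a / 2)%R + - (a / 2)%R) by (rewrite RtoC_div by lra; field).
rewrite Cexp_plus, <- RtoC_opp, Cexp_RtoC. set (x := exp (- (a / 2))).
assert (hx : (0 < x)%R) by apply exp_pos.
unfold cosh. replace (exp (a / 2)) with (/ x)%R by (unfold x; rewrite exp_Ropp, Rinv_inv; reflexivity). fold x.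
replace (1 - - 1 * (x * x)) with (RtoC (1 + x * x)) by (rewrite RtoC_plus, RtoC_mult; ring).
rewrite <- RtoC_mult, <- RtoC_div by nra. f_equal. field. repeat split; nra.
Qed.

Lemma sg_of_nat (n : nat) : sg (- Z.of_nat n) = (- 1) ^ n /\ sg (1 + Z.of_nat n) = - (- 1) ^ n.
Proof.
assert (E : sg (Z.of_nat n) = (- 1) ^ n).
{ induction n as [|n IH]; [reflexivity|]. rewrite Nat2Z.inj_succ. unfold Z.succ. rewrite sg_succ, IH.
  change ((- 1) ^ S n) with (- 1 * (- 1) ^ n). ring. }
rewrite sg_opp, Z.add_comm, sg_succ, E. auto.
Qed.

Lemma lattice_halves (P : R) (w : C) (n : nat) :
  w - IZR (- Z.of_nat n) * P = w + INR n * P /\ w - IZR (1 + Z.of_nat n) * P = - (P - w + INR n * P).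
Proof.
rewrite opp_IZR, plus_IZR, <- INR_IZR_INZ, RtoC_opp, RtoC_plus. split; ring.
Qed.

Lemma Re_rows (P : R) (z : C) (n : nat) : (0 < P)%R -> (Rabs (Re z) < P / 2)%R -> let w := P / 2 + z in
  (0 < Re (w + INR n * P))%R /\ (0 < Re (P - w + INR n * P))%R.
Proof.
intros hP hz w. apply Rabs_def2 in hz.
assert (hn : (0 <= INR n * P)%R) by (apply Rmult_le_pos; [apply pos_INR|lra]).
assert (hw : (Re w = P / 2 + Re z)%R) by (unfold w; destruct z; unfold Cdiv, Cinv, Cmult, Cplus, RtoC; simpl; field).
destruct w as [w1 w2]; simpl in *. rewrite Rmult_0_l, Rminus_0_r. lra.
Qed.

Lemma C1_pow (n : nat) : RtoC 1 ^ n = 1.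
Proof. induction n as [|n IH]; [reflexivity|]. change (RtoC 1 ^ S n) with (1 * RtoC 1 ^ n). rewrite IH. ring. Qed.

Lemma latD_trig (P : R) (z : C) : (0 < P)%R -> (Rabs (Re z) < P / 2)%R ->
  latD P (P / 2 + z) = trig 0 (fun j => - csch_at P odds j) (csch_at P odds) odds z.
Proof.
intros hP hz. unfold latD, zsum, trig. rewrite Cplus_0_l. set (w := P / 2 + z).
transitivity (CSeries (fun n => 1 ^ n * (CSeries (fun j => 2 * Cexp (- (w + INR n * P)) ^ odds j) +
    - 1 * CSeries (fun j => 2 * Cexp (- (P - w + INR n * P)) ^ odds j)))).
- apply CSeries_ext. intros n. destruct (lattice_halves P w n) as [-> ->].
  destruct (Re_rows P z n hP hz) as [R1 R2]. fold w in R1, R2.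
  rewrite csch_opp by (apply Csinh_neq_0_Re; lra).
  destruct (csch_geometric _ R1) as [-> _]. destruct (csch_geometric _ R2) as [-> _].
  rewrite C1_pow. unfold odds. ring.
- unfold w. rewrite (lambert_lattice P z 1 (- 1) odds hP hz);
    [|apply Cmod_1|rewrite Cmod_R, Rabs_left; lra|intros j; unfold odds; lia].
  apply CSeries_ext. intros j. unfold csch_at.
  rewrite csch_coef; [ring|]. apply Rmult_lt_0_compat; [|easy]. apply lt_0_INR. unfold odds. lia.
Qed.

Lemma latB_trig (P : R) (z : C) : (0 < P)%R -> (Rabs (Re z) < P / 2)%R ->
  latB P (P / 2 + z) = trig 0 (sech_at P odds) (sech_at P odds) odds z.
Proof.
intros hP hz. unfold latB, zsum, trig. rewrite Cplus_0_l. set (w := P / 2 + z).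
transitivity (CSeries (fun n => (- 1) ^ n * (CSeries (fun j => 2 * Cexp (- (w + INR n * P)) ^ odds j) +
    1 * CSeries (fun j => 2 * Cexp (- (P - w + INR n * P)) ^ odds j)))).
- apply CSeries_ext. intros n. destruct (lattice_halves P w n) as [-> ->]. destruct (sg_of_nat n) as [-> ->].
  destruct (Re_rows P z n hP hz) as [R1 R2]. fold w in R1, R2.
  rewrite csch_opp by (apply Csinh_neq_0_Re; lra).
  destruct (csch_geometric _ R1) as [-> _]. destruct (csch_geometric _ R2) as [-> _]. unfold odds. ring.
- unfold w. rewrite (lambert_lattice P z (- 1) 1 odds hP hz);
    [|rewrite Cmod_R, Rabs_left; lra|apply Cmod_1|intros j; unfold odds; lia].
  apply CSeries_ext. intros j. unfold sech_at. rewrite sech_coef. ring.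
Qed.

Lemma latA_trig (P : R) (z : C) : (0 < P)%R -> (Rabs (Re z) < P / 2)%R ->
  latA P (P / 2 + z) = trig 1 (sech_at P evens) (sech_at P evens) evens z.
Proof.
intros hP hz. unfold latA, zsum, trig. f_equal. set (w := P / 2 + z).
transitivity (CSeries (fun n => (- 1) ^ n * (CSeries (fun j => 2 * Cexp (- (w + INR n * P)) ^ evens j) +
    1 * CSeries (fun j => 2 * Cexp (- (P - w + INR n * P)) ^ evens j)))).
- apply CSeries_ext. intros n. destruct (lattice_halves P w n) as [-> ->]. destruct (sg_of_nat n) as [-> ->].
  destruct (Re_rows P z n hP hz) as [R1 R2]. fold w in R1, R2.
  rewrite coth_opp by (apply Csinh_neq_0_Re; lra).
  unfold coth_limit. replace (- Z.of_nat n <=? 0)%Z with true by (symmetry; apply Z.leb_le; lia).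
  replace (1 + Z.of_nat n <=? 0)%Z with false by (symmetry; apply Z.leb_gt; lia).
  destruct (csch_geometric _ R1) as [_ E1]. destruct (csch_geometric _ R2) as [_ E2]. unfold evens.
  rewrite <- E1, <- E2. ring.
- unfold w. rewrite (lambert_lattice P z (- 1) 1 evens hP hz);
    [|rewrite Cmod_R, Rabs_left; lra|apply Cmod_1|intros j; unfold evens; lia].
  apply CSeries_ext. intros j. unfold sech_at. rewrite sech_coef. ring.
Qed.

(** The rate of decay that makes the series converge in the open strip |Re z| < P / 2. *)
Definition coef_bounded (P : R) (p : nat -> C) (l : nat -> nat) : Prop :=
  exists M, forall j, (Cmod (p j) <= M * exp (- (INR (l j) * P / 2)))%R.

Lemma sech_at_bounded (P : R) (l : nat -> nat) : coef_bounded P (sech_at P l) l.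
Proof.
exists 2%R. intros j. unfold sech_at. set (x := (INR (l j) * P / 2)%R). rewrite Cmod_R.
pose proof (cosh_pos x). rewrite Rabs_pos_eq by (apply Rlt_le, Rinv_0_lt_compat; easy).
pose proof (exp_pos x). pose proof (exp_pos (- x)).
apply (Rmult_le_reg_r (cosh x)); [easy|]. rewrite Rinv_l by lra. unfold cosh. rewrite exp_Ropp in *.
replace (2 * / exp x * ((exp x + / exp x) / 2))%R with (1 + / exp x * / exp x)%R by (field; lra). nra.
Qed.

Lemma csch_at_bounded (P : R) (l : nat -> nat) : (0 < P)%R -> (forall j, (0 < l j)%nat) -> coef_bounded P (csch_at P l) l.
Proof.
intros hP hl. exists (2 / (1 - exp (- P)))%R. intros j. unfold csch_at. set (x := (INR (l j) * P / 2)%R). rewrite Cmod_R.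
destruct (exp_range P hP) as [e1 e2].
assert (hx : (P <= 2 * x)%R).
{ unfold x. specialize (hl j). apply le_INR in hl. simpl in hl. nra. }
pose proof (exp_pos x) as h1.
assert (h2 : (/ exp x * / exp x <= exp (- P))%R).
{ rewrite <- exp_Ropp, <- exp_plus. apply exp_le. lra. }
assert (hs : (0 < sinh x)%R) by (pose proof (sinh_ge_id x ltac:(lra)); lra).
rewrite Rabs_pos_eq by (apply Rlt_le, Rinv_0_lt_compat; easy).
apply (Rmult_le_reg_r (sinh x)); [easy|]. rewrite Rinv_l by lra. unfold sinh. rewrite !exp_Ropp in *.
set (y := (/ exp x)%R) in *. assert (hy : (exp x * y = 1)%R) by (unfold y; apply Rinv_r; lra).
set (t := (/ exp P)%R) in *. clearbody t y. apply (Rmult_le_reg_r (1 - t)); [lra|].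
replace (2 / (1 - t) * y * ((exp x - y) / 2) * (1 - t))%R with (exp x * y - y * y)%R.
- rewrite hy. lra.
- field. lra.
Qed.

Definition strip_series (P : R) (G : C -> C) (c0 : C) (p q : nat -> C) (l : nat -> nat) : Prop :=
  coef_bounded P p l /\ coef_bounded P q l /\ (forall j, (2 * j < l j)%nat) /\
  forall z, (Rabs (Re z) < P / 2)%R -> G (P / 2 + z) = trig c0 p q l z /\ Ccont G (P / 2 + z).

Definition trig_term (P : R) (p q : nat -> C) (l : nat -> nat) (th : C) (phi : R -> C) (y : R) (j : nat) : C :=
  p j * Cexp (INR (l j) * th) * phi (y + INR (l j) * P / (2 * PI))%R +
  q j * Cexp (- (INR (l j) * th)) * phi (y - INR (l j) * P / (2 * PI))%R.

Definition trig_sum (P : R) (c0 : C) (p q : nat -> C) (l : nat -> nat) (th : C) (phi : R -> C) (y : R) : C :=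
  c0 * phi y + CSeries (trig_term P p q l th phi y).

Lemma Re_half_plus (P : R) (z : C) : Re (P / 2 + z) = (P / 2 + Re z)%R.
Proof. destruct z. unfold Cdiv, Cinv, Cmult, Cplus, RtoC; simpl. field. Qed.

Lemma off_half_plus (P : R) (z : C) : (Rabs (Re z) < P / 2)%R -> off P (P / 2 + z).
Proof. intros h. apply Rabs_def2 in h. apply off_Re. rewrite Re_half_plus. lra. Qed.

Lemma coef_bounded_opp (P : R) (p : nat -> C) (l : nat -> nat) : coef_bounded P p l -> coef_bounded P (fun j => - p j) l.
Proof. intros [M H]. exists M. intros j. rewrite Cmod_opp. apply H. Qed.

Lemma strip_series_A (P : R) : (0 < P)%R ->
  strip_series P (latA P) 1 (sech_at P evens) (sech_at P evens) evens.
Proof.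
intros hP. split; [apply sech_at_bounded|]. split; [apply sech_at_bounded|]. split; [intros j; unfold evens; lia|].
intros z hz. split; [now apply latA_trig|now apply Ccont_latA, off_half_plus].
Qed.

Lemma strip_series_B (P : R) : (0 < P)%R ->
  strip_series P (latB P) 0 (sech_at P odds) (sech_at P odds) odds.
Proof.
intros hP. split; [apply sech_at_bounded|]. split; [apply sech_at_bounded|]. split; [intros j; unfold odds; lia|].
intros z hz. split; [now apply latB_trig|now apply Ccont_latB, off_half_plus].
Qed.

Lemma strip_series_D (P : R) : (0 < P)%R ->
  strip_series P (latD P) 0 (fun j => - csch_at P odds j) (csch_at P odds) odds.
Proof.
intros hP. assert (B : coef_bounded P (csch_at P odds) odds) by (apply csch_at_bounded; [easy|intros; unfold odds; lia]).
split; [now apply coef_bounded_opp|]. split; [easy|]. split; [intros j; unfold odds; lia|].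
intros z hz. split; [now apply latD_trig|now apply Ccont_latD, off_half_plus].
Qed.

(** At height [e] a wave of frequency [l P / (2 PI)] is at most [exp (l P |e|)] against a
    coefficient of order [exp (- l P / 2)]. The balance is negative because |e| < 1/2, and
    [2 * j < l j] converts it into a geometric rate in [j]; the imaginary phases do not affect
    moduli. *)
Lemma coef_bounded_phase (P e : R) (p : nat -> C) (l : nat -> nat) (th : nat -> C) : (0 < P)%R ->
  (Rabs e < 1 / 2)%R -> (forall j, (2 * j < l j)%nat) -> (forall j, Re (th j) = 0%R) -> coef_bounded P p l ->
  exists M, forall j, (Cmod (p j * Cexp (th j)) * exp (2 * PI * Rabs (INR (l j) * P / (2 * PI)) * Rabs e) <=
    M * exp (- (P * (1 - 2 * Rabs e))) ^ j)%R.
Proof.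
intros hP he hl hth [M H]. exists M. intros j. specialize (H j). specialize (hl j). pose proof PI_RGT_0.
rewrite Cmod_mult, Cmod_Cexp, hth, exp_0, Rmult_1_r.
assert (hM : (0 <= M)%R).
{ pose proof (Cmod_ge_0 (p j)). pose proof (exp_pos (- (INR (l j) * P / 2))). nra. }
assert (l0 : (2 * INR j <= INR (l j))%R) by (replace 2%R with (INR 2) by reflexivity; rewrite <- mult_INR; apply le_INR; lia).
pose proof (pos_INR j) as j0. pose proof (Rabs_pos e) as e0.
rewrite (Rabs_pos_eq (INR (l j) * P / (2 * PI))) by (apply Rdiv_le_0_compat; [apply Rmult_le_pos; lra|lra]).
apply Rle_trans with (M * exp (- (INR (l j) * P / 2)) * exp (2 * PI * (INR (l j) * P / (2 * PI)) * Rabs e))%R.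
- apply Rmult_le_compat_r; [apply Rlt_le, exp_pos|easy].
- rewrite Rmult_assoc, <- exp_plus. apply Rmult_le_compat_l; [easy|]. rewrite exp_pow_nat. apply exp_le.
  replace (- (INR (l j) * P / 2) + 2 * PI * (INR (l j) * P / (2 * PI)) * Rabs e)%R with
    (- (INR (l j) * (P * (1 - 2 * Rabs e) / 2)))%R by (field; lra).
  set (s := (P * (1 - 2 * Rabs e))%R). assert (0 < s)%R by (apply Rmult_lt_0_compat; lra). nra.
Qed.

Lemma trig_term_geom (P : R) (p q : nat -> C) (l : nat -> nat) (th : C) (phi : R -> C) (L y : R) : (0 < P)%R ->
  coef_bounded P p l -> coef_bounded P q l -> (forall j, (2 * j < l j)%nat) -> Re th = 0%R ->
  (forall b, (Cmod (phi b) <= L)%R) -> geom (trig_term P p q l th phi y).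
Proof.
intros hP hp hq hl hth hL.
assert (e0 : (Rabs 0 < 1 / 2)%R) by (rewrite Rabs_R0; lra).
destruct (coef_bounded_phase P 0 p l (fun j => INR (l j) * th) hP e0 hl) as [M1 H1]; [|exact hp|].
{ intros j. destruct th; simpl in *. rewrite hth. ring. }
destruct (coef_bounded_phase P 0 q l (fun j => - (INR (l j) * th)) hP e0 hl) as [M2 H2]; [|exact hq|].
{ intros j. destruct th; simpl in *. rewrite hth. ring. }
rewrite Rabs_R0 in *. set (r := exp (- (P * (1 - 2 * 0)))) in *.
assert (hr : (0 < r < 1)%R) by (unfold r; rewrite Rmult_0_r, Rminus_0_r, Rmult_1_r; now apply exp_range).
apply geom_plus.
- apply (geom_ext (fun j => phi (y + INR (l j) * P / (2 * PI))%R * (p j * Cexp (INR (l j) * th)))); [intros; ring|].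
  apply geom_bounded_mult with L; [intros; apply hL|]. exists M1, r. split; [easy|]. intros j. specialize (H1 j).
  rewrite Rmult_0_r, exp_0, Rmult_1_r in H1. exact H1.
- apply (geom_ext (fun j => phi (y - INR (l j) * P / (2 * PI))%R * (q j * Cexp (- (INR (l j) * th))))); [intros; ring|].
  apply geom_bounded_mult with L; [intros; apply hL|]. exists M2, r. split; [easy|]. intros j. specialize (H2 j).
  rewrite Rmult_0_r, exp_0, Rmult_1_r in H2. exact H2.
Qed.

(** Under [z = Ci * P * x + th], the exponential of [l z] is a wave of frequency [l P / (2 PI)] with
    phase [exp (l th)]. As [th] is imaginary, Re z is [- P e] and stays in the strip. *)
Lemma FT_strip (P e L : R) (kappa G : C -> C) (phi : R -> C) (c0 th : C) (p q : nat -> C) (l : nat -> nat) :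
  (0 < P)%R -> (Rabs e < 1 / 2)%R -> kernel kappa e phi -> (forall b, (Cmod (phi b) <= L)%R) -> Re th = 0%R ->
  strip_series P G c0 p q l -> forall y,
  intR (fun t => wave y (t, e) * (G (P / 2 + (Ci * P * (t, e) + th)) * kappa (t, e))) (trig_sum P c0 p q l th phi y).
Proof.
intros hP he K hL hth [hp [hq [hl H]]] y.
destruct (coef_bounded_phase P e p l (fun j => INR (l j) * th) hP he hl) as [M1 H1]; [|exact hp|].
{ intros j. destruct th; simpl in *. rewrite hth. ring. }
destruct (coef_bounded_phase P e q l (fun j => - (INR (l j) * th)) hP he hl) as [M2 H2]; [|exact hq|].
{ intros j. destruct th; simpl in *. rewrite hth. ring. }
set (r := exp (- (P * (1 - 2 * Rabs e)))) in *.
assert (hr : (0 < r < 1)%R) by (apply exp_range, Rmult_lt_0_compat; lra).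
assert (hz : forall t, (Rabs (Re (Ci * P * (t, e) + th)) < P / 2)%R).
{ intros t. replace (Re (Ci * P * (t, e) + th)) with (P * - e)%R by (destruct th; simpl in *; rewrite hth; ring).
  rewrite Rabs_mult, Rabs_Ropp, Rabs_pos_eq by lra. nra. }
pose proof PI_RGT_0 as hpi.
assert (mon : forall M j, (M <= Rmax M1 M2)%R -> (M * r ^ j <= Rmax M1 M2 * r ^ j)%R).
{ intros M j h. apply Rmult_le_compat_r; [apply pow_le; lra|easy]. }
apply (FT_trig kappa (fun x => G (P / 2 + (Ci * P * x + th))) e phi c0
  (fun j => p j * Cexp (INR (l j) * th)) (fun j => q j * Cexp (- (INR (l j) * th)))
  (fun j => (INR (l j) * P / (2 * PI))%R) (Rmax M1 M2) L r y K hr hL).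
- intros j. eapply Rle_trans; [apply H1|]. apply mon, Rmax_l.
- intros j. eapply Rle_trans; [apply H2|]. apply mon, Rmax_r.
- intros t. destruct (H _ (hz t)) as [_ CG].
  assert (n0 : Ci * P <> 0) by (apply Cmult_neq_0; [apply Ci_neq_0|apply RtoC_neq_0; lra]).
  apply (Clim_eq _ (G (Ci * P * (t, e) + (P / 2 + th)))); [f_equal; ring|].
  apply (Clim_ext (fun h => G (Ci * P * ((t, e) + h) + (P / 2 + th)))); [intros; f_equal; ring|].
  apply (Ccont_scal_arg (fun w => G (w + (P / 2 + th))) (Ci * P) (t, e) n0).
  apply Ccont_translate. replace (Ci * P * (t, e) + (P / 2 + th)) with (P / 2 + (Ci * P * (t, e) + th)) by ring. exact CG.
- intros t. destruct (H _ (hz t)) as [-> _]. unfold trig. f_equal. apply CSeries_ext. intros j.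
  assert (E : wave (INR (l j) * P / (2 * PI))%R (t, e) * Cexp (INR (l j) * th) = Cexp (INR (l j) * (Ci * P * (t, e) + th))).
  { unfold wave. rewrite <- Cexp_plus. f_equal. rewrite RtoC_div, !RtoC_mult by lra. field. apply CPI_neq_0. }
  assert (F : wave (- (INR (l j) * P / (2 * PI)))%R (t, e) * Cexp (- (INR (l j) * th)) = Cexp (- (INR (l j) * (Ci * P * (t, e) + th)))).
  { unfold wave. rewrite <- Cexp_plus. f_equal. rewrite RtoC_opp, RtoC_div, !RtoC_mult by lra. field. apply CPI_neq_0. }
  rewrite <- E, <- F. ring.
Qed.

Lemma trig_sum_lipschitz (P L D : R) (G : C -> C) (phi : R -> C) (c0 th : C) (p q : nat -> C) (l : nat -> nat) :
  (0 < P)%R -> (forall b, (Cmod (phi b) <= L)%R) -> (forall a b, (Cmod (phi a - phi b) <= D * Rabs (a - b))%R) ->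
  Re th = 0%R -> strip_series P G c0 p q l ->
  exists K, forall a b, (Cmod (trig_sum P c0 p q l th phi a - trig_sum P c0 p q l th phi b) <= K * Rabs (a - b))%R.
Proof.
intros hP hL hD hth [hp [hq [hl _]]].
assert (e0 : (Rabs 0 < 1 / 2)%R) by (rewrite Rabs_R0; lra).
destruct (coef_bounded_phase P 0 p l (fun j => INR (l j) * th) hP e0 hl) as [M1 H1]; [|exact hp|].
{ intros j. destruct th; simpl in *. rewrite hth. ring. }
destruct (coef_bounded_phase P 0 q l (fun j => - (INR (l j) * th)) hP e0 hl) as [M2 H2]; [|exact hq|].
{ intros j. destruct th; simpl in *. rewrite hth. ring. }
rewrite Rabs_R0 in *. set (r := exp (- (P * (1 - 2 * 0)))) in *.
assert (hr : (0 < r < 1)%R) by (unfold r; rewrite Rmult_0_r, Rminus_0_r, Rmult_1_r; now apply exp_range).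
assert (mon : forall M j, (M <= Rmax M1 M2)%R -> (M * r ^ j <= Rmax M1 M2 * r ^ j)%R).
{ intros M j h. apply Rmult_le_compat_r; [apply pow_le; lra|easy]. }
apply (trigsum_lipschitz phi c0 (fun j => p j * Cexp (INR (l j) * th)) (fun j => q j * Cexp (- (INR (l j) * th)))
  (fun j => (INR (l j) * P / (2 * PI))%R) (Rmax M1 M2) L D r hr hL hD).
- intros j. specialize (H1 j). rewrite Rmult_0_r, exp_0, Rmult_1_r in H1. eapply Rle_trans; [apply H1|]. apply mon, Rmax_l.
- intros j. specialize (H2 j). rewrite Rmult_0_r, exp_0, Rmult_1_r in H2. eapply Rle_trans; [apply H2|]. apply mon, Rmax_r.
Qed.

Lemma CSeries_comb (s c d : C) (t a b : nat -> C) : geom t -> geom a -> geom b ->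
  (forall j, s * t j = c * a j + d * b j) -> s * CSeries t = c * CSeries a + d * CSeries b.
Proof.
intros Gt Ga Gb E. rewrite <- !CSeries_scal, <- CSeries_plus by (try apply geom_scal; easy).
apply CSeries_ext, E.
Qed.

(** Groups the indices about 0, where [zsum] groups them about 1/2: the nodes of [evens] are
    multiples of [P], symmetric about the term of index 0. *)
Lemma zsum_center (a : Z -> C) : geomZ a ->
  geom (fun n => a (1 + Z.of_nat n)%Z + a (- (1 + Z.of_nat n))%Z) /\
  zsum a = a 0%Z + CSeries (fun n => a (1 + Z.of_nat n)%Z + a (- (1 + Z.of_nat n))%Z).
Proof.
intros Ga. rewrite zsum_split by easy. destruct Ga as [G1 G2].
assert (G3 : geom (fun n => a (- (1 + Z.of_nat n))%Z)).
{ apply geom_incr in G1. eapply geom_ext; [|exact G1]. intros n; cbv beta; f_equal; lia. }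
split; [now apply geom_plus|]. rewrite CSeries_plus by easy. rewrite (CSeries_incr _ G1).
replace (CSeries (fun n => a (- Z.of_nat (S n))%Z)) with (CSeries (fun n => a (- (1 + Z.of_nat n))%Z))
  by (apply CSeries_ext; intros n; f_equal; lia).
simpl (- Z.of_nat 0)%Z. ring.
Qed.

(** * Summation of the transformed series *)

Definition node (P : R) (l : nat -> nat) (j : nat) : R := (INR (l j) * P / 2)%R.

Definition sech_pair (P : R) (l : nat -> nat) (th : C) (Y : R) (j : nat) : C :=
  Cexp (INR (l j) * th) * RtoC (/ cosh (Y + node P l j)) + Cexp (- (INR (l j) * th)) * RtoC (/ cosh (Y - node P l j)).

Lemma csch_on_line (X : R) : csch (X + Ci * (PI / 2)) = - Ci * RtoC (/ cosh X).
Proof.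
unfold csch. rewrite Csinh_shift, Ccosh_RtoC. pose proof (cosh_pos X).
assert (RtoC (cosh X) <> 0) by (apply RtoC_neq_0; lra). rewrite RtoC_inv by lra.
transitivity (/ Ci * / RtoC (cosh X)); [field; split; [easy|apply Ci_neq_0]|]. now rewrite Cinv_Ci.
Qed.

Lemma coth_on_line (X : R) : coth (X + Ci * (PI / 2)) = RtoC (tanh X).
Proof.
unfold coth. rewrite Csinh_shift, Ccosh_shift, Ccosh_RtoC, Csinh_RtoC. pose proof (cosh_pos X).
assert (RtoC (cosh X) <> 0) by (apply RtoC_neq_0; lra). unfold tanh. rewrite RtoC_div by lra. field.
split; [easy|apply Ci_neq_0].
Qed.

Lemma line_point (P Y : R) (m : Z) : Y + Ci * (PI / 2) - IZR m * P = (Y - IZR m * P)%R + Ci * (PI / 2).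
Proof. rewrite RtoC_minus, RtoC_mult. ring. Qed.

Lemma line_half (P Y : R) : Y + Ci * (PI / 2) + P / 2 = (Y + P / 2)%R + Ci * (PI / 2).
Proof. rewrite RtoC_plus, RtoC_div by lra. ring. Qed.

Lemma node_evens (P Y : R) (n : nat) :
  (Y - IZR (1 + Z.of_nat n) * P = Y - node P evens n)%R /\ (Y - IZR (- (1 + Z.of_nat n)) * P = Y + node P evens n)%R.
Proof.
unfold node, evens. rewrite opp_IZR, plus_IZR, <- INR_IZR_INZ, plus_INR, mult_INR. simpl (INR 2). split; field.
Qed.

Lemma node_odds (P Y : R) (n : nat) :
  (Y + P / 2 - IZR (- Z.of_nat n) * P = Y + node P odds n)%R /\ (Y + P / 2 - IZR (1 + Z.of_nat n) * P = Y - node P odds n)%R.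
Proof.
unfold node, odds. rewrite opp_IZR, plus_IZR, <- INR_IZR_INZ, plus_INR, mult_INR. simpl (INR 2). simpl (INR 1). split; field.
Qed.

Lemma Cexp_opp_iPI2 : Cexp (- (Ci * (PI / 2))) = - Ci.
Proof. rewrite Cexp_opp, Cexp_iPI2. apply Cinv_Ci. Qed.

Lemma Cpow_odds (x : C) (j : nat) : x ^ odds j = x * (x * x) ^ j.
Proof.
induction j as [|j IH]; [unfold odds; simpl; ring|].
replace (odds (S j)) with (S (S (odds j))) by (unfold odds; lia).
change (x ^ S (S (odds j))) with (x * (x * x ^ odds j)). rewrite IH.
change ((x * x) ^ S j) with (x * x * (x * x) ^ j). ring.
Qed.

Lemma phase_odds (j : nat) : Cexp (INR (odds j) * (Ci * (PI / 2))) = Ci * (- 1) ^ j /\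
  Cexp (- (INR (odds j) * (Ci * (PI / 2)))) = - Ci * (- 1) ^ j.
Proof.
replace (- (INR (odds j) * (Ci * (PI / 2)))) with (INR (odds j) * - (Ci * (PI / 2))) by ring.
rewrite !Cexp_pow, Cexp_opp_iPI2, Cexp_iPI2, !Cpow_odds, Ci_sqr.
replace (- Ci * - Ci) with (Ci * Ci) by ring. rewrite Ci_sqr. auto.
Qed.

Lemma phase_evens (j : nat) : Cexp (INR (evens j) * (Ci * (PI / 2))) = - (- 1) ^ j /\
  Cexp (- (INR (evens j) * (Ci * (PI / 2)))) = - (- 1) ^ j.
Proof.
replace (- (INR (evens j) * (Ci * (PI / 2)))) with (INR (evens j) * - (Ci * (PI / 2))) by ring.
replace (evens j) with (S (odds j)) by (unfold odds, evens; lia).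
rewrite !Cexp_pow. change (Cexp (Ci * (PI / 2)) ^ S (odds j)) with (Cexp (Ci * (PI / 2)) * Cexp (Ci * (PI / 2)) ^ odds j).
change (Cexp (- (Ci * (PI / 2))) ^ S (odds j)) with (Cexp (- (Ci * (PI / 2))) * Cexp (- (Ci * (PI / 2))) ^ odds j).
rewrite Cexp_opp_iPI2, Cexp_iPI2, !Cpow_odds.
replace (- Ci * - Ci) with (Ci * Ci) by ring. rewrite Ci_sqr.
split; [transitivity (Ci * Ci * (- 1) ^ j)|transitivity (Ci * Ci * (- 1) ^ j)]; try ring; rewrite Ci_sqr; ring.
Qed.

Lemma phase_0 (n : nat) : Cexp (INR n * 0) = 1 /\ Cexp (- (INR n * 0)) = 1.
Proof. rewrite Cmult_0_r, Copp_0, Cexp_0. auto. Qed.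

(** On the line Im = PI / 2, csch is [- Ci] times sech. Here and in the next three lemmas, even
    nodes give the sum at [Y] and odd nodes the sum at [Y + P / 2]; the phase 0 gives [latD], and
    the phase [Ci * (PI / 2)], whose powers alternate, gives [latB]. *)
Lemma sech_pairs_D (P Y : R) : (0 < P)%R ->
  RtoC (/ cosh Y) + CSeries (sech_pair P evens 0 Y) = Ci * latD P (Y + Ci * (PI / 2)).
Proof.
intros hP. unfold latD. destruct (zsum_center _ (geomZ_csch P (Y + Ci * (PI / 2)) hP)) as [G ->].
rewrite line_point, csch_on_line. rewrite Rmult_0_l, Rminus_0_r.
assert (E : forall n, Ci * (csch (Y + Ci * (PI / 2) - IZR (1 + Z.of_nat n) * P) + csch (Y + Ci * (PI / 2) - IZR (- (1 + Z.of_nat n)) * P))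
  = sech_pair P evens 0 Y n).
{ intros n. rewrite !line_point, !csch_on_line. destruct (node_evens P Y n) as [-> ->]. unfold sech_pair.
  destruct (phase_0 (evens n)) as [-> ->]. transitivity (- (Ci * Ci) * (RtoC (/ cosh (Y - node P evens n)) + RtoC (/ cosh (Y + node P evens n)))); [ring|].
  rewrite Ci_sqr. ring. }
rewrite <- (CSeries_ext _ _ E), CSeries_scal by exact G.
transitivity (- (Ci * Ci) * RtoC (/ cosh Y) + Ci * CSeries (fun n => csch (Y + Ci * (PI / 2) - IZR (1 + Z.of_nat n) * P) + csch (Y + Ci * (PI / 2) - IZR (- (1 + Z.of_nat n)) * P)));
 [rewrite Ci_sqr; ring|ring].
Qed.

Lemma sech_pairs_B (P Y : R) : (0 < P)%R ->
  RtoC (/ cosh Y) + CSeries (sech_pair P evens (Ci * (PI / 2)) Y) = Ci * latB P (Y + Ci * (PI / 2)).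
Proof.
intros hP. unfold latB. destruct (zsum_center _ (geomZ_sg _ (geomZ_csch P (Y + Ci * (PI / 2)) hP))) as [G ->].
rewrite line_point, csch_on_line. rewrite Rmult_0_l, Rminus_0_r.
assert (E : forall n, Ci * (sg (1 + Z.of_nat n) * csch (Y + Ci * (PI / 2) - IZR (1 + Z.of_nat n) * P) +
   sg (- (1 + Z.of_nat n)) * csch (Y + Ci * (PI / 2) - IZR (- (1 + Z.of_nat n)) * P))
  = sech_pair P evens (Ci * (PI / 2)) Y n).
{ intros n. rewrite !line_point, !csch_on_line, sg_opp. destruct (node_evens P Y n) as [-> ->]. unfold sech_pair.
  destruct (phase_evens n) as [-> ->]. destruct (sg_of_nat n) as [_ ->].
  transitivity ((Ci * Ci) * (- 1) ^ n * (RtoC (/ cosh (Y - node P evens n)) + RtoC (/ cosh (Y + node P evens n)))); [ring|].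
  rewrite Ci_sqr. ring. }
rewrite <- (CSeries_ext _ _ E), CSeries_scal by exact G.
replace (sg 0) with (RtoC 1) by reflexivity.
match goal with |- _ + Ci * ?s = _ => transitivity (- (Ci * Ci) * RtoC (/ cosh Y) + Ci * s); [rewrite Ci_sqr; ring|ring] end.
Qed.

Lemma sech_pairs_D_half (P Y : R) : (0 < P)%R ->
  CSeries (sech_pair P odds 0 Y) = Ci * latD P (Y + Ci * (PI / 2) + P / 2).
Proof.
intros hP. rewrite line_half. unfold latD, zsum. rewrite <- CSeries_scal by (apply (geomZ_pair _ (geomZ_csch P _ hP))).
apply CSeries_ext. intros n. rewrite !line_point, !csch_on_line. destruct (node_odds P Y n) as [-> ->]. unfold sech_pair.
destruct (phase_0 (odds n)) as [-> ->].
transitivity (- (Ci * Ci) * (RtoC (/ cosh (Y - node P odds n)) + RtoC (/ cosh (Y + node P odds n)))); [rewrite Ci_sqr; ring|ring].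
Qed.

Lemma sech_pairs_B_half (P Y : R) : (0 < P)%R ->
  CSeries (sech_pair P odds (Ci * (PI / 2)) Y) = - latB P (Y + Ci * (PI / 2) + P / 2).
Proof.
intros hP. rewrite line_half. unfold latB, zsum. rewrite <- CSeries_opp by (apply (geomZ_pair _ (geomZ_sg _ (geomZ_csch P _ hP)))).
apply CSeries_ext. intros n. rewrite !line_point, !csch_on_line. destruct (node_odds P Y n) as [-> ->]. unfold sech_pair.
destruct (phase_odds n) as [-> ->]. destruct (sg_of_nat n) as [-> ->]. ring.
Qed.

Lemma latA_center (P Y : R) : (0 < P)%R ->
  latA P (Y + Ci * (PI / 2)) = RtoC (tanh Y) + CSeries (fun n => - (- 1) ^ n * (RtoC (tanh (Y + node P evens n)) + RtoC (tanh (Y - node P evens n)))).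
Proof.
intros hP. unfold latA. destruct (zsum_center _ (geomZ_sg _ (geomZ_coth P (Y + Ci * (PI / 2)) hP))) as [G ->].
rewrite line_point, coth_on_line. rewrite Rmult_0_l, Rminus_0_r.
replace (sg 0) with (RtoC 1) by reflexivity. replace (coth_limit 0) with (RtoC 1) by reflexivity.
rewrite Cplus_assoc. f_equal; [ring|]. apply CSeries_ext. intros n.
rewrite !line_point, !coth_on_line, sg_opp. destruct (node_evens P Y n) as [-> ->]. destruct (sg_of_nat n) as [_ ->].
unfold coth_limit. replace (1 + Z.of_nat n <=? 0)%Z with false by (symmetry; apply Z.leb_gt; lia).
replace (- (1 + Z.of_nat n) <=? 0)%Z with true by (symmetry; apply Z.leb_le; lia). ring.
Qed.

(** The [- 2] gathers the two renormalising limits; it makes the alternating series converge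
    absolutely and disappears in differences of two such series. *)
Definition coth_pair (x y : R) (n : nat) : C := (- 1) ^ n * (RtoC x - RtoC y - 2).

Lemma latA_half_line (P Y : R) : (0 < P)%R ->
  let a := fun n => coth_pair (tanh (Y + node P odds n)) (tanh (Y - node P odds n)) n in
  geom a /\ latA P (Y + Ci * (PI / 2) + P / 2) = 1 + CSeries a.
Proof.
intros hP a. rewrite line_half. set (z := (Y + P / 2)%R + Ci * (PI / 2)).
pose proof (geomZ_pair _ (geomZ_sg _ (geomZ_coth P z hP))) as G.
assert (E : forall n, sg (- Z.of_nat n) * (coth (z - IZR (- Z.of_nat n) * P) - coth_limit (- Z.of_nat n)) +
  sg (1 + Z.of_nat n) * (coth (z - IZR (1 + Z.of_nat n) * P) - coth_limit (1 + Z.of_nat n)) = a n).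
{ intros n. unfold z, a, coth_pair. rewrite !line_point, !coth_on_line. destruct (node_odds P Y n) as [-> ->].
  destruct (sg_of_nat n) as [-> ->]. unfold coth_limit.
  replace (1 + Z.of_nat n <=? 0)%Z with false by (symmetry; apply Z.leb_gt; lia).
  replace (- Z.of_nat n <=? 0)%Z with true by (symmetry; apply Z.leb_le; lia). ring. }
split; [exact (geom_ext _ _ E G)|]. unfold latA, zsum. f_equal. now apply CSeries_ext.
Qed.

Lemma coth_RtoC (x : R) : x <> 0%R -> coth x = RtoC (cosh x / sinh x).
Proof.
intros hx. assert (n : Csinh x <> 0) by (apply Csinh_neq_0_Re; exact hx).
unfold coth. rewrite Csinh_RtoC in *. rewrite Ccosh_RtoC, RtoC_div; [reflexivity|].
intros e. apply n. now rewrite e.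
Qed.

Lemma node_pos (P : R) (j : nat) : (0 < P)%R -> (0 < node P odds j)%R.
Proof.
intros hP. unfold node. assert (0 < INR (odds j))%R by (apply lt_0_INR; unfold odds; lia).
assert (0 < INR (odds j) * P)%R by (now apply Rmult_lt_0_compat). lra.
Qed.

Lemma latA_half (P : R) : (0 < P)%R ->
  let a := fun n => coth_pair (cosh (node P odds n) / sinh (node P odds n)) (- (cosh (node P odds n) / sinh (node P odds n))) n in
  geom a /\ latA P (P / 2) = 1 + CSeries a.
Proof.
intros hP a.
pose proof (geomZ_pair _ (geomZ_sg _ (geomZ_coth P (P / 2) hP))) as G.
assert (E : forall n, sg (- Z.of_nat n) * (coth (P / 2 - IZR (- Z.of_nat n) * P) - coth_limit (- Z.of_nat n)) +
  sg (1 + Z.of_nat n) * (coth (P / 2 - IZR (1 + Z.of_nat n) * P) - coth_limit (1 + Z.of_nat n)) = a n).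
{ intros n. unfold a, coth_pair. pose proof (node_pos P n hP) as hn.
  destruct (node_odds P 0 n) as [E1 E2]. rewrite !Rplus_0_l in E1. rewrite Rplus_0_l, Rminus_0_l in E2.
  replace (P / 2 - IZR (- Z.of_nat n) * P) with (RtoC (node P odds n)) by (rewrite <- E1, RtoC_minus, RtoC_mult, RtoC_div by lra; ring).
  replace (P / 2 - IZR (1 + Z.of_nat n) * P) with (- RtoC (node P odds n)) by (rewrite <- RtoC_opp, <- E2, RtoC_minus, RtoC_mult, RtoC_div by lra; ring).
  rewrite coth_opp by (apply Csinh_neq_0_Re; simpl; lra). rewrite coth_RtoC by lra.
  destruct (sg_of_nat n) as [-> ->]. unfold coth_limit.
  replace (1 + Z.of_nat n <=? 0)%Z with false by (symmetry; apply Z.leb_gt; lia).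
  replace (- Z.of_nat n <=? 0)%Z with true by (symmetry; apply Z.leb_le; lia). rewrite RtoC_opp. ring. }
split; [exact (geom_ext _ _ E G)|]. unfold latA, zsum. f_equal. now apply CSeries_ext.
Qed.

Lemma sinh_minus (x y : R) : (sinh (x - y) = sinh x * cosh y - cosh x * sinh y)%R.
Proof. unfold sinh, cosh. replace (- (x - y))%R with (- x + y)%R by ring. unfold Rminus. rewrite !exp_plus. field. Qed.

Lemma cosh_minus (x y : R) : (cosh (x - y) = cosh x * cosh y - sinh x * sinh y)%R.
Proof. unfold sinh, cosh. replace (- (x - y))%R with (- x + y)%R by ring. unfold Rminus. rewrite !exp_plus. field. Qed.

Lemma sinh_neq_0 (x : R) : x <> 0%R -> sinh x <> 0%R.
Proof.
intros hx. destruct (Rlt_dec 0 x) as [h|h].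
- pose proof (sinh_ge_id x ltac:(lra)). lra.
- pose proof (sinh_ge_id (- x) ltac:(lra)). rewrite sinh_opp in H. lra.
Qed.

(** Here and in the next three lemmas, one of the arguments [a], [Y], [Y + a] is a combination of
    the other two, and the subtraction formula separates the coefficient at [a] from the kernel at
    [Y + a]. *)
Lemma sech_tanh_sum (Y a : R) : (sinh Y * (/ cosh a * tanh (Y + a)) = cosh Y * / cosh a - / cosh (Y + a))%R.
Proof.
assert (E : (cosh a = cosh (Y + a) * cosh Y - sinh (Y + a) * sinh Y)%R) by (rewrite <- cosh_minus; f_equal; ring).
pose proof (cosh_pos a). pose proof (cosh_pos (Y + a)). unfold tanh.
apply (Rmult_eq_reg_r (cosh a * cosh (Y + a))); [|apply Rmult_integral_contrapositive_currified; lra].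
transitivity (sinh Y * sinh (Y + a))%R; [field; lra|].
transitivity (cosh Y * cosh (Y + a) - cosh a)%R; [lra|field; lra].
Qed.

Lemma csch_tanh_sum (Y a : R) : a <> 0%R ->
  (cosh Y * (/ sinh a * tanh (Y + a)) = sinh Y * / sinh a + / cosh (Y + a))%R.
Proof.
intros ha. assert (E : (sinh a = sinh (Y + a) * cosh Y - cosh (Y + a) * sinh Y)%R) by (rewrite <- sinh_minus; f_equal; ring).
pose proof (sinh_neq_0 a ha). pose proof (cosh_pos (Y + a)). unfold tanh.
apply (Rmult_eq_reg_r (sinh a * cosh (Y + a))); [|apply Rmult_integral_contrapositive_currified; lra].
transitivity (cosh Y * sinh (Y + a))%R; [field; lra|].
transitivity (sinh Y * cosh (Y + a) + sinh a)%R; [lra|field; lra].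
Qed.

Lemma sech_sech_sum (Y a : R) : (sinh Y * (/ cosh a * / cosh (Y + a)) = tanh (Y + a) - tanh a)%R.
Proof.
assert (E : (sinh Y = sinh (Y + a) * cosh a - cosh (Y + a) * sinh a)%R) by (rewrite <- sinh_minus; f_equal; ring).
pose proof (cosh_pos a). pose proof (cosh_pos (Y + a)). unfold tanh. rewrite E. field. lra.
Qed.

Lemma csch_sech_sum (Y a : R) : a <> 0%R ->
  (cosh Y * (/ sinh a * / cosh (Y + a)) = cosh a / sinh a - tanh (Y + a))%R.
Proof.
intros ha. assert (E : (cosh Y = cosh (Y + a) * cosh a - sinh (Y + a) * sinh a)%R) by (rewrite <- cosh_minus; f_equal; ring).
pose proof (sinh_neq_0 a ha). pose proof (cosh_pos (Y + a)). unfold tanh. rewrite E. field. lra.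
Qed.

Lemma node_arg (P y : R) (l : nat -> nat) (j : nat) :
  (PI * (y + INR (l j) * P / (2 * PI)) = PI * y + node P l j)%R /\
  (PI * (y - INR (l j) * P / (2 * PI)) = PI * y - node P l j)%R.
Proof. pose proof PI_RGT_0. unfold node. split; field; lra. Qed.

Definition tanh_kernel (s : R) (b : R) : C := Ci * (RtoC (tanh (PI * b)) - s).
Definition sech_kernel (b : R) : C := RtoC (/ cosh (PI * b)).

Lemma tanh_kernel_bounded (s b : R) : (Cmod (tanh_kernel s b) <= 1 + Rabs s)%R.
Proof.
unfold tanh_kernel. rewrite Cmod_mult, Cmod_Ci, Rmult_1_l, <- RtoC_minus, Cmod_R.
pose proof (abs_tanh_le_1 (PI * b)). eapply Rle_trans; [apply Rabs_triang|]. rewrite Rabs_Ropp. lra.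
Qed.

Lemma sech_kernel_bounded (b : R) : (Cmod (sech_kernel b) <= 1)%R.
Proof. unfold sech_kernel. rewrite Cmod_R. pose proof (sech_le_1 (PI * b)). rewrite Rabs_pos_eq; lra. Qed.

(** Makes the bounds on transformed series available for the expansion itself, as the case of a
    constant kernel. *)
Lemma trig_one (P : R) (c0 : C) (p q : nat -> C) (l : nat -> nat) (th : C) :
  trig c0 p q l th = trig_sum P c0 p q l th (fun _ => 1) 0.
Proof. unfold trig, trig_sum. rewrite Cmult_1_r. f_equal. apply CSeries_ext. intros j. unfold trig_term. ring. Qed.

(** By [sech_tanh_sum] the products split in two: the coefficients alone sum to the expansion at
    [th], that is to a lattice sum at [P / 2 + th], and the rest are sech pairs. *)
Lemma trig_sum_sech_tanh (P s y : R) (c0 th : C) (l : nat -> nat) : (0 < P)%R -> (forall j, (2 * j < l j)%nat) -> Re th = 0%R ->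
  let Y := (PI * y)%R in
  sinh Y * trig_sum P c0 (sech_at P l) (sech_at P l) l th (tanh_kernel s) y =
  Ci * ((cosh Y - s * sinh Y) * trig c0 (sech_at P l) (sech_at P l) l th - (c0 * RtoC (/ cosh Y) + CSeries (sech_pair P l th Y))).
Proof.
intros hP hl hth Y. rewrite (trig_one P). unfold trig_sum.
set (p := sech_at P l). assert (hp : coef_bounded P p l) by apply sech_at_bounded.
assert (Gt := trig_term_geom P p p l th (tanh_kernel s) _ y hP hp hp hl hth (tanh_kernel_bounded s)).
assert (Ga := trig_term_geom P p p l th (fun _ => 1) 1 0 hP hp hp hl hth (fun _ => Req_le _ _ Cmod_1)).
set (t := trig_term P p p l th (tanh_kernel s) y) in *. set (a := trig_term P p p l th (fun _ => 1) 0) in *.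
assert (E : forall j, (cosh Y - s * sinh Y) * a j + Ci * sinh Y * t j = sech_pair P l th Y j).
{ intros j. unfold a, t, trig_term, sech_pair, tanh_kernel, p, sech_at. destruct (node_arg P y l j) as [-> ->]. fold Y. fold (node P l j).
  set (x := node P l j). set (u := Cexp (INR (l j) * th)). set (v := Cexp (- (INR (l j) * th))).
  pose proof (sech_tanh_sum Y x) as h1. pose proof (sech_tanh_sum Y (- x)) as h2.
  rewrite cosh_opp in h2. replace (Y + - x)%R with (Y - x)%R in h2 by ring.
  apply (f_equal RtoC) in h1, h2. rewrite RtoC_minus, !RtoC_mult in h1, h2.
  set (X := RtoC (/ cosh x)) in *. set (T1 := RtoC (tanh (Y + x))) in *. set (T2 := RtoC (tanh (Y - x))) in *.
  set (S1 := RtoC (/ cosh (Y + x))) in *. set (S2 := RtoC (/ cosh (Y - x))) in *.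
  transitivity (cosh Y * X * (u + v) - s * sinh Y * X * (u + v) + (Ci * Ci) * (u * (sinh Y * (X * T1)) + v * (sinh Y * (X * T2)) - s * sinh Y * X * (u + v))); [ring|].
  rewrite h1, h2, Ci_sqr. ring. }
assert (Gb : geom (sech_pair P l th Y)).
{ apply (geom_ext _ _ E). apply geom_plus; now apply geom_scal. }
assert (ET : sinh Y * CSeries t = - Ci * CSeries (sech_pair P l th Y) + Ci * (cosh Y - s * sinh Y) * CSeries a).
{ apply CSeries_comb; [easy|easy|easy|]. intros j. rewrite <- E.
  transitivity (- (Ci * Ci) * sinh Y * t j); [rewrite Ci_sqr; ring|ring]. }
assert (E0 : sinh Y * (RtoC (tanh Y)) = cosh Y - RtoC (/ cosh Y)).
{ pose proof (sech_tanh_sum Y 0) as h. rewrite Rplus_0_r, cosh_0 in h.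
  rewrite <- RtoC_mult, <- RtoC_minus. f_equal. lra. }
rewrite Cmult_plus_distr_l, ET. unfold tanh_kernel. fold Y.
transitivity (c0 * Ci * (sinh Y * RtoC (tanh Y)) - c0 * Ci * s * sinh Y + (- Ci * CSeries (sech_pair P l th Y) + Ci * (cosh Y - s * sinh Y) * CSeries a)); [ring|].
rewrite E0. ring.
Qed.

Lemma trig_sum_csch_tanh (P s y : R) (th : C) : (0 < P)%R -> Re th = 0%R ->
  let Y := (PI * y)%R in let p := fun j => - csch_at P odds j in
  cosh Y * trig_sum P 0 p (csch_at P odds) odds th (tanh_kernel s) y =
  Ci * ((sinh Y - s * cosh Y) * trig 0 p (csch_at P odds) odds th - CSeries (sech_pair P odds th Y)).
Proof.
intros hP hth Y p. rewrite (trig_one P). unfold trig_sum.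
set (q := csch_at P odds). assert (hl : forall j, (2 * j < odds j)%nat) by (intros; unfold odds; lia).
assert (hq : coef_bounded P q odds) by (apply csch_at_bounded; [easy|intros; unfold odds; lia]).
assert (hp : coef_bounded P p odds) by now apply coef_bounded_opp.
assert (Gt := trig_term_geom P p q odds th (tanh_kernel s) _ y hP hp hq hl hth (tanh_kernel_bounded s)).
assert (Ga := trig_term_geom P p q odds th (fun _ => 1) 1 0 hP hp hq hl hth (fun _ => Req_le _ _ Cmod_1)).
set (t := trig_term P p q odds th (tanh_kernel s) y) in *. set (a := trig_term P p q odds th (fun _ => 1) 0) in *.
assert (E : forall j, (sinh Y - s * cosh Y) * a j + Ci * cosh Y * t j = sech_pair P odds th Y j).
{ intros j. unfold a, t, trig_term, sech_pair, tanh_kernel, p, q, csch_at. destruct (node_arg P y odds j) as [-> ->]. fold Y. fold (node P odds j).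
  pose proof (node_pos P j hP). set (x := node P odds j) in *. set (u := Cexp (INR (odds j) * th)). set (v := Cexp (- (INR (odds j) * th))).
  pose proof (csch_tanh_sum Y x ltac:(lra)) as h1. pose proof (csch_tanh_sum Y (- x) ltac:(lra)) as h2.
  rewrite sinh_opp, Rinv_opp in h2. replace (Y + - x)%R with (Y - x)%R in h2 by ring.
  assert (h3 : (cosh Y * (/ sinh x * tanh (Y - x)) = sinh Y * / sinh x - / cosh (Y - x))%R) by lra.
  apply (f_equal RtoC) in h1, h3. rewrite RtoC_plus, !RtoC_mult in h1. rewrite RtoC_minus, !RtoC_mult in h3.
  set (X := RtoC (/ sinh x)) in *. set (T1 := RtoC (tanh (Y + x))) in *. set (T2 := RtoC (tanh (Y - x))) in *.
  set (S1 := RtoC (/ cosh (Y + x))) in *. set (S2 := RtoC (/ cosh (Y - x))) in *.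
  transitivity (sinh Y * X * (v - u) - s * cosh Y * X * (v - u) + (Ci * Ci) * (v * (cosh Y * (X * T2)) - u * (cosh Y * (X * T1)) - s * cosh Y * X * (v - u))); [ring|].
  rewrite h1, h3, Ci_sqr. ring. }
assert (Gb : geom (sech_pair P odds th Y)).
{ apply (geom_ext _ _ E). apply geom_plus; now apply geom_scal. }
assert (ET : cosh Y * CSeries t = - Ci * CSeries (sech_pair P odds th Y) + Ci * (sinh Y - s * cosh Y) * CSeries a).
{ apply CSeries_comb; [easy|easy|easy|]. intros j. rewrite <- E.
  transitivity (- (Ci * Ci) * cosh Y * t j); [rewrite Ci_sqr; ring|ring]. }
rewrite Cmult_plus_distr_l, ET. ring.
Qed.

(** In the two products at [Y + a] and [Y - a], the parts [tanh a] cancel, which leaves the centred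
    form of [latA]. *)
Lemma trig_sum_A_sech (P y : R) : (0 < P)%R -> let Y := (PI * y)%R in
  sinh Y * trig_sum P 1 (sech_at P evens) (sech_at P evens) evens (Ci * (PI / 2)) sech_kernel y =
  latA P (Y + Ci * (PI / 2)).
Proof.
intros hP Y. rewrite latA_center by easy. unfold trig_sum. rewrite Cmult_plus_distr_l. f_equal.
- unfold sech_kernel. fold Y. rewrite Cmult_1_l, <- RtoC_mult. f_equal.
- set (p := sech_at P evens). assert (hp : coef_bounded P p evens) by apply sech_at_bounded.
  assert (Gt := trig_term_geom P p p evens (Ci * (PI / 2)) sech_kernel _ y hP hp hp
    ltac:(intros; unfold evens; lia) ltac:(simpl; field) sech_kernel_bounded).
  rewrite <- CSeries_scal by exact Gt. apply CSeries_ext. intros j.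
  unfold trig_term, sech_kernel, p, sech_at. destruct (node_arg P y evens j) as [-> ->]. fold Y. fold (node P evens j).
  destruct (phase_evens j) as [-> ->]. set (x := node P evens j).
  pose proof (sech_sech_sum Y x) as h1. pose proof (sech_sech_sum Y (- x)) as h2.
  rewrite cosh_opp, tanh_opp in h2. replace (Y + - x)%R with (Y - x)%R in h2 by ring.
  apply (f_equal RtoC) in h1, h2. rewrite RtoC_minus, !RtoC_mult in h1, h2. rewrite RtoC_opp in h2.
  match goal with |- ?l = _ => transitivity (- (- 1) ^ j * (sinh Y * (RtoC (/ cosh x) * RtoC (/ cosh (Y + x))) + sinh Y * (RtoC (/ cosh x) * RtoC (/ cosh (Y - x))))); [ring|] end.
  rewrite h1, h2. ring.
Qed.

(** For odd nodes the phases are opposite and the parts [tanh a] add up; they form the same series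
    at [Y = 0], which is the subtracted value of [latA]. *)
Lemma trig_sum_B_sech (P y : R) : (0 < P)%R -> let Y := (PI * y)%R in
  sinh Y * trig_sum P 0 (sech_at P odds) (sech_at P odds) odds (Ci * (PI / 2)) sech_kernel y =
  Ci * (latA P (Y + Ci * (PI / 2) + P / 2) - latA P (P / 2 + Ci * (PI / 2))).
Proof.
intros hP Y. destruct (latA_half_line P Y hP) as [G1 ->]. destruct (latA_half_line P 0 hP) as [G2 E2].
replace (P / 2 + Ci * (PI / 2)) with (0 + Ci * (PI / 2) + P / 2) by ring. rewrite E2.
unfold trig_sum. rewrite Cmult_0_l, Cplus_0_l.
set (p := sech_at P odds). assert (hp : coef_bounded P p odds) by apply sech_at_bounded.
assert (Gt := trig_term_geom P p p odds (Ci * (PI / 2)) sech_kernel _ y hP hp hp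
    ltac:(intros; unfold odds; lia) ltac:(simpl; field) sech_kernel_bounded).
match goal with |- _ = _ * (?o + ?s - (?o + ?r)) => transitivity (Ci * s + - Ci * r); [|ring] end.
apply CSeries_comb; [exact Gt|exact G1|exact G2|]. intros j.
unfold trig_term, sech_kernel, p, sech_at, coth_pair. destruct (node_arg P y odds j) as [-> ->]. fold Y. fold (node P odds j).
destruct (phase_odds j) as [-> ->]. set (x := node P odds j).
pose proof (sech_sech_sum Y x) as h1. pose proof (sech_sech_sum Y (- x)) as h2.
rewrite cosh_opp, tanh_opp in h2. replace (Y + - x)%R with (Y - x)%R in h2 by ring.
replace (0 + x)%R with x by ring. replace (0 - x)%R with (- x)%R by ring. rewrite tanh_opp.
apply (f_equal RtoC) in h1, h2. rewrite RtoC_minus, !RtoC_mult in h1, h2. rewrite RtoC_opp in *.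
match goal with |- ?l = _ => transitivity (Ci * (- 1) ^ j * (sinh Y * (RtoC (/ cosh x) * RtoC (/ cosh (Y + x))) - sinh Y * (RtoC (/ cosh x) * RtoC (/ cosh (Y - x))))); [ring|] end.
rewrite h1, h2. ring.
Qed.

(** With csch coefficients the parts depending on [a] alone are [coth a]; their series is [latA] at
    the real point [P / 2]. *)
Lemma trig_sum_D_sech (P y : R) : (0 < P)%R -> let Y := (PI * y)%R in
  cosh Y * trig_sum P 0 (fun j => - csch_at P odds j) (csch_at P odds) odds (Ci * (PI / 2)) sech_kernel y =
  Ci * (latA P (Y + Ci * (PI / 2) + P / 2) - latA P (P / 2)).
Proof.
intros hP Y. destruct (latA_half_line P Y hP) as [G1 ->]. destruct (latA_half P hP) as [G2 ->].
unfold trig_sum. rewrite Cmult_0_l, Cplus_0_l.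
set (q := csch_at P odds). assert (hq : coef_bounded P q odds) by (apply csch_at_bounded; [easy|intros; unfold odds; lia]).
assert (hp : coef_bounded P (fun j => - q j) odds) by now apply coef_bounded_opp.
assert (Gt := trig_term_geom P (fun j => - q j) q odds (Ci * (PI / 2)) sech_kernel _ y hP hp hq
    ltac:(intros; unfold odds; lia) ltac:(simpl; field) sech_kernel_bounded).
match goal with |- _ = _ * (?o + ?s - (?o + ?r)) => transitivity (Ci * s + - Ci * r); [|ring] end.
apply CSeries_comb; [exact Gt|exact G1|exact G2|]. intros j.
unfold trig_term, sech_kernel, q, csch_at, coth_pair. destruct (node_arg P y odds j) as [-> ->]. fold Y. fold (node P odds j).
destruct (phase_odds j) as [-> ->]. pose proof (node_pos P j hP). set (x := node P odds j) in *.
pose proof (csch_sech_sum Y x ltac:(lra)) as h1. pose proof (csch_sech_sum Y (- x) ltac:(lra)) as h2.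
rewrite cosh_opp, sinh_opp, Rinv_opp in h2. unfold Rdiv in h2. rewrite Rinv_opp in h2. replace (Y + - x)%R with (Y - x)%R in h2 by ring.
assert (h3 : (cosh Y * (/ sinh x * / cosh (Y - x)) = cosh x / sinh x + tanh (Y - x))%R) by (unfold Rdiv; lra).
apply (f_equal RtoC) in h1, h3. rewrite RtoC_minus, !RtoC_mult in h1. rewrite RtoC_plus, !RtoC_mult in h3. rewrite RtoC_opp.
match goal with |- ?l = _ => transitivity (- Ci * (- 1) ^ j * (cosh Y * (RtoC (/ sinh x) * RtoC (/ cosh (Y + x))) + cosh Y * (RtoC (/ sinh x) * RtoC (/ cosh (Y - x))))); [ring|] end.
rewrite h1, h3. ring.
Qed.

(** * Closed forms of the transforms in Jacobi functions *)

Lemma line_values (k y : R) : (0 < k < 1)%R ->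
  let P := period k in let b := lat_b P in let k' := compl_modulus k in
  let u := 2 * ellipticK k * y in let z := (PI * y)%R + Ci * (PI / 2) in
  dn u k' <> 0 /\
  (latA P z = k' * b * sn u k' /\ latB P z = - Ci * (k' * b) * cn u k' /\ latD P z = - Ci * b * dn u k') /\
  (latA P (z + P / 2) = k' * b * cn u k' / dn u k' /\ latB P (z + P / 2) = Ci * (k * k' * b) * sn u k' / dn u k' /\
   latD P (z + P / 2) = - Ci * (b * k) / dn u k') /\
  (latA P (P / 2) = b /\ latB P (P / 2) = b * k /\ latD P (P / 2) = 0) /\
  (latA P (P / 2 + Ci * (PI / 2)) = k' * b /\ latB P (P / 2 + Ci * (PI / 2)) = 0 /\
   latD P (P / 2 + Ci * (PI / 2)) = - Ci * (b * k)).
Proof.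
intros hk P b k' u z. pose proof (period_pos k hk) as hP. fold P in hP. pose proof PI_RGT_0 as hpi.
pose proof (lat_b_pos P hP) as hb. fold b in hb. pose proof (compl_modulus_range k hk) as hk'. fold k' in hk'.
assert (b0 : RtoC b <> 0) by (apply RtoC_neq_0; lra). assert (k0' : RtoC k' <> 0) by (apply RtoC_neq_0; lra).
assert (ea : lat_a P = (k' * b)%R) by now apply lat_a_period.
pose proof (lat_on_Im_PI2 k y hk) as L. cbv zeta in L. fold P in L. fold k' in L. rewrite <- RtoC_mult in L. fold z in L.
assert (eu : u = RtoC (2 * ellipticK k * y)) by (unfold u; now rewrite !RtoC_mult).
assert (hz : (0 < Im z < PI)%R).
{ unfold z. replace (Im ((PI * y)%R + Ci * (PI / 2))) with (PI / 2)%R; [lra|]. unfold Cdiv, Cinv, Cmult, Cplus, Ci, RtoC; simpl. field. }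
assert (hz' : (0 < Im (z + P / 2) < PI)%R).
{ replace (Im (z + P / 2)) with (Im z); [easy|]. rewrite <- RtoC_div by lra. destruct z; simpl; ring. }
destruct (lat_shift_half P z hP ltac:(now right) ltac:(now apply off_Im)) as [D0 [GA [GB GD]]].
unfold P in GB, GD. rewrite kap_period, compl_modulus_involutive in GB, GD by easy. fold P in GB, GD. fold b in GA, GB, GD.
rewrite eu, sn_R, cn_R, dn_R by easy. set (v := (2 * ellipticK k * y)%R) in *.
destruct L as [LA [LB LD]]. rewrite ea, RtoC_mult in LA, LB. fold b in LD. rewrite LD in D0.
assert (d0 : RtoC (Rdn v k') <> 0) by (intros e; apply D0; rewrite e; ring).
destruct (lat_half_values P hP) as [VA [VB VD]]. unfold P in VB. rewrite kap_period, compl_modulus_involutive in VB by easy.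
fold P in VB. fold b in VA, VB.
assert (hh : (0 < Re (P / 2) < P)%R) by (rewrite <- RtoC_div by lra; simpl; lra).
destruct (lat_shift_iPI2 P (P / 2) hP hh) as [WA [WB WD]]. rewrite ea, VA, VB, VD, RtoC_mult in *. fold b in WA, WD.
rewrite GA, GB, GD, LA, LB, LD, WA, WB, WD. pose proof Ci_neq_0 as i0. pose proof Cinv_Ci as iv.
split; [exact d0|]. split; [split; [|split]; ring|]. split; [split; [|split]|split; [split; [|split]|split; [|split]]].
- field. repeat split; assumption.
- transitivity (- (k * k' * b * Rsn v k' / Rdn v k' * / Ci)); [field; repeat split; assumption|]. rewrite iv. field. repeat split; assumption.
- transitivity (b * k / Rdn v k' * / Ci); [field; repeat split; assumption|]. rewrite iv. field. repeat split; assumption.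
- ring.
- ring.
- ring.
- field. repeat split; assumption.
- field. repeat split; assumption.
- field. repeat split; assumption.
Qed.

Lemma Re_iPI2 : Re (Ci * (PI / 2)) = 0%R.
Proof. simpl. field. Qed.

Lemma trig_of_strip (P : R) (G : C -> C) (c0 th : C) (p q : nat -> C) (l : nat -> nat) : (0 < P)%R -> Re th = 0%R ->
  strip_series P G c0 p q l -> trig c0 p q l th = G (P / 2 + th).
Proof. intros hP hth [_ [_ [_ H]]]. symmetry. apply H. rewrite hth, Rabs_R0. lra. Qed.

(** Nine closed forms for eighteen transforms: the first six serve with [s = 1] and [s = - 1], the
    last three with the variables [x] and [x - Ci / 2]. *)
Lemma strip_sums (k y : R) : (0 < k < 1)%R ->
  let P := period k in let b := lat_b P in let k' := compl_modulus k in
  let u := 2 * ellipticK k * y in let S := RtoC (sinh (PI * y)) in let H := RtoC (cosh (PI * y)) in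
  let h := Ci * (PI / 2) in
  let TA th phi := trig_sum P 1 (sech_at P evens) (sech_at P evens) evens th phi y in
  let TB th phi := trig_sum P 0 (sech_at P odds) (sech_at P odds) odds th phi y in
  let TD th phi := trig_sum P 0 (fun j => - csch_at P odds j) (csch_at P odds) odds th phi y in
  (forall s : R,
    S * TA 0 (tanh_kernel s) = Ci * b * (H - s * S - dn u k') /\
    S * TB 0 (tanh_kernel s) = Ci * (b * k) * (H - s * S - nd u k') /\
    H * TD 0 (tanh_kernel s) = - Ci * (b * k) * nd u k' /\
    S * TA h (tanh_kernel s) = Ci * (k' * b) * (H - s * S - cn u k') /\
    S * TB h (tanh_kernel s) = - (k * k' * b) * sd u k' /\
    H * TD h (tanh_kernel s) = b * k * (S - s * H - k' * sd u k')) /\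
  S * TA h sech_kernel = k' * b * sn u k' /\
  S * TB h sech_kernel = Ci * (k' * b) * (cd u k' - 1) /\
  H * TD h sech_kernel = Ci * b * (k' * cd u k' - 1).
Proof.
intros hk P b k' u S H h TA TB TD. pose proof (period_pos k hk) as hP. fold P in hP.
destruct (line_values k y hk) as [d0 [[LA [LB LD]] [[MA [MB MD]] [[VA [VB VD]] [WA [WB WD]]]]]].
fold P b k' u in d0, LA, LB, LD, MA, MB, MD, VA, VB, VD, WA, WB, WD.
assert (he : forall j, (2 * j < evens j)%nat) by (intros; unfold evens; lia).
assert (ho : forall j, (2 * j < odds j)%nat) by (intros; unfold odds; lia).
assert (r0 : Re 0 = 0%R) by reflexivity. pose proof Re_iPI2 as r1. fold h in r1, WA, WB, WD, LA, LB, LD, MA, MB, MD.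
split.
- intros s. unfold TA, TB, TD, S, H.
  rewrite !(trig_sum_sech_tanh P s y) by assumption. rewrite !(trig_sum_csch_tanh P s y) by assumption.
  rewrite (trig_of_strip P (latA P) 1 0 _ _ _ hP r0 (strip_series_A P hP)), (trig_of_strip P (latA P) 1 h _ _ _ hP r1 (strip_series_A P hP)).
  rewrite (trig_of_strip P (latB P) 0 0 _ _ _ hP r0 (strip_series_B P hP)), (trig_of_strip P (latB P) 0 h _ _ _ hP r1 (strip_series_B P hP)).
  rewrite (trig_of_strip P (latD P) 0 0 _ _ _ hP r0 (strip_series_D P hP)), (trig_of_strip P (latD P) 0 h _ _ _ hP r1 (strip_series_D P hP)).
  rewrite !Cmult_1_l, !Cmult_0_l, !Cplus_0_l, !Cplus_0_r.
  unfold h at 2 4 6. rewrite sech_pairs_D, sech_pairs_B, !sech_pairs_D_half, sech_pairs_B_half by assumption. fold h.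
  rewrite LB, LD, MB, MD, VA, VB, VD, WA, WB, WD. unfold nd, sd.
  split; [|split; [|split; [|split; [|split]]]]; unfold Cdiv; ring [Ci_sqr].
- pose proof (trig_sum_A_sech P y hP) as EA. pose proof (trig_sum_B_sech P y hP) as EB. pose proof (trig_sum_D_sech P y hP) as ED.
  cbv zeta in EA, EB, ED. fold h in EA, EB, ED. rewrite LA in EA. rewrite MA, WA in EB. rewrite MA, VA in ED.
  split; [exact EA|]. unfold TB, TD, S, H, cd. split; [rewrite EB|rewrite ED]; unfold Cdiv; ring.
Qed.

(** * From closed forms to Fourier transforms *)

Lemma kernel_ext (kappa : C -> C) (e : R) (phi psi : R -> C) : (forall b, phi b = psi b) ->
  kernel kappa e phi -> kernel kappa e psi.
Proof. intros E [H1 H2]. split; [|exact H2]. intros b. rewrite <- E. apply H1. Qed.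

Lemma is_Fourier_strip (P L y : R) (kappa G f : C -> C) (phi : R -> C) (c c0 th : C) (p q : nat -> C) (l : nat -> nat) :
  (0 < P)%R -> (forall b, (Cmod (phi b) <= L)%R) -> Re th = 0%R -> strip_series P G c0 p q l ->
  (forall e, (0 < e < 1 / 2)%R -> kernel kappa e phi) ->
  (forall x, (0 < Im x < 1 / 2)%R -> f x = c * (G (P / 2 + (Ci * P * x + th)) * kappa x)) ->
  is_Fourier f y (c * trig_sum P c0 p q l th phi y).
Proof.
intros hP hL hth HG K hf e he.
apply (intR_ext (fun t => c * (wave y (t, e) * (G (P / 2 + (Ci * P * (t, e) + th)) * kappa (t, e))))).
- intros t. cbv beta zeta. rewrite (hf (t, e)) by exact he. fold (wave y (t, e)). ring.
- apply intR_scal. apply (FT_strip P e L); [easy| |now apply K|easy|easy|easy]. rewrite Rabs_pos_eq; lra.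
Qed.

(** In terms of [x - Ci / 2], the line of integration has height [e - 1 / 2], between - 1/2 and 0,
    and the wave acquires the factor [exp (- (PI * y))]. *)
Lemma is_Fourier_shifted (P L y : R) (kappa G f : C -> C) (phi : R -> C) (c c0 th : C) (p q : nat -> C) (l : nat -> nat) :
  (0 < P)%R -> (forall b, (Cmod (phi b) <= L)%R) -> Re th = 0%R -> strip_series P G c0 p q l ->
  (forall e, (- (1 / 2) < e < 0)%R -> kernel kappa e phi) ->
  (forall x, (0 < Im x < 1 / 2)%R -> f x = c * (G (P / 2 + (Ci * P * (x - Ci / 2) + th)) * kappa (x - Ci / 2))) ->
  is_Fourier f y (c * (exp (- (PI * y)) * trig_sum P c0 p q l th phi y)).
Proof.
intros hP hL hth HG K hf e he.
assert (Ex : forall t, ((t, e) - Ci / 2) = (t, (e - 1 / 2)%R)).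
{ intros t. unfold Ci, Cminus, Cdiv, Cinv, Cmult, Cplus, Copp, RtoC; simpl. f_equal; field. }
assert (W : forall t, wave y (t, e) = exp (- (PI * y)) * wave y (t, (e - 1 / 2)%R)).
{ intros t. rewrite <- Cexp_RtoC. unfold wave. rewrite <- Cexp_plus. f_equal. rewrite <- Ex.
  rewrite RtoC_opp, RtoC_mult. transitivity (2 * PI * Ci * (t, e) * y + (- (PI * y) - Ci * Ci * (PI * y))); [rewrite Ci_sqr; ring|field]. }
apply (intR_ext (fun t => c * (exp (- (PI * y)) * (wave y (t, (e - 1 / 2)%R) * (G (P / 2 + (Ci * P * (t, (e - 1 / 2)%R) + th)) * kappa (t, (e - 1 / 2)%R)))))).
- intros t. cbv beta zeta. rewrite (hf (t, e)) by exact he. fold (wave y (t, e)). rewrite W, Ex. ring.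
- do 2 apply intR_scal. apply (FT_strip P (e - 1 / 2) L); [easy| |apply K; lra|easy|easy|easy]. rewrite Rabs_left; lra.
Qed.

(** The closed form is known after multiplication by [D]. Off 0 it can be divided; if [D] vanishes
    at 0, then [N] does as well, and the quotient tends to the transform at 0 because [g * T] is
    continuous. In use, [g] is 1 or the factor of the half shift. *)
Lemma Fourier_eq_intro (f : C -> C) (a c : C) (N : R -> C) (D g : R -> R) (T : R -> C) (K : R) : a <> 0 ->
  (forall y, is_Fourier f y (c * (g y * T y))) -> (forall s t, (Cmod (T s - T t) <= K * Rabs (s - t))%R) ->
  (forall t, continuity_pt g t) -> (forall t, c * (g t * T t) * D t = a * N t) -> (forall t, t <> 0%R -> D t <> 0%R) ->
  Fourier_eq f a N D.
Proof.
intros ha HF HT Hg HN HD y. exists (c * (g y * T y) / a). split; [|].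
2: { replace (a * (c * (g y * T y) / a)) with (c * (g y * T y)) by (field; exact ha). apply HF. }
assert (Q : forall t, D t <> 0%R -> N t / D t = c * (g t * T t) / a).
{ intros t ht. assert (d0 : RtoC (D t) <> 0) by now apply RtoC_neq_0.
  transitivity (a * N t / (a * D t)); [field; split; assumption|]. rewrite <- HN. field. split; assumption. }
destruct (Req_dec (D y) 0) as [e|e]; [right|left; split; [exact e|symmetry; now apply Q]].
assert (N0 : N y = 0).
{ transitivity (a * N y / a); [field; exact ha|]. rewrite <- HN, e. field. exact ha. }
split; [exact N0|]. split; [exact e|].
assert (y0 : y = 0%R) by (destruct (Req_dec y 0) as [h|h]; [exact h|]; now apply HD in h).
intros V [eps HV].
(* The increment of [g * T] splits into [g t] times that of [T] and that of [g] times [T y]. The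
   choices of [w] and of the radius bound each part by [q], and [B * (2 * q) < eps]. *)
set (B := (Cmod c / Cmod a)%R). assert (hB : (0 <= B)%R) by (apply Rdiv_le_0_compat; [apply Cmod_ge_0|now apply Cmod_gt_0]).
set (m := (Rabs (g y) + 1)%R). assert (hm : (1 <= m)%R) by (unfold m; pose proof (Rabs_pos (g y)); lra).
pose proof (Cmod_ge_0 (T y)) as hTy. pose proof (cond_pos eps) as he.
set (K1 := (Rabs K + 1)%R). assert (hK : (1 <= K1)%R) by (unfold K1; pose proof (Rabs_pos K); lra).
set (q := (eps / (2 * (B + 1)))%R). assert (hq : (0 < q)%R) by (apply Rdiv_lt_0_compat; lra).
set (w := Rmin 1 (q / (Cmod (T y) + 1))). assert (hw : (0 < w)%R) by (apply Rmin_pos; [lra|apply Rdiv_lt_0_compat; lra]).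
destruct (Hg y w hw) as [d [hd Hd]].
assert (hdd : (0 < Rmin d (q / (m * K1)))%R) by (apply Rmin_pos; [easy|apply Rdiv_lt_0_compat; nra]).
exists (mkposreal _ hdd). intros t ht nt. change (Rabs (t - y) < Rmin d (q / (m * K1)))%R in ht.
rewrite Q by (apply HD; congruence). apply HV.
assert (ht1 : (Rabs (t - y) < d)%R) by (eapply Rlt_le_trans; [exact ht|apply Rmin_l]).
assert (ht2 : (Rabs (t - y) < q / (m * K1))%R) by (eapply Rlt_le_trans; [exact ht|apply Rmin_r]).
assert (g1 : (Rabs (g t - g y) < w)%R).
{ apply (Hd t). split; [split; [exact I|congruence]|exact ht1]. }
pose proof (Rmin_l 1 (q / (Cmod (T y) + 1))). pose proof (Rmin_r 1 (q / (Cmod (T y) + 1))). fold w in H, H0.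
assert (g2 : (Rabs (g t) <= m)%R).
{ unfold m. replace (g t) with (g y + (g t - g y))%R by ring. eapply Rle_trans; [apply Rabs_triang|]. lra. }
assert (E : (Cmod (c * (g t * T t) / a - c * (g y * T y) / a) < eps)%R).
{ replace (c * (g t * T t) / a - c * (g y * T y) / a) with (c / a * (g t * (T t - T y) + (g t - g y)%R * T y))
    by (rewrite RtoC_minus; field; exact ha).
  rewrite Cmod_mult, Cmod_div by exact ha. fold B.
  assert (E1 : (Cmod (g t * (T t - T y)) <= q)%R).
  { rewrite Cmod_mult, Cmod_R. apply Rle_trans with (m * (K1 * (q / (m * K1))))%R; [|right; field; lra].
    apply Rmult_le_compat; [apply Rabs_pos|apply Cmod_ge_0|exact g2|]. eapply Rle_trans; [apply HT|].
    apply Rle_trans with (K1 * Rabs (t - y))%R; [|apply Rmult_le_compat_l; lra].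
    apply Rmult_le_compat_r; [apply Rabs_pos|]. unfold K1. pose proof (Rle_abs K). lra. }
  assert (E2 : (Cmod ((g t - g y)%R * T y) <= q)%R).
  { rewrite Cmod_mult, Cmod_R. apply Rle_trans with (q / (Cmod (T y) + 1) * (Cmod (T y) + 1))%R; [|right; field; lra].
    apply Rmult_le_compat; [apply Rabs_pos|easy|lra|lra]. }
  apply Rle_lt_trans with (B * (2 * q))%R.
  - apply Rmult_le_compat_l; [easy|]. eapply Rle_trans; [apply Cmod_triangle|]. lra.
  - unfold q. apply (Rmult_lt_reg_r (B + 1)); [lra|].
    replace (B * (2 * (eps / (2 * (B + 1)))) * (B + 1))%R with (B * eps)%R by (field; lra). nra. }
split; unfold ball; simpl; unfold AbsRing_ball, abs, minus, plus, opp; simpl.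
- eapply Rle_lt_trans; [|exact E]. exact (Rabs_fst_le (c * (g t * T t) / a - c * (g y * T y) / a)).
- eapply Rle_lt_trans; [|exact E]. exact (Rabs_snd_le (c * (g t * T t) / a - c * (g y * T y) / a)).
Qed.

Lemma tanh_kernel_lipschitz (s a b : R) : (Cmod (tanh_kernel s a - tanh_kernel s b) <= PI * Rabs (a - b))%R.
Proof.
unfold tanh_kernel. replace (Ci * (RtoC (tanh (PI * a)) - s) - Ci * (RtoC (tanh (PI * b)) - s)) with
  (Ci * (tanh (PI * a) - tanh (PI * b))%R) by (rewrite RtoC_minus; ring).
rewrite Cmod_mult, Cmod_Ci, Rmult_1_l, Cmod_R. apply tanh_lipschitz.
Qed.

Lemma sech_kernel_lipschitz (a b : R) : (Cmod (sech_kernel a - sech_kernel b) <= PI * Rabs (a - b))%R.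
Proof. unfold sech_kernel. rewrite <- RtoC_minus, Cmod_R. apply sech_lipschitz. Qed.

Lemma kernel_csch_upper_tanh (e : R) : (0 < e < 1 / 2)%R -> kernel (fun x => csch (PI * x)) e (tanh_kernel 1).
Proof. intros he. apply kernel_csch_upper. lra. Qed.

Lemma kernel_csch_lower_tanh (e : R) : (- (1 / 2) < e < 0)%R -> kernel (fun x => csch (PI * x)) e (tanh_kernel (- 1)).
Proof.
intros he. eapply kernel_ext; [|apply kernel_csch_lower; lra]. intros b. unfold tanh_kernel. ring.
Qed.

Lemma Fourier_eq_unshifted (P L K : R) (kappa J G f : C -> C) (phi : R -> C) (c c0 th a : C) (p q : nat -> C)
  (l : nat -> nat) (N : R -> C) (D : R -> R) :
  (0 < P)%R -> (forall b, (Cmod (phi b) <= L)%R) -> (forall s t, (Cmod (phi s - phi t) <= K * Rabs (s - t))%R) ->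
  (forall e, (0 < e < 1 / 2)%R -> kernel kappa e phi) ->
  (forall x, (0 < Im x < 1 / 2)%R -> f x = J x * kappa x) ->
  Re th = 0%R -> strip_series P G c0 p q l ->
  (forall x, (0 < Im x < 1 / 2)%R -> J x = c * G (P / 2 + (Ci * P * x + th))) ->
  a <> 0 -> (forall t, t <> 0%R -> D t <> 0%R) ->
  (forall y, c * trig_sum P c0 p q l th phi y * D y = a * N y) -> Fourier_eq f a N D.
Proof.
intros hP hL hD hK hf hth HG hJ ha HD HN.
destruct (trig_sum_lipschitz P L K G phi c0 th p q l hP hL hD hth HG) as [M HM].
apply (Fourier_eq_intro f a c N D (fun _ => 1%R) (trig_sum P c0 p q l th phi) M ha); [|exact HM| | |exact HD].
- intros y. rewrite Cmult_1_l. apply (is_Fourier_strip P L y kappa G); [easy|easy|easy|easy|easy|].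
  intros x hx. rewrite (hf x hx), (hJ x hx). ring.
- intros t. apply continuity_pt_const. intros u v. reflexivity.
- intros t. rewrite Cmult_1_l. apply HN.
Qed.

(** For the functions with poles on the real axis. The factor [- Ci] arises when the kernel is
    rewritten at [x - Ci / 2], where csch and sech are exchanged. *)
Lemma Fourier_eq_shifted (P L K : R) (kappa J G f : C -> C) (phi : R -> C) (c c0 th a : C) (p q : nat -> C)
  (l : nat -> nat) (N : R -> C) (D : R -> R) :
  (0 < P)%R -> (forall b, (Cmod (phi b) <= L)%R) -> (forall s t, (Cmod (phi s - phi t) <= K * Rabs (s - t))%R) ->
  (forall e, (- (1 / 2) < e < 0)%R -> kernel kappa e phi) ->
  (forall x, (0 < Im x < 1 / 2)%R -> f x = - Ci * (J x * kappa (x - Ci / 2))) ->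
  Re th = 0%R -> strip_series P G c0 p q l ->
  (forall x, (0 < Im x < 1 / 2)%R -> J x = c * G (P / 2 + (Ci * P * (x - Ci / 2) + th))) ->
  a <> 0 -> (forall t, t <> 0%R -> D t <> 0%R) ->
  (forall y, - Ci * c * (exp (- (PI * y)) * trig_sum P c0 p q l th phi y) * D y = a * N y) -> Fourier_eq f a N D.
Proof.
intros hP hL hD hK hf hth HG hJ ha HD HN.
destruct (trig_sum_lipschitz P L K G phi c0 th p q l hP hL hD hth HG) as [M HM].
apply (Fourier_eq_intro f a (- Ci * c) N D (fun y => exp (- (PI * y))) (trig_sum P c0 p q l th phi) M ha); [|exact HM| |exact HN|exact HD].
- intros y. apply (is_Fourier_shifted P L y kappa G); [easy|easy|easy|easy|easy|].
  intros x hx. rewrite (hf x hx), (hJ x hx). ring.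
- intros t. apply continuity_pt_filterlim, (ex_derive_continuous (V := R_NormedModule) (fun y => exp (- (PI * y)))). auto_derive. easy.
Qed.

Lemma Csinh_half_shift (x : C) : Csinh (PI * x) = Ci * Ccosh (PI * (x - Ci / 2)).
Proof. rewrite <- Csinh_shift. f_equal. field. Qed.

Lemma Ccosh_half_shift (x : C) : Ccosh (PI * x) = Ci * Csinh (PI * (x - Ci / 2)).
Proof. rewrite <- Ccosh_shift. f_equal. field. Qed.

Lemma Im_half_shift (x : C) : Im (x - Ci / 2) = (Im x - 1 / 2)%R.
Proof. destruct x. unfold Ci, Cminus, Cdiv, Cinv, Cmult, Cplus, Copp, RtoC; simpl. field. Qed.

Lemma Csinh_PI_neq_0_low (z : C) : (- (1 / 2) < Im z < 0)%R -> Csinh (PI * z) <> 0.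
Proof.
intros hz E. apply (Csinh_PI_neq_0 (- z)).
- destruct z; simpl in *. lra.
- replace (PI * - z) with (- (PI * z)) by ring. rewrite Csinh_opp, E. ring.
Qed.

Lemma kernel_sech_upper (e : R) : (0 < e < 1 / 2)%R -> kernel (fun x => / Ccosh (PI * x)) e sech_kernel.
Proof. intros he. apply kernel_sech. lra. Qed.

Lemma kernel_sech_lower (e : R) : (- (1 / 2) < e < 0)%R -> kernel (fun x => / Ccosh (PI * x)) e sech_kernel.
Proof. intros he. apply kernel_sech. lra. Qed.

(** A partial application, one per kernel and side: the kernel facts are fixed, and a case has to
    provide its strip expansion, its expression through a lattice sum, the nonvanishing conditions
    and the identity of coefficients. *)
Definition Fourier_eq_csch (P : R) (J G : C -> C) (c c0 th a : C) (p q : nat -> C) (l : nat -> nat)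
  (N : R -> C) (D : R -> R) (hP : (0 < P)%R) :=
  Fourier_eq_unshifted P _ PI (fun x => csch (PI * x)) J G (fun x => J x / Csinh (PI * x)) (tanh_kernel 1) c c0 th a p q l N D
    hP (tanh_kernel_bounded 1) (tanh_kernel_lipschitz 1) kernel_csch_upper_tanh (fun x _ => eq_refl).

Definition Fourier_eq_sech (P : R) (J G : C -> C) (c c0 th a : C) (p q : nat -> C) (l : nat -> nat)
  (N : R -> C) (D : R -> R) (hP : (0 < P)%R) :=
  Fourier_eq_unshifted P 1 PI (fun x => / Ccosh (PI * x)) J G (fun x => J x / Ccosh (PI * x)) sech_kernel c c0 th a p q l N D
    hP sech_kernel_bounded sech_kernel_lipschitz
    kernel_sech_upper (fun x _ => eq_refl).

Lemma div_Ccosh_half_shift (w x : C) : (0 < Im x < 1 / 2)%R ->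
  w / Ccosh (PI * x) = - Ci * (w * csch (PI * (x - Ci / 2))).
Proof.
intros hx. pose proof (Csinh_PI_neq_0_low (x - Ci / 2) ltac:(rewrite Im_half_shift; lra)) as n.
rewrite Ccosh_half_shift, <- Cinv_Ci. unfold csch. field. split; [exact n|apply Ci_neq_0].
Qed.

Lemma div_Csinh_half_shift (w x : C) : (0 < Im x < 1 / 2)%R ->
  w / Csinh (PI * x) = - Ci * (w * / Ccosh (PI * (x - Ci / 2))).
Proof.
intros hx. pose proof (Ccosh_PI_neq_0 (x - Ci / 2) ltac:(rewrite Im_half_shift; lra)) as n.
rewrite Csinh_half_shift, <- Cinv_Ci. field. split; [exact n|apply Ci_neq_0].
Qed.

Definition Fourier_eq_csch_shifted (P : R) (J G : C -> C) (c c0 th a : C) (p q : nat -> C) (l : nat -> nat)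
  (N : R -> C) (D : R -> R) (hP : (0 < P)%R) :=
  Fourier_eq_shifted P _ PI (fun x => csch (PI * x)) J G (fun x => J x / Ccosh (PI * x)) (tanh_kernel (- 1)) c c0 th a p q l N D
    hP (tanh_kernel_bounded (- 1)) (tanh_kernel_lipschitz (- 1)) kernel_csch_lower_tanh
    (fun x => div_Ccosh_half_shift (J x) x).

Definition Fourier_eq_sech_shifted (P : R) (J G : C -> C) (c c0 th a : C) (p q : nat -> C) (l : nat -> nat)
  (N : R -> C) (D : R -> R) (hP : (0 < P)%R) :=
  Fourier_eq_shifted P 1 PI (fun x => / Ccosh (PI * x)) J G (fun x => J x / Csinh (PI * x)) sech_kernel c c0 th a p q l N D
    hP sech_kernel_bounded sech_kernel_lipschitz
    kernel_sech_lower
    (fun x => div_Csinh_half_shift (J x) x).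

(** The factor [exp (- (PI * y))] of the half shift turns the denominators [exp (2 * PI * y) - 1]
    and [exp (2 * PI * y) + 1] into the sinh and cosh of the closed forms. *)
Lemma exp_denominators (y : R) :
  RtoC (exp (- (PI * y))) * RtoC (exp (2 * PI * y) - 1) = 2 * RtoC (sinh (PI * y)) /\
  RtoC (exp (- (PI * y))) * RtoC (exp (2 * PI * y) + 1) = 2 * RtoC (cosh (PI * y)) /\
  RtoC (cosh (PI * y)) - RtoC (sinh (PI * y)) = RtoC (exp (- PI * y)) /\
  RtoC (cosh (PI * y)) + RtoC (sinh (PI * y)) = RtoC (exp (PI * y)).
Proof.
replace (2 * PI * y)%R with (PI * y + PI * y)%R by ring. replace (- PI * y)%R with (- (PI * y))%R by ring.
unfold sinh, cosh. rewrite exp_plus, exp_Ropp. pose proof (exp_pos (PI * y)).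
rewrite <- !RtoC_mult, <- RtoC_minus, <- RtoC_plus. repeat split; f_equal; field; lra.
Qed.

Lemma denominators_neq_0 (t : R) : t <> 0%R ->
  sinh (PI * t) <> 0%R /\ (exp (2 * PI * t) - 1 <> 0)%R.
Proof.
intros ht. pose proof PI_RGT_0.
split; [apply sinh_neq_0, Rmult_integral_contrapositive_currified; lra|].
intros E. assert (E1 : exp (2 * PI * t) = exp 0) by (rewrite exp_0; lra).
apply exp_inv in E1. apply Rmult_integral in E1. destruct E1; [lra|easy].
Qed.

(** * The eighteen transforms *)

Lemma cosh_PI_neq_0 (t : R) : cosh (PI * t) <> 0%R.
Proof. apply Rgt_not_eq, cosh_pos. Qed.

Lemma Copp_neq_0 (a : C) : a <> 0 -> - a <> 0.
Proof. intros ha e. now apply ha, Copp_0_inv. Qed.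

Lemma Cinv_neq_0 (a : C) : a <> 0 -> / a <> 0.
Proof. intros ha e. apply C1_neq_0. rewrite <- (Cinv_r a ha), e. ring. Qed.

Lemma exp_plus_1_neq_0 (x : R) : (exp x + 1 <> 0)%R.
Proof. pose proof (exp_pos x). lra. Qed.

Ltac prove_neq_0 := unfold Cdiv; repeat first [assumption | apply Cmult_neq_0 | apply Copp_neq_0 | apply Cinv_neq_0].
Ltac compare_coefficients := field [Ci_sqr]; repeat split; assumption.

Theorem mainTheorem1 : forall k : R, (0 < k < 1)%R ->
  let k' := compl_modulus k in
  let K := ellipticK k in
  let K' := ellipticK k' in
  (Fourier_eq (fun x => dc (2 * K' * x) k / Ccosh (PI * x))
     (- 2 * k) (fun y => k' * sd (2 * K * y) k' - exp (PI * y))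
     (fun y => (exp (2 * PI * y) + 1)%R) /\
   Fourier_eq (fun x => nc (2 * K' * x) k / Ccosh (PI * x))
     (2 * k) (fun y => sd (2 * K * y) k')
     (fun y => (exp (2 * PI * y) - 1)%R) /\
   Fourier_eq (fun x => sc (2 * K' * x) k / Ccosh (PI * x))
     (- 2 * Ci) (fun y => cn (2 * K * y) k' - exp (PI * y))
     (fun y => (exp (2 * PI * y) - 1)%R) /\
   Fourier_eq (fun x => cd (2 * K' * x) k / Ccosh (PI * x))
     (- (1 / k)) (fun y => k' * cd (2 * K * y) k' - 1)
     (fun y => cosh (PI * y)) /\
   Fourier_eq (fun x => nd (2 * K' * x) k / Ccosh (PI * x))
     1 (fun y => sn (2 * K * y) k')
     (fun y => sinh (PI * y)) /\
   Fourier_eq (fun x => sd (2 * K' * x) k / Ccosh (PI * x))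
     (- (Ci / k)) (fun y => cd (2 * K * y) k' - 1)
     (fun y => sinh (PI * y)) /\
   Fourier_eq (fun x => cs (2 * K' * x) k / Ccosh (PI * x))
     (2 * Ci) (fun y => dn (2 * K * y) k' - exp (PI * y))
     (fun y => (exp (2 * PI * y) - 1)%R) /\
   Fourier_eq (fun x => ds (2 * K' * x) k / Ccosh (PI * x))
     (2 * Ci * k) (fun y => nd (2 * K * y) k' - exp (PI * y))
     (fun y => (exp (2 * PI * y) - 1)%R) /\
   Fourier_eq (fun x => ns (2 * K' * x) k / Ccosh (PI * x))
     (- 2 * Ci * k) (fun y => nd (2 * K * y) k')
     (fun y => (exp (2 * PI * y) + 1)%R) /\
   Fourier_eq (fun x => dc (2 * K' * x) k / Csinh (PI * x))
     (2 * Ci) (fun y => k' * cd (2 * K * y) k' - 1)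
     (fun y => (exp (2 * PI * y) + 1)%R) /\
   Fourier_eq (fun x => nc (2 * K' * x) k / Csinh (PI * x))
     (- 2 * Ci) (fun y => cd (2 * K * y) k' - 1)
     (fun y => (exp (2 * PI * y) - 1)%R) /\
   Fourier_eq (fun x => sc (2 * K' * x) k / Csinh (PI * x))
     2 (fun y => sn (2 * K * y) k')
     (fun y => (exp (2 * PI * y) - 1)%R) /\
   Fourier_eq (fun x => cd (2 * K' * x) k / Csinh (PI * x))
     (- Ci) (fun y => k' * sd (2 * K * y) k' + exp (- PI * y))
     (fun y => cosh (PI * y)) /\
   Fourier_eq (fun x => nd (2 * K' * x) k / Csinh (PI * x))
     (- Ci) (fun y => cn (2 * K * y) k' - exp (- PI * y))
     (fun y => sinh (PI * y)) /\
   Fourier_eq (fun x => sd (2 * K' * x) k / Csinh (PI * x))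
     1 (fun y => sd (2 * K * y) k')
     (fun y => sinh (PI * y)) /\
   Fourier_eq (fun x => cn (2 * K' * x) k / Csinh (PI * x))
     (- Ci) (fun y => nd (2 * K * y) k' - exp (- PI * y))
     (fun y => sinh (PI * y)) /\
   Fourier_eq (fun x => dn (2 * K' * x) k / Csinh (PI * x))
     (- Ci) (fun y => dn (2 * K * y) k' - exp (- PI * y))
     (fun y => sinh (PI * y)) /\
   Fourier_eq (fun x => sn (2 * K' * x) k / Csinh (PI * x))
     1 (fun y => nd (2 * K * y) k')
     (fun y => cosh (PI * y)))%C.
Proof.
intros k hk k' K K'. set (P := period k). assert (hP : (0 < P)%R) by now apply period_pos.
set (b := lat_b P). assert (hb : (0 < b)%R) by now apply lat_b_pos.
pose proof (compl_modulus_range k hk) as hk'. fold k' in hk'.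
assert (b0 : RtoC b <> 0) by (apply RtoC_neq_0; lra). assert (k0 : RtoC k <> 0) by (apply RtoC_neq_0; lra).
assert (k0' : RtoC k' <> 0) by (apply RtoC_neq_0; lra). assert (r0 : Re 0 = 0%R) by reflexivity.
assert (i0 := Ci_neq_0). assert (t0 := C2_neq_0). assert (o0 := C1_neq_0). assert (m0 : RtoC (- 2) <> 0) by (apply RtoC_neq_0; lra).
set (h := Ci * (PI / 2)). assert (r1 : Re h = 0%R) by apply Re_iPI2.
assert (dS := fun t ht => proj1 (denominators_neq_0 t ht)). assert (dE := fun t ht => proj2 (denominators_neq_0 t ht)).
assert (dC := fun t (_ : t <> 0%R) => cosh_PI_neq_0 t). assert (dF := fun t (_ : t <> 0%R) => exp_plus_1_neq_0 (2 * PI * t)).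
assert (g := fun x (hx : (0 < Im x < 1 / 2)%R) => glaisher_strip k x hk hx). cbv zeta in g.
fold P in g. fold b in g. fold k' in g. fold K' in g. fold h in g.
assert (w0 : forall x : C, P / 2 + (Ci * P * x + 0) = P / 2 + Ci * P * x) by (intros; ring).
assert (w1 : forall x : C, P / 2 + (Ci * P * x + h) = P / 2 + Ci * P * x + h) by (intros; ring).
assert (s := fun y => strip_sums k y hk). cbv zeta in s. fold P in s. fold b in s. fold k' in s. fold K in s. fold h in s.
assert (e := exp_denominators).
(* Functions with real poles use the shifted csch kernel over cosh (1-3, 7-9) and the shifted sech
   kernel over sinh (10-12); the others use sech over cosh (4-6) and csch over sinh (13-18). The
   phase is [h] when the Glaisher denominator is [cn] or [dn], and 0 otherwise. *)
repeat match goal with |- _ /\ _ => split end.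
- refine (Fourier_eq_csch_shifted P (fun x => dc (2 * K' * x) k) (latD P) (Ci / b) 0 h _ _ _ _ _ _ hP r1 (strip_series_D P hP) _ _ dF _).
  + intros x hx. destruct (g x hx) as [[gdn [gcn gsn]] [[gnd [gsd gcd]] [[gcs [gds gns]] [gsc [gnc gdc]]]]]. rewrite gdc, w1. unfold Cdiv. ring.
  + prove_neq_0.
  + intros y. destruct (e y) as [e1 [e2 [e3 e4]]]. destruct (s y) as [sT [sA [sB sD]]].
    (* [s = - 1]: the shifted variable runs below the pole of csch. *)
    destruct (sT (- 1)%R) as [tA0 [tB0 [tD0 [tA [tB tD]]]]].
    match goal with |- _ * _ * (?E * ?T) * ?D = _ => transitivity (- Ci * (Ci / b) * 2 * ((RtoC (cosh (PI * y))) * T)); [transitivity (- Ci * (Ci / b) * (E * D) * T); [ring|rewrite e2; ring]|] end.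
    rewrite tD, <- ?e4. compare_coefficients.
- refine (Fourier_eq_csch_shifted P (fun x => nc (2 * K' * x) k) (latB P) (- Ci / (k' * b)) 0 h _ _ _ _ _ _ hP r1 (strip_series_B P hP) _ _ dE _).
  + intros x hx. destruct (g x hx) as [[gdn [gcn gsn]] [[gnd [gsd gcd]] [[gcs [gds gns]] [gsc [gnc gdc]]]]]. rewrite gnc, w1. unfold Cdiv. ring.
  + prove_neq_0.
  + intros y. destruct (e y) as [e1 [e2 [e3 e4]]]. destruct (s y) as [sT [sA [sB sD]]].
    destruct (sT (- 1)%R) as [tA0 [tB0 [tD0 [tA [tB tD]]]]].
    match goal with |- _ * _ * (?E * ?T) * ?D = _ => transitivity (- Ci * (- Ci / (k' * b)) * 2 * ((RtoC (sinh (PI * y))) * T)); [transitivity (- Ci * (- Ci / (k' * b)) * (E * D) * T); [ring|rewrite e1; ring]|] end.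
    rewrite tB, <- ?e4. compare_coefficients.
- refine (Fourier_eq_csch_shifted P (fun x => sc (2 * K' * x) k) (latA P) (Ci / (k' * b)) 1 h _ _ _ _ _ _ hP r1 (strip_series_A P hP) _ _ dE _).
  + intros x hx. destruct (g x hx) as [[gdn [gcn gsn]] [[gnd [gsd gcd]] [[gcs [gds gns]] [gsc [gnc gdc]]]]]. rewrite gsc, w1. unfold Cdiv. ring.
  + prove_neq_0.
  + intros y. destruct (e y) as [e1 [e2 [e3 e4]]]. destruct (s y) as [sT [sA [sB sD]]].
    destruct (sT (- 1)%R) as [tA0 [tB0 [tD0 [tA [tB tD]]]]].
    match goal with |- _ * _ * (?E * ?T) * ?D = _ => transitivity (- Ci * (Ci / (k' * b)) * 2 * ((RtoC (sinh (PI * y))) * T)); [transitivity (- Ci * (Ci / (k' * b)) * (E * D) * T); [ring|rewrite e1; ring]|] end.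
    rewrite tA, <- ?e4. compare_coefficients.
- refine (Fourier_eq_sech P (fun x => cd (2 * K' * x) k) (latD P) (Ci / (k * b)) 0 h _ _ _ _ _ _ hP r1 (strip_series_D P hP) _ _ dC _).
  + intros x hx. destruct (g x hx) as [[gdn [gcn gsn]] [[gnd [gsd gcd]] [[gcs [gds gns]] [gsc [gnc gdc]]]]]. rewrite gcd, w1. unfold Cdiv. ring.
  + prove_neq_0.
  + intros y. destruct (e y) as [e1 [e2 [e3 e4]]]. destruct (s y) as [sT [sA [sB sD]]].
    match goal with |- _ * ?T * ?D = _ => transitivity ((Ci / (k * b)) * (D * T)); [ring|] end.
    rewrite sD. compare_coefficients.
- refine (Fourier_eq_sech P (fun x => nd (2 * K' * x) k) (latA P) (/ (k' * b)) 1 h _ _ _ _ _ _ hP r1 (strip_series_A P hP) _ _ dS _).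
  + intros x hx. destruct (g x hx) as [[gdn [gcn gsn]] [[gnd [gsd gcd]] [[gcs [gds gns]] [gsc [gnc gdc]]]]]. rewrite gnd, w1. unfold Cdiv. ring.
  + prove_neq_0.
  + intros y. destruct (e y) as [e1 [e2 [e3 e4]]]. destruct (s y) as [sT [sA [sB sD]]].
    match goal with |- _ * ?T * ?D = _ => transitivity ((/ (k' * b)) * (D * T)); [ring|] end.
    rewrite sA. compare_coefficients.
- refine (Fourier_eq_sech P (fun x => sd (2 * K' * x) k) (latB P) (- / (k * k' * b)) 0 h _ _ _ _ _ _ hP r1 (strip_series_B P hP) _ _ dS _).
  + intros x hx. destruct (g x hx) as [[gdn [gcn gsn]] [[gnd [gsd gcd]] [[gcs [gds gns]] [gsc [gnc gdc]]]]]. rewrite gsd, w1. unfold Cdiv. ring.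
  + prove_neq_0.
  + intros y. destruct (e y) as [e1 [e2 [e3 e4]]]. destruct (s y) as [sT [sA [sB sD]]].
    match goal with |- _ * ?T * ?D = _ => transitivity ((- / (k * k' * b)) * (D * T)); [ring|] end.
    rewrite sB. compare_coefficients.
- refine (Fourier_eq_csch_shifted P (fun x => cs (2 * K' * x) k) (latA P) (- Ci / b) 1 0 _ _ _ _ _ _ hP r0 (strip_series_A P hP) _ _ dE _).
  + intros x hx. destruct (g x hx) as [[gdn [gcn gsn]] [[gnd [gsd gcd]] [[gcs [gds gns]] [gsc [gnc gdc]]]]]. rewrite gcs, w0. unfold Cdiv. ring.
  + prove_neq_0.
  + intros y. destruct (e y) as [e1 [e2 [e3 e4]]]. destruct (s y) as [sT [sA [sB sD]]].
    destruct (sT (- 1)%R) as [tA0 [tB0 [tD0 [tA [tB tD]]]]].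
    match goal with |- _ * _ * (?E * ?T) * ?D = _ => transitivity (- Ci * (- Ci / b) * 2 * ((RtoC (sinh (PI * y))) * T)); [transitivity (- Ci * (- Ci / b) * (E * D) * T); [ring|rewrite e1; ring]|] end.
    rewrite tA0, <- ?e4. compare_coefficients.
- refine (Fourier_eq_csch_shifted P (fun x => ds (2 * K' * x) k) (latB P) (- Ci / b) 0 0 _ _ _ _ _ _ hP r0 (strip_series_B P hP) _ _ dE _).
  + intros x hx. destruct (g x hx) as [[gdn [gcn gsn]] [[gnd [gsd gcd]] [[gcs [gds gns]] [gsc [gnc gdc]]]]]. rewrite gds, w0. unfold Cdiv. ring.
  + prove_neq_0.
  + intros y. destruct (e y) as [e1 [e2 [e3 e4]]]. destruct (s y) as [sT [sA [sB sD]]].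
    destruct (sT (- 1)%R) as [tA0 [tB0 [tD0 [tA [tB tD]]]]].
    match goal with |- _ * _ * (?E * ?T) * ?D = _ => transitivity (- Ci * (- Ci / b) * 2 * ((RtoC (sinh (PI * y))) * T)); [transitivity (- Ci * (- Ci / b) * (E * D) * T); [ring|rewrite e1; ring]|] end.
    rewrite tB0, <- ?e4. compare_coefficients.
- refine (Fourier_eq_csch_shifted P (fun x => ns (2 * K' * x) k) (latD P) (Ci / b) 0 0 _ _ _ _ _ _ hP r0 (strip_series_D P hP) _ _ dF _).
  + intros x hx. destruct (g x hx) as [[gdn [gcn gsn]] [[gnd [gsd gcd]] [[gcs [gds gns]] [gsc [gnc gdc]]]]]. rewrite gns, w0. unfold Cdiv. ring.
  + prove_neq_0.
  + intros y. destruct (e y) as [e1 [e2 [e3 e4]]]. destruct (s y) as [sT [sA [sB sD]]].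
    destruct (sT (- 1)%R) as [tA0 [tB0 [tD0 [tA [tB tD]]]]].
    match goal with |- _ * _ * (?E * ?T) * ?D = _ => transitivity (- Ci * (Ci / b) * 2 * ((RtoC (cosh (PI * y))) * T)); [transitivity (- Ci * (Ci / b) * (E * D) * T); [ring|rewrite e2; ring]|] end.
    rewrite tD0, <- ?e4. compare_coefficients.
- refine (Fourier_eq_sech_shifted P (fun x => dc (2 * K' * x) k) (latD P) (Ci / b) 0 h _ _ _ _ _ _ hP r1 (strip_series_D P hP) _ _ dF _).
  + intros x hx. destruct (g x hx) as [[gdn [gcn gsn]] [[gnd [gsd gcd]] [[gcs [gds gns]] [gsc [gnc gdc]]]]]. rewrite gdc, w1. unfold Cdiv. ring.
  + prove_neq_0.
  + intros y. destruct (e y) as [e1 [e2 [e3 e4]]]. destruct (s y) as [sT [sA [sB sD]]].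
    match goal with |- _ * _ * (?E * ?T) * ?D = _ => transitivity (- Ci * (Ci / b) * 2 * ((RtoC (cosh (PI * y))) * T)); [transitivity (- Ci * (Ci / b) * (E * D) * T); [ring|rewrite e2; ring]|] end.
    rewrite sD. compare_coefficients.
- refine (Fourier_eq_sech_shifted P (fun x => nc (2 * K' * x) k) (latB P) (- Ci / (k' * b)) 0 h _ _ _ _ _ _ hP r1 (strip_series_B P hP) _ _ dE _).
  + intros x hx. destruct (g x hx) as [[gdn [gcn gsn]] [[gnd [gsd gcd]] [[gcs [gds gns]] [gsc [gnc gdc]]]]]. rewrite gnc, w1. unfold Cdiv. ring.
  + prove_neq_0.
  + intros y. destruct (e y) as [e1 [e2 [e3 e4]]]. destruct (s y) as [sT [sA [sB sD]]].
    match goal with |- _ * _ * (?E * ?T) * ?D = _ => transitivity (- Ci * (- Ci / (k' * b)) * 2 * ((RtoC (sinh (PI * y))) * T)); [transitivity (- Ci * (- Ci / (k' * b)) * (E * D) * T); [ring|rewrite e1; ring]|] end.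
    rewrite sB. compare_coefficients.
- refine (Fourier_eq_sech_shifted P (fun x => sc (2 * K' * x) k) (latA P) (Ci / (k' * b)) 1 h _ _ _ _ _ _ hP r1 (strip_series_A P hP) _ _ dE _).
  + intros x hx. destruct (g x hx) as [[gdn [gcn gsn]] [[gnd [gsd gcd]] [[gcs [gds gns]] [gsc [gnc gdc]]]]]. rewrite gsc, w1. unfold Cdiv. ring.
  + prove_neq_0.
  + intros y. destruct (e y) as [e1 [e2 [e3 e4]]]. destruct (s y) as [sT [sA [sB sD]]].
    match goal with |- _ * _ * (?E * ?T) * ?D = _ => transitivity (- Ci * (Ci / (k' * b)) * 2 * ((RtoC (sinh (PI * y))) * T)); [transitivity (- Ci * (Ci / (k' * b)) * (E * D) * T); [ring|rewrite e1; ring]|] end.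
    rewrite sA. compare_coefficients.
- refine (Fourier_eq_csch P (fun x => cd (2 * K' * x) k) (latD P) (Ci / (k * b)) 0 h _ _ _ _ _ _ hP r1 (strip_series_D P hP) _ _ dC _).
  + intros x hx. destruct (g x hx) as [[gdn [gcn gsn]] [[gnd [gsd gcd]] [[gcs [gds gns]] [gsc [gnc gdc]]]]]. rewrite gcd, w1. unfold Cdiv. ring.
  + prove_neq_0.
  + intros y. destruct (e y) as [e1 [e2 [e3 e4]]]. destruct (s y) as [sT [sA [sB sD]]].
    (* [s = 1]: the variable itself runs above the pole of csch. *)
    destruct (sT 1%R) as [tA0 [tB0 [tD0 [tA [tB tD]]]]].
    match goal with |- _ * ?T * ?D = _ => transitivity ((Ci / (k * b)) * (D * T)); [ring|] end.
    rewrite tD, <- ?e3. compare_coefficients.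
- refine (Fourier_eq_csch P (fun x => nd (2 * K' * x) k) (latA P) (/ (k' * b)) 1 h _ _ _ _ _ _ hP r1 (strip_series_A P hP) _ _ dS _).
  + intros x hx. destruct (g x hx) as [[gdn [gcn gsn]] [[gnd [gsd gcd]] [[gcs [gds gns]] [gsc [gnc gdc]]]]]. rewrite gnd, w1. unfold Cdiv. ring.
  + prove_neq_0.
  + intros y. destruct (e y) as [e1 [e2 [e3 e4]]]. destruct (s y) as [sT [sA [sB sD]]].
    destruct (sT 1%R) as [tA0 [tB0 [tD0 [tA [tB tD]]]]].
    match goal with |- _ * ?T * ?D = _ => transitivity ((/ (k' * b)) * (D * T)); [ring|] end.
    rewrite tA, <- ?e3. compare_coefficients.
- refine (Fourier_eq_csch P (fun x => sd (2 * K' * x) k) (latB P) (- / (k * k' * b)) 0 h _ _ _ _ _ _ hP r1 (strip_series_B P hP) _ _ dS _).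
  + intros x hx. destruct (g x hx) as [[gdn [gcn gsn]] [[gnd [gsd gcd]] [[gcs [gds gns]] [gsc [gnc gdc]]]]]. rewrite gsd, w1. unfold Cdiv. ring.
  + prove_neq_0.
  + intros y. destruct (e y) as [e1 [e2 [e3 e4]]]. destruct (s y) as [sT [sA [sB sD]]].
    destruct (sT 1%R) as [tA0 [tB0 [tD0 [tA [tB tD]]]]].
    match goal with |- _ * ?T * ?D = _ => transitivity ((- / (k * k' * b)) * (D * T)); [ring|] end.
    rewrite tB, <- ?e3. compare_coefficients.
- refine (Fourier_eq_csch P (fun x => cn (2 * K' * x) k) (latB P) (/ (b * k)) 0 0 _ _ _ _ _ _ hP r0 (strip_series_B P hP) _ _ dS _).
  + intros x hx. destruct (g x hx) as [[gdn [gcn gsn]] [[gnd [gsd gcd]] [[gcs [gds gns]] [gsc [gnc gdc]]]]]. rewrite gcn, w0. unfold Cdiv. ring.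
  + prove_neq_0.
  + intros y. destruct (e y) as [e1 [e2 [e3 e4]]]. destruct (s y) as [sT [sA [sB sD]]].
    destruct (sT 1%R) as [tA0 [tB0 [tD0 [tA [tB tD]]]]].
    match goal with |- _ * ?T * ?D = _ => transitivity ((/ (b * k)) * (D * T)); [ring|] end.
    rewrite tB0, <- ?e3. compare_coefficients.
- refine (Fourier_eq_csch P (fun x => dn (2 * K' * x) k) (latA P) (/ b) 1 0 _ _ _ _ _ _ hP r0 (strip_series_A P hP) _ _ dS _).
  + intros x hx. destruct (g x hx) as [[gdn [gcn gsn]] [[gnd [gsd gcd]] [[gcs [gds gns]] [gsc [gnc gdc]]]]]. rewrite gdn, w0. unfold Cdiv. ring.
  + prove_neq_0.
  + intros y. destruct (e y) as [e1 [e2 [e3 e4]]]. destruct (s y) as [sT [sA [sB sD]]].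
    destruct (sT 1%R) as [tA0 [tB0 [tD0 [tA [tB tD]]]]].
    match goal with |- _ * ?T * ?D = _ => transitivity ((/ b) * (D * T)); [ring|] end.
    rewrite tA0, <- ?e3. compare_coefficients.
- refine (Fourier_eq_csch P (fun x => sn (2 * K' * x) k) (latD P) (Ci / (b * k)) 0 0 _ _ _ _ _ _ hP r0 (strip_series_D P hP) _ _ dC _).
  + intros x hx. destruct (g x hx) as [[gdn [gcn gsn]] [[gnd [gsd gcd]] [[gcs [gds gns]] [gsc [gnc gdc]]]]]. rewrite gsn, w0. unfold Cdiv. ring.
  + prove_neq_0.
  + intros y. destruct (e y) as [e1 [e2 [e3 e4]]]. destruct (s y) as [sT [sA [sB sD]]].
    destruct (sT 1%R) as [tA0 [tB0 [tD0 [tA [tB tD]]]]].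
    match goal with |- _ * ?T * ?D = _ => transitivity ((Ci / (b * k)) * (D * T)); [ring|] end.
    rewrite tD0, <- ?e3. compare_coefficients.
Qed.
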